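(* Model checking $\mathcal{L}_{\mathsf{EL}}$, $\mathcal{L}_{\mathsf{PAL}}$ and $\mathcal{L}_{\mathsf{DEL}}$ on belief structures is PSPACE-complete. That is, for each of the three languages $\mathcal{L}\in\{\mathcal{L}_{\mathsf{EL}},\mathcal{L}_{\mathsf{PAL}},\mathcal{L}_{\mathsf{DEL}}\}$ the following problem is PSPACE-complete: given a finite set of agents $A$, a belief structure $\mathcal{F}=(V,\theta,\Omega)$ with $\theta$ and the $\Omega_i$ given as BDDs, a state $s$ of $\mathcal{F}$ and $\phi\in\mathcal{L}(V)$, decide whether $\mathcal{F},s\vDash\phi$ (input size $|V|+|\theta|+\sum_{i\in A}|\Omega_i|+|\phi|$).
   Context: Vocabularies are finite linearly ordered sets of atoms; $A$ is a finite set of agents. Boolean formulas over a vocabulary $W$: $\beta::=\top\mid\bot\mid p\mid\neg\beta\mid\beta\land\beta$ ($p\in W$), with usual abbreviations; a valuation/state is a subset $s\subseteq W$ and $s\vDash\beta$ ordinary satisfaction. $W'=\{p'\mid p\in W\}$ is a fresh copy and $s'=\{p'\mid p\in s\}$. $[A\mapsto B]\beta$ is simultaneous substitution (for copies via the obvious bijection); $\forall p\,\beta:=[p\mapsto\top]\beta\land[p\mapsto\bot]\beta$, extended to finite sets; for $x\subseteq W$, $[x\sqsubseteq W]\beta$ substitutes $\top$ for atoms in $x$ and $\bot$ for atoms of $W\setminus x$. BDDs are reduced ordered binary decision diagrams; size = number of nodes. Formulas: $\phi::=\top\mid\bot\mid p\mid\neg\phi\mid\phi\land\phi\mid K_i\phi\mid[d]\phi$;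 $\mathcal{L}_{\mathsf{EL}}$ has no $[d]$; in $\mathcal{L}_{\mathsf{PAL}}$, $d$ is $!\psi$ with $\psi\in\mathcal{L}_{\mathsf{PAL}}$; in $\mathcal{L}_{\mathsf{DEL}}$, $d$ is an event $(\mathcal{X},x)$ (mutual recursion). Length: $|\top|=|\bot|=|p|=1$, $|\neg\phi|=|K_i\phi|=|\phi|+1$, $|\phi_1\land\phi_2|=|\phi_1|+|\phi_2|+1$, $|[!\psi]\phi|=|\psi|+|\phi|+1$, $|[\mathcal{X},x]\phi|=|\mathcal{X}|+|\phi|+1$. A belief structure is $\mathcal{F}=(V,\theta,\Omega)$, $\theta$ Boolean over $V$, $\Omega_i$ Boolean over $V\cup V'$ ($i\in A$); states of $\mathcal{F}$ are $s\subseteq V$ with $s\vDash\theta$. A transformer is $\mathcal{X}=(V^+,\theta^+,V_-,\theta_-,\Omega^+)$ with $V^+\cap V=\varnothing$, $\theta^+\in\mathcal{L}_{\mathsf{DEL}}(V\cup V^+)$, $V_-\subseteq V$, $\theta_-:V_-\to$ Boolean formulas over $V\cup V^+$, $\Omega_i^+$ Boolean over $V^+\cup(V^+)'$; an event is $(\mathcal{X},x)$ with $x\subseteq V^+$; $|\mathcal{X}|=|V^+|+|\theta^+|+|V_-|+\sum_{p\in V_-}|\theta_-(p)|+\sum_i|\Omega_i^+|$. With $V_-^\circ$ a fresh copy of $V_-$: $\mathcal{F}\times\mathcal{X}=(V\cup V^+\cup V_-^\circ,\theta^{new},\Omega^{new})$, $\theta^{new}=[V_-\mapsto V_-^\circ](\theta\land\|\theta^+\|_{\mathcal{F}})\land\bigwedge_{q\in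 V_-}(q\leftrightarrow[V_-\mapsto V_-^\circ]\theta_-(q))$, $\Omega_i^{new}=[V_-\mapsto V_-^\circ][(V_-)'\mapsto(V_-^\circ)']\Omega_i\land\Omega_i^+$, and $s^x=(s\setminus V_-)\cup(s\cap V_-)^\circ\cup x\cup\{p\in V_-\mid s\cup x\vDash\theta_-(p)\}$. Semantics: Boolean cases as usual; $\mathcal{F},s\vDash K_i\phi$ iff for all states $t$ of $\mathcal{F}$ with $s\cup t'\vDash\Omega_i$, $\mathcal{F},t\vDash\phi$; $\mathcal{F},s\vDash[!\psi]\phi$ iff $\mathcal{F},s\vDash\psi$ implies $\mathcal{F}^\psi,s\vDash\phi$ with $\mathcal{F}^\psi=(V,\theta\land\|\psi\|_{\mathcal{F}},\Omega)$; $\mathcal{F},s\vDash[\mathcal{X},x]\phi$ iff $\mathcal{F},s\vDash[x\sqsubseteq V^+]\theta^+$ implies $\mathcal{F}\times\mathcal{X},s^x\vDash\phi$. Local Boolean translation: identity on $\top,\bot,p$, commutes with $\neg,\land$; $\|K_i\psi\|_{\mathcal{F}}=\forall V'(\theta'\to(\Omega_i\to(\|\psi\|_{\mathcal{F}})'))$; $\|[!\psi]\xi\|_{\mathcal{F}}=\|\psi\|_{\mathcal{F}}\to\|\xi\|_{\mathcal{F}^\psi}$; $\|[\mathcal{X},x]\phi\|_{\mathcal{F}}=\|[x\sqsubseteq V^+]\theta^+\|_{\mathcal{F}}\to[V_-^\circ\mapsto V_-][x\sqsubseteq V^+][V_-\mapsto\theta_-(V_-)]\|\phi\|_{\mathcal{F}\times\mathcal{X}}$.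 *)

(* Defs.v *)
From HB Require Import structures.
From mathcomp Require Import all_boot.
From mathcomp Require Import finmap zify.

Set Implicit Arguments.
Unset Strict Implicit.
Unset Printing Implicit Defensive.

Local Open Scope fset_scope.
Local Open Scope nat_scope.

(* A cell is blank ([None]), holds a bit, or holds a work symbol.  A tape has
   its head on the first cell of [tright]; [tleft] lists the cells to the left
   of the head, nearest first; everything beyond the two lists is blank. *)
Definition cell (G : Type) : Type := option (bool + G).

Record tape (G : Type) := Tape { tleft : seq (cell G); tright : seq (cell G) }.

Inductive move := MoveL | Stay | MoveR.

Definition tread (G : Type) (t : tape G) : cell G := head None (tright t).

Definition twrite (G : Type) (c : cell G) (t : tape G) : tape G :=
  Tape (tleft t) (c :: behead (tright t)).

Definition tmove (G : Type) (m : move) (t : tape G) : tape G :=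
  match m with
  | MoveL => Tape (behead (tleft t)) (head None (tleft t) :: tright t)
  | Stay => t
  | MoveR => Tape (tread t :: tleft t) (behead (tright t))
  end.

(* A machine has [tm_k.+1] tapes, and halts when [tm_delta] returns [None]. *)
Record tm := TM {
  tm_k : nat;
  tm_symb : finType;
  tm_state : finType;
  tm_start : tm_state;
  tm_accept : pred tm_state;
  tm_delta : tm_state -> {ffun 'I_tm_k.+1 -> cell tm_symb} ->
             option (tm_state * {ffun 'I_tm_k.+1 -> cell tm_symb * move}) }.

Record config (M : tm) := Config {
  c_state : tm_state M;
  c_tapes : {ffun 'I_(tm_k M).+1 -> tape (tm_symb M)} }.

Definition action (M : tm) (c : config M) :=
  tm_delta (c_state c) [ffun i => tread (c_tapes c i)].

Definition halted (M : tm) (c : config M) : bool := ~~ isSome (action c).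

Definition step (M : tm) (c : config M) : config M :=
  if action c is Some (q, act) then
    Config q [ffun i => tmove (act i).2 (twrite (act i).1 (c_tapes c i))]
  else c.

Definition init (M : tm) (w : seq bool) : config M :=
  Config (tm_start M)
    [ffun i => if i == ord0 then Tape [::] [seq Some (inl b) | b <- w]
               else Tape [::] [::]].

Definition run (M : tm) (w : seq bool) (n : nat) : config M :=
  iter n (@step M) (init M w).

Definition space (M : tm) (c : config M) : nat :=
  \sum_i (size (tleft (c_tapes c i)) + size (tright (c_tapes c i))).

Fixpoint leading_bits (G : Type) (s : seq (cell G)) : seq bool :=
  if s is Some (inl b) :: s' then b :: leading_bits s' else [::].

(* The output is read on the first tape, from the head to the first non-bit. *)
Definition output (M : tm) (c : config M) : seq bool :=
  leading_bits (tright (c_tapes c ord0)).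

Definition language := seq bool -> Prop.

Definition poly_bound (c k n : nat) : nat := c * n ^ k + c.

Definition PSPACE (A : language) : Prop :=
  exists (M : tm) (c k : nat), forall w : seq bool,
    (forall n, space (run M w n) <= poly_bound c k (size w)) /\
    exists n, halted (run M w n) /\ (tm_accept (c_state (run M w n)) <-> A w).

Definition polytime_computable (f : seq bool -> seq bool) : Prop :=
  exists (M : tm) (c k : nat), forall w : seq bool,
    exists n, [/\ n <= poly_bound c k (size w), halted (run M w n)
                & output (run M w n) = f w].

Definition polytime_reducible (A B : language) : Prop :=
  exists f, polytime_computable f /\ forall w, A w <-> B (f w).

Definition PSPACE_hard (B : language) : Prop :=
  forall A, PSPACE A -> polytime_reducible A B.

Definition PSPACE_complete (B : language) : Prop := PSPACE B /\ PSPACE_hard B.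

(* [(p, 0)] is the atom with name [p]; the atoms [(p, k)] with [k > 0] are only
   used as the fresh copies [p°] made by a product update.  [(a, true)] is the
   primed copy of the atom [a]. *)
Definition atom : Type := (nat * nat)%type.
Definition var : Type := (atom * bool)%type.

Definition base (a : atom) : bool := a.2 == 0.

Definition atom_lt (a b : atom) : bool := a.1 < b.1.

Inductive bform :=
| BTop
| BBot
| BVar of var
| BNot of bform
| BAnd of bform & bform.

Definition bimp (b1 b2 : bform) := BNot (BAnd b1 (BNot b2)).
Definition biff (b1 b2 : bform) := BAnd (bimp b1 b2) (bimp b2 b1).
Definition bite (v : var) (b1 b0 : bform) :=
  BAnd (bimp (BVar v) b1) (bimp (BNot (BVar v)) b0).
Definition bconst (b : bool) := if b then BTop else BBot.

Fixpoint blen (b : bform) : nat :=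
  match b with
  | BTop | BBot | BVar _ => 1
  | BNot b1 => (blen b1).+1
  | BAnd b1 b2 => (blen b1 + blen b2).+1
  end.

Fixpoint bover (W : pred var) (b : bform) : bool :=
  match b with
  | BTop | BBot => true
  | BVar v => W v
  | BNot b1 => bover W b1
  | BAnd b1 b2 => bover W b1 && bover W b2
  end.

Fixpoint beval (e : pred var) (b : bform) : bool :=
  match b with
  | BTop => true
  | BBot => false
  | BVar v => e v
  | BNot b1 => ~~ beval e b1
  | BAnd b1 b2 => beval e b1 && beval e b2
  end.

Fixpoint bsubst (f : var -> bform) (b : bform) : bform :=
  match b with
  | BTop => BTop
  | BBot => BBot
  | BVar v => f v
  | BNot b1 => BNot (bsubst f b1)
  | BAnd b1 b2 => BAnd (bsubst f b1) (bsubst f b2)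
  end.

(* The valuations [s] and [s ∪ t'] *)
Definition val1 (s : {fset atom}) : pred var :=
  fun v => ~~ v.2 && (v.1 \in s).
Definition val2 (s t : {fset atom}) : pred var :=
  fun v => if v.2 then v.1 \in t else v.1 \in s.

Definition bset (v : var) (c : bool) : bform -> bform :=
  bsubst (fun u => if u == v then bconst c else BVar u).

Definition ball (v : var) (b : bform) : bform :=
  BAnd (bset v true b) (bset v false b).

Definition balls (vs : seq var) (b : bform) : bform := foldr ball b vs.

(* [[V ↦ V']] *)
Definition bprime (V : {fset atom}) : bform -> bform :=
  bsubst (fun v => if ~~ v.2 && (v.1 \in V) then BVar (v.1, true) else BVar v).

(* [[x ⊑ W]] *)
Definition bfix (x W : seq atom) : bform -> bform :=
  bsubst (fun v => if ~~ v.2 && (v.1 \in W) then bconst (v.1 \in x)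
                   else BVar v).

(* The agents are [0, ..., n - 1].  In a transformer, [V_-] is the list of first
   components of [t_minus], and [Ω⁺_i] is the [i]-th item of [t_obs]. *)
Inductive form :=
| Top
| Bot
| Atom of atom
| Not of form
| And of form & form
| Know of nat & form
| Announce of form & form
| Event of transformer & seq atom & form
with transformer :=
| Transformer (t_plus : seq atom) (t_pre : form)
    (t_minus : seq (atom * bform)) (t_obs : seq bform).

Definition t_plus (X : transformer) := let: Transformer Vp _ _ _ := X in Vp.
Definition t_pre (X : transformer) := let: Transformer _ f _ _ := X in f.
Definition t_minus (X : transformer) := let: Transformer _ _ tm _ := X in tm.
Definition t_obs (X : transformer) := let: Transformer _ _ _ om := X in om.

Definition vminus (X : transformer) : seq atom := unzip1 (t_minus X).

Definition post (X : transformer) (q : atom) : bform :=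
  nth BBot (unzip2 (t_minus X)) (index q (vminus X)).

Fixpoint flen (f : form) : nat :=
  match f with
  | Top | Bot | Atom _ => 1
  | Not g | Know _ g => (flen g).+1
  | And g h | Announce g h => (flen g + flen h).+1
  | Event X _ g => (tlen X + flen g).+1
  end
with tlen (X : transformer) : nat :=
  let: Transformer Vp g pm om := X in
  size Vp + flen g + size pm + sumn [seq blen qb.2 | qb <- pm]
  + sumn [seq blen b | b <- om].

Inductive logic := EL | PAL | DEL.

Fixpoint in_logic (L : logic) (f : form) : bool :=
  match f with
  | Top | Bot | Atom _ => true
  | Not g | Know _ g => in_logic L g
  | And g h => in_logic L g && in_logic L h
  | Announce g h =>
      if L is PAL then in_logic L g && in_logic L h else false
  | Event (Transformer _ g _ _) _ h =>
      if L is DEL then in_logic L g && in_logic L h else false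
  end.

Definition over_atoms (W : seq atom) : pred var :=
  fun v => ~~ v.2 && (v.1 \in W).
Definition over_primed (W : seq atom) : pred var := fun v => v.1 \in W.

(* [wf n V P f]: [f] is a formula for [n] agents, to be evaluated in structures
   with vocabulary [V] (copies [p°] apart), whose atoms are in [V ∪ P].  [P]
   collects the atoms of enclosing [V⁺]: the precondition of a transformer is a
   formula over [V ∪ V⁺], but is evaluated, after replacing [V⁺] by constants,
   in a structure with vocabulary [V]. *)
Fixpoint wf (n : nat) (V P : seq atom) (f : form) : bool :=
  match f with
  | Top | Bot => true
  | Atom a => a \in V ++ P
  | Not g => wf n V P g
  | And g h | Announce g h => wf n V P g && wf n V P h
  | Know i g => (i < n) && wf n V P g
  | Event X x g =>
      [&& wf_transformer n V P X, sorted atom_lt x,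
          all [in t_plus X] x & wf n (V ++ t_plus X) P g]
  end
with wf_transformer (n : nat) (V P : seq atom) (X : transformer) : bool :=
  let: Transformer Vp g pm om := X in
  [&& all base Vp, sorted atom_lt Vp, ~~ has [in V ++ P] Vp,
      wf n V (P ++ Vp) g,
      sorted atom_lt (unzip1 pm), all [in V] (unzip1 pm),
      all (bover (over_atoms (V ++ P ++ Vp))) (unzip2 pm),
      size om == n & all (bover (over_primed Vp)) om].

(* [[x ⊑ W]]; by well-formedness [W] does not meet the [V⁺] and [V_-] of the
   transformers in the formula. *)
Fixpoint ffix (x W : seq atom) (f : form) : form :=
  match f with
  | Top => Top
  | Bot => Bot
  | Atom a => if a \in W then (if a \in x then Top else Bot) else Atom a
  | Not g => Not (ffix x W g)
  | And g h => And (ffix x W g) (ffix x W h)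
  | Know i g => Know i (ffix x W g)
  | Announce g h => Announce (ffix x W g) (ffix x W h)
  | Event X y g => Event (tfix x W X) y (ffix x W g)
  end
with tfix (x W : seq atom) (X : transformer) : transformer :=
  let: Transformer Vp g pm om := X in
  Transformer Vp (ffix x W g) [seq (qb.1, bfix x W qb.2) | qb <- pm] om.

Record bstruct := BStruct {
  voc : {fset atom};
  law : bform;
  obs : nat -> bform }.

Definition is_state (F : bstruct) (s : {fset atom}) : bool :=
  (s `<=` voc F) && beval (val1 s) (law F).

Definition restrict (F : bstruct) (b : bform) : bstruct :=
  BStruct (voc F) (BAnd (law F) b) (obs F).

(* Atoms are copied into layers above those occurring in the vocabulary. *)
Definition layers (F : bstruct) : nat := (\max_(a <- voc F) a.2).+1.
Definition circ (F : bstruct) (a : atom) : atom := (a.1, a.2 + layers F).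
Definition uncirc (F : bstruct) (a : atom) : atom := (a.1, a.2 - layers F).

(* [[V_- ↦ V_-°]], on unprimed and on primed atoms *)
Definition bcirc (F : bstruct) (W : seq atom) : bform -> bform :=
  bsubst (fun v => if ~~ v.2 && (v.1 \in W) then BVar (circ F v.1, false)
                   else BVar v).
Definition bcirc' (F : bstruct) (W : seq atom) : bform -> bform :=
  bsubst (fun v => if v.2 && (v.1 \in W) then BVar (circ F v.1, true)
                   else BVar v).

(* [[V_-° ↦ V_-]] *)
Definition buncirc (F : bstruct) (W : seq atom) : bform -> bform :=
  bsubst (fun v => if ~~ v.2 && (v.1 \in [seq circ F a | a <- W])
                   then BVar (uncirc F v.1, false) else BVar v).

(* [[V_- ↦ θ_-(V_-)]] *)
Definition bpost (X : transformer) : bform -> bform :=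
  bsubst (fun v => if ~~ v.2 && (v.1 \in vminus X) then post X v.1
                   else BVar v).

(* The product update; [b] stands for [‖θ⁺‖_F]. *)
Definition product_with (b : bform) (F : bstruct) (X : transformer) : bstruct :=
  let W := vminus X in
  BStruct
    (voc F `|` [fset a | a in t_plus X] `|` [fset circ F a | a in W])
    (BAnd (bcirc F W (BAnd (law F) b))
       (foldr BAnd BTop
          [seq biff (BVar (q, false)) (bcirc F W (post X q)) | q <- W]))
    (fun i => BAnd (bcirc F W (bcirc' F W (obs F i))) (nth BBot (t_obs X) i)).

(* [s^x] *)
Definition state_update (F : bstruct) (s : {fset atom}) (X : transformer)
    (x : seq atom) : {fset atom} :=
  let W := [fset a | a in vminus X] in
  (s `\` W) `|` [fset circ F a | a in s `&` W] `|` [fset a | a in x]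
  `|` [fset a | a in W & beval (val1 (s `|` [fset c | c in x])) (post X a)].

(* Neither is structurally recursive, because of [[x ⊑ V⁺]θ⁺]: both recurse on a
   bound on the length.  The intended recursive clauses are the lemmas below. *)
Fixpoint translate_rec (n : nat) (F : bstruct) (f : form) : bform :=
  if n isn't m.+1 then BBot else
  match f with
  | Top => BTop
  | Bot => BBot
  | Atom a => BVar (a, false)
  | Not g => BNot (translate_rec m F g)
  | And g h => BAnd (translate_rec m F g) (translate_rec m F h)
  | Know i g =>
      balls [seq (a, true) | a <- voc F]
        (bimp (bprime (voc F) (law F))
           (bimp (obs F i) (bprime (voc F) (translate_rec m F g))))
  | Announce g h =>
      bimp (translate_rec m F g)
        (translate_rec m (restrict F (translate_rec m F g)) h)
  | Event X x g =>
      bimp (translate_rec m F (ffix x (t_plus X) (t_pre X)))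
        (buncirc F (vminus X) (bfix x (t_plus X) (bpost X
           (translate_rec m (product_with (translate_rec m F (t_pre X)) F X)
              g))))
  end.

Definition translate (F : bstruct) (f : form) : bform :=
  translate_rec (flen f) F f.

Definition announce (F : bstruct) (g : form) : bstruct :=
  restrict F (translate F g).

Definition product (F : bstruct) (X : transformer) : bstruct :=
  product_with (translate F (t_pre X)) F X.

Fixpoint sat_rec (n : nat) (F : bstruct) (s : {fset atom}) (f : form) : Prop :=
  if n isn't m.+1 then False else
  match f with
  | Top => True
  | Bot => False
  | Atom a => a \in s
  | Not g => ~ sat_rec m F s g
  | And g h => sat_rec m F s g /\ sat_rec m F s h
  | Know i g =>
      forall t, is_state F t -> beval (val2 s t) (obs F i) -> sat_rec m F t g
  | Announce g h => sat_rec m F s g -> sat_rec m (announce F g) s h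
  | Event X x g =>
      sat_rec m F s (ffix x (t_plus X) (t_pre X)) ->
      sat_rec m (product F X) (state_update F s X x) g
  end.

Definition sat (F : bstruct) (s : {fset atom}) (f : form) : Prop :=
  sat_rec (flen f) F s f.

Lemma flen_gt0 f : 0 < flen f.
Proof. by case: f. Qed.

Lemma bfix_len x W b : blen (bfix x W b) = blen b.
Proof.
rewrite /bfix; elim: b => //= [v|b -> //|b -> c -> //].
by case: ifP => // _; case: (_ \in _).
Qed.

Fixpoint ffix_len x W f : flen (ffix x W f) = flen f
with tfix_len x W X : tlen (tfix x W X) = tlen X.
Proof.
- case: f => //= [a|g|g h|i g|g h|X y g]; rewrite ?ffix_len ?tfix_len //.
  by case: ifP => // _; case: ifP.
- case: X => Vp g pm om /=; rewrite ffix_len size_map -map_comp.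
  by congr (_ + sumn _ + _); apply: eq_map => qb /=; rewrite bfix_len.
Qed.

Lemma tlen_pre X : flen (t_pre X) <= tlen X.
Proof.
by case: X => Vp g pm om /=; rewrite -!addnA addnCA leq_addr.
Qed.

Lemma translate_rec_stable n f F :
  flen f <= n -> translate_rec n F f = translate F f.
Proof.
move=> le_n; rewrite /translate.
suff H : forall n m g F, flen g <= n -> flen g <= m ->
    translate_rec n F g = translate_rec m F g by exact: H.
move=> {n f F le_n}; elim=> [|n IH] [|m] f F //.
- by rewrite leqNgt flen_gt0.
- by move=> _; rewrite leqNgt flen_gt0.
have leD p q r : p + q <= r -> p <= r /\ q <= r.
  by move=> h; rewrite !(leq_trans _ h) ?leq_addr ?leq_addl.
case: f => //= [g|g h|i g|g h|X x g]; rewrite !ltnS.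
- by move=> le1 le2; rewrite (IH m).
- by move=> /leD[? ?] /leD[? ?]; rewrite !(IH m).
- by move=> le1 le2; rewrite (IH m).
- by move=> /leD[? ?] /leD[? ?]; rewrite !(IH m).
move=> /leD[le1 ?] /leD[le2 ?].
by rewrite !(IH m) // ?ffix_len (leq_trans (tlen_pre X)).
Qed.

Lemma translate_not F g : translate F (Not g) = BNot (translate F g).
Proof. by []. Qed.

Lemma translate_and F g h :
  translate F (And g h) = BAnd (translate F g) (translate F h).
Proof.
by rewrite {1}/translate /= !translate_rec_stable ?leq_addr ?leq_addl.
Qed.

Lemma translate_know F i g :
  translate F (Know i g) =
  balls [seq (a, true) | a <- voc F]
    (bimp (bprime (voc F) (law F))
       (bimp (obs F i) (bprime (voc F) (translate F g)))).
Proof. by []. Qed.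

Lemma translate_announce F g h :
  translate F (Announce g h) =
  bimp (translate F g) (translate (announce F g) h).
Proof.
by rewrite {1}/translate /= !translate_rec_stable ?leq_addr ?leq_addl.
Qed.

Lemma translate_event F X x g :
  translate F (Event X x g) =
  bimp (translate F (ffix x (t_plus X) (t_pre X)))
    (buncirc F (vminus X) (bfix x (t_plus X) (bpost X
       (translate (product F X) g)))).
Proof.
by rewrite {1}/translate /= !translate_rec_stable ?ffix_len ?leq_addl //
   (leq_trans (tlen_pre X)) ?leq_addr.
Qed.

Lemma sat_rec_stable n f F s : flen f <= n -> sat_rec n F s f <-> sat F s f.
Proof.
move=> le_n; rewrite /sat.
suff H : forall n m g F s, flen g <= n -> flen g <= m ->
    sat_rec n F s g <-> sat_rec m F s g by exact: H.
move=> {n f F s le_n}; elim=> [|n IH] [|m] f F s //.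
- by rewrite leqNgt flen_gt0.
- by move=> _; rewrite leqNgt flen_gt0.
have leD p q r : p + q <= r -> p <= r /\ q <= r.
  by move=> h; rewrite !(leq_trans _ h) ?leq_addr ?leq_addl.
case: f => //= [g|g h|i g|g h|X x g]; rewrite !ltnS.
- by move=> le1 le2; rewrite (IH m).
- by move=> /leD[? ?] /leD[? ?]; rewrite !(IH m).
- move=> le1 le2; split=> sat_g t st ob; move: (sat_g t st ob);
  by rewrite (IH m).
- by move=> /leD[? ?] /leD[? ?]; rewrite !(IH m).
move=> /leD[le1 ?] /leD[le2 ?].
by rewrite !(IH m) // ffix_len (leq_trans (tlen_pre X)).
Qed.

Lemma sat_not F s g : sat F s (Not g) <-> ~ sat F s g.
Proof. by []. Qed.

Lemma sat_and F s g h : sat F s (And g h) <-> sat F s g /\ sat F s h.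
Proof. by rewrite {1}/sat /= !sat_rec_stable ?leq_addr ?leq_addl. Qed.

Lemma sat_know F s i g :
  sat F s (Know i g) <->
  forall t, is_state F t -> beval (val2 s t) (obs F i) -> sat F t g.
Proof. by []. Qed.

Lemma sat_announce F s g h :
  sat F s (Announce g h) <-> (sat F s g -> sat (announce F g) s h).
Proof. by rewrite {1}/sat /= !sat_rec_stable ?leq_addr ?leq_addl. Qed.

Lemma sat_event F s X x g :
  sat F s (Event X x g) <->
  (sat F s (ffix x (t_plus X) (t_pre X)) ->
   sat (product F X) (state_update F s X x) g).
Proof.
by rewrite {1}/sat /= !sat_rec_stable ?leq_addl // ffix_len
   (leq_trans (tlen_pre X)) ?leq_addr.
Qed.

(* Decision nodes are listed so that children precede parents; a node tests a
   variable and gives its low and high child.  A reference is a terminal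
   ([inl b]) or the position of a decision node ([inr j]). *)
Definition bref : Type := (bool + nat)%type.

Record bdd := Bdd {
  bdd_nodes : seq (var * (bref * bref));
  bdd_root : bref }.

(* The order of [V ∪ V'] is interleaved: [p < p' < q < q'] whenever [p < q]. *)
Definition var_lt (u v : var) : bool :=
  atom_lt u.1 v.1 || (u.1 == v.1) && ~~ u.2 && v.2.

Definition bdd_node (B : bdd) (i : nat) :=
  nth (((0, 0), false), (inl false, inl false)) (bdd_nodes B) i.

Definition bdd_child_ok (B : bdd) (i : nat) (r : bref) : bool :=
  if r is inr j then (j < i) && var_lt (bdd_node B i).1 (bdd_node B j).1
  else true.

(* [B] is a reduced ordered BDD over [W]: tests increase along edges, no two
   nodes are equal, no test is redundant, and every node is reachable from the
   root (as children precede parents, it is enough that each node except the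
   root has a parent). *)
Definition robdd (W : pred var) (B : bdd) : bool :=
  [&& uniq (bdd_nodes B),
      (if bdd_root B is inr j then j < size (bdd_nodes B) else true)
    & all (fun i => let: (v, (lo, hi)) := bdd_node B i in
             [&& W v, lo != hi, bdd_child_ok B i lo, bdd_child_ok B i hi
               & (bdd_root B == inr i) ||
                 has (fun u => (u.2.1 == inr i) || (u.2.2 == inr i))
                   (bdd_nodes B)])
        (iota 0 (size (bdd_nodes B)))].

(* A reduced diagram with a decision node has both terminals. *)
Definition bdd_size (B : bdd) : nat :=
  size (bdd_nodes B) + (if bdd_nodes B is [::] then 1 else 2).

Definition bref_form (fs : seq bform) (r : bref) : bform :=
  match r with inl b => bconst b | inr j => nth BBot fs j end.

(* The Boolean formula represented by a diagram (Shannon expansion) *)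
Definition bdd_form (B : bdd) : bform :=
  bref_form
    (foldl (fun fs u => let: (v, (lo, hi)) := u in
              rcons fs (bite v (bref_form fs hi) (bref_form fs lo)))
       [::] (bdd_nodes B))
    (bdd_root B).

(* Finite sets of atoms are given as increasing lists. *)
Record instance := Instance {
  i_voc : seq atom;
  i_law : bdd;
  i_obs : seq bdd;
  i_state : seq atom;
  i_form : form }.

Definition input_size (I : instance) : nat :=
  size (i_voc I) + bdd_size (i_law I) + sumn [seq bdd_size B | B <- i_obs I]
  + flen (i_form I).

Definition inst_struct (I : instance) : bstruct :=
  BStruct [fset a | a in i_voc I] (bdd_form (i_law I))
    (fun i => nth BBot [seq bdd_form B | B <- i_obs I] i).

Definition inst_state (I : instance) : {fset atom} := [fset a | a in i_state I].

Fixpoint new_atoms (f : form) : seq atom :=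
  match f with
  | Top | Bot | Atom _ => [::]
  | Not g | Know _ g => new_atoms g
  | And g h | Announce g h => new_atoms g ++ new_atoms h
  | Event (Transformer Vp g _ _) _ h => Vp ++ new_atoms g ++ new_atoms h
  end.

(* Since an atom counts for 1 in the input size, the names of the atoms are
   numbers smaller than the input size (which is no restriction up to renaming);
   otherwise the length of the encoding below could not be bounded in terms of
   the input size. *)
Definition compact (I : instance) : bool :=
  all (fun a => a.1 < input_size I) (i_voc I ++ new_atoms (i_form I)).

Definition valid (L : logic) (I : instance) : bool :=
  [&& all base (i_voc I), sorted atom_lt (i_voc I),
      robdd (over_atoms (i_voc I)) (i_law I),
      all (robdd (over_primed (i_voc I))) (i_obs I),
      sorted atom_lt (i_state I),
      is_state (inst_struct I) (inst_state I),
      wf (size (i_obs I)) (i_voc I) [::] (i_form I),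
      in_logic L (i_form I)
    & compact I].

(* Instances are serialized in prefix notation as lists of numbers, and the
   number [n] is written [1^n 0]. *)
Definition ser_seq (T : Type) (ser : T -> seq nat) (s : seq T) : seq nat :=
  size s :: flatten (map ser s).

Definition ser_atom (a : atom) : seq nat := [:: a.1; a.2].
Definition ser_var (v : var) : seq nat := rcons (ser_atom v.1) (nat_of_bool v.2).

Definition ser_bref (r : bref) : seq nat :=
  match r with inl b => [:: 0; nat_of_bool b] | inr j => [:: 1; j] end.

Definition ser_bdd (B : bdd) : seq nat :=
  ser_seq (fun u => ser_var u.1 ++ ser_bref u.2.1 ++ ser_bref u.2.2)
    (bdd_nodes B) ++ ser_bref (bdd_root B).

Fixpoint ser_bform (b : bform) : seq nat :=
  match b with
  | BTop => [:: 0]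
  | BBot => [:: 1]
  | BVar v => 2 :: ser_var v
  | BNot b1 => 3 :: ser_bform b1
  | BAnd b1 b2 => 4 :: ser_bform b1 ++ ser_bform b2
  end.

Fixpoint ser_form (f : form) : seq nat :=
  match f with
  | Top => [:: 0]
  | Bot => [:: 1]
  | Atom a => 2 :: ser_atom a
  | Not g => 3 :: ser_form g
  | And g h => 4 :: ser_form g ++ ser_form h
  | Know i g => 5 :: i :: ser_form g
  | Announce g h => 6 :: ser_form g ++ ser_form h
  | Event (Transformer Vp g pm om) x h =>
      7 :: ser_seq ser_atom Vp ++ ser_form g
        ++ ser_seq (fun qb => ser_atom qb.1 ++ ser_bform qb.2) pm
        ++ ser_seq ser_bform om ++ ser_seq ser_atom x ++ ser_form h
  end.

Definition ser_instance (I : instance) : seq nat :=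
  ser_seq ser_atom (i_voc I) ++ ser_bdd (i_law I) ++ ser_seq ser_bdd (i_obs I)
  ++ ser_seq ser_atom (i_state I) ++ ser_form (i_form I).

Definition ser_nat (n : nat) : seq bool := rcons (nseq n true) false.

Definition encode (I : instance) : seq bool :=
  flatten (map ser_nat (ser_instance I)).

Definition model_checking (L : logic) : language :=
  fun w => exists I : instance,
    [/\ encode I = w, valid L I
      & sat (inst_struct I) (inst_state I) (i_form I)].

Definition prefix_code (T U : Type) (ser : T -> seq U) : Prop :=
  forall x y r r', ser x ++ r = ser y ++ r' -> x = y /\ r = r'.

Lemma prefix_code_inj (T U : Type) (ser : T -> seq U) :
  prefix_code ser -> injective ser.
Proof.
by move=> H x y e; have [] := H x y [::] [::]; rewrite ?e.
Qed.

Lemma ser_seqP (T : Type) (ser : T -> seq nat) :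
  prefix_code ser -> prefix_code (ser_seq ser).
Proof.
move=> H; elim=> [|x s IH] [|y t] r r' //= [] //.
rewrite -!catA => es /H[-> e].
by have [|-> ->] := IH t r r'; rewrite //= es e.
Qed.

Lemma ser_atomP : prefix_code ser_atom.
Proof. by move=> [? ?] [? ?] r r' /= [-> -> ->]. Qed.

Lemma ser_varP : prefix_code ser_var.
Proof. by move=> [[? ?] [|]] [[? ?] [|]] r r' /= [-> -> // ->]. Qed.

Lemma ser_brefP : prefix_code ser_bref.
Proof.
by move=> [[|]|j] [[|]|j'] r r' //=; case=> // -> // ->.
Qed.

Lemma ser_bddP : prefix_code ser_bdd.
Proof.
move=> [s x] [t y] r r'; rewrite /ser_bdd -!catA => /ser_seqP[].
  move=> [u [a b]] [v [c d]] q q'; rewrite /= -!catA.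
  by move=> /ser_varP[-> /ser_brefP[-> /ser_brefP[-> ->]]].
by rewrite /= => -> /ser_brefP[-> ->].
Qed.

Lemma ser_bformP : prefix_code ser_bform.
Proof.
elim=> [||v|b IH|b IH c IH'] [||v'|b'|b' c'] r r' //= [].
- by move=> ->.
- by move=> ->.
- by case: v v' => [[? ?] [|]] [[? ?] [|]] /= -> -> // ->.
- by move=> /IH[-> ->].
- by rewrite -!catA => /IH[-> /IH'[-> ->]].
Qed.

Lemma ser_formP : prefix_code ser_form.
Proof.
rewrite /prefix_code; fix IH 1.
case=> [||a|g|g h|i g|g h|[Vp g pm om] x h]
       [||a'|g'|g' h'|i' g'|g' h'|[Vp' g' pm' om'] x' h'] r r' e;
  try by [].
- by case: e => ->.
- by case: e => ->.
- by case: a a' e => [? ?] [? ?] /= [-> -> ->].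
- by case: e => /= /IH[-> ->].
- by case: e; rewrite -!catA => /IH[-> /IH[-> ->]].
- by case: e => -> /IH[-> ->].
- by case: e; rewrite -!catA => /IH[-> /IH[-> ->]].
have cI (s t : seq nat) : (7 :: s) ++ r = (7 :: t) ++ r' -> s ++ r = t ++ r'.
  by case.
move/cI: e; rewrite -!catA.
move=> /(ser_seqP ser_atomP)[-> /IH[->]].
move=> /ser_seqP[|-> /(ser_seqP ser_bformP)[->]].
  move=> [[? ?] b] [[? ?] b'] q q' /=.
  by case=> -> -> /ser_bformP[-> ->].
by move=> /(ser_seqP ser_atomP)[-> /IH[-> ->]].
Qed.

Lemma ser_natP : prefix_code ser_nat.
Proof.
elim=> [|n IH] [|m] r r' //=; first by case=> ->.
by case=> /IH[-> ->].
Qed.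

Theorem encode_inj : injective encode.
Proof.
move=> I J; rewrite /encode => e.
have: ser_instance I = ser_instance J.
  elim: (ser_instance I) (ser_instance J) e => [|n s IH] [|m t] //=;
    rewrite /ser_nat; [by case: m | by case: n |].
  by move=> /ser_natP[-> /IH ->].
case: I J {e} => [V B O s f] [V' B' O' s' f']; rewrite /ser_instance /=.
rewrite -!cat_cons => /(ser_seqP ser_atomP)[-> /ser_bddP[->]].
move=> /(ser_seqP ser_bddP)[-> /(ser_seqP ser_atomP)[-> e]].
by rewrite (prefix_code_inj ser_formP e).
Qed.

Lemma size_ser_seq (T : Type) (ser : T -> seq nat) s :
  size (ser_seq ser s) = (sumn [seq size (ser x) | x <- s]).+1.
Proof. by rewrite /ser_seq /= size_flatten /shape -map_comp. Qed.

Lemma size_ser_atoms s : size (ser_seq ser_atom s) = (2 * size s).+1.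
Proof. by rewrite size_ser_seq; elim: s => //= a s [->]; rewrite mulnS. Qed.

Lemma sumn_le (T : Type) (m n : T -> nat) c s : (forall x, m x <= c * n x) ->
  sumn (map m s) <= c * sumn (map n s).
Proof. by move=> H; elim: s => //= x s IH; have := H x; lia. Qed.

Lemma size_ser_bform b : blen b <= size (ser_bform b) <= 4 * blen b.
Proof. by elim: b => //= [b|b IH c IH']; rewrite ?size_cat; lia. Qed.

Lemma size_ser_bdd B : bdd_size B <= size (ser_bdd B) <= 8 * bdd_size B.
Proof.
case: B => s r; rewrite /ser_bdd /bdd_size size_cat size_ser_seq /=.
have -> : size (ser_bref r) = 2 by case: r.
have -> : sumn [seq size (ser_var u.1 ++ ser_bref u.2.1 ++ ser_bref u.2.2)
               | u <- s] = 7 * size s.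
  elim: s => //= [[v [lo hi]]] s ->; rewrite !size_cat /= mulnS.
  by case: lo; case: hi.
by case: s => //= u s; lia.
Qed.

Lemma size_ser_post (s : seq (atom * bform)) :
  let n := sumn [seq size (ser_atom qb.1 ++ ser_bform qb.2) | qb <- s] in
  let m := sumn [seq blen qb.2 | qb <- s] in
  size s + m <= n <= 2 * size s + 4 * m.
Proof.
elim: s => //= -[q b] s /=.
by have := size_ser_bform b; lia.
Qed.

Lemma size_ser_obs (s : seq bform) :
  let n := sumn [seq size (ser_bform b) | b <- s] in
  let m := sumn [seq blen b | b <- s] in m <= n <= 4 * m.
Proof.
elim: s => //= b s.
by have := size_ser_bform b; lia.
Qed.

Lemma size_ser_event Vp g pm om x h :
  size (ser_form (Event (Transformer Vp g pm om) x h)) =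
  2 * size Vp + size (ser_form g)
  + sumn [seq size (ser_atom qb.1 ++ ser_bform qb.2) | qb <- pm]
  + sumn [seq size (ser_bform b) | b <- om] + 2 * size x
  + size (ser_form h) + 5.
Proof.
transitivity (size ([:: 7] ++ ser_seq ser_atom Vp ++ ser_form g
    ++ ser_seq (fun qb => ser_atom qb.1 ++ ser_bform qb.2) pm
    ++ ser_seq ser_bform om ++ ser_seq ser_atom x ++ ser_form h)) => //.
by rewrite !size_cat !size_ser_atoms !size_ser_seq [size [:: 7]]/=; lia.
Qed.

Lemma size_ser_form_ge f : flen f <= size (ser_form f).
Proof.
move: f; fix IH 1.
case=> [||a|g|g h|i g|g h|[Vp g pm om] x h]; last first.
  rewrite size_ser_event [flen _]/=; have := IH g; have := IH h.
  by have := size_ser_post pm; have := size_ser_obs om; cbv zeta; lia.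
all: rewrite /= ?size_cat //.
all: by try (have := IH h); have := IH g; lia.
Qed.

Lemma atom_lt_uniq s : sorted atom_lt s -> uniq s.
Proof.
apply: sorted_uniq => [b a c|a]; first exact: ltn_trans.
exact: ltnn.
Qed.

Lemma size_ser_form_le n V P f : wf n V P f -> size (ser_form f) <= 8 * flen f.
Proof.
move: f V P; fix IH 1.
case=> [||a|g|g h|i g|g h|[Vp g pm om] x h] V P; last first.
  rewrite size_ser_event [flen _]/= => /and4P[].
  move=> /and5P[_ _ _ /IH le_g _] /atom_lt_uniq x_uniq /allP x_sub /IH le_h.
  have le_x : size x <= size Vp by exact: uniq_leq_size.
  have := size_ser_post pm; have := size_ser_obs om; cbv zeta; lia.
all: rewrite /= ?size_cat //.
- by move=> /andP[/IH le_g /IH le_h]; lia.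
- by move=> /andP[_ /IH le_g]; lia.
- by move=> /andP[/IH le_g /IH le_h]; lia.
- by move=> /IH le_g; lia.
Qed.

Lemma size_ser_instance I :
  size (ser_instance I) =
  2 * size (i_voc I) + size (ser_bdd (i_law I))
  + sumn [seq size (ser_bdd B) | B <- i_obs I] + 2 * size (i_state I)
  + size (ser_form (i_form I)) + 3.
Proof.
rewrite /ser_instance; move: (ser_bdd (i_law I)) (ser_form _) => b f.
rewrite !size_cat !size_ser_atoms (size_ser_seq ser_bdd); lia.
Qed.

Theorem input_size_le_encode I : input_size I <= size (encode I).
Proof.
apply: (@leq_trans (size (ser_instance I))).
  rewrite /input_size size_ser_instance.
  have := size_ser_form_ge (i_form I); have := size_ser_bdd (i_law I).
  have : sumn [seq bdd_size B | B <- i_obs I] <=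
         sumn [seq size (ser_bdd B) | B <- i_obs I].
    rewrite -[X in _ <= X]mul1n sumn_le // => B.
    by have := size_ser_bdd B; lia.
  lia.
rewrite /encode; elim: (ser_instance I) => //= m s IH.
by rewrite size_cat size_rcons; lia.
Qed.

Definition small (N : nat) : pred nat := fun m => m <= N + 7.
Definition ok (N : nat) : pred atom := fun a => (a.1 < N) && base a.

Lemma ser_seq_small N (T : Type) (ser : T -> seq nat) (s : seq T) :
  size s <= N -> all (fun x => all (small N) (ser x)) s -> all (small N) (ser_seq ser s).
Proof.
move=> le_s H; apply/andP; split; first by rewrite /small; lia.
change (all (small N) (flatten (map ser s))).
by elim: s H {le_s} => //= x s IH /andP[? /IH ?]; rewrite all_cat; apply/andP.
Qed.

Lemma ser_atom_small N a : ok N a -> all (small N) (ser_atom a).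
Proof. by rewrite /ok /base /= /small; lia. Qed.

Lemma ser_atoms_small N s :
  size s <= N -> all (ok N) s -> all (small N) (ser_seq ser_atom s).
Proof.
move=> le_s s_ok; apply: ser_seq_small => //.
by apply: sub_all s_ok => a; apply: ser_atom_small.
Qed.

Lemma ser_var_small N v : ok N v.1 -> all (small N) (ser_var v).
Proof. by rewrite /ok /base /= /small; case: v.2; lia. Qed.

Lemma ser_bform_small N (W : pred var) b :
  (forall v, W v -> ok N v.1) -> bover W b -> all (small N) (ser_bform b).
Proof.
move=> W_ok; elim: b => [_|_|v /W_ok v_ok|b IH|b IH c IH' /andP[? ?]] /=.
- by rewrite /small; lia.
- by rewrite /small; lia.
- by have /= -> := ser_var_small v_ok; rewrite /small; lia.
- by move/IH->; rewrite /small; lia.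
- by rewrite all_cat IH // IH' // /small; lia.
Qed.

Lemma ser_bdd_small N (W : pred var) B : (forall v, W v -> ok N v.1) -> robdd W B ->
  bdd_size B <= N -> all (small N) (ser_bdd B).
Proof.
move=> W_ok /and3P[_ root_ok /allP nodes_ok] le_B.
have le_s : size (bdd_nodes B) <= N by move: le_B; rewrite /bdd_size; lia.
have ref_small r i : i <= N -> (if r is inr j then j < i else true) ->
    all (small N) (ser_bref r).
  by case: r => [b|j] /=; rewrite /small; [case: b|]; lia.
rewrite /ser_bdd all_cat (ref_small _ (size (bdd_nodes B))) // andbT.
apply: ser_seq_small => //; apply/(all_nthP (((0, 0), false), (inl false, inl false))).
move=> i lt_i; have := nodes_ok i; rewrite mem_iota add0n lt_i => /(_ isT).
rewrite -/(bdd_node B i); case: (bdd_node B i) => v [lo hi].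
move=> /and5P[/W_ok v_ok _ lo_ok hi_ok _].
have le_i : i <= N by exact: ltnW (leq_trans lt_i le_s).
have child_small r : bdd_child_ok B i r -> all (small N) (ser_bref r).
  by move=> r_ok; apply: ref_small le_i _; case: r r_ok => // j /andP[].
change (all (small N) (ser_var v ++ ser_bref lo ++ ser_bref hi)).
by rewrite all_cat ser_var_small // all_cat !child_small.
Qed.

Lemma sumn_mem (T : Type) (m : T -> nat) s : all (fun x => m x <= sumn (map m s)) s.
Proof.
elim: s => //= x s IH; rewrite leq_addr /=.
by apply: sub_all IH => y /leq_trans-> //; rewrite leq_addl.
Qed.

Lemma ser_form_small N n V P f : wf n V P f -> n <= N -> flen f <= N ->
  all (ok N) (V ++ P) -> all (fun a => a.1 < N) (new_atoms f) ->
  all (small N) (ser_form f).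
Proof.
have le7 k : k <= 7 -> small N k by rewrite /small; lia.
move: f V P; fix IH 1.
case=> [||a|g|g h|i g|g h|[Vp g pm om] x h] V P; last first.
- move=> /and4P[/and5P[base_Vp _ _ wf_g /and5P[_ sub_V over_pm /eqP size_om over_om]]].
  move=> /atom_lt_uniq x_uniq sub_x wf_h le_n.
  rewrite [flen _]/= => le_f VP_ok; rewrite [new_atoms _]/= !all_cat.
  move=> /and3P[lt_Vp lt_g lt_h].
  have [le_Vp le_g le_pm le_h] :
      [/\ size Vp <= N, flen g <= N, size pm <= N & flen h <= N].
    by clear -le_f; split; lia.
  have Vp_ok : all (ok N) Vp.
    by apply/allP=> a aV; rewrite /ok (allP lt_Vp) ?(allP base_Vp).
  have [V_ok P_ok] : all (ok N) V /\ all (ok N) P by move: VP_ok; rewrite all_cat => /andP.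
  have le_x : size x <= size Vp by apply: uniq_leq_size => // a /(allP sub_x).
  have small_g : all (small N) (ser_form g).
    by apply: (IH g V (P ++ Vp)); rewrite // !all_cat V_ok P_ok.
  have small_h : all (small N) (ser_form h).
    by apply: (IH h (V ++ Vp) P); rewrite // !all_cat V_ok P_ok Vp_ok.
  clear IH.
  change (all (small N) ([:: 7] ++ ser_seq ser_atom Vp ++ ser_form g
    ++ ser_seq (fun qb => ser_atom qb.1 ++ ser_bform qb.2) pm
    ++ ser_seq ser_bform om ++ ser_seq ser_atom x ++ ser_form h)).
  rewrite 6!all_cat; apply/and5P; split=> //; last (apply/and3P; split=> //).
  + by rewrite /= le7.
  + exact: ser_atoms_small.
  + apply: ser_seq_small => //.
    elim: (pm) sub_V over_pm => //= -[q b] s IHs /= /andP[qV sV] /andP[bo so].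
    rewrite IHs // andbT.
    change (all (small N) (ser_atom q ++ ser_bform b)).
    rewrite all_cat ser_atom_small ?(allP V_ok) //.
    apply: ser_bform_small bo => v /andP[_].
    by rewrite !mem_cat => /or3P[/(allP V_ok)|/(allP P_ok)|/(allP Vp_ok)].
  + apply: ser_seq_small; first by rewrite size_om.
    by apply: sub_all over_om => b; apply: ser_bform_small => v /(allP Vp_ok).
  + apply: ser_atoms_small; first exact: leq_trans le_x le_Vp.
    by apply/allP=> a /(allP sub_x)/(allP Vp_ok).
- move=> /= /andP[wf_g wf_h] le_n le_f VP_ok.
  by rewrite !all_cat => /andP[? ?]; rewrite le7 // (IH g V P) // ?(IH h V P) //;
     clear -le_f; lia.
- move=> /= /andP[lt_i wf_g] le_n le_f VP_ok lt_g.
  rewrite le7 // (IH g V P) ?(ltnW le_f) //= andbT.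
  by clear -lt_i le_n; rewrite /small; lia.
- move=> /= /andP[wf_g wf_h] le_n le_f VP_ok.
  by rewrite !all_cat => /andP[? ?]; rewrite le7 // (IH g V P) // ?(IH h V P) //;
     clear -le_f; lia.
- by move=> /= wf_g le_n le_f VP_ok lt_g; rewrite le7 // (IH g V P) ?(ltnW le_f).
- move=> aV _ _ /allP/(_ a aV) a_ok _.
  by have /= -> := ser_atom_small a_ok; rewrite le7.
all: by move=> *; rewrite /= ?le7.
Qed.

Theorem encode_le_input_size L I :
  valid L I -> size (encode I) <= 11 * input_size I * (input_size I + 8).
Proof.
move=> /and5P[base_V _ law_ok obs_ok /and5P[/atom_lt_uniq s_uniq]].
move=> /andP[s_sub _] wf_f _ lt_I.
set N := input_size I.
have sub_s a : a \in i_state I -> a \in i_voc I.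
  move=> aS; have := fsubsetP s_sub a; rewrite /= !inE /= => -> //.
have le_s : size (i_state I) <= size (i_voc I) by exact: uniq_leq_size.
have [lt_V lt_f] : all (fun a : atom => a.1 < N) (i_voc I) /\
                   all (fun a => a.1 < N) (new_atoms (i_form I)).
  by move: lt_I; rewrite /compact all_cat => /andP.
have V_ok : all (fun a : atom => (a.1 < N) && base a) (i_voc I).
  by apply/allP=> a aV; rewrite (allP lt_V) ?(allP base_V).
have le_N : [/\ size (i_voc I) <= N, bdd_size (i_law I) <= N,
                sumn [seq bdd_size B | B <- i_obs I] <= N
              & flen (i_form I) <= N] by rewrite /N /input_size; clear; split; lia.
have le_obs : size (i_obs I) <= sumn [seq bdd_size B | B <- i_obs I].
  elim: (i_obs I) => //= B s; rewrite /bdd_size; clear; case: (bdd_nodes B) => *; lia.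
have [le_V le_B le_O le_f] := le_N.
have count : size (ser_instance I) <= 11 * N.
  rewrite /N /input_size size_ser_instance.
  have := size_ser_form_le wf_f; have := size_ser_bdd (i_law I).
  have : sumn [seq size (ser_bdd B) | B <- i_obs I] <=
         8 * sumn [seq bdd_size B | B <- i_obs I].
    by apply: sumn_le => B; case/andP: (size_ser_bdd B).
  have := flen_gt0 (i_form I); move: le_s; clear; lia.
have tokens : all (fun m => m <= N + 7) (ser_instance I).
  have small_B : all (fun m => m <= N + 7) (ser_bdd (i_law I)).
    by apply: (ser_bdd_small _ law_ok) => // v /andP[_ /(allP V_ok)].
  rewrite /ser_instance; move: (ser_bdd _) small_B => b small_B.
  rewrite !all_cat; apply/and5P; split=> //.
  - exact: ser_atoms_small.
  - apply: ser_seq_small; first exact: leq_trans le_obs le_O.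
    have := conj obs_ok (sumn_mem bdd_size (i_obs I)).
    move/andP; rewrite -all_predI; apply: sub_all => B /andP[B_ok B_le].
    apply: (ser_bdd_small _ B_ok); last exact: leq_trans B_le le_O.
    by move=> v /(allP V_ok).
  - apply: ser_atoms_small; first exact: leq_trans le_s le_V.
    by apply/allP=> a /sub_s/(allP V_ok).
  - apply: (ser_form_small wf_f) => //; last by rewrite cats0.
    exact: leq_trans le_obs le_O.
have : size (encode I) <= size (ser_instance I) * (N + 8).
  rewrite /encode; elim: (ser_instance I) tokens => //= m s IH /andP[le_m /IH].
  move=> le_w; rewrite size_cat size_rcons size_nseq mulSn leq_add //.
  by rewrite addnS ltnS.
by move/leq_trans; apply; rewrite leq_mul2r count orbT.
Qed.

(* Main.v *)
From mathcomp Require Import all_boot finmap zify.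
From Stdlib Require Import Classical_Prop.
Require Import Defs.

(* Membership.  Programs over a fixed number of stacks compile to Turing
   machines, and functions on binary trees computed by such programs in
   polynomial space (or time) are closed under composition, bounded iteration
   and binary recursion of polynomial depth.  The truth of a formula, and of
   the Boolean translation of a formula, is decided by such a recursion: the
   structure reached by a sequence of updates is never written down, but
   represented by the list of the updates, and the law and the observations of
   an updated structure are evaluated by undoing the last update on the
   valuation.  The quantifier of [K_i] tries all subsets of the vocabulary, one
   atom at a time.

   Hardness.  The cells of a configuration of a space-bounded machine are
   written with polynomially many atoms, and a world consists of five
   configurations A, B, M, C, D.  Agents that keep some of the five and forget
   the others quantify over configurations, so that Savitch's recursion "B is
   reached from A in 2^(t+1) steps iff for some M, for (C, D) = (A, M) and for
   (C, D) = (M, B), D is reached from C in 2^t steps" is an epistemic formula in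
   which the formula for 2^t steps occurs once. *)

Set Implicit Arguments.
Unset Strict Implicit.
Unset Printing Implicit Defensive.

Local Open Scope nat_scope.

(** The obstacle to membership is that the law of an updated structure contains Boolean translations
    of the formulas of earlier updates. The translation is never identified with satisfaction: a
    flag in each query selects which of the two is evaluated, and both follow the same recursion. A
    recursion of polynomial depth stays in polynomial space only if its arguments stay small. Here
    they do, because every atom replaced by an update lies in layer 0, so an update adds only one
    layer of copies. One notion of cost serves both halves of the proof: a Boolean parameter tells
    whether the time is bounded along with the space, so the same closure lemmas build the
    space-bounded decision procedure and the polynomial-time reduction. Binary recursion is
    available for space only; the reduction has to do without it. Tape 0 holds input and output,
    tape 1 a stack of values, tapes 2 and 3 are scratch, tape 4 is a counter and tape 5 holds
    pending tasks. The formulas of the reduction contain no updates and its law is always true, so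
    one instance serves all three languages. *)

Notation sym := (bool + bool)%type.

(** * Programs over six stacks and their execution on tapes *)

Inductive cmd :=
| Skip
| Push of nat & sym
| Pop of nat
| Seq of cmd & cmd
| If of nat & pred (option sym) & cmd & cmd
| While of nat & pred (option sym) & cmd.

(** A state is a program point. [Push] has two, since the head moves left in one step and writes in
    the next; the extra [None] of [If] and [While] is the point where the test is made. *)
Fixpoint ctrl (c : cmd) : finType :=
  match c with
  | Skip | Pop _ => unit
  | Push _ _ => bool
  | Seq a b => (ctrl a + ctrl b)%type
  | If _ _ a b => option (ctrl a + ctrl b)
  | While _ _ a => option (ctrl a)
  end.

Fixpoint entry (c : cmd) : ctrl c :=
  match c return ctrl c with
  | Skip => tt
  | Pop _ => tt
  | Push _ _ => false
  | Seq a b => inl (entry a)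
  | If _ _ a b => None
  | While _ _ a => None
  end.

Definition tapes := {ffun 'I_6 -> tape bool}.
Definition symbols := {ffun 'I_6 -> cell bool}.
Definition acts := {ffun 'I_6 -> cell bool * move}.

Definition scan (T : tapes) : symbols := [ffun i => tread (T i)].
Definition perform (a : acts) (T : tapes) : tapes :=
  [ffun i => tmove (a i).2 (twrite (a i).1 (T i))].
Definition on (j : nat) (x : cell bool * move) (r : symbols) : acts :=
  [ffun i : 'I_6 => if i == j :> nat then x else (r i, Stay)].
Definition idle (r : symbols) : acts := [ffun i => (r i, Stay)].
Definition look (j : nat) (r : symbols) : cell bool := r (inord j).

Fixpoint nxt (c : cmd) : ctrl c -> symbols -> option (ctrl c) * acts :=
  match c return ctrl c -> symbols -> option (ctrl c) * acts with
  | Skip => fun _ r => (None, idle r)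
  | Push j x => fun q r =>
      if q then (None, on j (Some x, Stay) r)
      else (Some true, on j (look j r, MoveL) r)
  | Pop j => fun _ r =>
      (None, on j (None, if look j r is None then Stay else MoveR) r)
  | Seq a b => fun q r =>
      match q with
      | inl q => let: (o, s) := nxt q r in
                 (Some (if o is Some q' then inl q' else inr (entry b)), s)
      | inr q => let: (o, s) := nxt q r in (omap inr o, s)
      end
  | If j p a b => fun q r =>
      match q with
      | None => (Some (Some (if p (look j r) then inl (entry a)
                             else inr (entry b))), idle r)
      | Some (inl q) => let: (o, s) := nxt q r in (omap (Some \o inl) o, s)
      | Some (inr q) => let: (o, s) := nxt q r in (omap (Some \o inr) o, s)
      end
  | While j p a => fun q r =>
      match q with
      | None => (if p (look j r) then Some (Some (entry a)) else None, idle r)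
      | Some q => let: (o, s) := nxt q r in (Some o, s)
      end
  end.

(** The cell beyond the height [h] leaves room for a blank at the bottom of the stack, or for the
    cell onto which the head has moved in the middle of a push. *)
Definition fits (h : nat) (T : tapes) : Prop :=
  forall i, size (tleft (T i)) + size (tright (T i)) <= h.+1.

Definition after c (q : ctrl c) T := perform (nxt q (scan T)).2 T.

(** Time and space are recorded together: the number counts the steps up to the exit, and the tapes
    have to fit after each of them. *)
Inductive exits (h : nat) (c : cmd) : ctrl c -> tapes -> nat -> tapes -> Prop :=
| ExitNow q T : (nxt q (scan T)).1 = None -> fits h (after q T) ->
    exits h q T 1 (after q T)
| ExitLater q q' T n T' : (nxt q (scan T)).1 = Some q' -> fits h (after q T) ->
    exits h q' (after q T) n T' -> exits h q T n.+1 T'.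

Lemma exits_seqr h a b (q : ctrl b) T n T' :
  exits h q T n T' -> exits h (inr q : ctrl (Seq a b)) T n T'.
Proof.
elim=> {q T n T'} [q T e f|q q' T n T' e f _ IH].
- have -> : after q T = after (inr q : ctrl (Seq a b)) T.
    by rewrite /after /=; case: (nxt q _).
  constructor; last by move: f; rewrite /after /=; case: (nxt q _).
  by move: e => /=; case: (nxt q _) => o s /= ->.
- apply: (@ExitLater _ _ _ (inr q' : ctrl (Seq a b))).
  + by move: e => /=; case: (nxt q _) => o s /= ->.
  + by move: f; rewrite /after /=; case: (nxt q _).
  + by move: IH; rewrite /after /=; case: (nxt q _).
Qed.

Lemma exits_seq h a b (q : ctrl a) T n T' m T'' :
  exits h q T n T' -> exits h (entry b) T' m T'' ->
  exits h (inl q : ctrl (Seq a b)) T (n + m) T''.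
Proof.
elim=> {q T n T'} [q T e f|q q' T n T' e f _ IH] H.
- apply: (@ExitLater _ _ _ (inr (entry b) : ctrl (Seq a b))).
  + by move: e => /=; case: (nxt q _) => o s /= ->.
  + by move: f; rewrite /after /=; case: (nxt q _).
  + by move: (exits_seqr a H); rewrite /after /=; case: (nxt q _).
- apply: (@ExitLater _ _ _ (inl q' : ctrl (Seq a b))).
  + by move: e => /=; case: (nxt q _) => o s /= ->.
  + by move: f; rewrite /after /=; case: (nxt q _).
  + by move: (IH H); rewrite /after /=; case: (nxt q _).
Qed.

Lemma exits_ifl h j p a b (q : ctrl a) T n T' :
  exits h q T n T' -> exits h (Some (inl q) : ctrl (If j p a b)) T n T'.
Proof.
elim=> {q T n T'} [q T e f|q q' T n T' e f _ IH].
- have -> : after q T = after (Some (inl q) : ctrl (If j p a b)) T.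
    by rewrite /after /=; case: (nxt q _).
  constructor; last by move: f; rewrite /after /=; case: (nxt q _).
  by move: e => /=; case: (nxt q _) => o s /= ->.
- apply: (@ExitLater _ _ _ (Some (inl q') : ctrl (If j p a b))).
  + by move: e => /=; case: (nxt q _) => o s /= ->.
  + by move: f; rewrite /after /=; case: (nxt q _).
  + by move: IH; rewrite /after /=; case: (nxt q _).
Qed.

Lemma exits_ifr h j p a b (q : ctrl b) T n T' :
  exits h q T n T' -> exits h (Some (inr q) : ctrl (If j p a b)) T n T'.
Proof.
elim=> {q T n T'} [q T e f|q q' T n T' e f _ IH].
- have -> : after q T = after (Some (inr q) : ctrl (If j p a b)) T.
    by rewrite /after /=; case: (nxt q _).
  constructor; last by move: f; rewrite /after /=; case: (nxt q _).
  by move: e => /=; case: (nxt q _) => o s /= ->.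
- apply: (@ExitLater _ _ _ (Some (inr q') : ctrl (If j p a b))).
  + by move: e => /=; case: (nxt q _) => o s /= ->.
  + by move: f; rewrite /after /=; case: (nxt q _).
  + by move: IH; rewrite /after /=; case: (nxt q _).
Qed.

Lemma exits_while h j p a (q : ctrl a) T n T' m T'' :
  exits h q T n T' -> exits h (entry (While j p a)) T' m T'' ->
  exits h (Some q : ctrl (While j p a)) T (n + m) T''.
Proof.
elim=> {q T n T'} [q T e f|q q' T n T' e f _ IH] H.
- apply: (@ExitLater _ _ _ (None : ctrl (While j p a))).
  + by move: e => /=; case: (nxt q _) => o s /= ->.
  + by move: f; rewrite /after /=; case: (nxt q _).
  + by move: H; rewrite /after /=; case: (nxt q _).
- apply: (@ExitLater _ _ _ (Some q' : ctrl (While j p a))).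
  + by move: e => /=; case: (nxt q _) => o s /= ->.
  + by move: f; rewrite /after /=; case: (nxt q _).
  + by move: (IH H); rewrite /after /=; case: (nxt q _).
Qed.

(* A tape holds a stack whose top is under the head. *)
Definition trep (h : nat) (t : tape bool) (s : seq sym) : Prop :=
  exists l m, [/\ t = Tape (nseq l None) (map Some s ++ nseq m None),
                  l + size s <= h & m <= 1].

Definition memory := seq (seq sym).

Definition rep (h : nat) (T : tapes) (m : memory) : Prop :=
  forall i : 'I_6, trep h (T i) (nth [::] m i).

Lemma rep_fits h T m : rep h T m -> fits h T.
Proof.
move=> H i; have [l [k [-> /= le1 le2]]] := H i.
by rewrite size_cat size_map !size_nseq; lia.
Qed.

Lemma trep_read h t s : trep h t s -> tread t = ohead s.
Proof. by case=> l [[|m] [-> _ _]]; case: s. Qed.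

(** Rewriting the symbol under the head of an empty stack creates an explicit blank cell; this is
    why [trep] admits one blank below the stack. *)
Lemma trep_idle h t s : trep h t s -> trep h (twrite (tread t) t) s.
Proof.
case=> l [m [-> le1 le2]]; case: s le1 => [|x s] le1.
  by exists l, 1; split=> //; case: m le2 => [|[|]].
by exists l, m.
Qed.

Lemma trep_push h t s x : trep h t s -> size s < h ->
  trep h (twrite (Some x) (tmove MoveL (twrite (tread t) t))) (x :: s).
Proof.
move/trep_idle; case=> l [m [-> le1 le2]] lt_s.
case: l le1 => [|l] le1.
  by exists 0, m.
by exists l, m; split=> //=; lia.
Qed.

Lemma size_moveL h t s x : trep h t s -> size s < h ->
  let t' := tmove MoveL (twrite x t) in
  size (tleft t') + size (tright t') <= h.+1.
Proof.
case=> l [m [-> le1 le2]] lt_s /=; rewrite !size_behead size_cat size_map.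
by rewrite !size_nseq; lia.
Qed.

Lemma trep_pop h t s : trep h t s ->
  trep h (tmove (if tread t is None then Stay else MoveR) (twrite None t))
         (behead s).
Proof.
move=> H; rewrite (trep_read H); case: H => l [m [-> le1 le2]].
case: s le1 => [|x s] le1 /=.
  by exists l, 1; split=> //; case: m le2 => [|[|]].
by exists l.+1, m; split=> //=; move: le1 => /=; lia.
Qed.

Lemma scan_look h T m j : rep h T m -> j < 6 ->
  look j (scan T) = ohead (nth [::] m j).
Proof.
by move=> H lt_j; rewrite /look ffunE (trep_read (H _)) inordK.
Qed.

Lemma rep_idle h T m : rep h T m -> rep h (perform (idle (scan T)) T) m.
Proof. by move=> H i; rewrite !ffunE /=; apply: trep_idle. Qed.

Lemma rep_on h T m j x s : rep h T m ->
  (forall i : 'I_6, i = j :> nat -> trep h (tmove x.2 (twrite x.1 (T i))) s) ->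
  rep h (perform (on j x (scan T)) T) (set_nth [::] m j s).
Proof.
move=> H Hj i; rewrite !ffunE nth_set_nth /=.
by case: eqP => [/Hj|_] //=; apply: trep_idle.
Qed.

(** The heights [h'] above [h] are included because the blanks left behind by popping are never
    removed: a subprogram may be started on tapes that an earlier one has stretched further than it
    needs itself. *)
Definition exec (c : cmd) (m m' : memory) (t h : nat) : Prop :=
  forall h' T, h <= h' -> rep h' T m ->
  exists n T', [/\ exits h' (entry c) T n T', n <= t & rep h' T' m'].

Lemma exec_weaken c m m' t t' h h' :
  exec c m m' t h -> t <= t' -> h <= h' -> exec c m m' t' h'.
Proof.
move=> E le_t le_h k T le_k /E[|n [T' [X le_n R]]]; first exact: leq_trans le_k.
by exists n, T'; split=> //; apply: leq_trans le_t.
Qed.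

Lemma exec_skip m h : exec Skip m m 1 h.
Proof.
move=> h' T le R; exists 1, (perform (idle (scan T)) T); split=> //.
  by apply: (@ExitNow _ Skip) => //; apply: (rep_fits (rep_idle R)).
exact: rep_idle.
Qed.

Lemma exec_pop j m h : j < 6 ->
  exec (Pop j) m (set_nth [::] m j (behead (nth [::] m j))) 1 h.
Proof.
move=> lt_j h' T le R.
have H : rep h' (after (entry (Pop j)) T)
             (set_nth [::] m j (behead (nth [::] m j))).
  rewrite /after /=; apply: rep_on => // i <- /=; rewrite /look ffunE inord_val.
  exact: trep_pop.
by exists 1, (after (entry (Pop j)) T); split=> //; constructor=> //; apply: rep_fits H.
Qed.

Lemma exec_push j x m h : j < 6 -> size (nth [::] m j) < h ->
  exec (Push j x) m (set_nth [::] m j (x :: nth [::] m j)) 2 h.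
Proof.
move=> lt_j lt_s h' T le R.
(* Between the move and the write the tapes represent no memory; of [T1] only the size is
   controlled. *)
set T1 := after (entry (Push j x)) T.
set T2 := after (true : ctrl (Push j x)) T1.
have R2 : rep h' T2 (set_nth [::] m j (x :: nth [::] m j)).
  move=> i; rewrite /T2 /after [X in trep _ X _]ffunE nth_set_nth /=.
  rewrite !ffunE; case: eqP => [e|ne] /=.
    rewrite /look -{1}e inord_val ffunE.
    by apply: trep_push; [rewrite -e; apply: R | apply: leq_trans lt_s le].
  by do 2!apply: trep_idle; apply: R.
exists 2, T2; split=> //.
apply: (@ExitLater _ (Push j x) _ (true : ctrl (Push j x))) => //.
  move=> i; rewrite /T1 /after [perform _ _ _]ffunE /= ffunE.
  case: eqP => [e|ne] /=.
    have := @size_moveL h' (T i) _ (look j (scan T)) (R i).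
    by rewrite e; apply; apply: leq_trans lt_s le.
  have [l [k [-> le1 le2]]] := R i.
  by rewrite /= size_behead size_cat size_map !size_nseq; lia.
by constructor=> //; apply: rep_fits R2.
Qed.

Lemma exec_seq a b m m1 m2 t1 t2 h :
  exec a m m1 t1 h -> exec b m1 m2 t2 h -> exec (Seq a b) m m2 (t1 + t2) h.
Proof.
move=> Ea Eb h' T le /(Ea _ _ le)[n1 [T1 [X1 le1 /(Eb _ _ le)]]].
move=> [n2 [T2 [X2 le2 R2]]]; exists (n1 + n2), T2; split=> //.
  exact: exits_seq X2.
exact: leq_add.
Qed.

Lemma exec_if j (p : pred (option sym)) a b m m' t h : j < 6 ->
  exec (if p (ohead (nth [::] m j)) then a else b) m m' t h ->
  exec (If j p a b) m m' t.+1 h.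
Proof.
move=> lt_j E h' T le R; have R1 := rep_idle R.
have L := scan_look R lt_j.
have [n [T' [X le_n R']]] := E h' _ le R1; exists n.+1, T'; split=> //.
move: X; case: ifP => pj X.
  apply: (@ExitLater _ _ _ (Some (inl (entry a)) : ctrl (If j p a b))).
  - by rewrite /= L pj.
  - exact: rep_fits R1.
  - exact: exits_ifl.
apply: (@ExitLater _ _ _ (Some (inr (entry b)) : ctrl (If j p a b))).
- by rewrite /= L pj.
- exact: rep_fits R1.
- exact: exits_ifr.
Qed.

Lemma exec_while0 j (p : pred (option sym)) a m h : j < 6 ->
  ~~ p (ohead (nth [::] m j)) -> exec (While j p a) m m 1 h.
Proof.
move=> lt_j /negbTE pj h' T le R; have R1 := rep_idle R.
have L := scan_look R lt_j.
exists 1, (perform (idle (scan T)) T); split=> //.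
apply: (@ExitNow _ (While j p a)) => /=; first by rewrite L pj.
exact: rep_fits R1.
Qed.

Lemma exec_while1 j (p : pred (option sym)) a m m1 m2 t1 t2 h : j < 6 ->
  p (ohead (nth [::] m j)) -> exec a m m1 t1 h ->
  exec (While j p a) m1 m2 t2 h -> exec (While j p a) m m2 (t1 + t2).+1 h.
Proof.
move=> lt_j pj Ea Ew h' T le R; have R1 := rep_idle R.
have L := scan_look R lt_j.
have [n1 [T1 [X1 le1 /(Ew _ _ le)[n2 [T2 [X2 le2 R2]]]]]] := Ea h' _ le R1.
exists (n1 + n2).+1, T2; split=> //; last by rewrite ltnS leq_add.
apply: (@ExitLater _ _ _ (Some (entry a) : ctrl (While j p a))).
- by rewrite /= L pj.
- exact: rep_fits R1.
- exact: exits_while X2.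
Qed.

(* Tape 1 holds the result; its top decides acceptance. *)
Definition machine (c : cmd) : tm :=
  @TM 5 bool (ctrl c + option bool)%type (inl (entry c))
    (fun q => q == inr (Some true))
    (fun q r =>
       match q with
       | inl q => let: (o, s) := nxt q r in
                  Some (if o is Some q' then inl q' else inr None, s)
       | inr None => Some (inr (Some (look 1 r == Some (inl true))), idle r)
       | inr (Some _) => None
       end).

Definition cfg c (q : (ctrl c + option bool)%type) (T : tapes) : config (machine c) :=
  @Config (machine c) q T.

Lemma exits_run c h (q : ctrl c) T n T' : exits h q T n T' -> fits h T ->
  iter n (@step (machine c)) (cfg (inl q) T) = cfg (inr None) T'
  /\ forall i, i <= n ->
     fits h (c_tapes (iter i (@step (machine c)) (cfg (inl q) T))).
Proof.
have E (q' : ctrl c) T1 : @step (machine c) (cfg (inl q') T1)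
    = cfg (if (nxt q' (scan T1)).1 is Some q'' then inl q'' else inr None)
          (after q' T1).
  by rewrite /step /action /= /after /scan /cfg /perform; case: (nxt q' _).
elim=> {q T n T'} [q T e f|q q' T n T' e f _ IH] fT.
  by rewrite /= E e; split=> // -[|[|]] //= _; rewrite E.
rewrite iterSr E e; have [-> H] := IH f; split=> // -[|i] // le_i.
by rewrite iterSr E e; apply: H.
Qed.

(** One step is added to [t]: after the exit the machine looks at tape 1 to choose the verdict, and
    then halts. The factor 6 is the number of tapes. *)
Lemma exec_run c (w : seq bool) m t h :
  exec c (map inl w :: nseq 5 [::]) m t h -> size w <= h ->
  exists n, [/\ n <= t.+1, halted (run (machine c) w n),
    tm_accept (c_state (run (machine c) w n)) =
      (ohead (nth [::] m 1) == Some (inl true)),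
    output (run (machine c) w n) =
      leading_bits (map Some (nth [::] m 0) : seq (cell bool))
  & forall i, space (run (machine c) w i) <= 6 * h.+1].
Proof.
move=> E le_w; set T0 : tapes := c_tapes (init (machine c) w).
have R0 : rep h T0 (map inl w :: nseq 5 [::]).
  move=> i; rewrite /T0 ffunE; case: eqP => [->|/eqP ne] /=.
    by exists 0, 0; rewrite cats0 -map_comp size_map.
  exists 0, 0; have -> : nth [::] (map inl w :: nseq 5 [::]) i = [::] :> seq sym.
    by case: i ne => [[|[|[|[|[|[|i]]]]]] lt_i].
  by [].
have [n [T' [X le_n R']]] := E _ _ (leqnn h) R0.
have [Ei Ef] := exits_run X (rep_fits R0).
have e0 : init (machine c) w = cfg (inl (entry c)) T0 by [].
set b := ohead (nth [::] m 1) == Some (inl true).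
have Es : run (machine c) w n.+1 = cfg (inr (Some b)) (perform (idle (scan T')) T').
  rewrite /run e0 iterS Ei {1}/step /action /= -/(scan T') (scan_look R') //.
have R1 := rep_idle R'.
exists n.+1; split=> //.
- by rewrite Es.
- by rewrite Es /=; case: (b).
- rewrite Es /output /=; have [l [k [-> _ _]]] := R1 ord0.
  move: (nth _ _ _) => /=; elim=> [|[d|d] s IH] //=; first by case: k.
  by rewrite IH.
- move=> i; suff F : fits h (c_tapes (run (machine c) w i)).
    rewrite /space; apply: (@leq_trans (\sum_(i < 6) h.+1)); first exact: leq_sum.
    by rewrite sum_nat_const card_ord.
  have [le_i|lt_i] := leqP i n; first by rewrite /run e0; apply: Ef.
  rewrite -(subnK lt_i) /run iterD -/(run _ _ _) Es.
  suff -> : forall j, iter j (@step (machine c))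
      (cfg (inr (Some b)) (perform (idle (scan T')) T')) =
      cfg (inr (Some b)) (perform (idle (scan T')) T') by apply: rep_fits R1.
  by elim=> //= j ->.
Qed.

(** Only the first six stacks of a memory matter, and [set_nth] yields lists that agree on these
    without being syntactically equal. *)
Lemma exec_ext c m1 m2 m1' m2' t h :
  (forall i, i < 6 -> nth [::] m2 i = nth [::] m1 i) ->
  (forall i, i < 6 -> nth [::] m1' i = nth [::] m2' i) ->
  exec c m1 m1' t h -> exec c m2 m2' t h.
Proof.
move=> e e' E h' T le R; have [|n [T' [X le_n R']]] := E h' T le.
  by move=> i; rewrite -e.
by exists n, T'; split=> // i; rewrite -e'.
Qed.

(** * Moving bits between stacks *)

Definition bits : seq bool -> seq sym := map inl.
Definition one (x : option sym) : bool := if x is Some (inl true) then true else false.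
Definition zero (x : option sym) : bool := if x is Some (inl false) then true else false.
Definition some (x : option sym) : bool := isSome x.

Lemma bits_cat s t : bits (s ++ t) = bits s ++ bits t.
Proof. exact: map_cat. Qed.

Lemma size_bits s : size (bits s) = size s.
Proof. exact: size_map. Qed.

Lemma nthu (m : memory) i j s :
  nth [::] (set_nth [::] m j s) i = if i == j then s else nth [::] m i.
Proof. by rewrite nth_set_nth. Qed.

Definition xfer j k :=
  Seq (If j one (Push k (inl true)) (Push k (inl false))) (Pop j).

Lemma exec_xfer j k m b s h : j < 6 -> k < 6 -> j != k ->
  nth [::] m j = inl b :: s -> size (nth [::] m k) < h ->
  exec (xfer j k) m
    (set_nth [::] (set_nth [::] m k (inl b :: nth [::] m k)) j s) 4 h.
Proof.
move=> lt_j lt_k ne e lt_h; apply: (exec_seq (t1 := 3) (t2 := 1)).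
  apply: exec_if => //; rewrite e /=.
  by case: b e => e; apply: exec_push.
apply: (exec_ext _ _ (@exec_pop j _ h lt_j)) => // i _.
by rewrite !nthu /= (negbTE ne) e.
Qed.

Definition flush j k := While j some (xfer j k).

Lemma exec_flush j k m bs h : j < 6 -> k < 6 -> j != k ->
  nth [::] m j = bits bs -> size (nth [::] m k) + size bs <= h ->
  exec (flush j k) m
    (set_nth [::] (set_nth [::] m k (bits (rev bs) ++ nth [::] m k)) j [::])
    (5 * size bs + 1) h.
Proof.
move=> lt_j lt_k ne; elim: bs m => [|b bs IH] m e le_h.
  apply: exec_ext (@exec_while0 j some _ m h lt_j _) => //; last by rewrite e.
  move=> i _; rewrite !nthu /=; have [->|_] := eqVneq i j; first by rewrite e.
  by have [->|//] := eqVneq i k.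
have e2 : nth [::] m j = inl b :: bits bs by [].
set m1 := set_nth [::] (set_nth [::] m k (inl b :: nth [::] m k)) j (bits bs).
have X : exec (xfer j k) m m1 4 h.
  by apply: exec_xfer => //; move: le_h => /=; lia.
have ek : nth [::] m1 k = inl b :: nth [::] m k.
  by rewrite !nthu /= eq_sym (negbTE ne) eqxx.
have := IH m1; rewrite ek nthu /= eqxx => /(_ erefl).
rewrite addSnnS => /(_ le_h) Y.
apply: exec_weaken (leqnn h); first apply: exec_ext (exec_while1 lt_j _ X Y) => //.
- move=> i _; rewrite !nthu /=; case: eqP => // _; case: eqP => // _.
  by rewrite rev_cons -cats1 bits_cat -catA.
- by rewrite e2.
- by move=> /=; lia.
Qed.

Definition clear j := While j some (Pop j).

Lemma exec_clear j m h : j < 6 ->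
  exec (clear j) m (set_nth [::] m j [::]) (2 * size (nth [::] m j) + 1) h.
Proof.
move=> lt_j; have [s e] : exists s, nth [::] m j = s by exists (nth [::] m j).
elim: s m e => [|x s IH] m e.
  apply: exec_weaken (leqnn h); last exact: leq_addl.
  apply: exec_ext (@exec_while0 j some _ m h lt_j _) => //; last by rewrite e.
  by move=> i _; rewrite nthu /=; case: eqP => [->|].
have X := @exec_pop j m h lt_j; rewrite e /= in X.
have := IH (set_nth [::] m j s); rewrite nthu /= eqxx => /(_ erefl) Y.
apply: exec_weaken (leqnn h); first apply: exec_ext (exec_while1 lt_j _ X Y) => //.
- by move=> i _; rewrite !nthu /=; case: eqP.
- by rewrite e.
- by rewrite e /=; lia.
Qed.

(** * Binary trees on a stack *)

Inductive tree := Leaf | Node of tree & tree.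

(** The preorder code is prefix-free, so a program finds the end of the tree on top of a stack
    without a separator. *)
Fixpoint tbits (v : tree) : seq bool :=
  if v is Node a b then true :: tbits a ++ tbits b else [:: false].

Definition tc (v : tree) : seq sym := bits (tbits v).
Definition tsize (v : tree) : nat := size (tbits v).

Lemma size_tc v : size (tc v) = tsize v.
Proof. exact: size_bits. Qed.

Lemma tsize_gt0 v : 0 < tsize v.
Proof. by case: v. Qed.

Lemma tsize_node a b : tsize (Node a b) = (tsize a + tsize b).+1.
Proof. by rewrite /tsize /= size_cat. Qed.

Lemma tc_node a b : tc (Node a b) = inl true :: tc a ++ tc b.
Proof. by rewrite /tc /= bits_cat. Qed.

Lemma tbits_prefix a b r r' : tbits a ++ r = tbits b ++ r' -> a = b /\ r = r'.
Proof.
elim: a b r r' => [|a1 IH1 a2 IH2] [|b1 b2] r r' //=; first by case.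
by case; rewrite -!catA => /IH1[-> /IH2[-> ->]].
Qed.

Lemma tbits_inj : injective tbits.
Proof. by move=> a b e; have [] := @tbits_prefix a b [::] [::]; rewrite ?e. Qed.

(* Tape 4 counts the subtrees still to be moved. *)
Definition mvloop k :=
  While 4 some (Seq (If 1 one (Push 4 (inl true)) (Pop 4)) (xfer 1 k)).
Definition mv k := Seq (Push 4 (inl true)) (mvloop k).

(** The rest of the loop is passed as a hypothesis, because moving one subtree is only an initial
    segment of the iterations: for a node, the run for [a] is continued by the run for [b], and that
    one by the given run. *)
Lemma exec_mvloop k v s c m m' t h : k < 6 -> k != 1 -> k != 4 ->
  nth [::] m 1 = tc v ++ s -> nth [::] m 4 = inl true :: c ->
  size (nth [::] m k) + tsize v <= h -> size c + tsize v < h ->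
  exec (mvloop k) (set_nth [::] (set_nth [::] (set_nth [::] m 1 s) 4 c) k
                     (bits (rev (tbits v)) ++ nth [::] m k)) m' t h ->
  exec (mvloop k) m m' (9 * tsize v + t) h.
Proof.
move=> lt_k k1 k4; elim: v s c m t => [|a IHa b IHb] s c m t e1 e4 le1 le2 E.
  have X : exec (Seq (If 1 one (Push 4 (inl true)) (Pop 4)) (xfer 1 k)) m
     (set_nth [::] (set_nth [::] (set_nth [::] m 1 s) 4 c) k
                     (bits (rev (tbits Leaf)) ++ nth [::] m k)) (2 + 4) h.
    apply: (exec_seq (m1 := set_nth [::] m 4 c)).
      apply: exec_if => //; rewrite e1 /=.
      by have := @exec_pop 4 m h isT; rewrite e4.
    apply: exec_ext (@exec_xfer 1 k _ false s h _ _ _ _ _) => //.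
    - move=> i _; rewrite !nthu /=.
      have [ei|_] := eqVneq i 1; first by rewrite ei eq_sym (negbTE k1).
      have [ei|_] := eqVneq i k; first by rewrite ?ei (negbTE k4).
      by case: (eqVneq i 4) => // ->.
    - by rewrite eq_sym.
    - by rewrite nthu /= e1.
    - by rewrite nthu /= (negbTE k4); move: le1; rewrite /tsize /=; lia.
  apply: exec_weaken (exec_while1 _ _ X E) _ _ => //; first by rewrite e4.
  by rewrite /tsize /=; lia.
rewrite tsize_node in le1 le2 *.
rewrite tc_node in e1; rewrite /= -catA in e1.
set m1 := set_nth [::] (set_nth [::] (set_nth [::] m 1 (tc a ++ tc b ++ s)) 4
            (inl true :: nth [::] m 4)) k (inl true :: nth [::] m k).
have k1' : 1 == k = false by rewrite eq_sym; exact: negbTE.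
have k4' : 4 == k = false by rewrite eq_sym; exact: negbTE.
have X : exec (Seq (If 1 one (Push 4 (inl true)) (Pop 4)) (xfer 1 k)) m m1 (3 + 4) h.
  apply: (exec_seq (m1 := set_nth [::] m 4 (inl true :: nth [::] m 4))).
    apply: exec_if => //; rewrite e1 /=; apply: exec_push => //.
    by rewrite e4 /=; have := tsize_gt0 a; have := tsize_gt0 b; lia.
  apply: exec_ext (@exec_xfer 1 k _ true (tc a ++ tc b ++ s) h _ _ _ _ _) => //.
  - move=> i _; rewrite !nthu /=.
    have [ei|_] := eqVneq i 1; first by rewrite ei k1'.
    have [ei|_] := eqVneq i k; first by rewrite ?ei (negbTE k4).
    by case: (eqVneq i 4) => // ->.
  - by rewrite eq_sym.
  - by rewrite nthu /= e1.
  - by rewrite nthu /= (negbTE k4); lia.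
have m11 : nth [::] m1 1 = tc a ++ tc b ++ s by rewrite !nthu /= k1'.
have m14 : nth [::] m1 4 = inl true :: inl true :: c by rewrite !nthu /= k4' e4.
have m1k : nth [::] m1 k = inl true :: nth [::] m k by rewrite !nthu /= eqxx.
set m2 := set_nth [::] (set_nth [::] (set_nth [::] m1 1 (tc b ++ s)) 4 (inl true :: c)) k
            (bits (rev (tbits a)) ++ nth [::] m1 k).
have m21 : nth [::] m2 1 = tc b ++ s by rewrite !nthu /= k1'.
have m24 : nth [::] m2 4 = inl true :: c by rewrite !nthu /= k4'.
have m2k : nth [::] m2 k = bits (rev (tbits a)) ++ inl true :: nth [::] m k.
  by rewrite nthu /= eqxx m1k.
have Eb : exec (mvloop k) m2 m' (9 * tsize b + t) h.
  apply: (IHb s c m2 t m21 m24); rewrite ?m2k.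
  - by move: le1; rewrite size_cat size_bits size_rev /= /tsize; lia.
  - by move: le2; clear; lia.
  apply: exec_ext E => // i _; rewrite !nthu /=.
  have [_|_] := eqVneq i k.
    by rewrite rev_cons rev_cat -cats1 !bits_cat -!catA.
  have [//|_] := eqVneq i 4.
  by case: (eqVneq i 1) => // ->.
have Ea := IHa _ _ _ _ m11 m14 _ _ Eb.
apply: exec_weaken (exec_while1 _ _ X (Ea _ _)) _ _ => //.
- by rewrite e4.
- by rewrite m1k /=; lia.
- by move=> /=; have := tsize_gt0 b; lia.
- by lia.
Qed.

(** The memory between two operations on trees: values on tape 1, tasks on tape 5, all other tapes
    empty. *)
Definition st (s r : seq sym) : memory := [:: [::]; s; [::]; [::]; [::]; r].

Lemma exec_mv k v s m h : k < 6 -> k != 1 -> k != 4 ->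
  nth [::] m 1 = tc v ++ s -> nth [::] m 4 = [::] ->
  size (nth [::] m k) + tsize v < h ->
  exec (mv k) m (set_nth [::] (set_nth [::] m 1 s) k
                     (bits (rev (tbits v)) ++ nth [::] m k)) (9 * tsize v + 3) h.
Proof.
move=> lt_k k1 k4 e1 e4 le.
have P : exec (Push 4 (inl true)) m (set_nth [::] m 4 [:: inl true]) 2 h.
  by rewrite -{2}e4; apply: exec_push; rewrite // e4 /=; lia.
have k4' : 4 == k = false by rewrite eq_sym; exact: negbTE.
set m1 := set_nth [::] m 4 [:: inl true].
have a1 : nth [::] m1 1 = tc v ++ s by rewrite nthu.
have a4 : nth [::] m1 4 = inl true :: [::] by rewrite nthu.
have ak : size (nth [::] m1 k) + tsize v <= h by rewrite nthu (negbTE k4) ltnW.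
have lv : size ([::] : seq sym) + tsize v < h by move=> /=; lia.
have := @exec_mvloop k v s [::] m1 (set_nth [::] (set_nth [::] m 1 s) k
    (bits (rev (tbits v)) ++ nth [::] m k)) 1 h lt_k k1 k4 a1 a4 ak lv.
move=> W; apply: exec_weaken (exec_seq P (W _)) _ (leqnn h); last by lia.
  apply: exec_ext (@exec_while0 4 some _ (set_nth [::] (set_nth [::] m 1 s) k
      (bits (rev (tbits v)) ++ nth [::] m k)) h _ _) => //.
    move=> i _; rewrite !nthu /= (negbTE k4).
    have [//|_] := eqVneq i k.
    have [->|_] := eqVneq i 4; first by rewrite e4.
    by case: (eqVneq i 1).
  by rewrite !nthu /= k4' e4.
Qed.

Lemma exec_push1 x s r h : size s < h -> exec (Push 1 x) (st s r) (st (x :: s) r) 2 h.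
Proof. by move=> le; apply: (@exec_push 1 x (st s r) h). Qed.

Lemma exec_push5 x s r h : size r < h -> exec (Push 5 x) (st s r) (st s (x :: r)) 2 h.
Proof. by move=> le; apply: (@exec_push 5 x (st s r) h). Qed.

Lemma exec_pop1 x s r h : exec (Pop 1) (st (x :: s) r) (st s r) 1 h.
Proof. exact: (@exec_pop 1 (st (x :: s) r) h). Qed.

Lemma exec_pop5 x s r h : exec (Pop 5) (st s (x :: r)) (st s r) 1 h.
Proof. exact: (@exec_pop 5 (st s (x :: r)) h). Qed.

Definition droptop := Seq (mv 2) (clear 2).

Lemma exec_drop v s r h : tsize v < h ->
  exec droptop (st (tc v ++ s) r) (st s r) (11 * tsize v + 4) h.
Proof.
move=> le; have E1 : exec (mv 2) (st (tc v ++ s) r)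
    [:: [::]; s; bits (rev (tbits v)); [::]; [::]; r] (9 * tsize v + 3) h.
  by have := @exec_mv 2 v s (st (tc v ++ s) r) h; rewrite /= cats0; apply.
have E2 := @exec_clear 2 [:: [::]; s; bits (rev (tbits v)); [::]; [::]; r] h isT.
rewrite /= size_bits size_rev in E2.
by apply: exec_weaken (exec_seq E1 E2) _ (leqnn h); rewrite /tsize; lia.
Qed.

Definition dupxfer :=
  Seq (If 2 one (Seq (Push 1 (inl true)) (Push 3 (inl true)))
                (Seq (Push 1 (inl false)) (Push 3 (inl false)))) (Pop 2).
Definition dup := Seq (mv 2) (Seq (While 2 some dupxfer) (Seq (flush 3 2) (flush 2 1))).

Lemma exec_dupxfer bs s b r h : size s + size bs < h -> size b + size bs < h ->
  exec (While 2 some dupxfer) [:: [::]; s; bits bs; bits b; [::]; r]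
    [:: [::]; bits (rev bs) ++ s; [::]; bits (rev bs ++ b); [::]; r] (7 * size bs + 1) h.
Proof.
elim: bs s b => [|x bs IH] s b le1 le2; first exact: exec_while0.
have X : exec dupxfer [:: [::]; s; bits (x :: bs); bits b; [::]; r]
    [:: [::]; inl x :: s; bits bs; bits (x :: b); [::]; r] (5 + 1) h.
  apply: (exec_seq (m1 := [:: [::]; inl x :: s; bits (x :: bs); bits (x :: b); [::]; r])).
    apply: exec_if => //.
    case: x le1 le2 => le1 le2.
      apply: (exec_seq (t1 := 2) (t2 := 2)); first by apply: exec_push => //=; move: le1 => /=; lia.
      by apply: exec_push => //=; rewrite size_bits; move: le2 => /=; lia.
    apply: (exec_seq (t1 := 2) (t2 := 2)); first by apply: exec_push => //=; move: le1 => /=; lia.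
    by apply: exec_push => //=; rewrite size_bits; move: le2 => /=; lia.
  exact: exec_pop.
have Y := IH (inl x :: s) (x :: b).
rewrite rev_cons -cats1 bits_cat -!catA /=.
apply: exec_weaken (exec_while1 _ _ X (Y _ _)) _ (leqnn h) => //=.
- by move: le1 => /=; lia.
- by move: le2 => /=; lia.
- by lia.
Qed.

Lemma exec_dup v s r h : (tsize v).*2 + size s < h ->
  exec dup (st (tc v ++ s) r) (st (tc v ++ tc v ++ s) r) (30 * tsize v + 10) h.
Proof.
move=> le; have E1 : exec (mv 2) (st (tc v ++ s) r)
    [:: [::]; s; bits (rev (tbits v)); [::]; [::]; r] (9 * tsize v + 3) h.
  by have := @exec_mv 2 v s (st (tc v ++ s) r) h; rewrite /= cats0; apply => //; lia.
have E2 := @exec_dupxfer (rev (tbits v)) s [::] r h.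
rewrite size_rev revK cats0 in E2.
have le2 : size s + size (tbits v) < h by move: le; rewrite /tsize; lia.
have le3 : 0 + size (tbits v) < h by move: le; rewrite /tsize; lia.
have {}E2 := E2 le2 le3.
have E3 := @exec_flush 3 2 [:: [::]; tc v ++ s; [::]; tc v; [::]; r] (tbits v) h isT isT isT erefl.
rewrite /= cats0 in E3; have {}E3 := E3 (ltnW le3).
have E4 := @exec_flush 2 1 [:: [::]; tc v ++ s; bits (rev (tbits v)); [::]; [::]; r]
             (rev (tbits v)) h isT isT isT erefl.
rewrite /= revK size_cat size_rev size_tc in E4.
have {}E4 := E4 ltac:(by move: le; rewrite /tsize; lia).
apply: exec_weaken (exec_seq E1 (exec_seq E2 (exec_seq E3 E4))) _ (leqnn h).
by rewrite /tsize; lia.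
Qed.

Definition swap2 := Seq (mv 2) (Seq (mv 3) (Seq (flush 2 1) (flush 3 1))).

Lemma exec_swap v w s r h : tsize v + tsize w + size s < h ->
  exec swap2 (st (tc v ++ tc w ++ s) r) (st (tc w ++ tc v ++ s) r)
    (20 * (tsize v + tsize w) + 10) h.
Proof.
move=> le; have E1 : exec (mv 2) (st (tc v ++ tc w ++ s) r)
    [:: [::]; tc w ++ s; bits (rev (tbits v)); [::]; [::]; r] (9 * tsize v + 3) h.
  by have := @exec_mv 2 v (tc w ++ s) (st (tc v ++ tc w ++ s) r) h;
     rewrite /= cats0; apply => //; lia.
have E2 : exec (mv 3) [:: [::]; tc w ++ s; bits (rev (tbits v)); [::]; [::]; r]
    [:: [::]; s; bits (rev (tbits v)); bits (rev (tbits w)); [::]; r] (9 * tsize w + 3) h.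
  by have := @exec_mv 3 w s [:: [::]; tc w ++ s; bits (rev (tbits v)); [::]; [::]; r] h;
     rewrite /= cats0; apply => //; lia.
have E3 := @exec_flush 2 1 [:: [::]; s; bits (rev (tbits v)); bits (rev (tbits w)); [::]; r]
             (rev (tbits v)) h isT isT isT erefl.
rewrite /= revK size_rev in E3.
have {}E3 := E3 ltac:(by move: le; rewrite /tsize; lia).
have E4 := @exec_flush 3 1 [:: [::]; tc v ++ s; [::]; bits (rev (tbits w)); [::]; r]
             (rev (tbits w)) h isT isT isT erefl.
rewrite /= revK size_cat size_rev size_tc in E4.
have {}E4 := E4 ltac:(by move: le; rewrite /tsize; lia).
apply: exec_weaken (exec_seq E1 (exec_seq E2 (exec_seq E3 E4))) _ (leqnn h).
by rewrite /tsize; lia.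
Qed.

Definition mark := Push 4 (inl true).
Definition cmpbody :=
  Seq (If 2 one (If 3 one Skip mark) (If 3 zero Skip mark)) (Seq (Pop 3) (Pop 2)).
Definition eqtest :=
  Seq (mv 2) (Seq (mv 3) (Seq (While 2 some cmpbody)
    (Seq (While 3 some (Seq mark (Pop 3)))
      (If 4 some (Seq (clear 4) (Push 1 (inl false)))
         (Seq (Push 1 (inl false)) (Seq (Push 1 (inl false)) (Push 1 (inl true)))))))).

(** Tape 4 counts mismatches, including those where the second stack has run out. The loop stops
    with the first stack, so a rest [b'] of the second may remain; equality means that there is
    neither a mismatch nor a rest. *)
Lemma exec_cmp bs b n s r h : n + size bs < h -> exists k b',
  [/\ exec (While 2 some cmpbody)
       [:: [::]; s; bits bs; bits b; bits (nseq n true); r]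
       [:: [::]; s; [::]; bits b'; bits (nseq k true); r] (7 * size bs + 1) h,
      (k == 0) && ([::] == b') = (n == 0) && (bs == b),
      k <= n + size bs & size b' <= size b].
Proof.
elim: bs b n => [|x bs IH] b n le.
  by exists n, b; rewrite addn0; split=> //; apply: exec_while0.
have P : exec mark [:: [::]; s; bits (x :: bs); bits b; bits (nseq n true); r]
     [:: [::]; s; bits (x :: bs); bits b; bits (nseq n.+1 true); r] 2 h.
  by apply: exec_push => //=; rewrite size_bits size_nseq; move: le => /=; lia.
set n' := if ohead b == Some x then n else n.+1.
have X : exec cmpbody [:: [::]; s; bits (x :: bs); bits b; bits (nseq n true); r]
     [:: [::]; s; bits bs; bits (behead b); bits (nseq n' true); r] 6 h.
  apply: (@exec_weaken _ _ _ (4 + (1 + 1)) _ h h) => //.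
  apply: (exec_seq (m1 := [:: [::]; s; bits (x :: bs); bits b;
            bits (nseq n' true); r])); last first.
    apply: (exec_seq (m1 := [:: [::]; s; bits (x :: bs); bits (behead b);
            bits (nseq n' true); r])); last exact: exec_pop.
    by have := @exec_pop 3 [:: [::]; s; bits (x :: bs); bits b;
            bits (nseq n' true); r] h isT; rewrite /= /bits behead_map.
  apply: (@exec_if _ _ _ _ _ _ 3) => //.
  have K m : exec Skip m m 2 h := exec_weaken (@exec_skip m h) (leqnSn 1) (leqnn h).
  by rewrite /n'; case: (x) P => P /=; apply: (@exec_if _ _ _ _ _ _ 2) => //;
    case: (b) P => [|[] b0] P; [exact: P|exact: K|exact: P|exact: P|exact: P|exact: K].
have le_n : n' + size bs < h by rewrite /n'; move: le => /=; case: ifP; lia.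
have [k [b' [Y e le1 le2]]] := IH (behead b) n' le_n.
exists k, b'; split.
- by apply: exec_weaken (exec_while1 _ _ X Y) _ (leqnn h) => //=; lia.
- rewrite e /n'; case: (b) => [|y b0] /=; first by rewrite andbF.
  rewrite eqseq_cons; have [->|ne] := eqVneq x y; first by rewrite eqxx.
  by have -> : (Some y == Some x) = false; [apply/eqP; case=> /eqP; rewrite eq_sym (negbTE ne) | rewrite andbF].
- by move: le1; rewrite /n' /=; case: ifP; lia.
- by move: le2; rewrite size_behead; lia.
Qed.

Lemma exec_markrest b n s r h : n + size b < h ->
  exec (While 3 some (Seq mark (Pop 3)))
       [:: [::]; s; [::]; bits b; bits (nseq n true); r]
       [:: [::]; s; [::]; [::]; bits (nseq (n + size b) true); r] (4 * size b + 1) h.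
Proof.
elim: b n => [|y b IHb] n le; first by rewrite addn0; apply: exec_while0.
have X : exec (Seq mark (Pop 3)) [:: [::]; s; [::]; bits (y :: b); bits (nseq n true); r]
    [:: [::]; s; [::]; bits b; bits (nseq n.+1 true); r] (2 + 1) h.
  apply: (exec_seq (m1 := [:: [::]; s; [::]; bits (y :: b); bits (nseq n.+1 true); r])).
    by apply: exec_push => //=; rewrite size_bits size_nseq; move: le => /=; lia.
  exact: exec_pop.
have := IHb n.+1; rewrite addSnnS => Y.
apply: exec_weaken (exec_while1 _ _ X (Y _)) _ (leqnn h) => //=; move: le => /=; lia.
Qed.

Definition tbool (b : bool) : tree := if b then Node Leaf Leaf else Leaf.

Lemma exec_eqtest v w s r h : tsize v + tsize w + size s + 3 < h ->
  exec eqtest (st (tc v ++ tc w ++ s) r)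
    (st (tc (tbool (tbits v == tbits w)) ++ s) r) (40 * (tsize v + tsize w) + 20) h.
Proof.
move=> le; have E1 : exec (mv 2) (st (tc v ++ tc w ++ s) r)
    [:: [::]; tc w ++ s; bits (rev (tbits v)); [::]; [::]; r] (9 * tsize v + 3) h.
  by have := @exec_mv 2 v (tc w ++ s) (st (tc v ++ tc w ++ s) r) h;
     rewrite /= cats0; apply => //; lia.
have E2 : exec (mv 3) [:: [::]; tc w ++ s; bits (rev (tbits v)); [::]; [::]; r]
    [:: [::]; s; bits (rev (tbits v)); bits (rev (tbits w)); [::]; r] (9 * tsize w + 3) h.
  by have := @exec_mv 3 w s [:: [::]; tc w ++ s; bits (rev (tbits v)); [::]; [::]; r] h;
     rewrite /= cats0; apply => //; lia.
have [|k [b' [E3 ek le1 le2]]] := @exec_cmp (rev (tbits v)) (rev (tbits w)) 0 s r h.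
  by rewrite size_rev -/(tsize v); lia.
rewrite !size_rev -/(tsize v) -/(tsize w) in le1 le2.
have E4 := @exec_markrest b' k s r h ltac:(lia).
apply: (@exec_weaken _ _ _ (_ + (_ + (_ + (_ + (2 * (k + size b') + 10)))))); last exact: leqnn.
  apply: exec_seq E1 (exec_seq E2 (exec_seq E3 (exec_seq E4 _))).
  have <- : (k + size b' == 0) = (tbits v == tbits w).
    rewrite addn_eq0 size_eq0 [b' == _]eq_sym ek /=.
    by rewrite (inj_eq (can_inj revK)).
  apply: (@exec_weaken _ _ _ (2 * (k + size b') + 9).+1 _ h h) => //; last by lia.
  apply: exec_if => //; case: (k + size b') => [|n] /=.
    apply: (@exec_weaken _ _ _ (2 + (2 + 2)) _ h h) => //.
    have X1 : exec (Push 1 (inl false)) (st s r) (st (inl false :: s) r) 2 h.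
      by apply: exec_push1; lia.
    have X2 : exec (Push 1 (inl false)) (st (inl false :: s) r)
                (st (inl false :: inl false :: s) r) 2 h by apply: exec_push1 => /=; lia.
    by apply: exec_seq X1 (exec_seq X2 _); apply: exec_push1 => /=; lia.
  apply: (@exec_weaken _ _ _ ((2 * n.+1 + 1) + 2) _ h h) => //; last by lia.
  apply: (exec_seq (m1 := st s r)); last by apply: exec_push1; lia.
  have := @exec_clear 4 [:: [::]; s; [::]; [::]; bits (nseq n.+1 true); r] h isT.
  by rewrite /= size_bits size_nseq.
by rewrite !size_rev -/(tsize v); lia.
Qed.

(** Quantifying over the rest of the value stack and over the tasks makes the program usable as a
    subroutine. *)
Definition comp (c : cmd) (v w : tree) (t h : nat) : Prop :=
  forall s r, exec c (st (tc v ++ s) r) (st (tc w ++ s) r) t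
                (h + size s + size r).

Lemma comp_weaken c v w t t' h h' :
  comp c v w t h -> t <= t' -> h <= h' -> comp c v w t' h'.
Proof. by move=> E le le' s r; apply: exec_weaken (E s r) le _; lia. Qed.

Lemma comp_seq a b u v w t1 t2 h :
  comp a u v t1 h -> comp b v w t2 h -> comp (Seq a b) u w (t1 + t2) h.
Proof. by move=> A B s r; apply: exec_seq (A s r) (B s r). Qed.

(** Run on tapes without spare blanks, the program must leave its result within the same height.
    Hence the space bound of a program also bounds the size of its output, which is what composition
    needs. *)
Lemma exec_height c m m' t h i : exec c m m' t h ->
  (forall i, i < 6 -> size (nth [::] m i) <= h) -> i < 6 -> size (nth [::] m' i) <= h.
Proof.
move=> E le lt_i.
pose T : tapes := [ffun i : 'I_6 => Tape [::] (map Some (nth [::] m i))].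
have [|n [T' [_ _ R]]] := E h T (leqnn h).
  by move=> j; rewrite ffunE; exists 0, 0; rewrite cats0 le.
by have [l [k [_ + _]]] := R (Ordinal lt_i); move=> /=; lia.
Qed.

Lemma comp_size c v w t h : comp c v w t h -> tsize v <= h -> tsize w <= h.
Proof.
move=> E le; have := @exec_height _ _ _ _ _ 1 (E [::] [::]).
rewrite /= !cats0 !addn0 !size_tc; apply=> //.
by case=> [|[|[|[|[|[|]]]]]] //= _; rewrite size_tc.
Qed.

(** * Polynomials *)

(** The base is at least 2 and the function is monotone in [n], so the single exponent [q] can
    absorb constants, sums, products and compositions. *)
Definition pb (q n : nat) : nat := n.+2 ^ q.

Definition poly (p : nat -> nat) : Prop := exists q, forall n, p n <= pb q n.

Lemma leq_pb q n m : n <= m -> pb q n <= pb q m.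
Proof. by move=> le; rewrite /pb; case: q => // q; rewrite leq_exp2r. Qed.

Lemma poly_const c : poly (fun=> c).
Proof.
exists c => n; apply: (@leq_trans (2 ^ c)); first by rewrite ltnW // ltn_expl.
by rewrite /pb; case: c => // c; rewrite leq_exp2r.
Qed.

Lemma poly_id : poly id.
Proof. by exists 1 => n; rewrite /pb expn1; lia. Qed.

Lemma poly_mul p p' : poly p -> poly p' -> poly (fun n => p n * p' n).
Proof.
by move=> [q H] [q' H']; exists (q + q') => n; rewrite /pb expnD leq_mul ?H ?H'.
Qed.

Lemma poly_add p p' : poly p -> poly p' -> poly (fun n => p n + p' n).
Proof.
move=> [q H] [q' H']; exists (maxn q q').+1 => n; rewrite /pb expnS.
apply: (@leq_trans (2 * n.+2 ^ maxn q q')); last by rewrite leq_mul.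
rewrite mul2n -addnn leq_add // ?(leq_trans (H n)) ?(leq_trans (H' n)) //;
by apply: leq_pexp2l; rewrite // ?leq_maxl ?leq_maxr.
Qed.

Lemma poly_S p : poly p -> poly (fun n => (p n).+1).
Proof.
move=> H; have [q Hq] := poly_add H (poly_const 1).
by exists q => n; rewrite -addn1.
Qed.

Lemma poly_pb q p : poly p -> poly (fun n => pb q (p n)).
Proof.
move=> /poly_S/poly_S[q' H]; exists (q' * q) => n.
by rewrite /pb expnM; case: q => // q; rewrite leq_exp2r.
Qed.

Lemma poly_le p p' : (forall n, p n <= p' n) -> poly p' -> poly p.
Proof. by move=> le [q H]; exists q => n; apply: leq_trans (H n). Qed.

Ltac polyn := repeat (first [ apply: poly_const | exact: poly_id | apply: poly_add
  | apply: poly_S | apply: poly_mul | apply: poly_pb ]).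

(* Unlike [have :=], this resolves type classes in [t]. *)
Tactic Notation "know" constr(t) := generalize t.

(** * Cost-bounded computation on trees *)

(* [n] always bounds the space, and bounds the time when [P] holds. *)
Definition compb (P : bool) (c : cmd) (v w : tree) (n : nat) : Prop :=
  exists t, comp c v w t n /\ (P -> t <= n).

Lemma compb_weaken P c v w n n' : compb P c v w n -> n <= n' -> compb P c v w n'.
Proof.
move=> [t [E le_t]] le; exists t; split; first exact: comp_weaken E _ le.
by move=> /le_t/leq_trans; apply.
Qed.

Lemma compb_size P c v w n : compb P c v w n -> tsize w <= n + tsize v.
Proof.
move=> [t [E _]]; apply: (@comp_size c v w t); last exact: leq_addl.
by apply: comp_weaken E _ _ => //; exact: leq_addr.
Qed.

Lemma compb_seq P a b u v w n1 n2 :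
  compb P a u v n1 -> compb P b v w n2 -> compb P (Seq a b) u w (n1 + n2).
Proof.
move=> [t1 [E1 le1]] [t2 [E2 le2]]; exists (t1 + t2); split.
  by apply: comp_seq; [apply: comp_weaken E1 _ _ | apply: comp_weaken E2 _ _] => //; lia.
by move=> p; apply: leq_add; [apply: le1 | apply: le2].
Qed.

Lemma compb_skip P v : compb P Skip v v 1.
Proof. by exists 1; split=> // s r; apply: exec_skip. Qed.

Definition pushes (l : seq bool) := foldr (fun b c => Seq (Push 1 (inl b)) c) Skip l.

Lemma exec_pushes l s r h : size s + size l < h ->
  exec (pushes l) (st s r) (st (bits (rev l) ++ s) r) (2 * size l + 1) h.
Proof.
elim: l s => [|b l IH] s le; first exact: exec_skip.
have X : exec (Push 1 (inl b)) (st s r) (st (inl b :: s) r) 2 h.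
  by apply: exec_push1; move: le => /=; lia.
have Y := IH (inl b :: s); rewrite rev_cons -cats1 bits_cat -catA.
apply: exec_weaken (exec_seq X (Y _)) _ (leqnn h) => /=; last by lia.
by move: le => /=; lia.
Qed.

Definition constc w := Seq droptop (pushes (rev (tbits w))).

Lemma compb_const P v w : compb P (constc w) v w (20 * (tsize v + tsize w)).
Proof.
exists (11 * tsize v + 4 + (2 * tsize w + 1)); split; last first.
  by have := tsize_gt0 v; have := tsize_gt0 w; lia.
have gv := tsize_gt0 v; have gw := tsize_gt0 w.
move=> s r; have X := @exec_drop v s r (20 * (tsize v + tsize w) + size s + size r).
have Y := @exec_pushes (rev (tbits w)) s r (20 * (tsize v + tsize w) + size s + size r).
rewrite revK size_rev -/(tsize w) in Y.
by apply: exec_seq; [apply: X | apply: Y]; lia.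
Qed.

(** The second component is computed first, since the first has to end on top of the stack, right
    below the bit that marks a node. *)
Definition pairc c1 c2 := Seq dup (Seq c2 (Seq swap2 (Seq c1 (Push 1 (inl true))))).

Lemma compb_pair P c1 c2 v w1 w2 n1 n2 :
  compb P c1 v w1 n1 -> compb P c2 v w2 n2 ->
  compb P (pairc c1 c2) v (Node w1 w2) (30 * (n1 + n2) + 100 * tsize v).
Proof.
move=> E1 E2; have := compb_size E1; have := compb_size E2.
move: E1 E2 => [t1 [E1 l1]] [t2 [E2 l2]] s2 s1.
have gv := tsize_gt0 v.
exists (30 * tsize v + 10 + (t2 + (20 * (tsize w2 + tsize v) + 10 + (t1 + 2)))).
split; last by move=> p; move/(_ p): l1 => l1; move/(_ p): l2 => l2; lia.
move=> s r; set h := _ + size s + size r.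
have X1 : exec dup (st (tc v ++ s) r) (st (tc v ++ tc v ++ s) r) (30 * tsize v + 10) h.
  by apply: exec_dup; rewrite /h; lia.
have X2 : exec c2 (st (tc v ++ tc v ++ s) r) (st (tc w2 ++ tc v ++ s) r) t2 h.
  by apply: exec_weaken (E2 _ _) _ _ => //; rewrite /h size_cat size_tc; lia.
have X3 : exec swap2 (st (tc w2 ++ tc v ++ s) r) (st (tc v ++ tc w2 ++ s) r)
    (20 * (tsize w2 + tsize v) + 10) h by apply: exec_swap; rewrite /h; lia.
have X4 : exec c1 (st (tc v ++ tc w2 ++ s) r) (st (tc w1 ++ tc w2 ++ s) r) t1 h.
  by apply: exec_weaken (E1 _ _) _ _ => //; rewrite /h size_cat size_tc; lia.
apply: exec_seq X1 (exec_seq X2 (exec_seq X3 (exec_seq X4 _))).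
rewrite tc_node /= -?catA; apply: exec_push1.
by rewrite /h !size_cat !size_tc; lia.
Qed.

Definition fstc := Seq (Pop 1) (Seq swap2 droptop).
Definition sndc := Seq (Pop 1) droptop.

Lemma compb_fst P a b : compb P fstc (Node a b) a (50 * (tsize a + tsize b)).
Proof.
have ga := tsize_gt0 a; have gb := tsize_gt0 b.
exists (1 + (20 * (tsize a + tsize b) + 10 + (11 * tsize b + 4))); split; last by lia.
move=> s r; set h := _ + size s + size r; rewrite tc_node /= -?catA.
have X1 : exec swap2 (st (tc a ++ tc b ++ s) r) (st (tc b ++ tc a ++ s) r)
    (20 * (tsize a + tsize b) + 10) h by apply: exec_swap; rewrite /h; lia.
apply: exec_seq (@exec_pop1 _ _ _ h) (exec_seq X1 _).
by apply: exec_drop; rewrite /h; lia.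
Qed.

Lemma compb_snd P a b : compb P sndc (Node a b) b (50 * (tsize a + tsize b)).
Proof.
have ga := tsize_gt0 a; have gb := tsize_gt0 b.
exists (1 + (11 * tsize a + 4)); split; last by lia.
move=> s r; set h := _ + size s + size r; rewrite tc_node /= -?catA.
apply: exec_seq (@exec_pop1 _ _ _ h) _.
by apply: exec_drop; rewrite /h; lia.
Qed.

Lemma compb_eq P a b : compb P (Seq (Pop 1) eqtest) (Node a b)
  (tbool (tbits a == tbits b)) (100 * (tsize a + tsize b)).
Proof.
have ga := tsize_gt0 a; have gb := tsize_gt0 b.
exists (1 + (40 * (tsize a + tsize b) + 20)); split; last by lia.
move=> s r; set h := _ + size s + size r; rewrite tc_node /= -?catA.
apply: exec_seq (@exec_pop1 _ _ _ h) _.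
by apply: exec_eqtest; rewrite /h; lia.
Qed.

Lemma tsize_bool b : tsize (tbool b) <= 3.
Proof. by case: b. Qed.

Lemma one_tbool b s : one (ohead (tc (tbool b) ++ s)) = b.
Proof. by case: b. Qed.

Definition ifc c c1 c2 := Seq dup (Seq c (If 1 one (Seq droptop c1) (Seq droptop c2))).

Lemma compb_if P c c1 c2 b v w n n' :
  compb P c v (tbool b) n -> compb P (if b then c1 else c2) v w n' ->
  compb P (ifc c c1 c2) v w (n + n' + 100 * tsize v).
Proof.
move=> [t [E l]] [t' [E' l']]; have gv := tsize_gt0 v; have sb := tsize_bool b.
exists (30 * tsize v + 10 + (t + (11 * tsize (tbool b) + 4 + t').+1)); split; last first.
  by move=> p; move/(_ p): l => l; move/(_ p): l' => l'; lia.
move=> s r; set h := _ + size s + size r.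
have X1 : exec dup (st (tc v ++ s) r) (st (tc v ++ tc v ++ s) r) (30 * tsize v + 10) h.
  by apply: exec_dup; rewrite /h; lia.
have X2 : exec c (st (tc v ++ tc v ++ s) r) (st (tc (tbool b) ++ tc v ++ s) r) t h.
  by apply: exec_weaken (E _ _) _ _ => //; rewrite /h size_cat size_tc; lia.
apply: exec_seq X1 (exec_seq X2 _); apply: exec_if => //=; rewrite one_tbool.
have X3 : exec droptop (st (tc (tbool b) ++ tc v ++ s) r) (st (tc v ++ s) r)
    (11 * tsize (tbool b) + 4) h by apply: exec_drop; rewrite /h; lia.
have X4 : exec (if b then c1 else c2) (st (tc v ++ s) r) (st (tc w ++ s) r) t' h.
  by apply: exec_weaken (E' _ _) _ _ => //; rewrite /h; lia.
by case: (b) X3 X4 => X3 X4; apply: exec_seq X3 X4.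
Qed.

Definition matchc c0 c1 := Seq (Pop 1) (If 1 one (Seq swap2 (Seq (Push 1 (inl true)) c1)) (Seq (Pop 1) c0)).

Lemma compb_match P c0 c1 l v w n :
  (l = Leaf -> compb P c0 v w n) ->
  (forall a b, l = Node a b -> compb P c1 (Node v l) w n) ->
  compb P (matchc c0 c1) (Node l v) w (n + 50 * (tsize l + tsize v)).
Proof.
have gl := tsize_gt0 l; have gv := tsize_gt0 v.
case: l gl => [|a b] gl; [move=> /(_ erefl) + _ | move=> _ /(_ a b erefl)];
  move=> [t [E le]].
  exists (1 + (1 + t).+1); split; last by move=> p; move/(_ p): le; lia.
  move=> s r; set h := _ + size s + size r; rewrite tc_node /= -?catA.
  apply: exec_seq (@exec_pop1 _ _ _ h) _; apply: exec_if => //=.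
  apply: exec_seq (@exec_pop1 _ _ _ h) _.
  by apply: exec_weaken (E _ _) _ _ => //; rewrite /h; lia.
have hd s0 : one (ohead (tc (Node a b) ++ s0)) by [].
move: (Node a b) gl E hd => l gl E hd.
exists (1 + (20 * (tsize l + tsize v) + 10 + (2 + t)).+1); split.
  move=> s r; set h := _ + size s + size r; rewrite tc_node /= -?catA.
  apply: exec_seq (@exec_pop1 _ _ _ h) _; apply: exec_if => //=; rewrite hd.
  have X : exec swap2 (st (tc l ++ tc v ++ s) r) (st (tc v ++ tc l ++ s) r)
      (20 * (tsize l + tsize v) + 10) h by apply: exec_swap; rewrite /h; lia.
  have Y : exec (Push 1 (inl true)) (st (tc v ++ tc l ++ s) r) (st (tc (Node v l) ++ s) r) 2 h.
    rewrite tc_node /= -?catA; apply: exec_push1.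
    by rewrite /h !size_cat !size_tc; lia.
  apply: exec_seq X (exec_seq Y _).
  by apply: exec_weaken (E _ _) _ _ => //; rewrite /h; lia.
by move=> p; move/(_ p): le; lia.
Qed.

(** * Encodable types *)

(** Injectivity allows equality to be decided by comparing codes. *)
Class enc (A : Type) := Enc { code : A -> tree; code_inj : injective code }.

Definition sz (A : Type) (eA : enc A) (a : A) : nat := tsize (code a).
Arguments sz {A eA} a.

Lemma sz_gt0 A {eA : enc A} (a : A) : 0 < sz a.
Proof. exact: tsize_gt0. Qed.

#[global] Instance enc_tree : enc tree := Enc (fun _ _ e => e : _ = _).

Lemma tunit_inj : injective (fun _ : unit => Leaf).
Proof. by move=> [] []. Qed.
#[global] Instance enc_unit : enc unit := Enc tunit_inj.

Lemma tbool_inj : injective tbool.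
Proof. by move=> [] []. Qed.
#[global] Instance enc_bool : enc bool := Enc tbool_inj.

Lemma tpair_inj A B (eA : enc A) (eB : enc B) :
  injective (fun p : A * B => Node (code p.1) (code p.2)).
Proof. by move=> [a b] [a' b'] /= [e1 e2]; rewrite (code_inj e1) (code_inj e2). Qed.
#[global] Instance enc_prod A B (eA : enc A) (eB : enc B) : enc (A * B) :=
  Enc (@tpair_inj A B eA eB).

Lemma tsum_inj A B (eA : enc A) (eB : enc B) :
  injective (fun u : A + B => match u with inl a => Node (tbool false) (code a)
                                      | inr b => Node (tbool true) (code b) end).
Proof. by move=> [a|b] [a'|b'] //= [e]; rewrite (code_inj e). Qed.
#[global] Instance enc_sum A B (eA : enc A) (eB : enc B) : enc (A + B) :=
  Enc (@tsum_inj A B eA eB).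

Fixpoint tseq A (eA : enc A) (s : seq A) : tree :=
  if s is x :: s' then Node (code x) (tseq eA s') else Leaf.
Lemma tseq_inj A (eA : enc A) : injective (tseq eA).
Proof. by elim=> [|x s IH] [|y t] //= [e1 e2]; rewrite (code_inj e1) (IH _ e2). Qed.
#[global] Instance enc_seq A (eA : enc A) : enc (seq A) := Enc (@tseq_inj A eA).

Lemma toption_inj A (eA : enc A) :
  injective (fun u : option A => if u is Some x then Node (code x) Leaf else Leaf).
Proof. by move=> [x|] [y|] //= [e]; rewrite (code_inj e). Qed.
#[global] Instance enc_option A (eA : enc A) : enc (option A) := Enc (@toption_inj A eA).

(** Numbers are coded in unary, as in the encoding of instances, so a loop may run as often as a
    number says. *)
Lemma tnat_inj : injective (fun n => code (nseq n tt)).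
Proof. by move=> n m e; have := congr1 size (code_inj e); rewrite !size_nseq. Qed.
#[global] Instance enc_nat : enc nat := Enc tnat_inj.

Lemma sz_pair A B {eA : enc A} {eB : enc B} (a : A) (b : B) : sz (a, b) = (sz a + sz b).+1.
Proof. exact: tsize_node. Qed.

Lemma tc_pair A B {eA : enc A} {eB : enc B} (a : A) (b : B) :
  tc (code (a, b)) = inl true :: tc (code a) ++ tc (code b).
Proof. exact: tc_node. Qed.

Lemma sz_cons A {eA : enc A} (a : A) s : sz (a :: s) = (sz a + sz s).+1.
Proof. exact: tsize_node. Qed.

Lemma sz_nil A {eA : enc A} : sz ([::] : seq A) = 1.
Proof. by []. Qed.

Lemma sz_some A {eA : enc A} (a : A) : sz (Some a) = (sz a).+2.
Proof. by rewrite /sz /= tsize_node /= addn1. Qed.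

Lemma sz_nat n : sz n = n.*2.+1.
Proof.
rewrite /sz /=; elim: n => //= n IH.
by move: IH; rewrite tsize_node /code /= => ->.
Qed.

Lemma sz_bool (b : bool) : sz b <= 3.
Proof. exact: tsize_bool. Qed.

Lemma sz_cat A {eA : enc A} (s t : seq A) : (sz (s ++ t)).+1 = sz s + sz t.
Proof. by elim: s => [|x s IH] //=; rewrite !sz_cons addSn -addnA -IH addnS. Qed.

Lemma sz_mem (A : eqType) {eA : enc A} (x : A) (s : seq A) : x \in s -> sz x < sz s.
Proof.
elim: s => // y s IH; rewrite inE sz_cons => /predU1P[->|/IH]; lia.
Qed.

Lemma size_sz A {eA : enc A} (s : seq A) : size s < sz s.
Proof. by elim: s => //= x s IH; rewrite sz_cons; have := sz_gt0 x; lia. Qed.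

Lemma sz_all A {eA : enc A} (s : seq A) N :
  all (fun x => sz x <= N) s -> sz s <= size s * N.+1 + 1.
Proof.
elim: s => //= x s IH /andP[le /IH]; rewrite sz_cons mulSn; lia.
Qed.

(** Computability on codes, in polynomial time if [P] holds and in polynomial space otherwise. *)
Definition cpt (P : bool) A B (eA : enc A) (eB : enc B) (f : A -> B) : Prop :=
  exists c q, forall a, compb P c (code a) (code (f a)) (pb q (sz a)).
Arguments cpt P {A B eA eB} f.

Lemma cptI P A B {eA : enc A} {eB : enc B} (f : A -> B) c p : poly p ->
  (forall a, compb P c (code a) (code (f a)) (p (sz a))) -> cpt P f.
Proof. by move=> [q H] E; exists c, q => a; apply: compb_weaken (E a) (H _). Qed.

Lemma cpt_size P A B {eA : enc A} {eB : enc B} (f : A -> B) : cpt P f ->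
  exists q, forall a, sz (f a) <= pb q (sz a).
Proof.
move=> [c [q E]]; have [q' H] : poly (fun n => pb q n + n) by polyn; exact: poly_id.
by exists q' => a; apply: leq_trans (H _); apply: compb_size (E a).
Qed.

(** The same program computes both functions. Constructors and views whose codes coincide with those
    of pairs or sums therefore cost nothing. *)
Lemma cpt_code P A B C {eA : enc A} {eB : enc B} {eC : enc C} (f : A -> B) (g : A -> C) :
  (forall x, code (f x) = code (g x)) -> cpt P g -> cpt P f.
Proof. by move=> e [c [q E]]; exists c, q => a; rewrite e. Qed.

Lemma cpt_ext P A B {eA : enc A} {eB : enc B} (f g : A -> B) :
  f =1 g -> cpt P g -> cpt P f.
Proof. by move=> e; apply: cpt_code => x; rewrite e. Qed.

Section Closure.

Context (P : bool) (X : Type) {eX : enc X}.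

Lemma cpt_id : cpt P (fun x : X => x).
Proof. exists Skip, 0 => a; exact: compb_skip. Qed.

Lemma cpt_comp A B {eA : enc A} {eB : enc B} (f : X -> A) (g : A -> B) :
  cpt P g -> cpt P f -> cpt P (fun x => g (f x)).
Proof.
move=> [cg [q Eg]] F; have [q' szf] := cpt_size F; case: F => cf [q'' Ef].
apply: (@cptI P _ _ _ _ _ (Seq cf cg) (fun n => pb q'' n + pb q (pb q' n))).
  by polyn; exact: poly_id.
move=> a; apply: compb_weaken (compb_seq (Ef a) (Eg _)) _.
by rewrite leq_add2l leq_pb.
Qed.

Lemma cpt_const A {eA : enc A} (a : A) : cpt P (fun _ : X => a).
Proof.
apply: (@cptI P _ _ _ _ _ (constc (code a)) (fun n => 20 * (n + sz a))).
  by polyn; exact: poly_id.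
by move=> x; apply: compb_const.
Qed.

Lemma cpt_pair A B {eA : enc A} {eB : enc B} (f : X -> A) (g : X -> B) :
  cpt P f -> cpt P g -> cpt P (fun x => (f x, g x)).
Proof.
move=> [cf [q Ef]] [cg [q' Eg]].
apply: (@cptI P _ _ _ _ _ (pairc cf cg) (fun n => 30 * (pb q n + pb q' n) + 100 * n)).
  by polyn; exact: poly_id.
by move=> x; apply: compb_pair.
Qed.

Lemma cpt_fst A B {eA : enc A} {eB : enc B} (f : X -> A * B) :
  cpt P f -> cpt P (fun x => (f x).1).
Proof.
apply: cpt_comp; apply: (@cptI P _ _ _ _ _ fstc (fun n => 50 * n)).
  by polyn; exact: poly_id.
move=> [a b]; apply: compb_weaken (compb_fst _ _ _) _.
by rewrite sz_pair /sz /=; lia.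
Qed.

Lemma cpt_snd A B {eA : enc A} {eB : enc B} (f : X -> A * B) :
  cpt P f -> cpt P (fun x => (f x).2).
Proof.
apply: cpt_comp; apply: (@cptI P _ _ _ _ _ sndc (fun n => 50 * n)).
  by polyn; exact: poly_id.
move=> [a b]; apply: compb_weaken (compb_snd _ _ _) _.
by rewrite sz_pair /sz /=; lia.
Qed.

Lemma cpt_eq (A : eqType) {eA : enc A} (f g : X -> A) :
  cpt P f -> cpt P g -> cpt P (fun x => f x == g x).
Proof.
move=> F G; apply: (@cpt_comp (A * A)%type _ _ _ (fun x => (f x, g x)) (fun u => u.1 == u.2));
  last exact: cpt_pair.
apply: (@cptI P _ _ _ _ _ (Seq (Pop 1) eqtest) (fun n => 100 * n)).
  by polyn; exact: poly_id.
move=> [a b] /=; have -> : (a == b) = (tbits (code a) == tbits (code b)).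
  by apply/eqP/eqP => [->//|/tbits_inj e]; apply: code_inj e.
by apply: compb_weaken (compb_eq _ _ _) _; rewrite sz_pair /sz; lia.
Qed.

Lemma cpt_if A {eA : enc A} (c : X -> bool) (f g : X -> A) :
  cpt P c -> cpt P f -> cpt P g -> cpt P (fun x => if c x then f x else g x).
Proof.
move=> [cc [q Ec]] [cf [q' Ef]] [cg [q'' Eg]].
apply: (@cptI P _ _ _ _ _ (ifc cc cf cg) (fun n => pb q n + (pb q' n + pb q'' n) + 100 * n)).
  by polyn; exact: poly_id.
move=> x; apply: compb_if (Ec x) _.
case: (c x); [apply: compb_weaken (Ef x) _ | apply: compb_weaken (Eg x) _];
  by rewrite ?leq_addr ?leq_addl.
Qed.

(** Case distinctions on lists, options and numbers all reduce to testing the root of a code. [B] is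
    the type at which a value whose code is a node is read again, for a list the type of pairs of
    head and tail. *)
Lemma cpt_tmatch (A B C : Type) {eA : enc A} {eB : enc B} {eC : enc C}
    (l : X -> A) (f : X -> C) (G : X -> C) (F : X * B -> C) :
  (forall x, code (l x) = Leaf -> f x = G x) ->
  (forall x a b, code (l x) = Node a b ->
     exists2 y : B, code (l x) = code y & f x = F (x, y)) ->
  cpt P l -> cpt P G -> cpt P F -> cpt P f.
Proof.
move=> H0 H1 L [cg [q Eg]] [cf [q' Ef]]; have [ql szl] := cpt_size L.
have [c [q1 E1]] := cpt_pair L cpt_id.
apply: (@cptI P _ _ _ _ _ (Seq c (matchc cg cf))
  (fun n => pb q1 n + ((pb q n + pb q' (n + pb ql n).+1) + 50 * (pb ql n + n)))).
  by polyn; exact: poly_id.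
move=> x; pose (n0 := pb q (sz x) + pb q' (sz x + pb ql (sz x)).+1).
have M : compb P (matchc cg cf) (code (l x, x)) (code (f x)) (n0 + 50 * (sz (l x) + sz x)).
  apply: compb_match => [e|a b e].
    by rewrite (H0 x e); apply: compb_weaken (Eg x) _; rewrite leq_addr.
  have [y ey ->] := H1 x a b e; rewrite ey.
  apply: compb_weaken (Ef (x, y)) _; apply: leq_trans (leq_addl _ _).
  by apply: leq_pb; rewrite sz_pair /sz -ey ltnS leq_add2l szl.
apply: compb_weaken (compb_seq (E1 x) M) _.
by rewrite !leq_add2l leq_mul2l leq_add2r szl.
Qed.

Lemma cpt_lcase A B {eA : enc A} {eB : enc B} (l : X -> seq A) (G : X -> B)
    (F : X -> A -> seq A -> B) :
  cpt P l -> cpt P G -> cpt P (fun u : X * (A * seq A) => F u.1 u.2.1 u.2.2) ->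
  cpt P (fun x => match l x with [::] => G x | y :: s => F x y s end).
Proof.
apply: cpt_tmatch => [x|x a b]; first by case: (l x).
by case: (l x) => // y s _; exists (y, s).
Qed.

End Closure.

Lemma cpt_fst0 P A B {eA : enc A} {eB : enc B} : cpt P (@fst A B).
Proof. exact: (@cpt_fst P _ _ _ _ _ _ (fun x => x) (cpt_id P (X := A * B))). Qed.

Lemma cpt_snd0 P A B {eA : enc A} {eB : enc B} : cpt P (@snd A B).
Proof. exact: (@cpt_snd P _ _ _ _ _ _ (fun x => x) (cpt_id P (X := A * B))). Qed.

Lemma cpt_app2 P X A B C {eX : enc X} {eA : enc A} {eB : enc B} {eC : enc C}
    (F : A -> B -> C) (f : X -> A) (g : X -> B) :
  cpt P (fun u : A * B => F u.1 u.2) -> cpt P f -> cpt P g -> cpt P (fun x => F (f x) (g x)).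
Proof. by move=> CF Cf Cg; apply: cpt_comp CF (cpt_pair Cf Cg). Qed.

(** [cpt_user] and [cpt_lib] are hooks, redefined as further closure lemmas become available; [cpt]
    decomposes a function along its syntax. *)
Ltac cpt_user := fail.
Ltac cpt_lib := fail.
Ltac cpt_step := first [ cpt_user | lazymatch goal with
  | |- cpt _ (fun x => (@?f x, @?g x)) => apply: cpt_pair
  | |- cpt _ (fun x => fst (@?f x)) => first [exact: cpt_fst0 | apply: cpt_fst]
  | |- cpt _ (fun x => snd (@?f x)) => first [exact: cpt_snd0 | apply: cpt_snd]
  | |- cpt _ (fun x => eq_op (@?f x) (@?g x)) => apply: cpt_eq
  | |- cpt _ _ => first [ eassumption | exact: cpt_fst0 | exact: cpt_snd0 | exact: cpt_id
                        | exact: cpt_const | cpt_lib | apply: cpt_if | apply: cpt_lcase ]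
  end ].
Ltac cpt := repeat cpt_step.

Section Closure2.

Context (P : bool) (X : Type) {eX : enc X}.

Lemma cpt_ocase A B {eA : enc A} {eB : enc B} (l : X -> option A) (G : X -> B)
    (F : X -> A -> B) :
  cpt P l -> cpt P G -> cpt P (fun u : X * A => F u.1 u.2) ->
  cpt P (fun x => match l x with None => G x | Some y => F x y end).
Proof.
move=> L G0 F0.
apply: (@cpt_tmatch P X _ _ (A * unit)%type _ _ _ _ l _ G (fun u => F u.1 u.2.1)) => //.
- by move=> x; case: (l x).
- by move=> x a b; case: (l x) => // y _; exists (y, tt).
apply: (@cpt_comp P _ _ _ _ _ _ (fun u : X * (A * unit) => (u.1, u.2.1))
          (fun u => F u.1 u.2)) => //.
cpt.
Qed.

Lemma cpt_ncase B {eB : enc B} (n : X -> nat) (G : X -> B) (F : X -> nat -> B) :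
  cpt P n -> cpt P G -> cpt P (fun u : X * nat => F u.1 u.2) ->
  cpt P (fun x => match n x with 0 => G x | m.+1 => F x m end).
Proof.
move=> L G0 F0.
apply: (@cpt_tmatch P X _ _ (unit * nat)%type _ _ _ _ n _ G (fun u => F u.1 u.2.2)) => //.
- by move=> x; case: (n x).
- by move=> x a b; case: (n x) => // m _; exists (tt, m).
apply: (@cpt_comp P _ _ _ _ _ _ (fun u : X * (unit * nat) => (u.1, u.2.2))
          (fun u => F u.1 u.2)) => //.
cpt.
Qed.

Lemma cpt_scase A B C {eA : enc A} {eB : enc B} {eC : enc C} (u : X -> A + B)
    (F : X -> A -> C) (G : X -> B -> C) : cpt P u ->
  cpt P (fun p : X * A => F p.1 p.2) -> cpt P (fun p : X * B => G p.1 p.2) ->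
  cpt P (fun x => match u x with inl a => F x a | inr b => G x b end).
Proof.
move=> U [cf [q Ef]] [cg [q' Eg]]; have [qu szu] := cpt_size U.
(* the tag is tested on the tree [((tag, payload), x)] *)
have [c [q1 E1]] := cpt_pair U (@cpt_id P X eX).
have [ct [q2 E2]] : cpt P (fun p : (bool * tree) * X => p.1.1) by cpt.
have [cp [q3 E3]] : cpt P (fun p : (bool * tree) * X => (p.2, p.1.2)) by cpt.
pose p n := pb q1 n + (pb q2 (n + pb qu n).+1 + (pb q3 (n + pb qu n).+1 +
   (pb q (n + pb qu n).+1 + pb q' (n + pb qu n).+1)) + 100 * (n + pb qu n).+1).
apply: (@cptI P _ _ _ _ _ (Seq c (ifc ct (Seq cp cg) (Seq cp cf))) p).
  by rewrite /p; polyn; exact: poly_id.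
move=> x; have s1 := szu x; have := E1 x; rewrite /p.
case: (u x) s1 => [a|b] s1 E.
  have e : code (inl a : A + B, x) = code ((false, code a), x) by [].
  have s0 : sz ((false, code a), x) <= (sz x + pb qu (sz x)).+1.
    by move: s1; rewrite !sz_pair /sz /= !tsize_node /=; lia.
  have X3 : compb P (if false then Seq cp cg else Seq cp cf) (code ((false, code a), x))
      (code (F x a)) (pb q3 (sz ((false, code a), x)) + pb q (sz (x, a))).
    exact: compb_seq (E3 ((false, code a), x)) (Ef (x, a)).
  have X2 : compb P ct (code ((false, code a), x)) (tbool false) (pb q2 (sz ((false, code a), x))).
    exact: E2.
  rewrite e in E; apply: compb_weaken (compb_seq E (compb_if X2 X3)) _.
  rewrite leq_add2l leq_add ?leq_mul2l ?s0 ?orbT // leq_add ?leq_pb //.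
  rewrite leq_add ?leq_pb //; apply: leq_trans (leq_addr _ _); apply: leq_pb.
  by move: s1; rewrite !sz_pair /sz /= !tsize_node /=; lia.
have e : code (inr b : A + B, x) = code ((true, code b), x) by [].
have s0 : sz ((true, code b), x) <= (sz x + pb qu (sz x)).+1.
  by move: s1; rewrite !sz_pair /sz /= !tsize_node /=; lia.
have X3 : compb P (if true then Seq cp cg else Seq cp cf) (code ((true, code b), x))
    (code (G x b)) (pb q3 (sz ((true, code b), x)) + pb q' (sz (x, b))).
  exact: compb_seq (E3 ((true, code b), x)) (Eg (x, b)).
have X2 : compb P ct (code ((true, code b), x)) (tbool true) (pb q2 (sz ((true, code b), x))).
  exact: E2.
rewrite e in E; apply: compb_weaken (compb_seq E (compb_if X2 X3)) _.
rewrite leq_add2l leq_add ?leq_mul2l ?s0 ?orbT // leq_add ?leq_pb //.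
rewrite leq_add ?leq_pb //; apply: leq_trans (leq_addl _ _); apply: leq_pb.
by move: s1; rewrite !sz_pair /sz /= !tsize_node /=; lia.
Qed.

End Closure2.
Ltac cpt_lib ::= first [ apply: cpt_ocase | apply: cpt_ncase | apply: cpt_scase ].

(** * Loops and recursion *)

(** At each test the value of the condition lies on the stack above the current argument. *)
Definition wloop cc cb := While 1 one (Seq droptop (Seq cb (Seq dup cc))).
Definition loopc cc cb := Seq dup (Seq cc (Seq (wloop cc cb) droptop)).

(** Both the number of rounds and the sizes of all intermediate values have to be bounded by
    hypothesis: iterating a function of polynomial growth polynomially often may well produce values
    of exponential size. *)
Lemma cpt_loop P X A {eX : enc X} {eA : enc A} (init : X -> A) (cond : A -> bool)
    (body : A -> A) (f : X -> A) (p : nat -> nat) :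
  cpt P init -> cpt P cond -> cpt P body -> poly p ->
  (forall x, exists n, [/\ n <= p (sz x), f x = iter n body (init x),
     forall i, i < n -> cond (iter i body (init x)), ~~ cond (iter n body (init x))
   & forall i, i <= n -> sz (iter i body (init x)) <= p (sz x)]) ->
  cpt P f.
Proof.
move=> [ci [qi Ei]] [cc [q Ec]] [cb [q' Eb]] polyp H.
(* The cost of a round: the test, the body, and the copying and dropping of values of size at most
   [p n]. *)
pose K n := pb q (p n) + pb q' (p n) + 100 * (p n).+1.
apply: (@cptI P _ _ _ _ _ (Seq ci (loopc cc cb)) (fun n => pb qi n + (p n).+2 * K n)).
  have E q0 : poly (fun n => pb q0 (p n)) by apply: poly_pb.
  by rewrite /K; apply: poly_add; [apply: poly_pb; exact: poly_id | apply: poly_mul];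
    repeat (first [exact: E | exact: polyp | apply: poly_const
    | apply: poly_add | apply: poly_S | apply: poly_mul]).
move=> x0; apply: compb_seq (Ei x0) _.
have [n [le_n -> condT condF szs]] := H x0.
move: (init x0) condT condF szs => a condT condF szs.
set N := p (sz x0) in le_n szs *; set k := K (sz x0).
have kE : k = pb q N + pb q' N + 100 * N.+1 by [].
have szN i : i <= n -> tsize (code (iter i body a)) <= N := szs i.
(* Here [i] counts the rounds that remain, so the induction starts at the exit of the loop. *)
have L i : i <= n -> exists t, (forall s r, exec (wloop cc cb)
    (st (tc (tbool (cond (iter (n - i) body a))) ++ tc (code (iter (n - i) body a)) ++ s) r)
    (st (tc (tbool false) ++ tc (code (iter n body a)) ++ s) r) t (2 * k + size s + size r))
    /\ (P -> t <= 1 + i * k).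
  elim: i => [|i IH] le_i.
    rewrite subn0 (negbTE condF); exists 1; split=> // s r; exact: exec_while0.
  have [t [E le_t]] := IH (ltnW le_i).
  set b := iter (n - i.+1) body a.
  have eb : iter (n - i) body a = body b by rewrite /b -iterS -subnSK.
  have cb1 : cond b by apply: condT; lia.
  have sb : tsize (code b) <= N by apply: szN; lia.
  have sb' : tsize (code (body b)) <= N by rewrite -eb; apply: szN; lia.
  have [t1 [E1 l1]] := Eb b; have [t2 [E2 l2]] := Ec (body b).
  have le1 : pb q' (sz b) <= pb q' N by apply: leq_pb.
  have le2 : pb q (sz (body b)) <= pb q N by apply: leq_pb.
  exists (11 * 3 + 4 + (t1 + (30 * tsize (code (body b)) + 10 + t2)) + t).+1; split; last first.
    move=> pP; move/(_ pP): le_t; move/(_ pP): l1; move/(_ pP): l2.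
    by rewrite mulSn kE; lia.
  move=> s r; move/(_ s r): E; rewrite cb1; set h := _ + size s + size r => E.
  have X1 : exec droptop (st (tc (tbool true) ++ tc (code b) ++ s) r) (st (tc (code b) ++ s) r)
      (11 * 3 + 4) h.
    by apply: (@exec_drop (tbool true)); rewrite /h kE /tsize /=; lia.
  have X2 : exec cb (st (tc (code b) ++ s) r) (st (tc (code (body b)) ++ s) r) t1 h.
    by apply: exec_weaken (E1 _ _) _ _ => //; rewrite /h kE; lia.
  have X3 : exec dup (st (tc (code (body b)) ++ s) r)
      (st (tc (code (body b)) ++ tc (code (body b)) ++ s) r) (30 * tsize (code (body b)) + 10) h.
    by apply: exec_dup; rewrite /h kE; lia.
  have X4 : exec cc (st (tc (code (body b)) ++ tc (code (body b)) ++ s) r)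
      (st (tc (tbool (cond (body b))) ++ tc (code (body b)) ++ s) r) t2 h.
    by apply: exec_weaken (E2 _ _) _ _ => //; rewrite /h kE size_cat size_tc; lia.
  rewrite eb in E.
  exact: exec_while1 (exec_seq X1 (exec_seq X2 (exec_seq X3 X4))) E.
have [t1 [E1 l1]] := Ec a.
have sa : tsize (code a) <= N := szs 0 (leq0n n).
have le1 : pb q (sz a) <= pb q N by apply: leq_pb.
have k100 : 100 * N.+1 + pb q N <= k by rewrite kE; lia.
have kN : 2 * k <= N.+2 * k by rewrite leq_mul2r; lia.
have nk : n * k <= N * k by rewrite leq_mul2r le_n orbT.
have [t [E le_t]] := L n (leqnn n); rewrite subnn in E.
exists (30 * tsize (code a) + 10 + (t1 + (t + (11 * 1 + 4)))); split; last first.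
  move=> pP; move/(_ pP): le_t; move/(_ pP): l1.
  have -> : N.+2 * k = N * k + 2 * k by rewrite -mulnDl addn2.
  by lia.
move=> s r; set h := _ + size s + size r.
have X1 : exec dup (st (tc (code a) ++ s) r) (st (tc (code a) ++ tc (code a) ++ s) r)
    (30 * tsize (code a) + 10) h by apply: exec_dup; rewrite /h; lia.
have X2 : exec cc (st (tc (code a) ++ tc (code a) ++ s) r)
    (st (tc (tbool (cond a)) ++ tc (code a) ++ s) r) t1 h.
  by apply: exec_weaken (E1 _ _) _ _ => //; rewrite /h size_cat size_tc; lia.
have X3 := exec_weaken (E s r) (leqnn t) (_ : _ <= h).
have {}X3 := X3 ltac:(by rewrite /h; lia).
apply: exec_seq X1 (exec_seq X2 (exec_seq X3 _)).
by apply: (@exec_drop Leaf); rewrite /h /tsize /=; lia.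
Qed.

(* Tape 5 is a stack of pending tasks: [inl true] replaces the argument on top
   of tape 1 by its value, [inl false] and [inr true] resume a call after its
   first and its second recursive call. *)
Section Rec.

Variables (cbase cg ca cb ch : cmd).

Definition recbody :=
  If 5 one
    (Seq (Pop 5) (Seq dup (Seq cbase (If 1 one (Seq droptop cg)
       (Seq droptop (Seq (Push 5 (inl false)) (Seq (Push 5 (inl true)) (Seq dup ca))))))))
  (If 5 zero
    (Seq (Pop 5) (Seq swap2 (Seq (Push 1 (inl true)) (Seq (Push 5 (inr true))
       (Seq (Push 5 (inl true)) (Seq dup cb))))))
    (Seq (Pop 5) (Seq swap2 (Seq (Push 1 (inl true)) ch)))).
Definition running (x : option sym) : bool := if x is Some (inr false) then false else true.
Definition recloop := While 5 running recbody.
Definition recc :=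
  Seq (Push 5 (inr false)) (Seq (Push 5 (inl true)) (Seq recloop (Pop 5))).

Context (A B : Type) {eA : enc A} {eB : enc B}.
Variables (base : A -> bool) (g : A -> B) (a : A -> A) (b : A * B -> A) (h : (A * B) * B -> B).
Variables (f : A -> B) (K N : nat) (Inv : nat -> A -> Prop).
Hypothesis fE : forall m v, Inv m.+1 v ->
  f v = if base v then g v else h ((v, f (a v)), f (b (v, f (a v)))).
Hypothesis Inv0 : forall v, ~ Inv 0 v.
Hypothesis InvS : forall m v, Inv m.+1 v -> ~~ base v ->
  Inv m (a v) /\ Inv m (b (v, f (a v))).
Hypothesis InvN : forall m v, Inv m v -> sz v <= N /\ sz (f v) <= N.
Hypothesis Ebase : forall v, sz v <= N -> compb false cbase (code v) (code (base v)) K.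
Hypothesis Eg : forall v, sz v <= N -> compb false cg (code v) (code (g v)) K.
Hypothesis Ea : forall v, sz v <= N -> compb false ca (code v) (code (a v)) K.
Hypothesis Eb : forall v, sz v <= 2 * N + 1 -> compb false cb (code v) (code (b v)) K.
Hypothesis Eh : forall v, sz v <= 3 * N + 2 -> compb false ch (code v) (code (h v)) K.

(** In continuation form, as for [exec_mvloop]. A pending call keeps at most an argument and a first
    result, [2 * N + 1] symbols, together with its tasks; [2 * N + 4] per level of depth covers
    this. The time [T] is chosen before the stacks and is only known to exist. *)
Lemma exec_recloop m v : Inv m v -> exists T, forall s r w t H,
  size s + size r + K + m * (2 * N + 4) + (10 * N + 10) <= H ->
  exec recloop (st (tc (code (f v)) ++ s) r) w t H ->
  exec recloop (st (tc (code v) ++ s) (inl true :: r)) w (T + t) H.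
Proof.
elim: m v => [|m IH] v Iv; first by case: (Inv0 Iv).
have [svN sfN] := InvN Iv.
have sv : tsize (code v) <= N := svN.
have [t1 [E1 _]] := Ebase svN.
have tb3 := tsize_bool (base v).
pose ok (s r : seq sym) H := size s + size r + K + m.+1 * (2 * N + 4) + (10 * N + 10) <= H.
have X s r H : ok s r H -> [/\
  exec (Pop 5) (st (tc (code v) ++ s) (inl true :: r)) (st (tc (code v) ++ s) r) 1 H,
  exec dup (st (tc (code v) ++ s) r) (st (tc (code v) ++ tc (code v) ++ s) r)
    (30 * tsize (code v) + 10) H,
  exec cbase (st (tc (code v) ++ tc (code v) ++ s) r)
    (st (tc (tbool (base v)) ++ tc (code v) ++ s) r) t1 H &
  exec droptop (st (tc (tbool (base v)) ++ tc (code v) ++ s) r) (st (tc (code v) ++ s) r)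
    (11 * tsize (tbool (base v)) + 4) H].
  rewrite /ok => le; split; first exact: exec_pop5.
  - by apply: exec_dup; lia.
  - by apply: exec_weaken (E1 _ _) _ _ => //; rewrite size_cat size_tc; lia.
  - by apply: exec_drop; lia.
case bv: (base v) tb3 X => tb3 X.
  have [t2 [E2 _]] := Eg svN; exists (100 * N + 100 + t1 + t2) => s r w t H le E.
  have [X0 X1 X2 X3] := X s r H le.
  have X4 : exec cg (st (tc (code v) ++ s) r) (st (tc (code (f v)) ++ s) r) t2 H.
    by rewrite (fE Iv) bv; apply: exec_weaken (E2 _ _) _ _ => //; lia.
  have W : exec recbody (st (tc (code v) ++ s) (inl true :: r)) (st (tc (code (f v)) ++ s) r)
      (1 + (30 * tsize (code v) + 10 + (t1 + (11 * tsize (tbool true) + 4 + t2).+1))).+1 H.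
    apply: exec_if => //=; apply: exec_seq X0 (exec_seq X1 (exec_seq X2 _)).
    by apply: exec_if => //=; apply: exec_seq X3 X4.
  by apply: exec_weaken (exec_while1 _ _ W E) _ (leqnn H) => //; lia.
have [Ia Ib] := InvS Iv (negbT bv).
set u1 := f (a v) in Ib *; set u2 := f (b (v, u1)).
have [saN s1N] := InvN Ia; have [sbN s2N] := InvN Ib.
rewrite -/u1 in s1N; rewrite -/u2 in s2N.
have su1 : tsize (code u1) <= N := s1N.
have su2 : tsize (code u2) <= N := s2N.
have sp : sz (v, u1) <= 2 * N + 1 by rewrite sz_pair; lia.
have sp' : tsize (code (v, u1)) <= 2 * N + 1 := sp.
have sq : sz ((v, u1), u2) <= 3 * N + 2 by rewrite sz_pair; lia.
have fv : f v = h ((v, u1), u2) by rewrite (fE Iv) bv.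
have [ta [Ea' _]] := Ea svN; have [tb [Eb' _]] := Eb sp; have [th [Eh' _]] := Eh sq.
have [Ta Ha] := IH _ Ia; have [Tb Hb] := IH _ Ib.
exists (1000 * N + 1000 + t1 + ta + tb + th + Ta + Tb) => s r w t H le E.
have [X0 X1 X2 X3] := X s r H le.
have E3 : exec recloop (st (tc (code u2) ++ tc (code (v, u1)) ++ s) (inr true :: r)) w
    (100 * N + 100 + th + t) H.
  have Y0 : exec (Pop 5) (st (tc (code u2) ++ tc (code (v, u1)) ++ s) (inr true :: r))
     (st (tc (code u2) ++ tc (code (v, u1)) ++ s) r) 1 H by exact: exec_pop5.
  have Y1 : exec swap2 (st (tc (code u2) ++ tc (code (v, u1)) ++ s) r)
     (st (tc (code (v, u1)) ++ tc (code u2) ++ s) r) (20 * (tsize (code u2) + tsize (code (v, u1))) + 10) H.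
    by apply: exec_swap; lia.
  have Y2 : exec (Push 1 (inl true)) (st (tc (code (v, u1)) ++ tc (code u2) ++ s) r)
     (st (tc (code ((v, u1), u2)) ++ s) r) 2 H.
    rewrite (tc_pair (v, u1) u2) cat_cons -catA; apply: exec_push1.
    by rewrite !size_cat !size_tc; lia.
  have Y3 : exec ch (st (tc (code ((v, u1), u2)) ++ s) r) (st (tc (code (f v)) ++ s) r) th H.
    by rewrite fv; apply: exec_weaken (Eh' _ _) _ _ => //; lia.
  have W : exec recbody (st (tc (code u2) ++ tc (code (v, u1)) ++ s) (inr true :: r))
     (st (tc (code (f v)) ++ s) r)
      (1 + (20 * (tsize (code u2) + tsize (code (v, u1))) + 10 + (2 + th))).+2 H.
    apply: exec_if => //=; apply: exec_if => //=.
    exact: exec_seq Y0 (exec_seq Y1 (exec_seq Y2 Y3)).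
  by apply: exec_weaken (exec_while1 _ _ W E) _ (leqnn H) => //; lia.
have E4 := Hb (tc (code (v, u1)) ++ s) (inr true :: r) w _ H _ E3.
have {}E4 := E4 ltac:(by move: le; rewrite mulSn size_cat size_tc [size (_ :: r)]/=; lia).
have E5 : exec recloop (st (tc (code u1) ++ tc (code v) ++ s) (inl false :: r)) w
    (300 * N + 500 + th + tb + Tb + t) H.
  have Y0 : exec (Pop 5) (st (tc (code u1) ++ tc (code v) ++ s) (inl false :: r))
     (st (tc (code u1) ++ tc (code v) ++ s) r) 1 H by exact: exec_pop5.
  have Y1 : exec swap2 (st (tc (code u1) ++ tc (code v) ++ s) r)
     (st (tc (code v) ++ tc (code u1) ++ s) r) (20 * (tsize (code u1) + tsize (code v)) + 10) H.
    by apply: exec_swap; lia.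
  have Y2 : exec (Push 1 (inl true)) (st (tc (code v) ++ tc (code u1) ++ s) r)
     (st (tc (code (v, u1)) ++ s) r) 2 H.
    rewrite (tc_pair v u1) cat_cons -catA; apply: exec_push1.
    by rewrite !size_cat !size_tc; lia.
  have Y3 : exec (Push 5 (inr true)) (st (tc (code (v, u1)) ++ s) r)
     (st (tc (code (v, u1)) ++ s) (inr true :: r)) 2 H by apply: exec_push5; lia.
  have Y4 : exec (Push 5 (inl true)) (st (tc (code (v, u1)) ++ s) (inr true :: r))
     (st (tc (code (v, u1)) ++ s) (inl true :: inr true :: r)) 2 H.
    by apply: exec_push5 => /=; lia.
  have Y5 : exec dup (st (tc (code (v, u1)) ++ s) (inl true :: inr true :: r))
     (st (tc (code (v, u1)) ++ tc (code (v, u1)) ++ s) (inl true :: inr true :: r))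
     (30 * tsize (code (v, u1)) + 10) H by apply: exec_dup; lia.
  have Y6 : exec cb (st (tc (code (v, u1)) ++ tc (code (v, u1)) ++ s) (inl true :: inr true :: r))
     (st (tc (code (b (v, u1))) ++ tc (code (v, u1)) ++ s) (inl true :: inr true :: r)) tb H.
    apply: exec_weaken (Eb' _ _) _ _ => //; rewrite size_cat size_tc [size (_ :: _ :: r)]/=.
    by move: le; rewrite mulSn; lia.
  have W : exec recbody (st (tc (code u1) ++ tc (code v) ++ s) (inl false :: r))
     (st (tc (code (b (v, u1))) ++ tc (code (v, u1)) ++ s) (inl true :: inr true :: r))
      (1 + (20 * (tsize (code u1) + tsize (code v)) + 10 + (2 + (2 + (2 + (30 * tsize (code (v, u1)) + 10 + tb)))))).+2 H.
    apply: exec_if => //=; apply: exec_if => //=.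
    exact: exec_seq Y0 (exec_seq Y1 (exec_seq Y2 (exec_seq Y3 (exec_seq Y4 (exec_seq Y5 Y6))))).
  by apply: exec_weaken (exec_while1 _ _ W E4) _ (leqnn H) => //; lia.
have E6 := Ha (tc (code v) ++ s) (inl false :: r) w _ H _ E5.
have {}E6 := E6 ltac:(by move: le; rewrite mulSn size_cat size_tc [size (_ :: r)]/=; lia).
have Y3 : exec (Push 5 (inl false)) (st (tc (code v) ++ s) r)
   (st (tc (code v) ++ s) (inl false :: r)) 2 H by apply: exec_push5; lia.
have Y4 : exec (Push 5 (inl true)) (st (tc (code v) ++ s) (inl false :: r))
   (st (tc (code v) ++ s) (inl true :: inl false :: r)) 2 H.
  by apply: exec_push5 => /=; lia.
have Y5 : exec dup (st (tc (code v) ++ s) (inl true :: inl false :: r))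
   (st (tc (code v) ++ tc (code v) ++ s) (inl true :: inl false :: r))
   (30 * tsize (code v) + 10) H by apply: exec_dup; lia.
have Y6 : exec ca (st (tc (code v) ++ tc (code v) ++ s) (inl true :: inl false :: r))
   (st (tc (code (a v)) ++ tc (code v) ++ s) (inl true :: inl false :: r)) ta H.
  apply: exec_weaken (Ea' _ _) _ _ => //; rewrite size_cat size_tc [size (_ :: _ :: r)]/=.
  by move: le; rewrite mulSn; lia.
have W : exec recbody (st (tc (code v) ++ s) (inl true :: r))
   (st (tc (code (a v)) ++ tc (code v) ++ s) (inl true :: inl false :: r))
      (1 + (30 * tsize (code v) + 10 + (t1 + (11 * tsize (tbool false) + 4 + (2 + (2 + (30 * tsize (code v) + 10 + ta)))).+1))).+1 H.
  apply: exec_if => //=; apply: exec_seq X0 (exec_seq X1 (exec_seq X2 _)).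
  by apply: exec_if => //=; apply: exec_seq X3 (exec_seq Y3 (exec_seq Y4 (exec_seq Y5 Y6))).
by apply: exec_weaken (exec_while1 _ _ W E6) _ (leqnn H) => //; lia.
Qed.

End Rec.

Section Rec2.

Context (A B : Type) {eA : enc A} {eB : enc B}.
Variables (base : A -> bool) (g : A -> B) (a : A -> A) (b : A -> B -> A) (h : A -> B -> B -> B).

(** The argument of the second call may depend on the result of the first. Parsing needs this: the
    second subformula begins where the first one ends. *)
Fixpoint rec2 (n : nat) (v : A) : B :=
  if n is m.+1 then
    if base v then g v else
    let r1 := rec2 m (a v) in let r2 := rec2 m (b v r1) in h v r1 r2
  else g v.

(** The guard [D] restricts the size bounds to good inputs; for the evaluation of queries these are
    the valid instances. [Inv x m v] says that [v] occurs in the recursion for [x] with depth [m]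
    left. *)
Lemma cpt_rec2 X {eX : enc X} (D : X -> bool) (d : X -> B) (n : X -> nat) (v0 : X -> A)
    (p : nat -> nat) (Inv : X -> nat -> A -> Prop) :
  cpt false base -> cpt false g -> cpt false a -> cpt false (fun u => b u.1 u.2) ->
  cpt false (fun u => h u.1.1 u.1.2 u.2) -> cpt false D -> cpt false d ->
  cpt false n -> cpt false v0 -> poly p ->
  (forall x, D x -> Inv x (n x) (v0 x)) ->
  (forall x m v, D x -> Inv x m.+1 v -> ~~ base v ->
     Inv x m (a v) /\ Inv x m (b v (rec2 m (a v)))) ->
  (forall x m v, D x -> Inv x m v ->
     [/\ m <= p (sz x), sz v <= p (sz x) & sz (rec2 m v) <= p (sz x)]) ->
  cpt false (fun x => if D x then rec2 (n x) (v0 x) else d x).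
Proof.
move=> Cbase Cg Ca Cb Ch CD Cd Cn Cv polyp Inv0 InvS InvN.
(* The remaining depth becomes part of the argument, where the program can test and decrease it. *)
pose rbase (v : nat * A) := if v.1 is _.+1 then base v.2 else true.
pose rg (v : nat * A) := g v.2.
pose ra (v : nat * A) := (if v.1 is m.+1 then m else 0, a v.2).
pose rb (v : (nat * A) * B) := (if v.1.1 is m.+1 then m else 0, b v.1.2 v.2).
pose rh (v : ((nat * A) * B) * B) := h v.1.1.2 v.1.2 v.2.
have [cbase [q1 E1]] : cpt false rbase.
  by rewrite /rbase; cpt; apply: (@cpt_comp _ _ _ _ _ _ _ (fun u : nat * A * nat => u.1.2) base) => //; cpt.
have [cg [q2 E2]] : cpt false rg.
  by rewrite /rg; apply: (@cpt_comp _ _ _ _ _ _ _ (fun u : nat * A => u.2) g) => //; cpt.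
have [ca [q3 E3]] : cpt false ra.
  by rewrite /ra; cpt; apply: (@cpt_comp _ _ _ _ _ _ _ (fun u : nat * A => u.2) a) => //; cpt.
have [cb [q4 E4]] : cpt false rb.
  rewrite /rb; cpt.
  by apply: (@cpt_comp _ _ _ _ _ _ _ (fun u : (nat * A) * B => (u.1.2, u.2)) (fun u => b u.1 u.2)) => //; cpt.
have [ch [q5 E5]] : cpt false rh.
  rewrite /rh; apply: (@cpt_comp _ _ _ _ _ _ _ (fun u : ((nat * A) * B) * B => ((u.1.1.2, u.1.2), u.2))
    (fun u => h u.1.1 u.1.2 u.2)) => //; cpt.
have [cD [q6 E6]] := CD; have [cd [q7 E7]] := Cd.
have [cs [q8 E8]] := cpt_pair Cn Cv.
pose N k := (3 * p k + 3).
pose K k := pb q1 (N k) + pb q2 (N k) + pb q3 (N k) + pb q4 (2 * N k + 1) + pb q5 (3 * N k + 2).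
pose H k := K k + (N k).+1 * (2 * N k + 4) + (10 * N k + 14).
pose Q k := pb q6 k + (pb q8 k + H k + pb q7 k) + 100 * k.
have pN : poly N by rewrite /N; apply: poly_add; [apply: poly_mul => //; apply: poly_const | apply: poly_const].
have polyQ : poly Q.
  rewrite /Q /H /K; repeat (first [exact: poly_id | exact: pN | apply: poly_const | apply: poly_pb
    | apply: poly_add | apply: poly_S | apply: poly_mul]).
apply: (@cptI _ _ _ _ _ _ (ifc cD (Seq cs (recc cbase cg ca cb ch)) cd) Q polyQ).
move=> x; apply: compb_if (E6 x) _.
case Dx: (D x); last by apply: compb_weaken (E7 x) _; rewrite leq_addl.
apply: compb_weaken (compb_seq (E8 x) _) (leq_addr _ _).
pose f (v : nat * A) := rec2 v.1 v.2.
pose I (m : nat) (v : nat * A) := Inv x v.1 v.2 /\ v.1 < m.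
have h1 m v : I m.+1 v ->
    f v = if rbase v then rg v else rh ((v, f (ra v)), f (rb (v, f (ra v)))).
  by case: v => [[|k] v] [_ _].
have h2 v : ~ I 0 v by case.
have h3 m v : I m.+1 v -> ~~ rbase v -> I m (ra v) /\ I m (rb (v, f (ra v))).
  case: v => [[|k] v] [Iv lt_m] //= nb; have [I1 I2] := InvS x _ _ Dx Iv nb.
  by split; split.
have h4 m v : I m v -> sz v <= N (sz x) /\ sz (f v) <= N (sz x).
  case: v => [k v] [Iv _]; have [l1 l2 l3] := InvN x _ _ Dx Iv.
  by rewrite sz_pair sz_nat /N; move: l1 l2 l3; rewrite /f /=; lia.
have h5 v : sz v <= N (sz x) -> compb false cbase (code v) (code (rbase v)) (K (sz x)).
  by move=> le; apply: compb_weaken (E1 v) _; rewrite /K; have := leq_pb q1 le; lia.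
have h6 v : sz v <= N (sz x) -> compb false cg (code v) (code (rg v)) (K (sz x)).
  by move=> le; apply: compb_weaken (E2 v) _; rewrite /K; have := leq_pb q2 le; lia.
have h7 v : sz v <= N (sz x) -> compb false ca (code v) (code (ra v)) (K (sz x)).
  by move=> le; apply: compb_weaken (E3 v) _; rewrite /K; have := leq_pb q3 le; lia.
have h8 v : sz v <= 2 * N (sz x) + 1 -> compb false cb (code v) (code (rb v)) (K (sz x)).
  by move=> le; apply: compb_weaken (E4 v) _; rewrite /K; have := leq_pb q4 le; lia.
have h9 v : sz v <= 3 * N (sz x) + 2 -> compb false ch (code v) (code (rh v)) (K (sz x)).
  by move=> le; apply: compb_weaken (E5 v) _; rewrite /K; have := leq_pb q5 le; lia.
have h10 : I (n x).+1 (n x, v0 x) by split; [apply: Inv0|].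
have [T HT] := exec_recloop h1 h2 h3 h4 h5 h6 h7 h8 h9 h10.
have [nN vN rN] := InvN x _ _ Dx (Inv0 x Dx).
exists (2 + (2 + (T + 1 + 1))); split=> // s r; set hh := _ + size s + size r.
have Hn : K (sz x) + (n x).+1 * (2 * N (sz x) + 4) + (10 * N (sz x) + 14) <= H (sz x).
  by rewrite /H leq_add2r leq_add2l leq_mul2r ltnS (leq_trans nN) ?orbT // /N; lia.
have X1 : exec (Push 5 (inr false)) (st (tc (code (n x, v0 x)) ++ s) r)
    (st (tc (code (n x, v0 x)) ++ s) (inr false :: r)) 2 hh.
  by apply: exec_push5; rewrite /hh; move: Hn; lia.
have X2 : exec (Push 5 (inl true)) (st (tc (code (n x, v0 x)) ++ s) (inr false :: r))
    (st (tc (code (n x, v0 x)) ++ s) (inl true :: inr false :: r)) 2 hh.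
  by apply: exec_push5; rewrite /hh /=; move: Hn; lia.
have le1 : size s + (size r).+1 + K (sz x) + (n x).+1 * (2 * N (sz x) + 4)
    + (10 * N (sz x) + 10) <= hh.
  by rewrite /hh; move: Hn; set aa := _ * _; lia.
have w0 : exec (recloop cbase cg ca cb ch) (st (tc (code (f (n x, v0 x))) ++ s) (inr false :: r))
    (st (tc (code (f (n x, v0 x))) ++ s) (inr false :: r)) 1 hh by apply: exec_while0.
have X3 := HT s (inr false :: r) _ _ hh le1 w0.
by apply: exec_seq X1 (exec_seq X2 (exec_seq X3 _)); apply: exec_pop5.
Qed.

End Rec2.

(** * Lists and numbers *)

Lemma sz_take A {eA : enc A} i (s : seq A) : sz (take i s) <= sz s.
Proof.
by know (sz_cat (take i s) (drop i s)); rewrite cat_take_drop; know (sz_gt0 (drop i s)); lia.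
Qed.

Lemma sz_drop A {eA : enc A} i (s : seq A) : sz (drop i s) <= sz s.
Proof.
by know (sz_cat (take i s) (drop i s)); rewrite cat_take_drop; know (sz_gt0 (take i s)); lia.
Qed.

Lemma sz_catrev A {eA : enc A} (s t : seq A) : (sz (catrev s t)).+1 = sz s + sz t.
Proof. by elim: s t => [|x s IH] t //=; rewrite IH !sz_cons; lia. Qed.

Lemma sz_rev A {eA : enc A} (s : seq A) : sz (rev s) = sz s.
Proof. by know (sz_catrev s [::]); rewrite sz_nil /rev; lia. Qed.

Section Fold.

Context (P : bool) (X Y A : Type) {eX : enc X} {eY : enc Y} {eA : enc A}.

Lemma cpt_foldl (l : X -> seq Y) (s0 : X -> A) (op : X -> A -> Y -> A) (p : nat -> nat) :
  cpt P l -> cpt P s0 -> cpt P (fun u : (X * A) * Y => op u.1.1 u.1.2 u.2) -> poly p ->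
  (forall x i, sz (foldl (op x) (s0 x) (take i (l x))) <= p (sz x)) ->
  cpt P (fun x => foldl (op x) (s0 x) (l x)).
Proof.
move=> L S0 Op polyp bound; have [ql szl] := cpt_size L.
pose cond (u : X * (seq Y * A)) := if u.2.1 is y :: s then true else false.
pose body (u : X * (seq Y * A)) :=
  if u.2.1 is y :: s then (u.1, (s, op u.1 u.2.2 y)) else u.
have C1 : cpt P cond by rewrite /cond; cpt.
have C2 : cpt P body.
  rewrite /body; cpt.
  apply: (@cpt_comp P _ _ _ _ _ _ (fun u : X * (seq Y * A) * (Y * seq Y) =>
    ((u.1.1, u.1.2.2), u.2.1)) (fun u => op u.1.1 u.1.2 u.2)) => //; cpt.
have C3 : cpt P (fun x => (x, (l x, s0 x))) by cpt.
have It x i : iter i body (x, (l x, s0 x)) =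
    (x, (drop i (l x), foldl (op x) (s0 x) (take i (l x)))).
  elim: i => [|i IH] /=; first by rewrite drop0 take0.
  rewrite IH /body /=; case: (ltnP i (size (l x))) => [lt_i|le_i].
    have y0 : Y by case: (l x) lt_i.
    by rewrite (drop_nth y0 lt_i) (take_nth y0 lt_i) foldl_rcons.
  by rewrite drop_oversize // !take_oversize ?drop_oversize //; lia.
have F : cpt P (fun x => (x, ([::] : seq Y, foldl (op x) (s0 x) (l x)))); last first.
  apply: (@cpt_comp P _ _ _ _ _ _ (fun x => (x, ([::] : seq Y, foldl (op x) (s0 x) (l x))))
     (fun u => u.2.2)) => //; cpt.
apply: (cpt_loop (p := fun n => n + (pb ql n + p n) + 2) C3 C1 C2) => [|x].
  by repeat (first [exact: polyp | exact: poly_id | apply: poly_const | apply: poly_add | apply: poly_pb]).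
exists (size (l x)); split.
- by have := szl x; know (size_sz (l x)); lia.
- by rewrite It drop_size take_size.
- move=> i lt_i; rewrite It /cond /=.
  have y0 : Y by case: (l x) lt_i.
  by rewrite (drop_nth y0 lt_i).
- by rewrite It /cond drop_size.
move=> i _; rewrite It !sz_pair.
by have := bound x i; have := szl x; know (sz_drop i (l x)); lia.
Qed.

End Fold.

Section Lists.

Context (P : bool) (X : Type) {eX : enc X}.

Lemma cpt_cons A {eA : enc A} (f : X -> A) (g : X -> seq A) :
  cpt P f -> cpt P g -> cpt P (fun x => f x :: g x).
Proof.
by move=> F G; apply: (@cpt_code P _ _ _ _ _ _ _ (fun x => (f x, g x))) => //; cpt.
Qed.

Lemma cpt_some A {eA : enc A} (f : X -> A) : cpt P f -> cpt P (fun x => Some (f x)).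
Proof. by move=> F; apply: (@cpt_code P _ _ _ _ _ _ _ (fun x => (f x, tt))) => //; cpt. Qed.

Lemma cpt_S (n : X -> nat) : cpt P n -> cpt P (fun x => (n x).+1).
Proof. by move=> F; apply: (@cpt_code P _ _ _ _ _ _ _ (fun x => (tt, n x))) => //; cpt. Qed.

Lemma cpt_inl A B {eA : enc A} {eB : enc B} (f : X -> A) :
  cpt P f -> cpt P (fun x => inl (f x) : A + B).
Proof. by move=> F; apply: (@cpt_code P _ _ _ _ _ _ _ (fun x => (false, f x))) => //; cpt. Qed.

Lemma cpt_inr A B {eA : enc A} {eB : enc B} (f : X -> B) :
  cpt P f -> cpt P (fun x => inr (f x) : A + B).
Proof. by move=> F; apply: (@cpt_code P _ _ _ _ _ _ _ (fun x => (true, f x))) => //; cpt. Qed.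

Lemma cpt_units (n : X -> nat) : cpt P n -> cpt P (fun x => nseq (n x) tt).
Proof. exact: cpt_code. Qed.

Lemma cpt_catrev A {eA : enc A} (f g : X -> seq A) :
  cpt P f -> cpt P g -> cpt P (fun x => catrev (f x) (g x)).
Proof.
move=> F G; have [q szf] := cpt_size F; have [q' szg] := cpt_size G.
have E (s t : seq A) : catrev s t = foldl (fun a y => y :: a) t s.
  by elim: s t => //= y s IH t; rewrite IH.
apply: (@cpt_ext P _ _ _ _ _ (fun x => foldl (fun a y => y :: a) (g x) (f x))) => [x|].
  exact: E.
apply: (cpt_foldl (op := fun _ a y => y :: a) (p := fun n => pb q n + pb q' n) F G).
- apply: (@cpt_code P _ _ _ _ _ _ _ (fun u : X * seq A * A => (u.2, u.1.2))) => //; cpt.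
- by polyn; exact: poly_id.
move=> x i; rewrite -E; know (sz_catrev (take i (f x)) (g x)).
by know (sz_take i (f x)); have := szf x; have := szg x; lia.
Qed.

Lemma cpt_rev A {eA : enc A} (f : X -> seq A) : cpt P f -> cpt P (fun x => rev (f x)).
Proof. by move=> F; apply: cpt_catrev => //; cpt. Qed.

Lemma cpt_map A B {eA : enc A} {eB : enc B} (l : X -> seq A) (F : X -> A -> B) :
  cpt P l -> cpt P (fun u : X * A => F u.1 u.2) ->
  cpt P (fun x => [seq F x y | y <- l x]).
Proof.
move=> L CF; have [q szl] := cpt_size L; have [q' szF] := cpt_size CF.
pose op x (a : seq B) (y : A) := F x y :: a.
have E x s t : foldl (op x) t s = rev [seq F x y | y <- s] ++ t.
  by elim: s t => //= y s IH t; rewrite IH rev_cons cat_rcons.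
apply: (@cpt_ext P _ _ _ _ _ (fun x => rev (foldl (op x) [::] (l x)))) => [x|].
  by rewrite E cats0 revK.
apply: cpt_rev.
apply: (cpt_foldl (p := fun n => pb q n * (pb q' (n + pb q n).+1).+1 + 1)) => //; first by cpt.
- rewrite /op; apply: (@cpt_code P _ _ _ _ _ _ _
    (fun u : X * seq B * A => (F u.1.1 u.2, u.1.2))) => //; cpt.
  apply: (@cpt_comp P _ _ _ _ _ _ (fun u : X * seq B * A => (u.1.1, u.2))
    (fun u => F u.1 u.2)) => //; cpt.
- by polyn; exact: poly_id.
move=> x i; rewrite E cats0 sz_rev; apply: leq_trans (@sz_all _ _ _ (pb q' (sz x + pb q (sz x)).+1) _) _.
  have: sz (take i (l x)) <= pb q (sz x) by apply: leq_trans (sz_take _ _) (szl x).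
  elim: (take i (l x)) => //= y s IH; rewrite sz_cons => le; rewrite IH ?andbT; last by lia.
  by apply: leq_trans (szF (x, y)) _; apply: leq_pb; rewrite sz_pair; lia.
rewrite leq_add2r leq_mul2r size_map orbC.
by know (size_sz (take i (l x))); know (sz_take i (l x)); have := szl x; lia.
Qed.

Lemma cpt_cat A {eA : enc A} (f g : X -> seq A) :
  cpt P f -> cpt P g -> cpt P (fun x => f x ++ g x).
Proof.
move=> F G; apply: (@cpt_ext P _ _ _ _ _ (fun x => catrev (rev (f x)) (g x))) => [x|].
  by rewrite catrevE revK.
by apply: cpt_catrev => //; apply: cpt_rev.
Qed.

Lemma cpt_size_seq A {eA : enc A} (l : X -> seq A) :
  cpt P l -> cpt P (fun x => size (l x)).
Proof.
move=> L; apply: (@cpt_code P _ _ _ _ _ _ _ (fun x => [seq tt | _ <- l x])) => [x|].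
  by have -> : [seq tt | _ <- l x] = nseq (size (l x)) tt by elim: (l x) => //= y s ->.
by apply: (cpt_map (F := fun _ _ => tt)) => //; cpt.
Qed.

End Lists.

Ltac cpt_lib ::= lazymatch goal with
  | |- cpt _ (fun x => @cons _ (@?f x) (@?g x)) => apply: cpt_cons
  | |- cpt _ (fun x => Some (@?f x)) => apply: cpt_some
  | |- cpt _ (fun x => S (@?f x)) => apply: cpt_S
  | |- cpt _ (fun x => inl (@?f x)) => apply: cpt_inl
  | |- cpt _ (fun x => inr (@?f x)) => apply: cpt_inr
  | |- cpt _ (fun x => nseq (@?f x) tt) => apply: cpt_units
  | |- cpt _ (fun x => rev (@?f x)) => apply: cpt_rev
  | |- cpt _ (fun x => cat (@?f x) (@?g x)) => apply: cpt_cat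
  | |- cpt _ (fun x => map (@?f x) (@?g x)) => apply: cpt_map
  | |- cpt _ (fun x => size (@?f x)) => apply: cpt_size_seq
  | |- _ => first [ apply: cpt_if | apply: cpt_lcase | apply: cpt_ocase | apply: cpt_ncase
                  | apply: cpt_scase ]
  end.

Section Lists2.

Context (P : bool) (X : Type) {eX : enc X}.

Lemma cpt_flatten A {eA : enc A} (l : X -> seq (seq A)) :
  cpt P l -> cpt P (fun x => flatten (l x)).
Proof.
move=> L; have [q szl] := cpt_size L.
have E (s : seq (seq A)) t : foldl (fun a y => a ++ y) t s = t ++ flatten s.
  by elim: s t => [|y s IH] t /=; rewrite ?cats0 // IH catA.
apply: (@cpt_ext P _ _ _ _ _ (fun x => foldl (fun a y => a ++ y) [::] (l x))) => [x|].
  by rewrite E.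
apply: (cpt_foldl (op := fun _ a y => a ++ y) (p := fun n => pb q n)) => //; first by cpt.
- by cpt.
- by polyn; exact: poly_id.
move=> x i; rewrite E /=; have: sz (take i (l x)) <= pb q (sz x).
  by apply: leq_trans (sz_take _ _) (szl x).
apply: leq_trans; elim: (take i (l x)) => //= y s IH.
by rewrite sz_cons; know (sz_cat y (flatten s)); lia.
Qed.

Lemma cpt_filter A {eA : enc A} (l : X -> seq A) (F : X -> A -> bool) :
  cpt P l -> cpt P (fun u : X * A => F u.1 u.2) ->
  cpt P (fun x => [seq y <- l x | F x y]).
Proof.
move=> L CF; apply: (@cpt_ext P _ _ _ _ _
  (fun x => flatten [seq if F x y then [:: y] else [::] | y <- l x])) => [x|].
  by elim: (l x) => //= y s ->; case: (F x y).
by apply: cpt_flatten; apply: (cpt_map (F := fun x y => if F x y then [:: y] else [::])) => //; cpt.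
Qed.

Lemma cpt_all A {eA : enc A} (l : X -> seq A) (F : X -> A -> bool) :
  cpt P l -> cpt P (fun u : X * A => F u.1 u.2) -> cpt P (fun x => all (F x) (l x)).
Proof.
move=> L CF; apply: (@cpt_ext P _ _ _ _ _
  (fun x => if [seq y <- l x | ~~ F x y] is _ :: _ then false else true)) => [x|].
  by elim: (l x) => //= y s ->; case: (F x y).
apply: (cpt_lcase (F := fun _ _ _ => false)); [|by cpt|by cpt].
by apply: (cpt_filter (F := fun x y => ~~ F x y)) => //; cpt.
Qed.

Lemma cpt_has A {eA : enc A} (l : X -> seq A) (F : X -> A -> bool) :
  cpt P l -> cpt P (fun u : X * A => F u.1 u.2) -> cpt P (fun x => has (F x) (l x)).
Proof.
move=> L CF; apply: (@cpt_ext P _ _ _ _ _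
  (fun x => if [seq y <- l x | F x y] is _ :: _ then true else false)) => [x|].
  by elim: (l x) => //= y s ->; case: (F x y).
apply: (cpt_lcase (F := fun _ _ _ => true)); [|by cpt|by cpt].
exact: cpt_filter.
Qed.

Lemma cpt_mem (A : eqType) {eA : enc A} (y : X -> A) (l : X -> seq A) :
  cpt P y -> cpt P l -> cpt P (fun x => y x \in l x).
Proof.
move=> Y L; apply: (@cpt_ext P _ _ _ _ _ (fun x => has (fun z => y x == z) (l x))) => [x|].
  by elim: (l x) => //= z s IH; rewrite inE IH.
apply: (cpt_has (F := fun x z => y x == z)) => //; cpt.
by apply: cpt_comp Y _; cpt.
Qed.

Lemma cpt_iter A {eA : enc A} (n : X -> nat) (s0 : X -> A) (F : X -> A -> A) (p : nat -> nat) :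
  cpt P n -> cpt P s0 -> cpt P (fun u : X * A => F u.1 u.2) -> poly p ->
  (forall x i, i <= n x -> sz (iter i (F x) (s0 x)) <= p (sz x)) ->
  cpt P (fun x => iter (n x) (F x) (s0 x)).
Proof.
move=> N S0 CF polyp bound.
have E x s (l : seq unit) : foldl (fun a _ => F x a) s l = iter (size l) (F x) s.
  by elim: l s => //= _ l IH s; rewrite IH -iterSr.
apply: (@cpt_ext P _ _ _ _ _ (fun x => foldl (fun a _ => F x a) (s0 x) (nseq (n x) tt))) => [x|].
  by rewrite E size_nseq.
have C : cpt P (fun x => nseq (n x) tt) by apply: cpt_units.
apply: (cpt_foldl (op := fun x a _ => F x a) (p := p) C) => //.
  by apply: (cpt_app2 CF); cpt.
move=> x i; rewrite E; apply: bound; rewrite size_take size_nseq; case: ltnP => //.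
exact: ltnW.
Qed.

Lemma cpt_drop A {eA : enc A} (n : X -> nat) (l : X -> seq A) :
  cpt P n -> cpt P l -> cpt P (fun x => drop (n x) (l x)).
Proof.
move=> N L; have [q szl] := cpt_size L.
have E (s : seq A) i : iter i behead s = drop i s.
  by elim: i => [|i IH]; rewrite ?drop0 //= IH -drop1 drop_drop add1n.
apply: (@cpt_ext P _ _ _ _ _ (fun x => iter (n x) behead (l x))) => [x|]; first by rewrite E.
apply: (cpt_iter (F := fun _ s => behead s) (p := fun n => pb q n)) => //.
- by cpt.
- by polyn; exact: poly_id.
by move=> x i _; rewrite E; apply: leq_trans (sz_drop _ _) (szl x).
Qed.

Lemma cpt_nth A {eA : enc A} (d : X -> A) (l : X -> seq A) (n : X -> nat) :
  cpt P d -> cpt P l -> cpt P n -> cpt P (fun x => nth (d x) (l x) (n x)).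
Proof.
move=> D L N; apply: (@cpt_ext P _ _ _ _ _
  (fun x => if drop (n x) (l x) is y :: _ then y else d x)) => [x|].
  case: (ltnP (n x) (size (l x))) => [lt|le]; first by rewrite (drop_nth (d x) lt).
  by rewrite drop_oversize // nth_default.
by apply: cpt_lcase => //; [apply: cpt_drop | cpt].
Qed.

Lemma cpt_sub (m n : X -> nat) : cpt P m -> cpt P n -> cpt P (fun x => m x - n x).
Proof.
move=> M N; apply: (@cpt_ext P _ _ _ _ _ (fun x => size (drop (n x) (nseq (m x) tt)))) => [x|].
  by rewrite size_drop size_nseq.
by apply: cpt_size_seq; apply: cpt_drop => //; cpt.
Qed.

Lemma cpt_leq (m n : X -> nat) : cpt P m -> cpt P n -> cpt P (fun x => m x <= n x).
Proof. by move=> M N; apply: cpt_eq; [apply: cpt_sub | cpt]. Qed.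

Lemma cpt_add (m n : X -> nat) : cpt P m -> cpt P n -> cpt P (fun x => m x + n x).
Proof.
move=> M N; apply: (@cpt_ext P _ _ _ _ _ (fun x => size (nseq (m x) tt ++ nseq (n x) tt))) => [x|].
  by rewrite size_cat !size_nseq.
by cpt.
Qed.

Lemma cpt_mul (m n : X -> nat) : cpt P m -> cpt P n -> cpt P (fun x => m x * n x).
Proof.
move=> M N; apply: (@cpt_ext P _ _ _ _ _ (fun x =>
   size (flatten [seq nseq (n x) tt | _ <- nseq (m x) tt]))) => [x|].
  by rewrite size_flatten /shape -map_comp; elim: (m x) => //= k <-; rewrite size_nseq mulSn.
apply: cpt_size_seq; apply: cpt_flatten; apply: (cpt_map (F := fun x _ => nseq (n x) tt)).
  by cpt.
by apply: cpt_units; apply: (@cpt_comp P _ _ _ _ _ _ (fun u : X * unit => u.1) n) => //; cpt.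
Qed.

Lemma cpt_exp (n : X -> nat) k : cpt P n -> cpt P (fun x => n x ^ k).
Proof.
move=> N; elim: k => [|k IH]; first by apply: (@cpt_ext P _ _ _ _ _ (fun _ => 1)) => //; cpt.
by apply: (@cpt_ext P _ _ _ _ _ (fun x => n x * n x ^ k)) => [x|]; [rewrite expnS | apply: cpt_mul].
Qed.

Lemma cpt_nseq A {eA : enc A} (n : X -> nat) (y : X -> A) :
  cpt P n -> cpt P y -> cpt P (fun x => nseq (n x) (y x)).
Proof.
move=> N Y; apply: (@cpt_ext P _ _ _ _ _ (fun x => [seq y x | _ <- nseq (n x) tt])) => [x|].
  by rewrite map_nseq.
apply: (cpt_map (F := fun x _ => y x)); first by cpt.
by apply: (@cpt_comp P _ _ _ _ _ _ (fun u : X * unit => u.1) y) => //; cpt.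
Qed.

Lemma cpt_iota (n : X -> nat) : cpt P n -> cpt P (fun x => iota 0 (n x)).
Proof.
move=> N; have [q szn] := cpt_size N.
(* The next number is the length of the list built so far, so the list is its own counter. *)
have E i : iter i (fun s => size s :: s) [::] = rev (iota 0 i).
  elim: i => // i; rewrite iterS => ->; by rewrite size_rev size_iota -addn1 [in RHS]iotaD add0n rev_cat.
apply: (@cpt_ext P _ _ _ _ _ (fun x => rev (iter (n x) (fun s => size s :: s) [::]))) => [x|].
  by rewrite E revK.
apply: cpt_rev; apply: (cpt_iter (F := fun _ s => size s :: s) (s0 := fun _ => [::])
  (p := fun n => pb q n * (pb q n).*2.+2 + 1)) => //; first by cpt.
- by cpt.
- apply: (@poly_le _ (fun n => pb q n * (2 * pb q n + 2) + 1)) => [k|]; first by rewrite -mul2n addn2.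
  by polyn; exact: poly_id.
move=> x i le; rewrite E sz_rev.
have ln : n x <= pb q (sz x) by have := szn x; rewrite sz_nat; lia.
apply: leq_trans (@sz_all _ _ _ (pb q (sz x)).*2.+1 _) _.
  by apply/allP => j; rewrite mem_iota add0n sz_nat ltnS leq_double => /andP[_ lt]; lia.
by rewrite leq_add2r leq_mul2r size_iota; apply/orP; right; lia.
Qed.

Lemma cpt_sumn (l : X -> seq nat) : cpt P l -> cpt P (fun x => sumn (l x)).
Proof.
move=> L; apply: (@cpt_ext P _ _ _ _ _ (fun x => size (flatten [seq nseq k tt | k <- l x]))) => [x|].
  by rewrite size_flatten /shape -map_comp; congr sumn; rewrite -[LHS]map_id; apply: eq_map => k /=; rewrite size_nseq.
apply: cpt_size_seq; apply: cpt_flatten; apply: (cpt_map (F := fun _ k => nseq k tt)) => //; cpt.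
Qed.

End Lists2.

Ltac cpt_case := first [ apply: cpt_if | apply: cpt_lcase | apply: cpt_ocase | apply: cpt_ncase
  | apply: cpt_scase ].
Ltac cpt_lib ::= lazymatch goal with
  | |- cpt _ (fun x => @cons _ (@?f x) (@?g x)) => apply: cpt_cons
  | |- cpt _ (fun x => Some (@?f x)) => apply: cpt_some
  | |- cpt _ (fun x => S (@?f x)) => apply: cpt_S
  | |- cpt _ (fun x => inl (@?f x)) => apply: cpt_inl
  | |- cpt _ (fun x => inr (@?f x)) => apply: cpt_inr
  | |- cpt _ (fun x => nseq (@?f x) tt) => apply: cpt_units
  | |- cpt _ (fun x => rev (@?f x)) => apply: cpt_rev
  | |- cpt _ (fun x => cat (@?f x) (@?g x)) => apply: cpt_cat
  | |- cpt _ (fun x => map (@?f x) (@?g x)) => apply: cpt_map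
  | |- cpt _ (fun x => size (@?f x)) => apply: cpt_size_seq
  | |- cpt _ (fun x => flatten (@?f x)) => apply: cpt_flatten
  | |- cpt _ (fun x => filter (@?f x) (@?g x)) => apply: cpt_filter
  | |- cpt _ (fun x => all (@?f x) (@?g x)) => apply: cpt_all
  | |- cpt _ (fun x => has (@?f x) (@?g x)) => apply: cpt_has
  | |- cpt _ (fun x => in_mem (@?f x) (mem (@?g x))) => apply: cpt_mem
  | |- cpt _ (fun x => drop (@?f x) (@?g x)) => apply: cpt_drop
  | |- cpt _ (fun x => nth (@?d x) (@?f x) (@?g x)) => apply: cpt_nth
  | |- cpt _ (fun x => subn (@?f x) (@?g x)) => apply: cpt_sub
  | |- cpt _ (fun x => addn (@?f x) (@?g x)) => apply: cpt_add
  | |- cpt _ (fun x => muln (@?f x) (@?g x)) => apply: cpt_mul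
  | |- cpt _ (fun x => expn (@?f x) _) => apply: cpt_exp
  | |- cpt _ (fun x => leq (@?f x) (@?g x)) => apply: cpt_leq
  | |- cpt _ (fun x => iota 0 (@?f x)) => apply: cpt_iota
  | |- cpt _ (fun x => sumn (@?f x)) => apply: cpt_sumn
  | |- cpt _ (fun x => nseq (@?f x) (@?g x)) => apply: cpt_nseq
  | |- _ => cpt_case
  end.

(** * Turing machines deciding and computing *)

(** For positive n, n + 2 is at most 3 * n, whence the factor [3 ^ q]; the additive constant takes
    care of n = 0. *)
Lemma poly_poly_bound p : poly p -> exists c k, forall n, p n <= poly_bound c k n.
Proof.
move=> [q H]; exists (3 ^ q), q => n; apply: leq_trans (H n) _; rewrite /pb /poly_bound.
case: n => [|n].
  by apply: leq_trans (leq_addl _ _); case: q {H} => // q; rewrite leq_exp2r.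
apply: leq_trans (leq_addr _ _); rewrite -expnMn.
by case: q {H} => // q; rewrite leq_exp2r //; lia.
Qed.

Definition loadbody :=
  Seq (If 2 one (Seq (Push 1 (inl false)) (Seq (Push 1 (inl false)) (Push 1 (inl true))))
                (Push 1 (inl false)))
      (Seq (Push 1 (inl true)) (Pop 2)).
(** Replaces the raw input by its code as a list. The flush reverses the word, so the list is built
    from its end. *)
Definition load := Seq (flush 0 2) (Seq (Push 1 (inl false)) (While 2 some loadbody)).

Lemma exec_loadloop w s h : size s + 4 * size w < h ->
  exec (While 2 some loadbody) [:: [::]; s; bits w; [::]; [::]; [::]]
    (st (flatten [seq inl true :: tc (tbool b) | b <- rev w] ++ s) [::]) (11 * size w + 1) h.
Proof.
elim: w s => [|b w IH] s le; first exact: exec_while0.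
have X : exec loadbody [:: [::]; s; bits (b :: w); [::]; [::]; [::]]
   [:: [::]; inl true :: tc (tbool b) ++ s; bits w; [::]; [::]; [::]] (7 + (2 + 1)) h.
  apply: (exec_seq (m1 := [:: [::]; tc (tbool b) ++ s; bits (b :: w); [::]; [::]; [::]])).
    apply: exec_if => //; case: b le => /= le; last first.
      apply: (@exec_weaken _ _ _ 2 _ h h) => //.
      by apply: (@exec_push 1 _ [:: [::]; s; bits (false :: w); [::]; [::]; [::]]) => //=; lia.
    apply: (@exec_weaken _ _ _ (2 + (2 + 2)) _ h h) => //.
    apply: (exec_seq (m1 := [:: [::]; inl false :: s; bits (true :: w); [::]; [::]; [::]])).
      by apply: (@exec_push 1 _ [:: [::]; s; bits (true :: w); [::]; [::]; [::]]) => //=; lia.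
    apply: (exec_seq (m1 := [:: [::]; inl false :: inl false :: s; bits (true :: w); [::]; [::]; [::]])).
      by apply: (@exec_push 1 _ [:: [::]; inl false :: s; bits (true :: w); [::]; [::]; [::]]) => //=; lia.
    by apply: (@exec_push 1 _ [:: [::]; inl false :: inl false :: s; bits (true :: w); [::]; [::]; [::]]) => //=; lia.
  apply: (exec_seq (m1 := [:: [::]; inl true :: tc (tbool b) ++ s; bits (b :: w); [::]; [::]; [::]])).
    apply: (@exec_push 1 _ [:: [::]; tc (tbool b) ++ s; bits (b :: w); [::]; [::]; [::]]) => //=.
    by rewrite size_cat size_tc; have := tsize_bool b; move: le => /=; lia.
  exact: (@exec_pop 2 [:: [::]; inl true :: tc (tbool b) ++ s; bits (b :: w); [::]; [::]; [::]]).
have Y := IH (inl true :: tc (tbool b) ++ s).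
rewrite rev_cons map_rcons flatten_rcons -catA.
apply: exec_weaken (exec_while1 _ _ X (Y _)) _ (leqnn h) => //=; last by lia.
by rewrite size_cat size_tc; have := tsize_bool b; move: le => /=; lia.
Qed.

Lemma tc_bits (w : seq bool) :
  tc (code w) = flatten [seq inl true :: tc (tbool b) | b <- w] ++ [:: inl false].
Proof.
elim: w => // b w IH; rewrite /= -catA -IH; exact: tc_node.
Qed.

Lemma exec_load w h : 4 * size w + 2 < h ->
  exec load (map inl w :: nseq 5 [::]) (st (tc (code w)) [::]) (16 * size w + 4) h.
Proof.
move=> le; have X := @exec_flush 0 2 (map inl w :: nseq 5 [::]) w h isT isT isT erefl.
rewrite /= cats0 in X; have {}X := X ltac:(lia).
have Y : exec (Push 1 (inl false)) [:: [::]; [::]; bits (rev w); [::]; [::]; [::]]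
     [:: [::]; [:: inl false]; bits (rev w); [::]; [::]; [::]] 2 h.
  by apply: (@exec_push 1 _ [:: [::]; [::]; bits (rev w); [::]; [::]; [::]]) => //=; lia.
have Z := @exec_loadloop (rev w) [:: inl false] h.
rewrite revK size_rev -tc_bits in Z; have {}Z := Z ltac:(move=> /=; lia).
by apply: exec_weaken (exec_seq X (exec_seq Y Z)) _ (leqnn h); lia.
Qed.

Definition unloadbody :=
  Seq (Pop 1) (If 1 one (Seq (Pop 1) (Seq (Pop 1) (Seq (Pop 1) (Push 2 (inl true)))))
                        (Seq (Pop 1) (Push 2 (inl false)))).
(** The inverse of [load]; the word must end on tape 0, where the output is read. *)
Definition unload := Seq (While 1 one unloadbody) (Seq (Pop 1) (flush 2 0)).

Lemma exec_unloadloop w o h : size o + size w < h ->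
  exec (While 1 one unloadbody) [:: [::]; tc (code w); bits o; [::]; [::]; [::]]
    [:: [::]; [:: inl false]; bits (rev w ++ o); [::]; [::]; [::]] (8 * size w + 1) h.
Proof.
elim: w o => [|b w IH] o le; first exact: exec_while0.
have e : tc (code (b :: w)) = inl true :: tc (tbool b) ++ tc (code w) by exact: tc_node.
have X : exec unloadbody [:: [::]; tc (code (b :: w)); bits o; [::]; [::]; [::]]
   [:: [::]; tc (code w); bits (b :: o); [::]; [::]; [::]] (1 + 6) h.
  rewrite e; apply: (exec_seq (m1 := [:: [::]; tc (tbool b) ++ tc (code w); bits o; [::]; [::]; [::]])).
    exact: (@exec_pop 1 [:: [::]; inl true :: tc (tbool b) ++ tc (code w); bits o; [::]; [::]; [::]]).
  apply: (@exec_if _ _ _ _ _ _ 5) => //; case: b {e} le => le /=; last first.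
    apply: (@exec_weaken _ _ _ (1 + 2) _ h h) => //.
    apply: (exec_seq (m1 := [:: [::]; tc (code w); bits o; [::]; [::]; [::]])).
      exact: (@exec_pop 1 [:: [::]; inl false :: tc (code w); bits o; [::]; [::]; [::]]).
    by apply: (@exec_push 2 _ [:: [::]; tc (code w); bits o; [::]; [::]; [::]]) => //=; rewrite size_bits; move: le => /=; lia.
  apply: (exec_seq (m1 := [:: [::]; inl false :: inl false :: tc (code w); bits o; [::]; [::]; [::]]) (t1 := 1) (t2 := 4)).
    exact: (@exec_pop 1 [:: [::]; inl true :: inl false :: inl false :: tc (code w); bits o; [::]; [::]; [::]]).
  apply: (exec_seq (m1 := [:: [::]; inl false :: tc (code w); bits o; [::]; [::]; [::]]) (t1 := 1) (t2 := 3)).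
    exact: (@exec_pop 1 [:: [::]; inl false :: inl false :: tc (code w); bits o; [::]; [::]; [::]]).
  apply: (exec_seq (m1 := [:: [::]; tc (code w); bits o; [::]; [::]; [::]]) (t1 := 1) (t2 := 2)).
    exact: (@exec_pop 1 [:: [::]; inl false :: tc (code w); bits o; [::]; [::]; [::]]).
  by apply: (@exec_push 2 _ [:: [::]; tc (code w); bits o; [::]; [::]; [::]]) => //=; rewrite size_bits; move: le => /=; lia.
have top : one (ohead (tc (code (b :: w)))) by rewrite e.
have Y := IH (b :: o); rewrite rev_cons cat_rcons.
have {}Y := Y ltac:(by move: le => /=; lia).
have Z := exec_while1 (isT : 1 < 6) (top : one (ohead (nth [::] [:: [::]; tc (code (b :: w)); bits o; [::]; [::]; [::]] 1))) X Y.
by apply: exec_weaken Z _ (leqnn h); rewrite [size (b :: w)]/=; lia.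
Qed.

Lemma exec_unload w h : size w + 2 < h ->
  exec unload (st (tc (code w)) [::]) [:: bits w; [::]; [::]; [::]; [::]; [::]]
    (13 * size w + 3) h.
Proof.
move=> le; have X := @exec_unloadloop w [::] h; rewrite cats0 in X.
have {}X := X ltac:(move=> /=; lia).
have Y : exec (Pop 1) [:: [::]; [:: inl false]; bits (rev w); [::]; [::]; [::]]
    [:: [::]; [::]; bits (rev w); [::]; [::]; [::]] 1 h.
  exact: (@exec_pop 1 [:: [::]; [:: inl false]; bits (rev w); [::]; [::]; [::]]).
have Z := @exec_flush 2 0 [:: [::]; [::]; bits (rev w); [::]; [::]; [::]] (rev w) h isT isT isT erefl.
rewrite /= cats0 revK size_rev in Z; have {}Z := Z ltac:(lia).
by apply: exec_weaken (exec_seq X (exec_seq Y Z)) _ (leqnn h); lia.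
Qed.

Lemma sz_bits (w : seq bool) : size w < sz w <= 4 * size w + 1.
Proof.
rewrite size_sz /=; elim: w => // b w IH; rewrite sz_cons /=.
by know (sz_bool b); lia.
Qed.

Lemma cpt_PSPACE (A : language) (f : seq bool -> bool) :
  cpt false f -> (forall w, f w <-> A w) -> PSPACE A.
Proof.
move=> [c [q E]] fA; exists (machine (Seq load c)).
pose p n := 6 * (pb q (4 * n + 1) + 4 * n + 5).+1.
have [k [d Hp]] : exists c k, forall n, p n <= poly_bound c k n.
  by apply: poly_poly_bound; rewrite /p; polyn; exact: poly_id.
exists k, d => w; have [t [X _]] := E w; pose (h := pb q (sz w) + 4 * size w + 5).
have L : exec load (map inl w :: nseq 5 [::]) (st (tc (code w)) [::]) (16 * size w + 4) h.
  by apply: exec_load; rewrite /h; lia.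
have C : exec c (st (tc (code w)) [::]) (st (tc (tbool (f w))) [::]) t h.
  by have := X [::] [::]; rewrite !cats0 => Y; apply: exec_weaken Y _ _ => //; rewrite /h /=; lia.
have [|n [_ Hh Ha _ Hs]] := @exec_run _ w _ _ h (exec_seq L C); first by rewrite /h; lia.
split=> [i|].
  apply: leq_trans (Hs i) _; apply: leq_trans (Hp _); rewrite /p /h.
  have /andP[_ s1] := sz_bits w; have := leq_pb q s1; lia.
exists n; split=> //; rewrite Ha -fA /=.
by case: (f w).
Qed.

Lemma cpt_polytime (f : seq bool -> seq bool) : cpt true f -> polytime_computable f.
Proof.
move=> F; have [qs szf] := cpt_size F; case: F => c [q E].
exists (machine (Seq load (Seq c unload))).
pose p n := 16 * n + 20 + (pb q (4 * n + 1) + 13 * pb qs (4 * n + 1)).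
have [k [d Hp]] : exists c k, forall n, p n <= poly_bound c k n.
  by apply: poly_poly_bound; rewrite /p; polyn; exact: poly_id.
exists k, d => w; have [t [X le_t]] := E w.
pose (h := pb q (sz w) + 4 * size w + 5 + size (f w)).
have L : exec load (map inl w :: nseq 5 [::]) (st (tc (code w)) [::]) (16 * size w + 4) h.
  by apply: exec_load; rewrite /h; lia.
have C : exec c (st (tc (code w)) [::]) (st (tc (code (f w))) [::]) t h.
  by have := X [::] [::]; rewrite !cats0 => Y; apply: exec_weaken Y _ _ => //; rewrite /h /=; lia.
have U : exec unload (st (tc (code (f w))) [::]) [:: bits (f w); [::]; [::]; [::]; [::]; [::]]
    (13 * size (f w) + 3) h by apply: exec_unload; rewrite /h; lia.
have [|n [le_n Hh _ Ho _]] := @exec_run _ w _ _ h (exec_seq L (exec_seq C U)); first by rewrite /h; lia.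
exists n; split=> //.
  apply: leq_trans le_n _; apply: leq_trans (Hp _); rewrite /p.
  have /andP[_ s1] := sz_bits w; have /andP[s2 _] := sz_bits (f w).
  have := le_t isT; have := leq_pb q s1; have := leq_pb qs s1; have := szf w; lia.
by rewrite Ho /=; elim: (f w) => //= b s ->.
Qed.

(** * Formulas as trees *)

(** Constructors get unary tags built like nested injections. The code of a formula is then also the
    code of its view in a nested sum, and case analysis on formulas is inherited from sums. *)
Definition tl0 (t : tree) := Node (tbool false) t.
Definition tl1 (t : tree) := Node (tbool true) t.

#[global] Instance enc_atom : enc atom := enc_prod enc_nat enc_nat.
#[global] Instance enc_var : enc var := enc_prod enc_atom enc_bool.
#[global] Instance enc_bref : enc bref := enc_sum enc_bool enc_nat.

Fixpoint tbform (b : bform) : tree :=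
  match b with
  | BTop => tl0 Leaf
  | BBot => tl1 (tl0 Leaf)
  | BVar v => tl1 (tl1 (tl0 (code v)))
  | BNot c => tl1 (tl1 (tl1 (tl0 (tbform c))))
  | BAnd c d => tl1 (tl1 (tl1 (tl1 (Node (tbform c) (tbform d)))))
  end.

Lemma tbform_inj : injective tbform.
Proof.
elim=> [||v|b IH|b IH c IH'] [||v'|b'|b' c'] //=.
- by case=> e1 e2 e3; congr BVar; apply: (@code_inj _ enc_var); rewrite /= e1 e2 e3.
- by case=> /IH->.
- by case=> /IH-> /IH'->.
Qed.
#[global] Instance enc_bform : enc bform := Enc tbform_inj.

Definition bview (b : bform) : unit + (unit + (var + (bform + bform * bform))) :=
  match b with
  | BTop => inl tt
  | BBot => inr (inl tt)
  | BVar v => inr (inr (inl v))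
  | BNot c => inr (inr (inr (inl c)))
  | BAnd c d => inr (inr (inr (inr (c, d))))
  end.

Lemma code_bview b : code (bview b) = code b.
Proof. by case: b. Qed.

Lemma tbdd_inj : injective (fun B : bdd => Node (code (bdd_nodes B)) (code (bdd_root B))).
Proof.
move=> [n r] [n' r'] /= [e1 e2]; have e3 := tseq_inj e1.
by have := @tsum_inj _ _ enc_bool enc_nat r r' e2; rewrite e3 => ->.
Qed.
#[global] Instance enc_bdd : enc bdd := Enc tbdd_inj.

Fixpoint tform (f : form) : tree :=
  match f with
  | Top => tl0 Leaf
  | Bot => tl1 (tl0 Leaf)
  | Atom a => tl1 (tl1 (tl0 (code a)))
  | Not g => tl1 (tl1 (tl1 (tl0 (tform g))))
  | And g h => tl1 (tl1 (tl1 (tl1 (tl0 (Node (tform g) (tform h))))))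
  | Know i g => tl1 (tl1 (tl1 (tl1 (tl1 (tl0 (Node (code i) (tform g)))))))
  | Announce g h => tl1 (tl1 (tl1 (tl1 (tl1 (tl1 (tl0 (Node (tform g) (tform h))))))))
  | Event X x g => tl1 (tl1 (tl1 (tl1 (tl1 (tl1 (tl1 (Node (ttransformer X) (Node (code x) (tform g)))))))))
  end
with ttransformer (X : transformer) : tree :=
  let: Transformer Vp g pm om := X in
  Node (code Vp) (Node (tform g) (Node (code pm) (code om))).

Lemma tform_inj : injective tform.
Proof.
rewrite /injective; fix IH 1.
case=> [||a|g|g h|i g|g h|[Vp g pm om] x h]
       [||a'|g'|g' h'|i' g'|g' h'|[Vp' g' pm' om'] x' h'] //= e.
- by case: e => e1 e2; congr Atom; apply: (@code_inj _ enc_atom); rewrite /= e1 e2.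
- by case: e => /IH->.
- by case: e => /IH-> /IH->.
- by case: e => e1 /IH->; congr Know; apply: (@code_inj _ enc_nat); rewrite /= e1.
- by case: e => /IH-> /IH->.
case: e => e1 /IH-> e2 e3 e4 /IH->.
by rewrite (tseq_inj e1) (tseq_inj e2) (tseq_inj e3) (tseq_inj e4).
Qed.
#[global] Instance enc_form : enc form := Enc tform_inj.

Definition tview (X : transformer) := (t_plus X, (t_pre X, (t_minus X, t_obs X))).

Lemma ttransformer_inj : injective ttransformer.
Proof.
move=> [Vp g pm om] [Vp' g' pm' om'] /= [e1 /tform_inj-> e2 e3].
by rewrite (tseq_inj e1) (tseq_inj e2) (tseq_inj e3).
Qed.
#[global] Instance enc_transformer : enc transformer := Enc ttransformer_inj.

Lemma code_tview X : code (tview X) = code X.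
Proof. by case: X. Qed.

Definition fview (f : form) : unit + (unit + (atom + (form + (form * form + (nat * form +
    (form * form + transformer * (seq atom * form))))))) :=
  match f with
  | Top => inl tt
  | Bot => inr (inl tt)
  | Atom a => inr (inr (inl a))
  | Not g => inr (inr (inr (inl g)))
  | And g h => inr (inr (inr (inr (inl (g, h)))))
  | Know i g => inr (inr (inr (inr (inr (inl (i, g))))))
  | Announce g h => inr (inr (inr (inr (inr (inr (inl (g, h)))))))
  | Event X x g => inr (inr (inr (inr (inr (inr (inr (X, (x, g))))))))
  end.

Lemma code_fview f : code (fview f) = code f.
Proof. by case: f. Qed.

Lemma sz_Top : sz Top = 3.
Proof. by rewrite /sz /= /tl0 /tl1 ?tsize_node /tsize /=; lia. Qed.
Lemma sz_Bot : sz Bot = 7.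
Proof. by rewrite /sz /= /tl0 /tl1 ?tsize_node /tsize /=; lia. Qed.
Lemma sz_Atom a : sz (Atom a) = sz a + 10.
Proof. by rewrite /sz /= /tl0 /tl1 ?tsize_node /tsize /=; lia. Qed.
Lemma sz_Not g : sz (Not g) = sz g + 14.
Proof. by rewrite /sz /= /tl0 /tl1 ?tsize_node /tsize /=; lia. Qed.
Lemma sz_And g h : sz (And g h) = sz g + sz h + 19.
Proof. by rewrite /sz /= /tl0 /tl1 ?tsize_node /tsize /=; lia. Qed.
Lemma sz_Know i g : sz (Know i g) = sz i + sz g + 23.
Proof. by rewrite /sz /= /tl0 /tl1 ?tsize_node /tsize /=; lia. Qed.
Lemma sz_Announce g h : sz (Announce g h) = sz g + sz h + 27.
Proof. by rewrite /sz /= /tl0 /tl1 ?tsize_node /tsize /=; lia. Qed.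
Lemma sz_Event T x g : sz (Event T x g) = sz T + sz x + sz g + 30.
Proof. by rewrite /sz /= /tl0 /tl1 ?tsize_node /tsize /=; lia. Qed.
Lemma sz_Transformer Vp g pm om : sz (Transformer Vp g pm om) = sz Vp + sz g + sz pm + sz om + 3.
Proof. by rewrite /sz /= /tl0 /tl1 ?tsize_node /tsize /=; lia. Qed.
Lemma sz_BTop : sz BTop = 3.
Proof. by rewrite /sz /= /tl0 /tl1 ?tsize_node /tsize /=; lia. Qed.
Lemma sz_BBot : sz BBot = 7.
Proof. by rewrite /sz /= /tl0 /tl1 ?tsize_node /tsize /=; lia. Qed.
Lemma sz_BVar v : sz (BVar v) = sz v + 10.
Proof. by rewrite /sz /= /tl0 /tl1 ?tsize_node /tsize /=; lia. Qed.
Lemma sz_BNot b : sz (BNot b) = sz b + 14.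
Proof. by rewrite /sz /= /tl0 /tl1 ?tsize_node /tsize /=; lia. Qed.
Lemma sz_BAnd b c : sz (BAnd b c) = sz b + sz c + 17.
Proof. by rewrite /sz /= /tl0 /tl1 ?tsize_node /tsize /=; lia. Qed.
Definition szE := (sz_Top, sz_Bot, sz_Atom, sz_Not, sz_And, sz_Know, sz_Announce, sz_Event, sz_Transformer).
Definition szBE := (sz_BTop, sz_BBot, sz_BVar, sz_BNot, sz_BAnd).

Section Views.

Context (P : bool) (X : Type) {eX : enc X}.

Lemma cpt_bview (b : X -> bform) : cpt P b -> cpt P (fun x => bview (b x)).
Proof. by apply: cpt_code => x; apply: code_bview. Qed.

Lemma cpt_fview (f : X -> form) : cpt P f -> cpt P (fun x => fview (f x)).
Proof. by apply: cpt_code => x; apply: code_fview. Qed.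

Lemma cpt_tview (T : X -> transformer) : cpt P T -> cpt P (fun x => tview (T x)).
Proof. by apply: cpt_code => x; apply: code_tview. Qed.

Lemma cpt_unbview (b : X -> bform) : cpt P (fun x => bview (b x)) -> cpt P b.
Proof. by apply: cpt_code => x; rewrite code_bview. Qed.

Lemma cpt_unfview (f : X -> form) : cpt P (fun x => fview (f x)) -> cpt P f.
Proof. by apply: cpt_code => x; rewrite code_fview. Qed.

Lemma cpt_bdd_nodes (B : X -> bdd) : cpt P B -> cpt P (fun x => bdd_nodes (B x)).
Proof.
move=> C; apply: (@cpt_ext P _ _ _ _ _ (fun x => ((bdd_nodes (B x), bdd_root (B x)).1))) => //.
by apply: (@cpt_fst P _ _ _ _ _ _ (fun x => (bdd_nodes (B x), bdd_root (B x)))); apply: cpt_code C.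
Qed.

Lemma cpt_bdd_root (B : X -> bdd) : cpt P B -> cpt P (fun x => bdd_root (B x)).
Proof.
move=> C; apply: (@cpt_ext P _ _ _ _ _ (fun x => ((bdd_nodes (B x), bdd_root (B x)).2))) => //.
by apply: (@cpt_snd P _ _ _ _ _ _ (fun x => (bdd_nodes (B x), bdd_root (B x)))); apply: cpt_code C.
Qed.

Lemma cpt_Bdd (n : X -> seq (var * (bref * bref))) (r : X -> bref) :
  cpt P n -> cpt P r -> cpt P (fun x => Bdd (n x) (r x)).
Proof.
by move=> N R; apply: (@cpt_code P _ _ _ _ _ _ _ (fun x => (n x, r x))) => //; cpt.
Qed.

Lemma cpt_t_plus (T : X -> transformer) : cpt P T -> cpt P (fun x => t_plus (T x)).
Proof. by move=> C; apply: (@cpt_fst P _ _ _ _ _ _ (fun x => tview (T x))); apply: cpt_tview. Qed.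

Lemma cpt_t_pre (T : X -> transformer) : cpt P T -> cpt P (fun x => t_pre (T x)).
Proof. by move/cpt_tview/cpt_snd/cpt_fst. Qed.

Lemma cpt_t_minus (T : X -> transformer) : cpt P T -> cpt P (fun x => t_minus (T x)).
Proof. by move/cpt_tview/cpt_snd/cpt_snd/cpt_fst. Qed.

Lemma cpt_t_obs (T : X -> transformer) : cpt P T -> cpt P (fun x => t_obs (T x)).
Proof. by move/cpt_tview/cpt_snd/cpt_snd/cpt_snd. Qed.

Lemma cpt_Transformer (Vp : X -> seq atom) (g : X -> form) (pm : X -> seq (atom * bform))
    (om : X -> seq bform) : cpt P Vp -> cpt P g -> cpt P pm -> cpt P om ->
  cpt P (fun x => Transformer (Vp x) (g x) (pm x) (om x)).
Proof.
move=> C1 C2 C3 C4; apply: (@cpt_code P _ _ _ _ _ _ _ (fun x => (Vp x, (g x, (pm x, om x))))) => //.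
by cpt.
Qed.

Lemma cpt_bcase B {eB : enc B} (b : X -> bform) (F0 F1 : X -> B) (F2 : X -> var -> B)
    (F3 : X -> bform -> B) (F4 : X -> bform -> bform -> B) :
  cpt P b -> cpt P F0 -> cpt P F1 -> cpt P (fun u : X * var => F2 u.1 u.2) ->
  cpt P (fun u : X * bform => F3 u.1 u.2) ->
  cpt P (fun u : X * (bform * bform) => F4 u.1 u.2.1 u.2.2) ->
  cpt P (fun x => match b x with BTop => F0 x | BBot => F1 x | BVar v => F2 x v
                    | BNot c => F3 x c | BAnd c d => F4 x c d end).
Proof.
move=> Cb C0 C1 C2 C3 C4.
apply: (@cpt_ext P _ _ _ _ _ (fun x => match bview (b x) with
   | inl _ => F0 x | inr u => match u with inl _ => F1 x | inr u =>
   match u with inl v => F2 x v | inr u => match u with inl c => F3 x c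
   | inr u => F4 x u.1 u.2 end end end end)) => [x|]; first by case: (b x).
apply: cpt_scase; [exact: cpt_bview | by apply: cpt_comp C0 _; cpt |].
apply: cpt_scase; [by cpt | by apply: (cpt_comp C1); cpt |].
apply: cpt_scase; [by cpt | by apply: (cpt_app2 C2); cpt |].
apply: cpt_scase; [by cpt | by apply: (cpt_app2 C3); cpt |].
by apply: (@cpt_app2 P _ _ _ _ _ _ _ _ (fun x u => F4 x u.1 u.2) _ _ C4); cpt.
Qed.

Lemma cpt_fcase B {eB : enc B} (f : X -> form) (F0 F1 : X -> B) (F2 : X -> atom -> B)
    (F3 : X -> form -> B) (F4 : X -> form -> form -> B) (F5 : X -> nat -> form -> B)
    (F6 : X -> form -> form -> B) (F7 : X -> transformer -> seq atom -> form -> B) :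
  cpt P f -> cpt P F0 -> cpt P F1 -> cpt P (fun u : X * atom => F2 u.1 u.2) ->
  cpt P (fun u : X * form => F3 u.1 u.2) ->
  cpt P (fun u : X * (form * form) => F4 u.1 u.2.1 u.2.2) ->
  cpt P (fun u : X * (nat * form) => F5 u.1 u.2.1 u.2.2) ->
  cpt P (fun u : X * (form * form) => F6 u.1 u.2.1 u.2.2) ->
  cpt P (fun u : X * (transformer * (seq atom * form)) => F7 u.1 u.2.1 u.2.2.1 u.2.2.2) ->
  cpt P (fun x => match f x with Top => F0 x | Bot => F1 x | Atom a => F2 x a
     | Not g => F3 x g | And g h => F4 x g h | Know i g => F5 x i g
     | Announce g h => F6 x g h | Event T y g => F7 x T y g end).
Proof.
move=> Cf C0 C1 C2 C3 C4 C5 C6 C7.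
apply: (@cpt_ext P _ _ _ _ _ (fun x => match fview (f x) with
   | inl _ => F0 x | inr u => match u with inl _ => F1 x | inr u =>
   match u with inl v => F2 x v | inr u => match u with inl c => F3 x c
   | inr u => match u with inl u => F4 x u.1 u.2 | inr u => match u with inl u => F5 x u.1 u.2
   | inr u => match u with inl u => F6 x u.1 u.2 | inr u => F7 x u.1 u.2.1 u.2.2
   end end end end end end end)) => [x|]; first by case: (f x).
apply: cpt_scase; [exact: cpt_fview | by apply: cpt_comp C0 _; cpt |].
apply: cpt_scase; [by cpt | by apply: (cpt_comp C1); cpt |].
apply: cpt_scase; [by cpt | by apply: (cpt_app2 C2); cpt |].
apply: cpt_scase; [by cpt | by apply: (cpt_app2 C3); cpt |].
apply: cpt_scase; [by cpt | by apply: (@cpt_app2 P _ _ _ _ _ _ _ _ (fun x u => F4 x u.1 u.2) _ _ C4); cpt |].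
apply: cpt_scase; [by cpt | by apply: (@cpt_app2 P _ _ _ _ _ _ _ _ (fun x u => F5 x u.1 u.2) _ _ C5); cpt |].
apply: cpt_scase; [by cpt | by apply: (@cpt_app2 P _ _ _ _ _ _ _ _ (fun x u => F6 x u.1 u.2) _ _ C6); cpt |].
by apply: (@cpt_app2 P _ _ _ _ _ _ _ _ (fun x u => F7 x u.1 u.2.1 u.2.2) _ _ C7); cpt.
Qed.

End Views.

Ltac cpt_case ::= first [ apply: cpt_if | apply: cpt_lcase | apply: cpt_ocase | apply: cpt_ncase
  | apply: cpt_scase | apply: cpt_bcase | apply: cpt_fcase ].
Ltac cpt_con := first [ apply: cpt_unbview | apply: cpt_unfview ]; cbn [bview fview].
Ltac cpt_form := lazymatch goal with
  | |- cpt _ (fun x => t_plus (@?f x)) => apply: cpt_t_plus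
  | |- cpt _ (fun x => t_pre (@?f x)) => apply: cpt_t_pre
  | |- cpt _ (fun x => t_minus (@?f x)) => apply: cpt_t_minus
  | |- cpt _ (fun x => t_obs (@?f x)) => apply: cpt_t_obs
  | |- cpt _ (fun x => bdd_nodes (@?f x)) => apply: cpt_bdd_nodes
  | |- cpt _ (fun x => bdd_root (@?f x)) => apply: cpt_bdd_root
  | |- cpt _ (fun x => Bdd (@?f x) (@?g x)) => apply: cpt_Bdd
  | |- cpt _ (fun x => BVar (@?f x)) => cpt_con
  | |- cpt _ (fun x => BNot (@?f x)) => cpt_con
  | |- cpt _ (fun x => BAnd (@?f x) (@?g x)) => cpt_con
  | |- cpt _ (fun x => Atom (@?f x)) => cpt_con
  | |- cpt _ (fun x => Not (@?f x)) => cpt_con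
  | |- cpt _ (fun x => And (@?f x) (@?g x)) => cpt_con
  | |- cpt _ (fun x => Know (@?f x) (@?g x)) => cpt_con
  | |- cpt _ (fun x => Announce (@?f x) (@?g x)) => cpt_con
  | |- cpt _ (fun x => Event (@?f x) (@?g x) (@?h x)) => cpt_con
  | |- cpt _ (fun x => Transformer (@?f x) (@?g x) (@?h x) (@?k x)) => apply: cpt_Transformer
  end.
Ltac cpt_user ::= cpt_form.

Definition sizec := Seq (mv 2) (Seq (Push 1 (inl false))
  (While 2 some (Seq (Pop 2) (Seq (Push 1 (inl false)) (Push 1 (inl true)))))).

Lemma exec_sizeloop (l : seq bool) n s r h : size s + 2 * (size l + n) + 1 < h ->
  exec (While 2 some (Seq (Pop 2) (Seq (Push 1 (inl false)) (Push 1 (inl true)))))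
    [:: [::]; tc (code n) ++ s; bits l; [::]; [::]; r]
    (st (tc (code (size l + n)) ++ s) r) (6 * size l + 1) h.
Proof.
elim: l n => [|b l IH] n le; first exact: exec_while0.
have e : tc (code n.+1) = inl true :: inl false :: tc (code n) by exact: tc_node.
have sn : size (tc (code n)) = n.*2.+1 by rewrite size_tc; apply: sz_nat.
have X : exec (Seq (Pop 2) (Seq (Push 1 (inl false)) (Push 1 (inl true))))
   [:: [::]; tc (code n) ++ s; bits (b :: l); [::]; [::]; r]
   [:: [::]; tc (code n.+1) ++ s; bits l; [::]; [::]; r] (1 + (2 + 2)) h.
  apply: (exec_seq (m1 := [:: [::]; tc (code n) ++ s; bits l; [::]; [::]; r])).
    exact: (@exec_pop 2 [:: [::]; tc (code n) ++ s; bits (b :: l); [::]; [::]; r]).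
  apply: (exec_seq (m1 := [:: [::]; inl false :: tc (code n) ++ s; bits l; [::]; [::]; r])).
    apply: (@exec_push 1 _ [:: [::]; tc (code n) ++ s; bits l; [::]; [::]; r]) => //.
    by rewrite [nth _ _ _]/= size_cat sn; move: le; rewrite [size (b :: l)]/=; lia.
  rewrite e; apply: (@exec_push 1 _ [:: [::]; inl false :: tc (code n) ++ s; bits l; [::]; [::]; r]) => //.
  by rewrite [nth _ _ _]/= [size _]/= size_cat sn; move: le; rewrite [size (b :: l)]/=; lia.
have Y := IH n.+1 ltac:(by move: le; rewrite [size (b :: l)]/=; lia).
have -> : size (b :: l) + n = size l + n.+1 by rewrite /= addnS.
have Z := exec_while1 (isT : 2 < 6) (isT : some (ohead (nth [::]
   [:: [::]; tc (code n) ++ s; bits (b :: l); [::]; [::]; r] 2))) X Y.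
by apply: exec_weaken Z _ (leqnn h); rewrite [size (b :: l)]/=; lia.
Qed.

(** The size, available as a number, serves as fuel for recursion on formulas. *)
Lemma cpt_sz P X A {eX : enc X} {eA : enc A} (f : X -> A) :
  cpt P f -> cpt P (fun x => sz (f x)).
Proof.
apply: (@cpt_comp P _ _ _ _ _ _ f (fun a : A => sz a)).
apply: (@cptI P _ _ _ _ _ sizec (fun n => 30 * n)); first by polyn; exact: poly_id.
move=> a; have g0 : 0 < sz a by exact: sz_gt0.
exists (9 * sz a + 3 + (2 + (6 * sz a + 1))); split; last by lia.
move=> s r; set h := _ + size s + size r.
have X1 : exec (mv 2) (st (tc (code a) ++ s) r)
    [:: [::]; s; bits (rev (tbits (code a))); [::]; [::]; r] (9 * sz a + 3) h.
  rewrite -[bits (rev _)]cats0.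
  apply: (@exec_mv 2 (code a) s (st (tc (code a) ++ s) r) h isT isT isT erefl erefl).
  by rewrite /h /sz /=; move: g0; rewrite /sz; lia.
have X2 : exec (Push 1 (inl false)) [:: [::]; s; bits (rev (tbits (code a))); [::]; [::]; r]
    [:: [::]; tc (code 0) ++ s; bits (rev (tbits (code a))); [::]; [::]; r] 2 h.
  apply: (@exec_push 1 _ [:: [::]; s; bits (rev (tbits (code a))); [::]; [::]; r]) => //.
  by rewrite /h /=; lia.
pose proof (@exec_sizeloop (rev (tbits (code a))) 0 s r h) as X3.
rewrite size_rev addn0 in X3.
have {}X3 := X3 ltac:(by rewrite /h /sz /tsize; move: g0; rewrite /sz /tsize; lia).
exact: exec_seq X1 (exec_seq X2 X3).
Qed.

(** * Structural recursion on Boolean and epistemic formulas *)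

Section Rec.

Context (Y B : Type) {eY : enc Y} {eB : enc B}.

Definition bleaf (b : bform) := match b with BTop => true | BBot => true | BVar _ => true
  | BNot _ => false | BAnd _ _ => false end.
Definition bl (b : bform) := match b with BTop => BTop | BBot => BTop | BVar _ => BTop
  | BNot c => c | BAnd c _ => c end.
Definition br (b : bform) := match b with BTop => BTop | BBot => BTop | BVar _ => BTop
  | BNot c => c | BAnd _ d => d end.

Lemma cpt_bleaf : cpt false bleaf.
Proof. by rewrite /bleaf; apply: (@cpt_bcase false); cpt. Qed.
Lemma cpt_bl : cpt false bl.
Proof. by rewrite /bl; apply: (@cpt_bcase false); cpt. Qed.
Lemma cpt_br : cpt false br.
Proof. by rewrite /br; apply: (@cpt_bcase false); cpt. Qed.

(** A negation has its argument as both children, so that each inner formula makes exactly two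
    calls, as [rec2] does. Both children are smaller in [sz], hence the fuel [sz b] suffices. *)
Lemma cpt_brec X {eX : enc X} (F : Y -> bform -> B) (g : Y -> bform -> B)
    (h : Y -> bform -> B -> B -> B) (y : X -> Y) (b : X -> bform) (p : nat -> nat) :
  (forall y b, F y b = if bleaf b then g y b else h y b (F y (bl b)) (F y (br b))) ->
  cpt false (fun u : Y * bform => g u.1 u.2) ->
  cpt false (fun u : ((Y * bform) * B) * B => h u.1.1.1 u.1.1.2 u.1.2 u.2) ->
  poly p -> (forall y b, sz (F y b) <= p (sz y + sz b)) ->
  cpt false y -> cpt false b -> cpt false (fun x => F (y x) (b x)).
Proof.
move=> FE Cg Ch [q Hq] szF Cy Cb.
apply: (@cpt_app2 false _ _ _ _ _ _ _ _ F y b) => //.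
pose rb (v : Y * bform) (r : B) := (v.1, br v.2).
pose R := rec2 (fun v => bleaf v.2) (fun v => g v.1 v.2) (fun v : Y * bform => (v.1, bl v.2))
   rb (fun v r1 r2 => h v.1 v.2 r1 r2).
have szl c : ~~ bleaf c -> sz (bl c) < sz c /\ sz (br c) < sz c.
  by case: c => //= [c|c d] _; rewrite /sz /= !tsize_node /=; lia.
have RE n v : sz v.2 <= n -> R n v = F v.1 v.2.
  elim: n v => [|n IH] [u c] le; first by move: le; know (sz_gt0 c); rewrite /=; lia.
  rewrite /= FE; case lc: (bleaf c) => //=.
  have [l1 l2] := szl c (negbT lc); rewrite /= in le.
  by rewrite /rb /= -/R !IH //=; lia.
apply: (@cpt_ext false _ _ _ _ _ (fun u => if true then R (sz u.2) (u.1, u.2) else g u.1 u.2)) => [u|].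
  by rewrite RE.
apply: (@cpt_rec2 _ _ _ _ (fun v => bleaf v.2) (fun v => g v.1 v.2)
  (fun v : Y * bform => (v.1, bl v.2)) rb (fun v r1 r2 => h v.1 v.2 r1 r2) _ _
  (fun _ => true) (fun u => g u.1 u.2) (fun u => sz u.2) (fun u => (u.1, u.2))
  (fun n => n + pb q n)
  (fun u m v => [/\ v.1 = u.1, sz v.2 <= sz u.2, m <= sz u.2 & sz v.2 <= m])).
- by apply: cpt_comp cpt_bleaf _; cpt.
- by [].
- by cpt; apply: cpt_comp cpt_bl _; cpt.
- by rewrite /rb /=; cpt; apply: cpt_comp cpt_br _; cpt.
- by [].
- by cpt.
- by [].
- by apply: cpt_sz; cpt.
- by cpt.
- by polyn; exact: poly_id.
- by move=> u _; split=> /=.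
- move=> u m [w c] _ [/= e1 l1 l2 l3] nl; have [s1 s2] := szl c nl.
  by split; split=> //=; lia.
- move=> u m [w c] _ [/= e1 l1 l2 l3]; rewrite -/R RE //= e1 sz_pair.
  have s1 : sz u = (sz u.1 + sz u.2).+1 by case: (u) => u1 u2; apply: sz_pair.
  split; [by lia | by lia |].
  apply: leq_trans (szF _ _) _; apply: leq_trans (Hq _) _; apply: leq_trans (leq_addl _ _).
  by apply: leq_pb; lia.
Qed.

Definition fleaf (f : form) := match f with Top => true | Bot => true | Atom _ => true
  | Not _ => false | And _ _ => false | Know _ _ => false | Announce _ _ => false
  | Event _ _ _ => false end.
Definition fl (f : form) := match f with Top => Top | Bot => Top | Atom _ => Top
  | Not g => g | And g _ => g | Know _ g => g | Announce g _ => g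
  | Event X _ _ => t_pre X end.
Definition fr (f : form) := match f with Top => Top | Bot => Top | Atom _ => Top
  | Not g => g | And _ h => h | Know _ g => g | Announce _ h => h
  | Event _ _ h => h end.

Lemma cpt_fleaf : cpt false fleaf.
Proof. by rewrite /fleaf; apply: (@cpt_fcase false); cpt. Qed.
Lemma cpt_fl : cpt false fl.
Proof. by rewrite /fl; apply: (@cpt_fcase false); cpt. Qed.
Lemma cpt_fr : cpt false fr.
Proof. by rewrite /fr; apply: (@cpt_fcase false); cpt. Qed.

Lemma sz_fl c : ~~ fleaf c -> sz (fl c) < sz c /\ sz (fr c) < sz c.
Proof.
by case: c => //= [g|g h|i g|g h|[Vp g pm om] x h] _; rewrite /sz /= !tsize_node /=; lia.
Qed.

(** The parameter may change on the way down, as the vocabulary does in [wf], but it may grow only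
    by what the formula loses. This keeps all arguments within the size of the first one. *)
Lemma cpt_frec X {eX : enc X} (F : Y -> form -> B) (g : Y -> form -> B) (al be : Y -> form -> Y)
    (h : Y -> form -> B -> B -> B) (y : X -> Y) (f : X -> form) (p : nat -> nat) :
  (forall y f, F y f = if fleaf f then g y f else
                       h y f (F (al y f) (fl f)) (F (be y f) (fr f))) ->
  cpt false (fun u : Y * form => g u.1 u.2) ->
  cpt false (fun u : Y * form => al u.1 u.2) ->
  cpt false (fun u : Y * form => be u.1 u.2) ->
  cpt false (fun u : ((Y * form) * B) * B => h u.1.1.1 u.1.1.2 u.1.2 u.2) ->
  poly p -> (forall y f, sz (F y f) <= p (sz y + sz f)) ->
  (forall y f, ~~ fleaf f -> sz (al y f) + sz (fl f) <= sz y + sz f) ->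
  (forall y f, ~~ fleaf f -> sz (be y f) + sz (fr f) <= sz y + sz f) ->
  cpt false y -> cpt false f -> cpt false (fun x => F (y x) (f x)).
Proof.
move=> FE Cg Ca Cb Ch [q Hq] szF sza szb Cy Cf.
apply: (@cpt_app2 false _ _ _ _ _ _ _ _ F y f) => //.
pose ra (v : Y * form) := (al v.1 v.2, fl v.2).
pose rb (v : Y * form) (r : B) := (be v.1 v.2, fr v.2).
pose R := rec2 (fun v => fleaf v.2) (fun v => g v.1 v.2) ra rb (fun v r1 r2 => h v.1 v.2 r1 r2).
have RE n v : sz v.2 <= n -> R n v = F v.1 v.2.
  elim: n v => [|n IH] [u c] le; first by move: le; know (sz_gt0 c); rewrite /=; lia.
  rewrite /= FE; case lc: (fleaf c) => //=.
  have [l1 l2] := sz_fl (negbT lc); rewrite /= in le.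
  by rewrite /rb /ra /= -/R !IH //=; lia.
apply: (@cpt_ext false _ _ _ _ _ (fun u => if true then R (sz u.2) (u.1, u.2) else g u.1 u.2)) => [u|].
  by rewrite RE.
apply: (@cpt_rec2 _ _ _ _ (fun v => fleaf v.2) (fun v => g v.1 v.2)
  ra rb (fun v r1 r2 => h v.1 v.2 r1 r2) _ _
  (fun _ => true) (fun u => g u.1 u.2) (fun u => sz u.2) (fun u => (u.1, u.2))
  (fun n => n + pb q n)
  (fun u m v => [/\ sz v.1 + sz v.2 <= sz u.1 + sz u.2, m <= sz u.2 & sz v.2 <= m])).
- by apply: cpt_comp cpt_fleaf _; cpt.
- by [].
- by rewrite /ra; cpt; apply: cpt_comp cpt_fl _; cpt.
- rewrite /rb /=; apply: cpt_pair; first by apply: (@cpt_comp false _ _ _ _ _ _ fst _ Cb); cpt.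
  by apply: cpt_comp cpt_fr _; cpt.
- by [].
- by cpt.
- by [].
- by apply: cpt_sz; cpt.
- by cpt.
- by polyn; exact: poly_id.
- by move=> u _; split=> /=.
- move=> u m [w c] _ [/= e1 l1 l2] nl; have [s1 s2] := sz_fl nl.
  have a1 := sza w c nl; have a2 := szb w c nl.
  by split; split=> //=; lia.
- move=> u m [w c] _ [/= e1 l1 l2]; rewrite -/R RE //= sz_pair.
  have s1 : sz u = (sz u.1 + sz u.2).+1 by case: (u) => u1 u2; apply: sz_pair.
  split; [by lia | by lia |].
  apply: leq_trans (szF _ _) _; apply: leq_trans (Hq _) _; apply: leq_trans (leq_addl _ _).
  by apply: leq_pb; lia.
Qed.

End Rec.

(** * Functions on formulas *)

Definition bev (e : seq var) (b : bform) : bool := beval (fun v => v \in e) b.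

Lemma cpt_bev X {eX : enc X} (e : X -> seq var) (b : X -> bform) :
  cpt false e -> cpt false b -> cpt false (fun x => bev (e x) (b x)).
Proof.
apply: (cpt_brec (F := bev)
  (g := fun e b => match b with BTop => true | BVar v => v \in e | _ => false end)
  (h := fun e b r1 r2 => match b with BNot _ => ~~ r1 | _ => r1 && r2 end) (p := fun _ => 3)).
- by move=> e0 [].
- by cpt.
- by cpt.
- exact: poly_const.
- by move=> *; apply: sz_bool.
Qed.

Fixpoint bvars (b : bform) : seq var :=
  match b with BVar v => [:: v] | BNot c => bvars c | BAnd c d => bvars c ++ bvars d | _ => [::] end.

Lemma boverE W b : bover W b = all W (bvars b).
Proof. by elim: b => //= [v|b IH c IH']; rewrite ?andbT // all_cat IH IH'. Qed.

Lemma cpt_bvars X {eX : enc X} (b : X -> bform) :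
  cpt false b -> cpt false (fun x => bvars (b x)).
Proof.
move=> Cb; apply: (cpt_brec (F := fun (_ : unit) b => bvars b) (y := fun _ => tt)
  (g := fun _ b => match b with BVar v => [:: v] | _ => [::] end)
  (h := fun _ b r1 r2 => match b with BNot _ => r1 | _ => r1 ++ r2 end) (p := fun n => n)) => //.
- by move=> _ [].
- by cpt.
- by cpt.
- exact: poly_id.
- move=> u c; apply: leq_trans (leq_addl _ _).
  elim: c => [||v|c IH|c IH d IH'] //=; rewrite szBE ?sz_cons ?sz_nil; try lia.
  by know (sz_cat (bvars c) (bvars d)); lia.
- by cpt.
Qed.

Lemma blen_sz b : blen b <= sz b.
Proof.
by elim: b => [||v|c IH|c IH d IH'] //=; rewrite szBE; lia.
Qed.

Lemma cpt_blen X {eX : enc X} (b : X -> bform) :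
  cpt false b -> cpt false (fun x => blen (b x)).
Proof.
move=> Cb; apply: (cpt_brec (F := fun (_ : unit) b => blen b) (y := fun _ => tt)
  (g := fun _ _ => 1)
  (h := fun _ b r1 r2 => match b with BNot _ => r1.+1 | _ => (r1 + r2).+1 end)
  (p := fun n => 2 * n + 1)) => //.
- by move=> _ [].
- by cpt.
- by cpt.
- by polyn; exact: poly_id.
- by move=> u c; rewrite sz_nat; have := blen_sz c; lia.
- by cpt.
Qed.

Lemma sz_bfix x W b : sz (bfix x W b) <= sz b.
Proof.
rewrite /bfix; elim: b => [||v|c IH|c IH d IH'] //=; rewrite ?szBE ?leq_add2r //.
- by case: ifP => _; rewrite ?szBE //; case: (v.1 \in x); rewrite /bconst ?szBE; lia.
- exact: leq_add.
Qed.

Lemma cpt_bfix X {eX : enc X} (x W : X -> seq atom) (b : X -> bform) :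
  cpt false x -> cpt false W -> cpt false b -> cpt false (fun u => bfix (x u) (W u) (b u)).
Proof.
move=> Cx CW Cb; apply: (cpt_brec (F := fun y b => bfix y.1 y.2 b) (y := fun u => (x u, W u))
  (g := fun y b => match b with
     BVar v => if ~~ v.2 && (v.1 \in y.2) then (if v.1 \in y.1 then BTop else BBot) else BVar v
     | _ => b end)
  (h := fun _ b r1 r2 => match b with BNot _ => BNot r1 | _ => BAnd r1 r2 end)
  (p := fun n => n)) => //.
- by move=> y [].
- by cpt.
- by cpt.
- exact: poly_id.
- by move=> y c; apply: leq_trans (sz_bfix _ _ _) (leq_addl _ _).
- by cpt.
Qed.

Lemma flenE f : flen f = match f with
  | Top | Bot | Atom _ => 1
  | Not g | Know _ g => (flen g).+1
  | And g h | Announce g h => (flen g + flen h).+1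
  | Event (Transformer Vp g pm om) _ h =>
    (size Vp + flen g + size pm + sumn [seq blen qb.2 | qb <- pm]
     + sumn [seq blen b | b <- om] + flen h).+1
  end.
Proof. by case: f => // -[]. Qed.

Lemma sz_flen f : flen f <= sz f.
Proof.
have szt (A : Type) (eA : enc A) (m : A -> nat) (s : seq A) :
   (forall x, m x <= sz x) -> size s + sumn [seq m x | x <- s] <= sz s.
  by move=> H; elim: s => //= x s IH; rewrite sz_cons; have := H x; lia.
have h1 (qb : atom * bform) : blen qb.2 <= sz qb.
  by case: qb => q b; rewrite sz_pair /=; have := blen_sz b; lia.
move: f; fix IH 1.
case=> [||a|g|g h|i g|g h|[Vp g pm om] x h]; last first.
- rewrite flenE !szE; have := IH g; have := IH h; clear IH.
  have h2 : size pm + sumn [seq blen qb.2 | qb <- pm] <= sz pm by exact: (szt _ _ (fun qb : atom * bform => blen qb.2) pm h1).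
  move: h2; have := szt _ _ blen om blen_sz; know (size_sz Vp); clear.
  lia.
- by rewrite flenE !szE; have := IH g; have := IH h; clear; lia.
- by rewrite flenE !szE; have := IH g; clear; lia.
- by rewrite flenE !szE; have := IH g; have := IH h; clear; lia.
- by rewrite flenE !szE; have := IH g; clear; lia.
all: by clear; rewrite !szE.
Qed.

Lemma cpt_flen X {eX : enc X} (f : X -> form) : cpt false f -> cpt false (fun x => flen (f x)).
Proof.
move=> Cf; apply: (cpt_frec (F := fun (_ : unit) f => flen f) (y := fun _ => tt)
  (g := fun _ _ => 1) (al := fun y _ => y) (be := fun y _ => y)
  (h := fun _ f r1 r2 => match f with
     | Top => 1 | Bot => 1 | Atom _ => 1 | Not _ => r1.+1 | Know _ _ => r1.+1
     | And _ _ => (r1 + r2).+1 | Announce _ _ => (r1 + r2).+1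
     | Event T _ _ => (size (t_plus T) + r1 + size (t_minus T)
         + sumn [seq blen qb.2 | qb <- t_minus T] + sumn [seq blen b | b <- t_obs T] + r2).+1
     end)
  (p := fun n => 2 * n + 1)) => //.
- by move=> _ [] // [].
- by cpt.
- by cpt.
- by cpt.
- by cpt; apply: cpt_blen; cpt.
- by polyn; exact: poly_id.
- by move=> u c; rewrite sz_nat; have := sz_flen c; lia.
- by move=> u c nl; rewrite leq_add2l ltnW //; case: (sz_fl nl).
- by move=> u c nl; rewrite leq_add2l ltnW //; case: (sz_fl nl).
- by cpt.
Qed.

Lemma ffixE x W f : ffix x W f = match f with
  | Top => Top
  | Bot => Bot
  | Atom a => if a \in W then (if a \in x then Top else Bot) else Atom a
  | Not g => Not (ffix x W g)
  | And g h => And (ffix x W g) (ffix x W h)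
  | Know i g => Know i (ffix x W g)
  | Announce g h => Announce (ffix x W g) (ffix x W h)
  | Event (Transformer Vp g pm om) y h => Event (Transformer Vp (ffix x W g)
      [seq (qb.1, bfix x W qb.2) | qb <- pm] om) y (ffix x W h)
  end.
Proof. by case: f => // -[]. Qed.

Lemma sz_ffix x W f : sz (ffix x W f) <= sz f.
Proof.
have szt (pm : seq (atom * bform)) : sz [seq (qb.1, bfix x W qb.2) | qb <- pm] <= sz pm.
  by elim: pm => //= -[q b] s IH; rewrite !sz_cons !sz_pair /=; have := sz_bfix x W b; lia.
move: f; fix IH 1.
case=> [||a|g|g h|i g|g h|[Vp g pm om] y h]; last first.
- by rewrite ffixE !szE; have := IH g; have := IH h; have := szt pm; clear; lia.
- by rewrite ffixE !szE; have := IH g; have := IH h; clear; lia.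
- by rewrite ffixE !szE; have := IH g; clear; lia.
- by rewrite ffixE !szE; have := IH g; have := IH h; clear; lia.
- by rewrite ffixE !szE; have := IH g; clear; lia.
- by clear; rewrite ffixE; case: ifP => // _; case: ifP => _; rewrite !szE; lia.
all: by clear; rewrite !szE.
Qed.

Lemma cpt_ffix X {eX : enc X} (x W : X -> seq atom) (f : X -> form) :
  cpt false x -> cpt false W -> cpt false f -> cpt false (fun u => ffix (x u) (W u) (f u)).
Proof.
move=> Cx CW Cf; apply: (cpt_frec (F := fun y f => ffix y.1 y.2 f) (y := fun u => (x u, W u))
  (g := fun y f => match f with
     | Atom a => if a \in y.2 then (if a \in y.1 then Top else Bot) else Atom a
     | _ => f end) (al := fun y _ => y) (be := fun y _ => y)
  (h := fun y f r1 r2 => match f with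
     | Top => Top | Bot => Top | Atom _ => Top | Not _ => Not r1 | Know i _ => Know i r1
     | And _ _ => And r1 r2 | Announce _ _ => Announce r1 r2
     | Event T z _ => Event (Transformer (t_plus T) r1
         [seq (qb.1, bfix y.1 y.2 qb.2) | qb <- t_minus T] (t_obs T)) z r2
     end)
  (p := fun n => n)) => //.
- by move=> y [] // [].
- by cpt.
- by cpt.
- by cpt.
- cpt.
  by apply: cpt_bfix; cpt.
- exact: poly_id.
- by move=> y c; apply: leq_trans (sz_ffix _ _ _) (leq_addl _ _).
- by move=> u c nl; rewrite leq_add2l ltnW //; case: (sz_fl nl).
- by move=> u c nl; rewrite leq_add2l ltnW //; case: (sz_fl nl).
- by cpt.
Qed.

Definition sortedb (s : seq atom) : bool :=
  all (fun i => (nth (0, 0) s i).1 < (nth (0, 0) s i.+1).1) (iota 0 (size s - 1)).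

Lemma sortedbE s : sorted atom_lt s = sortedb s.
Proof.
apply/(sortedP (0, 0))/allP => [H i|H i lt_i].
  by rewrite mem_iota /= add0n ltn_subRL add1n => /H.
by apply: H; rewrite mem_iota /= add0n ltn_subRL add1n.
Qed.

Lemma cpt_sorted X {eX : enc X} (s : X -> seq atom) :
  cpt false s -> cpt false (fun x => sorted atom_lt (s x)).
Proof.
move=> C; apply: (@cpt_ext false _ _ _ _ _ (fun x => sortedb (s x))) => [x|].
  exact: sortedbE.
by rewrite /sortedb; cpt; apply: cpt_comp C _; cpt.
Qed.

Ltac cpt_fun := lazymatch goal with
  | |- cpt _ (fun x => bev (@?f x) (@?g x)) => apply: cpt_bev
  | |- cpt _ (fun x => bvars (@?f x)) => apply: cpt_bvars
  | |- cpt _ (fun x => blen (@?f x)) => apply: cpt_blen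
  | |- cpt _ (fun x => bfix (@?f x) (@?g x) (@?h x)) => apply: cpt_bfix
  | |- cpt _ (fun x => flen (@?f x)) => apply: cpt_flen
  | |- cpt _ (fun x => ffix (@?f x) (@?g x) (@?h x)) => apply: cpt_ffix
  | |- cpt _ (fun x => sorted atom_lt (@?f x)) => apply: cpt_sorted
  end.
Ltac cpt_user ::= first [ cpt_form | cpt_fun ].

Definition is_PAL (L : logic) := if L is PAL then true else false.
Definition is_DEL (L : logic) := if L is DEL then true else false.

(* [y] is made of the number of agents, a bound on atoms, [V] and [P]. *)
Definition check (L : logic) (y : (nat * nat) * (seq atom * seq atom)) (f : form) : bool :=
  [&& wf y.1.1 y.2.1 y.2.2 f, in_logic L f & all (fun a => a.1 < y.1.2) (new_atoms f)].

Definition check_event (L : logic) (y : (nat * nat) * (seq atom * seq atom))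
    (T : transformer) (x : seq atom) : bool :=
  [&& is_DEL L, all (fun a => a.1 < y.1.2) (t_plus T),
   all (fun a => a.2 == 0) (t_plus T), sorted atom_lt (t_plus T),
   ~~ has (fun a => a \in y.2.1 ++ y.2.2) (t_plus T),
   sorted atom_lt [seq qb.1 | qb <- t_minus T],
   all (fun qb => qb.1 \in y.2.1) (t_minus T) &
   [&& all (fun qb => all (fun v => ~~ v.2 && (v.1 \in y.2.1 ++ y.2.2 ++ t_plus T)) (bvars qb.2))
         (t_minus T),
   size (t_obs T) == y.1.1,
   all (fun b => all (fun v => v.1 \in t_plus T) (bvars b)) (t_obs T),
   sorted atom_lt x & all (fun a => a \in t_plus T) x]].

Lemma checkE L y f : check L y f = if fleaf f then
    (if f is Atom a then a \in y.2.1 ++ y.2.2 else true)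
  else
    let r1 := check L (if f is Event T _ _ then (y.1, (y.2.1, y.2.2 ++ t_plus T)) else y) (fl f) in
    let r2 := check L (if f is Event T _ _ then (y.1, (y.2.1 ++ t_plus T, y.2.2)) else y) (fr f) in
    match f with
    | Know i _ => (i < y.1.1) && r1
    | Announce _ _ => [&& is_PAL L, r1 & r2]
    | Event T x _ => [&& check_event L y T x, r1 & r2]
    | _ => r1 && r2
    end.
Proof.
have aE (a b c a' b' c' : bool) : [&& a && a', b && b' & c && c'] = [&& a, b & c] && [&& a', b' & c'].
  by case: a; case: b; case: c; case: a'; case: b'; case: c'.
case: f => [||a|g|g h|i g|g h|[Vp g pm om] x h]; rewrite /check //=.
- by rewrite !andbT.
- by rewrite andbb.
- by rewrite all_cat aE.
- by rewrite -!andbA.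
- by rewrite all_cat; case: L => //=; rewrite ?andbF // aE.
case: L => /=; rewrite ?andbF //= !all_cat.
rewrite /check_event /= !all_map.
rewrite (eq_all (a1 := preim snd (bover _)) (a2 := fun qb => all
   (fun v => ~~ v.2 && (v.1 \in y.2.1 ++ y.2.2 ++ Vp)) (bvars qb.2))); last first.
  by move=> qb /=; rewrite boverE.
rewrite (eq_all (a1 := bover _) (a2 := fun b => all (fun v => v.1 \in Vp) (bvars b))); last first.
  by move=> b /=; rewrite boverE.
by apply/idP/idP => H; repeat match goal with H : is_true (_ && _) |- _ => move: H => /andP[? ?] end;
   repeat (apply/andP; split); assumption.
Qed.

Lemma cpt_check X {eX : enc X} L (y : X -> (nat * nat) * (seq atom * seq atom)) (f : X -> form) :
  cpt false y -> cpt false f -> cpt false (fun x => check L (y x) (f x)).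
Proof.
apply: (cpt_frec (F := check L) (p := fun _ => 3)
  (g := fun y f => if f is Atom a then a \in y.2.1 ++ y.2.2 else true)
  (al := fun y f => if f is Event T _ _ then (y.1, (y.2.1, y.2.2 ++ t_plus T)) else y)
  (be := fun y f => if f is Event T _ _ then (y.1, (y.2.1 ++ t_plus T, y.2.2)) else y)
  (h := fun y f r1 r2 => match f with
    | Know i _ => (i < y.1.1) && r1
    | Announce _ _ => [&& is_PAL L, r1 & r2]
    | Event T x _ => [&& check_event L y T x, r1 & r2]
    | _ => r1 && r2
    end)).
- exact: checkE.
- by cpt.
- by cpt.
- by cpt.
- by rewrite /check_event; cpt.
- exact: poly_const.
- by move=> *; apply: sz_bool.
- move=> [[n N] [V Q]] c nl; have [s1 s2] := sz_fl nl.
  case: c nl s1 s2 => //= [g|g h|i g|g h|[Vp g pm om] x h] _ s1 s2; rewrite ?leq_add2l ?(ltnW s1) //.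
  rewrite !sz_pair; know (sz_cat Q Vp).
  by rewrite !szE /=; lia.
- move=> [[n N] [V Q]] c nl; have [s1 s2] := sz_fl nl.
  case: c nl s1 s2 => //= [g|g h|i g|g h|[Vp g pm om] x h] _ s1 s2; rewrite ?leq_add2l ?(ltnW s2) //.
  rewrite !sz_pair; know (sz_cat V Vp).
  by rewrite !szE /=; lia.
Qed.

(** * Parsing *)

Definition tokstep (a : nat * seq nat) (b : bool) : nat * seq nat :=
  if b then (a.1.+1, a.2) else (0, a.1 :: a.2).
(** A nonzero counter at the end betrays an unterminated number, so the word is no encoding. *)
Definition tokens (w : seq bool) : option (seq nat) :=
  let r := foldl tokstep (0, [::]) w in if r.1 == 0 then Some (rev r.2) else None.

Lemma tokensP w s : tokens w = Some s <-> flatten (map ser_nat s) = w.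
Proof.
rewrite /tokens; split=> [|<-].
  have : flatten (map ser_nat (rev (foldl tokstep (0, [::]) w).2))
         ++ nseq (foldl tokstep (0, [::]) w).1 true = w.
    elim/last_ind: w => // w b IH; rewrite foldl_rcons -[in RHS]IH.
    case: (foldl _ _ w) => k acc; case: b => /=.
      by rewrite rcons_cat; congr (_ ++ _); elim: k {IH} => //= k ->.
    by rewrite rev_cons map_rcons flatten_rcons cats0 rcons_cat.
  case: (foldl _ _ w) => k acc /=; case: eqP => // -> + [<-].
  by rewrite cats0.
have H k acc t : foldl tokstep (k, acc) (flatten (map ser_nat t)) =
   if t is n :: t' then (0, rev t' ++ (k + n) :: acc) else (k, acc).
  elim: t k acc => // n t IH k acc /=; rewrite foldl_cat.
  have -> : foldl tokstep (k, acc) (ser_nat n) = (0, (k + n) :: acc).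
    rewrite /ser_nat foldl_rcons.
    suff -> : foldl tokstep (k, acc) (nseq n true) = (k + n, acc) by [].
    by elim: n k => [|n IHn] k /=; rewrite ?addn0 // IHn addnS.
  rewrite IH; case: t {IH} => //= m t; congr (_, _).
  by rewrite add0n rev_cons cat_rcons.
by rewrite H; case: s => // n s /=; rewrite add0n rev_cat /= revK.
Qed.

Lemma cpt_tokens : cpt false tokens.
Proof.
rewrite /tokens; have C : cpt false (fun w => foldl tokstep (0, [::]) w).
  apply: (@cpt_foldl false (seq bool) bool (nat * seq nat)%type _ _ _ (fun w => w)
    (fun _ => (0, [::])) (fun _ => tokstep) (fun n => 2 * n + 3)).
  - by cpt.
  - by cpt.
  - by rewrite /tokstep; cpt.
  - by polyn; exact: poly_id.
  move=> w i.
  have H a (t : seq bool) : sz (foldl tokstep a t) <= sz a + 2 * size t.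
    elim: t a => [|b t IH] a /=; first by rewrite addn0.
    apply: leq_trans (IH _) _; rewrite /tokstep; case: a => k acc; case: b;
      rewrite !sz_pair ?sz_cons !sz_nat /=; lia.
  apply: leq_trans (H _ _) _; rewrite sz_pair sz_nat sz_nil.
  by know (size_sz (take i w)); know (sz_take i w); lia.
by cpt; apply: cpt_comp C _; cpt.
Qed.

(** The length of the unary encoding. It is additive under concatenation and, by [sz_wt], half the
    size of the list as a tree up to a constant. *)
Definition wt (s : seq nat) : nat := sumn s + size s.

Lemma wt_cat s t : wt (s ++ t) = wt s + wt t.
Proof. by rewrite /wt sumn_cat size_cat; lia. Qed.

Lemma wt_cons n s : wt (n :: s) = n.+1 + wt s.
Proof. by rewrite /wt /=; lia. Qed.

Lemma sz_wt (s : seq nat) : sz s = 2 * wt s + 1.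
Proof. by elim: s => // n s IH; rewrite sz_cons IH sz_nat wt_cons; lia. Qed.

Definition parser T := seq nat -> option (T * seq nat).

(** The size condition bounds a parsed object by the tokens it consumes, so the partial results of a
    parser remain polynomial. It is strict in order to absorb the additional node of a pair. *)
Definition good T {eT : enc T} (p : parser T) (ser : T -> seq nat) : Prop :=
  [/\ forall s x r, p s = Some (x, r) <-> s = ser x ++ r,
      forall x, sz x < 6 * wt (ser x) & cpt false p].

Definition ppair T U (p : parser T) (q : parser U) : parser (T * U) := fun s =>
  if p s is Some (x, r) then (if q r is Some (y, r') then Some ((x, y), r') else None) else None.

Lemma good_pair T U {eT : enc T} {eU : enc U} (p : parser T) (q : parser U) st su :
  good p st -> good q su -> good (ppair p q) (fun u => st u.1 ++ su u.2).
Proof.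
move=> [p1 p2 p3] [q1 q2 q3]; split.
- move=> s [x y] r; rewrite /ppair; split=> [|->].
    case e: (p s) => [[x' r']|] //; case e': (q r') => [[y' r'']|] // -[<- <- <-].
    by move/p1: e => ->; move/q1: e' => ->; rewrite catA.
  rewrite -catA /=; have -> : p (st x ++ su y ++ r) = Some (x, su y ++ r) by apply/p1.
  by have -> : q (su y ++ r) = Some (y, r) by apply/q1.
- by move=> [x y]; rewrite sz_pair wt_cat /=; have := p2 x; have := q2 y; lia.
rewrite /ppair.
apply: (@cpt_ext false _ _ _ _ _ (fun s => match p s with None => None | Some u =>
   match q u.2 with None => None | Some v => Some ((u.1, v.1), v.2) end end)).
  by move=> s; case: (p s) => [[x r]|] //; case: (q r) => [[y r']|].
by cpt; apply: cpt_comp q3 _; cpt.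
Qed.

Lemma good_map T U {eT : enc T} {eU : enc U} (p : parser T) st (f : T -> U) (g : U -> T) su :
  good p st -> cancel f g -> cancel g f -> (forall x, code (f x) = code x) ->
  (forall y, su y = st (g y)) ->
  good (fun s => if p s is Some (x, r) then Some (f x, r) else None) su.
Proof.
move=> [p1 p2 p3] fK gK fc suE; split.
- move=> s y r; rewrite suE; split=> [|->].
    by case e: (p s) => [[x r']|] // -[<- <-]; rewrite fK; apply/p1.
  have -> : p (st (g y) ++ r) = Some (g y, r) by apply/p1.
  by rewrite gK.
- by move=> y; rewrite suE -[y in sz y]gK /sz fc; apply: p2.
apply: cpt_code p3 => s; case: (p s) => [[x r]|] //=.
by rewrite fc.
Qed.

(** The announced length of a list is a unary number, so iterating that often is affordable; after a
    failure all further steps return [None]. *)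
Definition pseq_step T (p : parser T) (a : option (seq T * seq nat)) : option (seq T * seq nat) :=
  if a is Some (acc, s) then (if p s is Some (x, r) then Some (x :: acc, r) else None) else None.
Definition pseq T (p : parser T) : parser (seq T) := fun s =>
  if s is n :: r then
    (if iter n (pseq_step p) (Some ([::], r)) is Some (acc, r') then Some (rev acc, r') else None)
  else None.

Lemma pseq_iter T {eT : enc T} (p : parser T) ser n s acc r :
  (forall s x r, p s = Some (x, r) <-> s = ser x ++ r) ->
  iter n (pseq_step p) (Some ([::], s)) = Some (acc, r) <->
  size acc = n /\ s = flatten (map ser (rev acc)) ++ r.
Proof.
move=> H; elim: n acc r => [|n IH] acc r.
  by split=> [[<- <-]|[/size0nil-> ->]].
rewrite iterS; split.
  case e: (iter n _ _) => [[acc' r']|] //=; move/IH: e => [<- ->].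
  case e: (p r') => [[x r'']|] // -[<- <-]; move/H: e => ->; split=> //.
  by rewrite rev_cons map_rcons flatten_rcons catA.
case: acc => [|x acc] [] // [sz_acc] es.
have -> : iter n (pseq_step p) (Some ([::], s)) = Some (acc, ser x ++ r).
  by apply/IH; split=> //; rewrite es rev_cons map_rcons flatten_rcons catA.
by rewrite /=; have -> : p (ser x ++ r) = Some (x, r) by apply/H.
Qed.

Lemma sz_wt_flatten T {eT : enc T} (ser : T -> seq nat) s :
  (forall x, sz x < 6 * wt (ser x)) -> sz s <= 6 * wt (flatten (map ser s)) + 1.
Proof.
by move=> H; elim: s => //= x s IH; rewrite sz_cons wt_cat; have := H x; lia.
Qed.

Lemma good_seq T {eT : enc T} (p : parser T) ser : good p ser -> good (pseq p) (ser_seq ser).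
Proof.
move=> [p1 p2 p3]; split.
- move=> s x r; rewrite /pseq /ser_seq; split=> [|->].
    case: s => // n s; case e: (iter _ _ _) => [[acc r']|] // -[<- <-].
    by move/(pseq_iter _ _ _ _ p1): e => [<- ->]; rewrite /= size_rev.
  rewrite cat_cons; have -> : iter (size x) (pseq_step p) (Some ([::], flatten [seq ser i | i <- x] ++ r))
     = Some (rev x, r).
    by apply/(pseq_iter _ _ _ _ p1); rewrite size_rev revK.
  by rewrite revK.
- move=> s; apply: leq_ltn_trans (sz_wt_flatten s p2) _.
  by rewrite /ser_seq wt_cons; lia.
rewrite /pseq.
apply: (@cpt_ext false _ _ _ _ _ (fun s => match s with [::] => None | n :: r =>
   match iter n (pseq_step p) (Some ([::], r)) with None => None
   | Some u => Some (rev u.1, u.2) end end)).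
  by move=> [|n r] //; case: (iter _ _ _) => [[]|].
cpt; apply: (@cpt_iter false _ _ _ _ (fun u : seq nat * (nat * seq nat) => u.2.1)
  (fun u => Some ([::], u.2.2)) (fun _ => pseq_step p) (fun n => 8 * n + 10)).
- by cpt.
- by cpt.
- rewrite /pseq_step.
  apply: (@cpt_ext false _ _ _ _ _ (fun u : (seq nat * (nat * seq nat)) * option (seq T * seq nat) =>
    match u.2 with None => None | Some a => match p a.2 with None => None | Some b =>
      Some (b.1 :: a.1, b.2) end end)).
    by move=> [u [[acc s]|]] //=; case: (p s) => [[]|].
  by cpt; apply: cpt_comp p3 _; cpt.
- by polyn; exact: poly_id.
move=> [s0 [n r]] i _ /=; case e: (iter _ _ _) => [[acc r']|]; last exact: (leq_trans (isT : 1 <= 10) (leq_addl _ _)).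
move/(pseq_iter _ _ _ _ p1): e => [_ er].
have h1 := sz_wt_flatten (rev acc) p2; rewrite sz_rev in h1.
have h2 : wt r = wt (flatten (map ser (rev acc))) + wt r' by rewrite er wt_cat.
rewrite sz_some !sz_pair (sz_wt r') (sz_wt r).
lia.
Qed.

Definition patom : parser atom := fun s => if s is a :: b :: r then Some ((a, b), r) else None.
Lemma good_atom : good patom ser_atom.
Proof.
split.
- by move=> [|a [|b s]] // [a' b'] r /=; split=> [[<- <- <-]|[<- <- <-]].
- by move=> [a b]; rewrite sz_pair !sz_nat /ser_atom !wt_cons /wt /=; lia.
by rewrite /patom; cpt.
Qed.

Definition pbool : parser bool := fun s =>
  if s is a :: r then (if a == 0 then Some (false, r) else if a == 1 then Some (true, r) else None) else None.
Lemma good_bool : good pbool (fun b => [:: nat_of_bool b]).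
Proof.
split.
- by move=> [|[|[|a]] s] // [] r /=; split=> // -[] <-.
- by move=> []; rewrite wt_cons; know (sz_bool true); know (sz_bool false); rewrite /wt /=; lia.
by rewrite /pbool; cpt.
Qed.

Definition pbref : parser bref := fun s => if s is t :: a :: r then
  (if t == 0 then (if a == 0 then Some (inl false, r) else if a == 1 then Some (inl true, r) else None)
   else if t == 1 then Some (inr a, r) else None) else None.
Lemma good_bref : good pbref ser_bref.
Proof.
split.
- by move=> [|[|[|t]] [|[|[|a]] s]] // [[]|j] r /=; split=> // -[] <- //; move=> <-.
- by move=> [[]|j]; rewrite /ser_bref !wt_cons /wt /sz /= ?tsize_node /= /tsize /=; try lia;
    know (sz_nat j); rewrite /sz /tsize /=; lia.
by rewrite /pbref; cpt.
Qed.

Lemma good_eq T {eT : enc T} (p : parser T) ser ser' :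
  good p ser -> ser =1 ser' -> good p ser'.
Proof. by move=> [p1 p2 p3] e; split=> // [s x r|x]; rewrite -e. Qed.

Definition pvar : parser var := ppair patom pbool.
Lemma good_var : good pvar ser_var.
Proof. by apply: good_eq (good_pair good_atom good_bool) _ => -[[a b] c]. Qed.

Definition pbdd : parser bdd := fun s =>
  if ppair (pseq (ppair pvar (ppair pbref pbref))) pbref s is Some (u, r)
  then Some (Bdd u.1 u.2, r) else None.
Lemma good_bdd : good pbdd ser_bdd.
Proof.
apply: (good_map (g := fun B => (bdd_nodes B, bdd_root B))
  (good_pair (good_seq (good_pair good_var (good_pair good_bref good_bref))) good_bref)) => //.
- by case.
- by case.
Qed.

Lemma cpt_parser X T {eX : enc X} {eT : enc T} (p : parser T) ser (f : X -> seq nat) :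
  good p ser -> cpt false f -> cpt false (fun x => p (f x)).
Proof. by case=> _ _; apply: cpt_comp. Qed.

Ltac cpt_parse := lazymatch goal with
  | |- cpt _ (fun x => pvar (@?f x)) => apply: (cpt_parser good_var)
  end.
Ltac cpt_user ::= first [ cpt_form | cpt_parse ].

(** Recursive descent as an instance of [rec2]: an argument is a list of tokens, a result is a
    formula with the tokens left over. All tags but those of negation and conjunction belong to the
    base case, ill-formed ones included. *)
Definition Bbase (s : seq nat) := if s is t :: _ then ~~ ((t == 3) || (t == 4)) else true.
Definition Bg (s : seq nat) : option (bform * seq nat) :=
  if s is t :: r then
    if t == 0 then Some (BTop, r) else if t == 1 then Some (BBot, r)
    else if t == 2 then (if pvar r is Some u then Some (BVar u.1, u.2) else None) else None
  else None.
Definition Bb (s : seq nat) (r1 : option (bform * seq nat)) : seq nat :=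
  if r1 is Some u then u.2 else [::].
Definition Bh (s : seq nat) (r1 r2 : option (bform * seq nat)) : option (bform * seq nat) :=
  if r1 is Some u then
    if nth 0 s 0 == 3 then Some (BNot u.1, u.2)
    else if r2 is Some v then Some (BAnd u.1 v.1, v.2) else None
  else None.
Definition Brec := rec2 Bbase Bg behead Bb Bh.
Definition pbform : parser bform := fun s => Brec (size s) s.

Lemma BrecP n s x r : size s <= n -> Brec n s = Some (x, r) <-> s = ser_bform x ++ r.
Proof.
have gP s' x' r' : Bbase s' -> Bg s' = Some (x', r') <-> s' = ser_bform x' ++ r'.
  have [vP _ _] := good_var.
  case: s' => [|[|[|[|[|[|t]]]]] s'] // _; rewrite /Bg /=; last by case: x'.
  - by case: x' => //=; split=> [[->]|[->]].
  - by case: x' => //=; split=> [[->]|[->]].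
  - by case: x' => //=; split=> [[->]|[->]].
  - case: x' => [||v|b|b c]; split=> //=; try by case: (pvar _) => [[]|].
      by case e: (pvar s') => [[v' r'']|] // -[<- <-]; move/vP: e => ->.
    by case=> e; have -> : pvar s' = Some (v, r') by apply/vP.
elim: n s x r => [|n IH] s x r le.
  have -> : s = [::] by case: s le.
  by split=> //; case: x.
rewrite /=; case bs: (Bbase s); first exact: gP.
case: s le bs => // t s /= le; rewrite ltnS in le => bs.
have sub c r0 : s = ser_bform c ++ r0 -> size r0 <= n.
  by move=> e; rewrite e size_cat in le; lia.
rewrite /Bb /Bh /=; split.
  case e: (Brec n s) => [[c r0]|] //; move/(IH _ _ _ le): e => e /=.
  case: eqP => [->|ne]; first by case=> <- <-; rewrite e.
  case e': (Brec n r0) => [[d r']|] //; move/(IH _ _ _ (sub _ _ e)): e' => e' /= [<- <-].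
  have -> : t = 4 by case: (t) bs ne => [|[|[|[|[|]]]]].
  by rewrite e e' catA.
case: x => [||v|c|c d] /= [et es]; rewrite et // in bs *.
  by have -> : Brec n s = Some (c, r) by apply/IH.
rewrite -catA in es.
have -> : Brec n s = Some (c, ser_bform d ++ r) by apply/IH.
by have -> : Brec n (ser_bform d ++ r) = Some (d, r) by apply/IH => //; apply: sub es.
Qed.

Lemma sz_ser_bform b : sz b < 6 * wt (ser_bform b).
Proof.
elim: b => [||v|b IH|b IH c IH'] /=; rewrite ?szBE !wt_cons ?wt_cat; first [by rewrite /wt /=; lia | idtac].
- have [_ /(_ v) + _] := good_var; rewrite /ser_var /= !wt_cons /wt /=; lia.
- lia.
- lia.
Qed.

Lemma good_bform : good pbform ser_bform.
Proof.
split; first by move=> s x r; apply: BrecP.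
  exact: sz_ser_bform.
have [_ _ Cv] := good_var.
apply: (@cpt_ext false _ _ _ _ _ (fun s => if true then Brec (size s) s else None)) => //.
apply: (@cpt_rec2 _ _ _ _ Bbase Bg behead Bb Bh _ _ (fun _ => true) (fun _ => None)
  (fun s => size s) (fun s => s) (fun n => 8 * n + 10)
  (fun s0 m s => [/\ size s <= m, m <= size s0 & wt s <= wt s0])).
- by rewrite /Bbase; cpt.
- by rewrite /Bg; cpt.
- by rewrite /behead; cpt.
- by rewrite /Bb; cpt.
- by rewrite /Bh; cpt.
- by cpt.
- by cpt.
- by cpt.
- by cpt.
- by polyn; exact: poly_id.
- by move=> s _; split.
- move=> s0 m [|t s] _ [l1 l2 l3] //= _.
  have [h1 h2] : size s <= m /\ wt s <= wt s0 by move: l1 l3; rewrite /= wt_cons; lia.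
  split; first by split=> //; lia.
  rewrite -/Brec /Bb; case e: (Brec m s) => [[c r]|]; last by split=> //=; rewrite /wt /=; lia.
  move/(BrecP _ _ h1): e => e; rewrite e in h1 h2.
  by split=> /=; [move: h1; rewrite size_cat; lia | lia | move: h2; rewrite wt_cat; lia].
- move=> s0 m s _ [l1 l2 l3]; rewrite -/Brec; split.
  + by know (size_sz s0); lia.
  + by rewrite !sz_wt; lia.
  case e: (Brec m s) => [[c r]|]; last exact: (leq_trans (isT : 1 <= 10) (leq_addl _ _)).
  move/(BrecP _ _ l1): e => e; rewrite e wt_cat in l3.
  by have := sz_ser_bform c; rewrite sz_some sz_pair !sz_wt; lia.
Qed.

(** In the serialization of an event these lists stand between the precondition and the formula
    after the event, so they are read between the two recursive calls. *)
Definition pmid : parser (seq (atom * bform) * (seq bform * seq atom)) :=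
  ppair (pseq (ppair patom pbform)) (ppair (pseq pbform) (pseq patom)).
Definition ser_mid (u : seq (atom * bform) * (seq bform * seq atom)) :=
  ser_seq (fun qb => ser_atom qb.1 ++ ser_bform qb.2) u.1
  ++ ser_seq ser_bform u.2.1 ++ ser_seq ser_atom u.2.2.
Lemma good_mid : good pmid ser_mid.
Proof.
exact: (good_pair (good_seq (good_pair good_atom good_bform))
   (good_pair (good_seq good_bform) (good_seq good_atom))).
Qed.
Definition patoms : parser (seq atom) := pseq patom.
Lemma good_atoms : good patoms (ser_seq ser_atom).
Proof. exact: good_seq good_atom. Qed.

Ltac cpt_parse2 := lazymatch goal with
  | |- cpt _ (fun x => patom (@?f x)) => apply: (cpt_parser good_atom)
  | |- cpt _ (fun x => patoms (@?f x)) => apply: (cpt_parser good_atoms)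
  | |- cpt _ (fun x => pmid (@?f x)) => apply: (cpt_parser good_mid)
  end.
Ltac cpt_user ::= first [ cpt_form | cpt_parse2 ].

Definition Fbase (s : seq nat) :=
  if s is t :: _ then ~~ [|| t == 3, t == 4, t == 5, t == 6 | t == 7] else true.
Definition Fg (s : seq nat) : option (form * seq nat) :=
  if s is t :: r then
    if t == 0 then Some (Top, r) else if t == 1 then Some (Bot, r)
    else if t == 2 then (if patom r is Some u then Some (Atom u.1, u.2) else None) else None
  else None.
Definition Fa (s : seq nat) : seq nat :=
  if s is t :: r then
    if t == 5 then behead r
    else if t == 7 then (if patoms r is Some u then u.2 else [::])
    else r
  else [::].
Definition Fb (s : seq nat) (r1 : option (form * seq nat)) : seq nat :=
  if r1 is Some u then
    if nth 0 s 0 == 7 then (if pmid u.2 is Some v then v.2 else [::]) else u.2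
  else [::].
Definition Fh (s : seq nat) (r1 r2 : option (form * seq nat)) : option (form * seq nat) :=
  if r1 is Some u then
    if nth 0 s 0 == 3 then Some (Not u.1, u.2)
    else if nth 0 s 0 == 5 then (if s is _ :: r then
       (if r is i :: _ then Some (Know i u.1, u.2) else None) else None)
    else if r2 is Some v then
      if nth 0 s 0 == 4 then Some (And u.1 v.1, v.2)
      else if nth 0 s 0 == 6 then Some (Announce u.1 v.1, v.2)
      else if patoms (behead s) is Some w then
        (if pmid u.2 is Some z then
           Some (Event (Transformer w.1 u.1 z.1.1 z.1.2.1) z.1.2.2 v.1, v.2) else None)
      else None
    else None
  else None.
Definition Frec := rec2 Fbase Fg Fa Fb Fh.
Definition pform : parser form := fun s => Frec (size s) s.

Lemma ser_formE f : ser_form f =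
  match f with
  | Top => [:: 0] | Bot => [:: 1] | Atom a => 2 :: ser_atom a | Not g => 3 :: ser_form g
  | And g h => 4 :: ser_form g ++ ser_form h | Know i g => 5 :: i :: ser_form g
  | Announce g h => 6 :: ser_form g ++ ser_form h
  | Event T x h => 7 :: ser_seq ser_atom (t_plus T) ++ ser_form (t_pre T)
        ++ ser_mid (t_minus T, (t_obs T, x)) ++ ser_form h
  end.
Proof.
have cA (a b c d : seq nat) : (a ++ b ++ c) ++ d = a ++ b ++ c ++ d by rewrite -!catA.
by case: f => // -[Vp g pm om] x h; rewrite /ser_mid cA.
Qed.

Lemma FrecP n s x r : size s <= n -> Frec n s = Some (x, r) <-> s = ser_form x ++ r.
Proof.
have [aP _ _] := good_atom; have [asP _ _] := good_atoms; have [mP _ _] := good_mid.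
have gP s' x' r' : Fbase s' -> Fg s' = Some (x', r') <-> s' = ser_form x' ++ r'.
  rewrite ser_formE; case: s' => [|[|[|[|[|[|[|[|[|t]]]]]]]] s'] // _; rewrite /Fg /=; last by case: x'.
  - by case: x'.
  - by case: x' => //=; split=> [[->]|[->]].
  - by case: x' => //=; split=> [[->]|[->]].
  - case: x' => [||a|g|g h|i g|g h|T y h]; split=> //=; try by case: (patom _) => [[]|].
      by case e: (patom s') => [[v' r'']|] // -[<- <-]; move/aP: e => ->.
    by case: a => a1 a2 [->].
elim: n s x r => [|n IH] s x r le.
  have -> : s = [::] by case: s le.
  by split=> //; rewrite ser_formE; case: x.
rewrite /=; case bs: (Fbase s); first exact: gP.
case: s le bs => // t s /= le; rewrite ltnS in le => bs.
rewrite -/Frec; split.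
  case e: (Frec n (Fa (t :: s))) => [[g r0]|] //=.
  have le_a : size (Fa (t :: s)) <= n.
    rewrite /Fa; case: ifP => _; first by rewrite size_behead; lia.
    case: ifP => _ //; case e': (patoms s) => [[Vp r1]|] //=; move/asP: e' => e'.
    by rewrite e' size_cat in le; lia.
  move/(IH _ _ _ le_a): e => e.
  have le_0 : size r0 <= n by rewrite e size_cat in le_a; lia.
  rewrite /Fh /Fb /=; case: eqP => [et|n3].
    by case=> <- <-; rewrite et; move: e; rewrite /Fa et /= => ->; rewrite ser_formE.
  case: eqP => [et|n5].
    move: e; rewrite /Fa et /=; case: s {le bs le_a} => [|i s] //= e [<- <-].
    by rewrite ser_formE e.
  case: eqP => [et|n7].
    move: e; rewrite /Fa et /=; case ea: (patoms s) => [[Vp r1]|] //=; last by rewrite ser_formE; case: g.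
    move/asP: ea => ea e.
    case em: (pmid r0) => [[[pm [om y]] r2]|] //=; last by case: (Frec n [::]) => [[]|].
    move/mP: em => em; have le_2 : size r2 <= n by rewrite em size_cat in le_0; lia.
    case eh: (Frec n r2) => [[h r3]|] // -[<- <-]; move/(IH _ _ _ le_2): eh => eh.
    rewrite ser_formE ea e em eh cat_cons -!catA.
    by [].
  case eh: (Frec n r0) => [[h r3]|] //; move/(IH _ _ _ le_0): eh => eh.
  move: e; rewrite /Fa; case: eqP => // _; case: eqP => // _ e.
  case: eqP => [-> [<- <-]|n4]; first by rewrite ser_formE /= e eh -catA.
  case: eqP => [-> [<- <-]|n6]; first by rewrite ser_formE /= e eh -catA.
  by move: bs n3 n4 n5 n6 n7; case: (t) => [|[|[|[|[|[|[|[|]]]]]]]].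
case: x => [||a|g|g h|i g|g h|[Vp g pm om] y h]; rewrite ser_formE; last 1 first.
  set m := ser_mid (pm, (om, y)); rewrite cat_cons -!catA => E.
  have et : t = 7 := congr1 (head 0) E.
  have es : s = ser_seq ser_atom Vp ++ ser_form g ++ m ++ ser_form h ++ r.
    by rewrite /m /ser_mid -!catA; apply: (congr1 behead E).
  have em r' : pmid (m ++ r') = Some ((pm, (om, y)), r') by apply/mP.
  clearbody m; rewrite {E}et in bs *.
  have ea : patoms s = Some (Vp, ser_form g ++ m ++ ser_form h ++ r) by apply/asP.
  rewrite es !size_cat in le; rewrite /Fa [7 == 5]/= [7 == 7]/= ea.
  have -> : Frec n (ser_form g ++ m ++ ser_form h ++ r) = Some (g, m ++ ser_form h ++ r).
    by apply/IH => //; rewrite !size_cat; lia.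
  rewrite /Fb /Fh [7 == _]/= em ea.
  have -> // : Frec n (ser_form h ++ r) = Some (h, r).
  by apply/IH => //; rewrite size_cat; lia.
all: move=> /= [et es]; rewrite et // in bs *; rewrite /Fa /=.
- by have -> : Frec n s = Some (g, r) by apply/IH.
- rewrite -catA in es; have -> : Frec n s = Some (g, ser_form h ++ r) by apply/IH.
  rewrite /Fb /=; have -> // : Frec n (ser_form h ++ r) = Some (h, r).
  by apply/IH => //; rewrite es size_cat in le; lia.
- case: s es le {bs} => [|j s] //= [-> es] le.
  by have -> : Frec n s = Some (g, r) by apply/IH => //; apply: ltnW.
- rewrite -catA in es; have -> : Frec n s = Some (g, ser_form h ++ r) by apply/IH.
  rewrite /Fb /=; have -> // : Frec n (ser_form h ++ r) = Some (h, r).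
  by apply/IH => //; rewrite es size_cat in le; lia.
Qed.

Lemma sz_ser_form f : sz f < 6 * wt (ser_form f).
Proof.
have [_ sa _] := good_atom; have [_ sas _] := good_atoms; have [_ sm _] := good_mid.
move: f; fix IH 1.
case=> [||a|g|g h|i g|g h|[Vp g pm om] y h]; rewrite ser_formE.
- by clear; rewrite !szE.
- by clear; rewrite !szE.
- by have := sa a; clear; rewrite !szE wt_cons; lia.
- by have := IH g; clear; rewrite !szE wt_cons; lia.
- by have := IH g; have := IH h; clear; rewrite !szE wt_cons wt_cat; lia.
- by have := IH g; clear; rewrite !szE !wt_cons sz_nat; lia.
- by have := IH g; have := IH h; clear; rewrite !szE wt_cons wt_cat; lia.
have := IH g; have := IH h; have := sas Vp; have := sm (pm, (om, y)); clear.
by rewrite !szE !sz_pair wt_cons !wt_cat /=; lia.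
Qed.

Lemma good_form : good pform ser_form.
Proof.
split; first by move=> s x r; apply: FrecP.
  exact: sz_ser_form.
have [asP _ _] := good_atoms; have [mP _ _] := good_mid.
apply: (@cpt_ext false _ _ _ _ _ (fun s => if true then Frec (size s) s else None)) => //.
apply: (@cpt_rec2 _ _ _ _ Fbase Fg Fa Fb Fh _ _ (fun _ => true) (fun _ => None)
  (fun s => size s) (fun s => s) (fun n => 8 * n + 10)
  (fun s0 m s => [/\ size s <= m, m <= size s0 & wt s <= wt s0])).
- by rewrite /Fbase; cpt.
- by rewrite /Fg; cpt.
- by rewrite /Fa; cpt.
- by rewrite /Fb; cpt.
- by rewrite /Fh; cpt.
- by cpt.
- by cpt.
- by cpt.
- by cpt.
- by polyn; exact: poly_id.
- by move=> s _; split.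
- move=> s0 m [|t s] _ [l1 l2 l3] //= _.
  have [h1 h2] : size s <= m /\ wt s <= wt s0 by move: l1 l3; rewrite /= wt_cons; lia.
  have [k1 k2] : size (Fa (t :: s)) <= m /\ wt (Fa (t :: s)) <= wt s0.
    rewrite /Fa; case: ifP => _.
      by case: (s) h1 h2 => [|j s'] /=; rewrite ?wt_cons; lia.
    case: ifP => _ //; case e: (patoms s) => [[Vp r]|] //=; move/asP: e => e.
    by rewrite e size_cat wt_cat in h1 h2; lia.
  split; first by split=> //; lia.
  rewrite -/Frec /Fb; case e: (Frec m _) => [[c r]|]; last by split=> //=; rewrite /wt /=; lia.
  move/(FrecP _ _ k1): e => e; rewrite e size_cat wt_cat in k1 k2; rewrite [(_, _).2]/=.
  case: ifP => _; last by split; lia.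
  case em: (pmid r) => [[u r2]|]; last by split=> //=; rewrite /wt /=; lia.
  by move/mP: em => em; rewrite em size_cat wt_cat in k1 k2; split=> /=; lia.
- move=> s0 m s _ [l1 l2 l3]; rewrite -/Frec; split.
  + by know (size_sz s0); lia.
  + by rewrite !sz_wt; lia.
  case e: (Frec m s) => [[c r]|]; last exact: (leq_trans (isT : 1 <= 10) (leq_addl _ _)).
  move/(FrecP _ _ l1): e => e; rewrite e wt_cat in l3.
  by have := sz_ser_form c; rewrite sz_some sz_pair !sz_wt; lia.
Qed.

Definition inst := (seq atom * (bdd * (seq bdd * (seq atom * form))))%type.
Definition inst_of (u : inst) : instance :=
  Instance u.1 u.2.1 u.2.2.1 u.2.2.2.1 u.2.2.2.2.
Definition pinst : parser inst :=
  ppair patoms (ppair pbdd (ppair (pseq pbdd) (ppair patoms pform))).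
Lemma good_inst : good pinst (fun u => ser_instance (inst_of u)).
Proof.
exact: (good_pair good_atoms (good_pair good_bdd (good_pair (good_seq good_bdd)
   (good_pair good_atoms good_form)))).
Qed.

Definition parse (w : seq bool) : option inst :=
  if tokens w is Some s then
    (if pinst s is Some u then (if u.2 is [::] then Some u.1 else None) else None)
  else None.

Lemma parseP w u : parse w = Some u <-> encode (inst_of u) = w.
Proof.
have [iP _ _] := good_inst; rewrite /parse /encode; split.
  case e: (tokens w) => [s|] //; move/tokensP: e => <-.
  case e: (pinst s) => [[v [|n r]]|] // -[<-]; move/iP: e => ->.
  by rewrite cats0.
move/tokensP => ->.
by have -> : pinst (ser_instance (inst_of u)) = Some (u, [::]) by apply/iP; rewrite cats0.
Qed.

Lemma cpt_parse_inst X {eX : enc X} (w : X -> seq bool) : cpt false w -> cpt false (fun x => parse (w x)).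
Proof.
apply: cpt_comp; rewrite /parse; apply: cpt_ocase; [exact: cpt_tokens | by cpt |].
apply: cpt_ocase; [by apply: (cpt_parser good_inst); cpt | by cpt | by cpt].
Qed.

Local Open Scope fset_scope.
Local Open Scope nat_scope.

(** * Evaluation of queries *)

Lemma beval_ext e e' b : e =1 e' -> beval e b = beval e' b.
Proof. by move=> E; elim: b => //= [b ->|b -> c ->]. Qed.

Lemma beval_subst e f b : beval e (bsubst f b) = beval (fun v => beval e (f v)) b.
Proof. by elim: b => //= [b ->|b -> c ->]. Qed.

Lemma beval_balls e vs b :
  beval e (balls vs b) <-> forall e', (forall v, v \notin vs -> e' v = e v) -> beval e' b.
Proof.
elim: vs e => [|w vs IH] e /=.
  split=> [H e' E|]; last by apply.
  by rewrite (@beval_ext e' e) // => v; apply: E.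
have E c e0 : beval e0 (bset w c (balls vs b)) =
    beval (fun u => if u == w then c else e0 u) (balls vs b).
  rewrite beval_subst; apply: beval_ext => u; case: ifP => // _.
  by case: c.
rewrite !E; split=> [/andP[H1 H0] e' E'|H].
  have {}E' c : e' w = c -> forall v, v \notin vs -> e' v = if v == w then c else e v.
    by move=> ew v nv; case: eqP => [->//|/eqP ne]; apply: E'; rewrite inE negb_or ne.
  by case ew: (e' w); [move/IH: H1; apply | move/IH: H0; apply]; apply: E'.
apply/andP; split; apply/IH => e' E'; apply: H => v; rewrite inE negb_or => /andP[ne nv];
  by rewrite E' // (negbTE ne).
Qed.

Definition bref_val (vs : seq bool) (r : bref) : bool :=
  match r with inl b => b | inr j => nth false vs j end.
(** One pass computes the values of all nodes, as children precede parents. The formula [bdd_form]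
    unfolds shared nodes, may be exponentially longer than the diagram, and is never written
    down. *)
Definition bddev (e : seq var) (B : bdd) : bool :=
  bref_val (foldl (fun vs (u : var * (bref * bref)) =>
     vs ++ [:: if u.1 \in e then bref_val vs u.2.2 else bref_val vs u.2.1]) [::] (bdd_nodes B))
    (bdd_root B).

Lemma bddevE e B : bev e (bdd_form B) = bddev e B.
Proof.
rewrite /bev /bddev /bdd_form.
have R fs r : beval (fun v => v \in e) (bref_form fs r) = bref_val (map (beval (fun v => v \in e)) fs) r.
  case: r => [[]|j] //=; case: (ltnP j (size fs)) => [lt|le]; first by rewrite (nth_map BBot).
  by rewrite !nth_default ?size_map.
rewrite R; congr bref_val.
elim/last_ind: (bdd_nodes B) => //= s [v [lo hi]] IH.
rewrite !foldl_rcons -IH map_rcons -cats1; congr (_ ++ [:: _]).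
by rewrite /bite /bimp /= !R; case: (v \in e); rewrite /= ?andbT ?negbK ?andbF.
Qed.

(** The semantic side of a substitution: among the variables of [W] with prime flag [b], exactly
    those in [new] become true, provided that [new] is included in [W]; all others keep their
    values. *)
Definition msub (W : seq atom) (b : bool) (new : seq atom) (e : seq var) : seq var :=
  [seq v <- e | ~~ ((v.2 == b) && (v.1 \in W))] ++ [seq (a, b) | a <- new].

Lemma mem_msub W b new e v : {subset new <= W} ->
  (v \in msub W b new e) = if (v.2 == b) && (v.1 \in W) then v.1 \in new else v \in e.
Proof.
move=> sub; rewrite /msub mem_cat mem_filter; case: ifP => [/andP[/eqP vb vW]|nv] /=.
  apply/mapP/idP => [[a an ->]//|vn]; exists v.1 => //.
  by rewrite -vb; case: (v).
case: (v \in e) => //=; apply/mapP => -[a an ev].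
by rewrite ev /= eqxx sub in nv.
Qed.

Definition unp (s : seq atom) : seq var := [seq (a, false) | a <- s].
Definition prm (s : seq atom) : seq var := [seq (a, true) | a <- s].

Lemma mem_unp s v : (v \in unp s) = ~~ v.2 && (v.1 \in s).
Proof.
apply/mapP/andP => [[a as_ ->]//|[]]; case: v => a [] //= _ as_; by exists a.
Qed.

Lemma mem_prm s v : (v \in prm s) = v.2 && (v.1 \in s).
Proof.
apply/mapP/andP => [[a as_ ->]//|[]]; case: v => a [] //= _ as_; by exists a.
Qed.

Definition lmax (s : seq atom) : nat := (foldl maxn 0 [seq a.2 | a <- s]).+1.

Lemma lmaxE F (s : seq atom) : voc F =i s -> layers F = lmax s.
Proof.
move=> E; rewrite /layers /lmax; congr _.+1.
have -> : foldl maxn 0 [seq a.2 | a <- s] = \max_(a <- s) a.2.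
  have G (t : seq atom) k : foldl maxn k [seq a.2 | a <- t] = maxn k (\max_(a <- t) a.2).
    elim: t k => [|a t IH] k /=; first by rewrite big_nil maxn0.
    by rewrite IH big_cons maxnA.
  by rewrite G max0n.
by apply: eq_big_idem => //; apply: maxnn.
Qed.

Definition circl (l : nat) (a : atom) : atom := (a.1, a.2 + l).
Definition Wof (X : transformer) : seq atom := [seq qb.1 | qb <- t_minus X].
Definition postb (X : transformer) (q : atom) : bform :=
  if [seq qb <- t_minus X | qb.1 == q] is qb :: _ then qb.2 else BBot.

Lemma postbE X q : post X q = postb X q.
Proof.
rewrite /post /postb /vminus; elim: (t_minus X) => //= -[a b] s IH /=.
by case: eqP.
Qed.

Lemma circl_inj l : injective (circl l).
Proof. by move=> [a k] [b j] /= [-> /addIn->]. Qed.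

(** The latest update comes first. Of the structure after an update only the vocabulary is
    stored. *)
Definition hist := seq (form * seq atom).
Definition curv (V : seq atom) (H : hist) : seq atom := if H is h :: _ then h.2 else V.
Definition newv (vc : seq atom) (f : form) : seq atom :=
  if f is Event X _ _ then vc ++ t_plus X ++ [seq circl (lmax vc) a | a <- Wof X] else vc.

(** [env_obs] and [env_new] are the valuations at which a knowledge operator evaluates the
    observation, and the law and its argument, once the set [t] has been chosen. For the translation
    they are derived from the old valuation, because quantification and priming affect only the
    current vocabulary; there the primed atoms are reset to [t] as well, since they are
    quantified. *)
Definition env_obs (b : bool) (vc t : seq atom) (e : seq var) : seq var :=
  if b then e ++ prm t else msub vc true t e.
Definition env_new (b : bool) (vc t : seq atom) (e : seq var) : seq var :=
  if b then unp t else msub vc false t (msub vc true t e).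

(** Substitutions act on the valuation from the outside in: first the copies take the values of the
    replaced atoms, then the new atoms are fixed by [x], and finally, in [env_ev], the replaced
    atoms receive the values of their postconditions. For satisfaction [env_ev] lists the state
    s^x. *)
Definition env_ev2 (l : nat) (X : transformer) (x : seq atom) (e : seq var) : seq var :=
  msub (t_plus X) false [seq a <- x | a \in t_plus X]
   (msub [seq circl l a | a <- Wof X] false
     [seq circl l a | a <- Wof X & (a, false) \in e] e).
Definition env_ev (b : bool) (l : nat) (X : transformer) (x : seq atom) (e : seq var) : seq var :=
  if b then [seq v <- e | v.1 \notin Wof X] ++ unp [seq circl l a | a <- Wof X & (a, false) \in e]
            ++ unp x ++ unp [seq a <- Wof X | bev (e ++ unp x) (postb X a)]
  else msub (Wof X) false [seq a <- Wof X | bev (env_ev2 l X x e) (postb X a)] (env_ev2 l X x e).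

(** The valuation before the update: a replaced atom gets back the value kept by its copy. *)
Definition env_law (l : nat) (X : transformer) (e : seq var) : seq var :=
  msub (Wof X) false [seq a <- Wof X | (circl l a, false) \in e] e.
Definition env_obs2 (l : nat) (X : transformer) (e : seq var) : seq var :=
  msub (Wof X) true [seq a <- Wof X | (circl l a, true) \in e] (env_law l X e).
Definition post_ok (l : nat) (X : transformer) (e : seq var) : bool :=
  all (fun a => ((a, false) \in e) == bev (env_law l X e) (postb X a)) (Wof X).

(* A query: a mode, a flag, a history of updates, an environment, a formula, an
   agent, and the atoms of a state left to choose and chosen.  The flag selects
   satisfaction or the Boolean translation.  The modes are: 0, the formula
   holds; 1, it holds in all states that the agent considers possible and that
   extend the choice made so far; 2, the same for the chosen state; 3, the same
   once that state satisfies the law; 4 and 5, the environment satisfies the law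
   and the observation of the agent. *)
Definition query := (nat * (bool * (hist * (seq var * (form * (nat * (seq atom * seq atom)))))))%type.
Definition mkq m b H e f i vs t : query := (m, (b, (H, (e, (f, (i, (vs, t))))))).

Definition vq := (inst * query)%type.
Notation qm v := v.2.1.
Notation qb v := v.2.2.1.
Notation qH v := v.2.2.2.1.
Notation qe v := v.2.2.2.2.1.
Notation qf v := v.2.2.2.2.2.1.
Notation qi v := v.2.2.2.2.2.2.1.
Notation qvs v := v.2.2.2.2.2.2.2.1.
Notation qt v := v.2.2.2.2.2.2.2.2.

Definition qbase (v : vq) : bool :=
  if qm v == 0 then fleaf (qf v)
  else if 4 <= qm v then (if qH v is _ :: _ then false else true) else false.

Definition qg (v : vq) : bool :=
  if qm v == 0 then (match qf v with Top => true | Atom a => (a, false) \in qe v | _ => false end)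
  else if qm v == 4 then bddev (qe v) v.1.2.1
  else bddev (qe v) (nth (Bdd [::] (inl false)) v.1.2.2.1 (qi v)).

Definition qtl (v : vq) : hist := behead (qH v).
Definition qhd (v : vq) : form := if qH v is h :: _ then h.1 else Top.

Definition qa (v : vq) : vq := (v.1,
  if qm v == 0 then
    match qf v with
    | Know i g => mkq 1 (qb v) (qH v) (qe v) g i (curv v.1.1 (qH v)) [::]
    | Event X x _ => mkq 0 (qb v) (qH v) (qe v) (ffix x (t_plus X) (t_pre X)) 0 [::] [::]
    | _ => mkq 0 (qb v) (qH v) (qe v) (fl (qf v)) 0 [::] [::]
    end
  else if qm v == 1 then
    (if qvs v is a :: vs then mkq 1 (qb v) (qH v) (qe v) (qf v) (qi v) vs (qt v)
     else mkq 2 (qb v) (qH v) (qe v) (qf v) (qi v) [::] (qt v))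
  else if qm v == 2 then
    mkq 4 false (qH v) (env_new (qb v) (curv v.1.1 (qH v)) (qt v) (qe v)) Top 0 [::] [::]
  else if qm v == 3 then
    mkq 5 false (qH v) (env_obs (qb v) (curv v.1.1 (qH v)) (qt v) (qe v)) Top (qi v) [::] [::]
  else if qm v == 4 then
    mkq 4 false (qtl v) (if qhd v is Event X _ _
      then env_law (lmax (curv v.1.1 (qtl v))) X (qe v) else qe v) Top 0 [::] [::]
  else mkq 5 false (qtl v) (if qhd v is Event X _ _
      then env_obs2 (lmax (curv v.1.1 (qtl v))) X (qe v) else qe v) Top (qi v) [::] [::]).

Definition qpush (v : vq) (e : seq var) (g : form) : query :=
  mkq 0 (qb v) ((qf v, newv (curv v.1.1 (qH v)) (qf v)) :: qH v) e g 0 [::] [::].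

(** Where one query would do, the second call repeats the first. In mode 4 the second call evaluates
    the translation of what the last update added to the law, the announced formula or the
    precondition; [fl] yields both. *)
Definition qbb (v : vq) (r : bool) : vq := (v.1,
  if qm v == 0 then
    match qf v with
    | And _ h => mkq 0 (qb v) (qH v) (qe v) h 0 [::] [::]
    | Announce _ h => qpush v (qe v) h
    | Event X x h => qpush v (env_ev (qb v) (lmax (curv v.1.1 (qH v))) X x (qe v)) h
    | _ => (qa v).2
    end
  else if qm v == 1 then
    (if qvs v is a :: vs then mkq 1 (qb v) (qH v) (qe v) (qf v) (qi v) vs (a :: qt v)
     else (qa v).2)
  else if qm v == 2 then mkq 3 (qb v) (qH v) (qe v) (qf v) (qi v) [::] (qt v)
  else if qm v == 3 then
    mkq 0 (qb v) (qH v) (env_new (qb v) (curv v.1.1 (qH v)) (qt v) (qe v)) (qf v) 0 [::] [::]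
  else if qm v == 4 then
    mkq 0 false (qtl v) (if qhd v is Event X _ _
      then env_law (lmax (curv v.1.1 (qtl v))) X (qe v) else qe v) (fl (qhd v)) 0 [::] [::]
  else (qa v).2).

Definition qh (v : vq) (r1 r2 : bool) : bool :=
  if qm v == 0 then
    match qf v with Not _ => ~~ r1 | And _ _ => r1 && r2 | Know _ _ => r1 | _ => r1 ==> r2 end
  else if qm v == 1 then r1 && r2
  else if (qm v == 2) || (qm v == 3) then r1 ==> r2
  else if qm v == 4 then
    (if qhd v is Event X _ _ then [&& r1, r2 & post_ok (lmax (curv v.1.1 (qtl v))) X (qe v)]
     else r1 && r2)
  else (if qhd v is Event X _ _ then r1 && bev (qe v) (nth BBot (t_obs X) (qi v)) else r1).

Definition qrec := rec2 qbase qg qa qbb qh.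

Section Correct.

Variable u : inst.

Fixpoint St (H : hist) : bstruct :=
  if H is (w, _) :: H' then
    match w with
    | Announce g _ => announce (St H') g
    | Event X _ _ => product (St H') X
    | _ => St H'
    end
  else inst_struct (inst_of u).

Notation curu := (curv u.1).

Definition isupd (f : form) := match f with Announce _ _ | Event _ _ _ => true | _ => false end.

(** [K] bounds the current vocabulary plus the length of the formula still to be evaluated. Updates
    preserve such a bound, because the atoms they add are counted in the length of the transformer
    that is used up. *)
Fixpoint okH (K : nat) (H : hist) : Prop :=
  if H is (w, vc) :: H' then
    [/\ isupd w, vc = newv (curu H') w, size (curu H') + flen w <= K & okH K H'] else True.

Lemma voc_St K H : okH K H -> voc (St H) =i curu H.
Proof.
elim: H => [|[w vc] H IH] /=; first by move=> _ a; rewrite /= inE.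
case=> uw -> _ /IH{}IH; case: w uw => //= X x h _ a.
rewrite /product /product_with /= 2!in_fsetU IH !mem_cat -orbA; congr (_ || (_ || _)).
  by apply/imfsetP/idP => [[b bX ->]//|aX]; exists a.
by apply/imfsetP/mapP => -[b bX ->]; exists b; rewrite // /circ (lmaxE IH).
Qed.

(** The weight of an update must exceed that of its announced formula or precondition, whose
    translation the new law asks for, and must stay below what an announcement or event loses when
    it is pushed on the history. Counting lengths twice leaves room for a value strictly between. *)
Definition mu1 (w : form) : nat :=
  match w with Announce g _ => 2 * flen g + 1 | Event X _ _ => 2 * tlen X + 1 | _ => 1 end.
Definition mu (H : hist) : nat := sumn [seq mu1 h.1 | h <- H].

(** Choosing a state takes one query per atom of the vocabulary and a few more in modes 2 and 3. The
    remainders thus stay below [K + 5], the unit in which weights are counted. *)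
Definition rank (K : nat) (q : query) : nat :=
  let v := (u, q) in
  if qm v == 0 then (K + 5) * (mu (qH v) + 2 * flen (qf v))
  else if qm v == 1 then (K + 5) * (mu (qH v) + 2 * flen (qf v)) + size (qvs v) + 4
  else if qm v == 2 then (K + 5) * (mu (qH v) + 2 * flen (qf v)) + 3
  else if qm v == 3 then (K + 5) * (mu (qH v) + 2 * flen (qf v)) + 2
  else (K + 5) * mu (qH v) + 1.

Definition fs (e : seq var) : {fset atom} := [fset v.1 | v in e & ~~ v.2].

Definition spec0 (b : bool) H e f : Prop :=
  if b then sat (St H) (fs e) f else bev e (translate (St H) f).
Definition specK (b : bool) H e f i t : Prop :=
  bev (env_new b (curu H) t e) (law (St H)) ->
  bev (env_obs b (curu H) t e) (obs (St H) i) ->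
  spec0 b H (env_new b (curu H) t e) f.

Definition spec (q : query) : Prop :=
  let v := (u, q) in
  if qm v == 0 then spec0 (qb v) (qH v) (qe v) (qf v)
  else if qm v == 1 then forall t, {subset qt v <= t} -> {subset t <= qvs v ++ qt v} ->
     specK (qb v) (qH v) (qe v) (qf v) (qi v) t
  else if qm v == 2 then specK (qb v) (qH v) (qe v) (qf v) (qi v) (qt v)
  else if qm v == 3 then
     bev (env_obs (qb v) (curu (qH v)) (qt v) (qe v)) (obs (St (qH v)) (qi v)) ->
     spec0 (qb v) (qH v) (env_new (qb v) (curu (qH v)) (qt v) (qe v)) (qf v)
  else if qm v == 4 then bev (qe v) (law (St (qH v)))
  else bev (qe v) (obs (St (qH v)) (qi v)).

Definition okq (K : nat) (q : query) : Prop :=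
  let v := (u, q) in
  [/\ okH K (qH v), qm v <= 5,
      qm v < 4 -> size (curu (qH v)) + flen (qf v) <= K,
      qb v -> qm v < 4 -> all (fun w => ~~ w.2) (qe v)
    & 1 <= qm v <= 3 -> {subset qvs v ++ qt v <= curu (qH v)}].

Lemma bev_ext (e e' : seq var) b : e =i e' -> bev e b = bev e' b.
Proof. by move=> E; apply: beval_ext => v; apply: E. Qed.

Lemma fs_ext e e' : e =i e' -> fs e = fs e'.
Proof.
move=> E; apply/fsetP => a; apply/imfsetP/imfsetP => -[v /=]; rewrite !inE ?E => vP ->;
  by exists v; rewrite //= inE ?E // -E.
Qed.

Lemma mem_fs e a : (a \in fs e) = ((a, false) \in e).
Proof.
apply/imfsetP/idP => [[[b c] /=]|ae]; first by rewrite inE /= => /andP[be nc] ->; case: c be nc.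
by exists (a, false); rewrite //= inE ae.
Qed.

Lemma val1_fs e : all (fun w => ~~ w.2) e -> val1 (fs e) =1 (fun v => v \in e).
Proof.
move=> /allP E [a []]; rewrite /val1 /= ?mem_fs //.
by apply/esym/negP => /E.
Qed.

Lemma env_ext b vc t t' e : t =i t' -> {subset t <= vc} ->
  env_obs b vc t e =i env_obs b vc t' e /\ env_new b vc t e =i env_new b vc t' e.
Proof.
move=> E sub; have sub' : {subset t' <= vc} by move=> a; rewrite -E; apply: sub.
rewrite /env_obs /env_new; case: b; split=> v.
- by rewrite !mem_cat !mem_prm E.
- by rewrite !mem_unp E.
- by rewrite !mem_msub // E.
- by rewrite !mem_msub // E.
Qed.

Lemma spec0_ext b H e e' f : e =i e' -> spec0 b H e f <-> spec0 b H e' f.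
Proof. by move=> E; rewrite /spec0 (fs_ext E) (bev_ext _ E). Qed.

Lemma specK_ext b H e f i t t' : t =i t' -> {subset t <= curu H} ->
  specK b H e f i t <-> specK b H e f i t'.
Proof.
move=> E sub; have [E1 E2] := env_ext b e E sub.
by rewrite /specK (bev_ext _ E1) (bev_ext _ E2) (spec0_ext _ _ _ E2).
Qed.

Lemma unp_unp t : all (fun w : var => ~~ w.2) (unp t).
Proof. by rewrite all_map; apply/allP. Qed.

(** Both meanings range over the subsets of the current vocabulary: for satisfaction these are the
    candidates for a state, and for the translation they are the valuations of the quantified primed
    atoms. *)
Lemma spec_know K (b : bool) H (e : seq var) i g : okH K H -> (b -> all (fun w => ~~ w.2) e) ->
  spec0 b H e (Know i g) <-> forall t, {subset t <= curu H} -> specK b H e g i t.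
Proof.
move=> okK unpe; have vE := voc_St okK; rewrite /spec0 /specK; case: b unpe => unpe.
  rewrite sat_know; split=> [S t sub L O|S t].
    have tf : fs (unp t) = [fset a | a in t].
      by apply/fsetP => a; rewrite mem_fs mem_unp /= inE.
    rewrite /spec0 /env_new tf; apply: S.
      rewrite /is_state; apply/andP; split.
        by apply/fsubsetP => a; rewrite inE vE => /sub.
      by rewrite -tf (beval_ext _ (val1_fs (unp_unp t))).
    move: O; rewrite /bev; congr is_true; apply: beval_ext => -[a []] /=.
      by rewrite /env_obs mem_cat mem_prm /val2 /= inE; case aP: ((a, true) \in e) => //; have /allP/(_ _ aP) := unpe isT.
    by rewrite /env_obs mem_cat mem_prm /val2 /= orbF mem_fs.
  move=> /andP[/fsubsetP sub L] O.
  have E : fs (unp (enum_fset t)) = t.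
    by apply/fsetP => a; rewrite mem_fs mem_unp.
  rewrite -E; apply: S => [a at_||].
  - by rewrite -vE; apply: sub.
  - by rewrite /bev -(beval_ext _ (val1_fs (unp_unp _))) E.
  - move: O; rewrite /bev; congr is_true; apply: beval_ext => -[a []] /=.
      by rewrite /env_obs mem_cat mem_prm /val2 /=; case aP: ((a, true) \in e) => //; have /allP/(_ _ aP) := unpe isT.
    by rewrite /env_obs mem_cat mem_prm /val2 /= orbF mem_fs.
rewrite translate_know /bev beval_balls.
have prE e' B : beval e' (bprime (voc (St H)) B) =
   beval (fun v => if ~~ v.2 && (v.1 \in curu H) then e' (v.1, true) else e' v) B.
  by rewrite beval_subst; apply: beval_ext => v; rewrite vE; case: ifP.
have vsE v : (v \in [seq (a, true) | a <- voc (St H)]) = v.2 && (v.1 \in curu H).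
  by rewrite -vE (mem_prm (enum_fset (voc (St H)))).
split=> [S t sub|S e' E'].
  have : forall v, v \notin [seq (a, true) | a <- voc (St H)] ->
      (v \in env_obs false (curu H) t e) = (v \in e).
    by move=> v; rewrite vsE /env_obs mem_msub // eqb_id => /negbTE->.
  move/(S (fun v => v \in env_obs false (curu H) t e)); rewrite /bimp /= !prE.
  have nE : (fun v => if ~~ v.2 && (v.1 \in curu H) then (v.1, true) \in env_obs false (curu H) t e
       else v \in env_obs false (curu H) t e) =1 (fun v => v \in env_new false (curu H) t e).
    move=> [a c] /=; rewrite /env_new /env_obs mem_msub // [in RHS]mem_msub //= eqbF_neg.
    by case: c => //=; case: (a \in curu H); rewrite ?mem_msub //= ?eqxx.
  rewrite !(beval_ext _ nE).
  rewrite /env_new /bev; case: (beval _ (law _)) => //=.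
  by case: (beval _ (obs _ _)) => //=; case: (beval _ _).
pose t := [seq a <- curu H | e' (a, true)].
have sub : {subset t <= curu H} by move=> a; rewrite mem_filter => /andP[].
have oE : (fun v => v \in env_obs false (curu H) t e) =1 e'.
  move=> [a c]; rewrite /env_obs mem_msub //= eqb_id.
  case: ifP => [/andP[cT aC]|nv]; first by rewrite mem_filter aC andbT; case: c cT.
  by rewrite E' // vsE /= nv.
have nE : (fun v => v \in env_new false (curu H) t e) =1
    (fun v => if ~~ v.2 && (v.1 \in curu H) then e' (v.1, true) else e' v).
  move=> [a c]; rewrite /env_new mem_msub //= eqbF_neg.
  case: ifP => [/andP[cF aC]|nv]; first by rewrite mem_filter aC andbT.
  exact: oE.
have := S t sub; rewrite /specK /bev !(beval_ext _ nE) !(beval_ext _ oE) -!prE /bimp /= => SK.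
case: (beval e' (bprime _ (law _))) SK => //= SK; case: (beval e' (obs _ _)) SK => //= SK.
have : bev (env_new false (curu H) t e) (translate (St H) g) := SK isT isT.
by rewrite /bev (beval_ext _ nE) -prE => ->.
Qed.

Lemma env_ev_true K H e X x : okH K H -> all (fun w => ~~ w.2) e ->
  fs (env_ev true (lmax (curu H)) X x e) = state_update (St H) (fs e) X x.
Proof.
move=> okK ue; have lE := lmaxE (voc_St okK).
apply/fsetP => a; rewrite mem_fs /env_ev /state_update !mem_cat mem_filter !mem_unp.
rewrite 3!in_fsetU in_fsetD -!orbA mem_fs; congr [|| _, _, _ | _].
- by congr (~~ _ && _); apply/idP/imfsetP => [aW|[b bW ->]//]; exists a.
- rewrite /=; apply/mapP/imfsetP => [[b]|[b /= ]].
    rewrite mem_filter => /andP[be bW] ->; exists b; last by rewrite /circ lE.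
    by rewrite /= in_fsetI mem_fs be; apply/imfsetP; exists b.
  rewrite in_fsetI mem_fs => /andP[be /imfsetP[c /= cW eb]] ->.
  by exists b; rewrite /circ ?lE // mem_filter be eb.
- by apply/idP/imfsetP => [aW|[b bW ->]//]; exists a.
have E c : bev (e ++ unp x) (postb X c) =
    beval (val1 (fs e `|` [fset c | c in x])) (post X c).
  rewrite postbE; apply: beval_ext => -[d []]; rewrite /val1 mem_cat mem_unp /=.
    by rewrite orbF; apply/negP => /(allP ue).
  by rewrite in_fsetU mem_fs; congr (_ || _); apply/idP/imfsetP => [dx|[b bW ->]//]; exists d.
rewrite /= mem_filter E; apply/andP/imfsetP => [[ca aW]|[b /=]].
  exists a => //=; rewrite inE /= ca andbT; apply/imfsetP; by exists a.
by rewrite inE /= => /andP[/imfsetP[c /= cW eb] cb] ->; rewrite eb in cb *.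
Qed.

Lemma all_env_ev l X x e : all (fun w => ~~ w.2) e -> all (fun w => ~~ w.2) (env_ev true l X x e).
Proof.
move=> /allP ue; apply/allP => v; rewrite /env_ev !mem_cat mem_filter !mem_unp.
by case/or4P => /andP[] // _ /ue.
Qed.

Lemma env_ev_false K H e X x B : okH K H ->
  bev e (buncirc (St H) (vminus X) (bfix x (t_plus X) (bpost X B)))
  = bev (env_ev false (lmax (curu H)) X x e) B.
Proof.
move=> okK; have lE := lmaxE (voc_St okK).
rewrite /bev /buncirc /bfix /bpost !beval_subst.
set l := lmax _ in lE *.
have cE : circ (St H) =1 circl l by move=> a; rewrite /circ lE.
have uK a : uncirc (St H) (circl l a) = a.
  by rewrite /uncirc lE /circl /= addnK; case: a.
have s1 : {subset [seq circl l a | a <- Wof X & (a, false) \in e] <= [seq circl l a | a <- Wof X]}.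
  by move=> a /mapP[b]; rewrite mem_filter => /andP[_ bW] ->; apply: map_f.
have s2 : {subset [seq a <- x | a \in t_plus X] <= t_plus X}.
  by move=> a; rewrite mem_filter => /andP[].
have E1 v : beval (fun v => v \in e) (if ~~ v.2 && (v.1 \in [seq circ (St H) a | a <- vminus X])
      then BVar (uncirc (St H) v.1, false) else BVar v) =
   (v \in msub [seq circl l a | a <- Wof X] false [seq circl l a | a <- Wof X & (a, false) \in e] e).
  rewrite mem_msub // (eq_map cE) eqbF_neg; case: ifP => //= /andP[_ /mapP[a aW ->]].
  by rewrite uK (mem_map (@circl_inj l)) mem_filter aW andbT.
have E2 v : beval (fun v => v \in msub [seq circl l a | a <- Wof X] false
        [seq circl l a | a <- Wof X & (a, false) \in e] e)
      (if ~~ v.2 && (v.1 \in t_plus X) then bconst (v.1 \in x) else BVar v) = (v \in env_ev2 l X x e).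
  rewrite mem_msub // eqbF_neg; case: ifP => //= /andP[_ vV].
  by rewrite mem_filter vV; case: (_ \in x).
have s3 : {subset [seq a <- Wof X | bev (env_ev2 l X x e) (postb X a)] <= Wof X}.
  by move=> a; rewrite mem_filter => /andP[].
apply: beval_ext => v; rewrite mem_msub // eqbF_neg.
have E12 b : beval (fun v => beval (fun v => beval (fun v => v \in e)
      (if ~~ v.2 && (v.1 \in [seq circ (St H) a | a <- vminus X])
      then BVar (uncirc (St H) v.1, false) else BVar v))
      (if ~~ v.2 && (v.1 \in t_plus X) then bconst (v.1 \in x) else BVar v)) b = bev (env_ev2 l X x e) b.
  by apply: beval_ext => w; rewrite -E2; apply: beval_ext.
rewrite E12; case: ifP => [/andP[_ vW]|] //.
by rewrite mem_filter vW andbT postbE.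
Qed.

Lemma env_lawE K H e X B : okH K H ->
  bev e (bcirc (St H) (vminus X) B) = bev (env_law (lmax (curu H)) X e) B.
Proof.
move=> okK; have lE := lmaxE (voc_St okK).
rewrite /bev /bcirc beval_subst; apply: beval_ext => v.
rewrite mem_msub => [|a]; last by rewrite mem_filter => /andP[].
rewrite eqbF_neg; case: ifP => //= /andP[_ vW].
by rewrite mem_filter vW andbT /circ lE.
Qed.

Lemma env_obsE K H e X B : okH K H ->
  bev e (bcirc (St H) (vminus X) (bcirc' (St H) (vminus X) B)) = bev (env_obs2 (lmax (curu H)) X e) B.
Proof.
move=> okK; have lE := lmaxE (voc_St okK).
rewrite (env_lawE _ _ _ okK) /bev /bcirc' beval_subst; apply: beval_ext => v.
have s1 b : {subset [seq a <- Wof X | (circl (lmax (curu H)) a, b) \in e] <= Wof X}.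
  by move=> a; rewrite mem_filter => /andP[].
rewrite mem_msub // eqb_id; case: ifP => //= /andP[_ vW].
by rewrite mem_filter vW andbT mem_msub //= /circ lE.
Qed.

Lemma law_product K H e X : okH K H ->
  bev e (law (product (St H) X)) =
  [&& bev (env_law (lmax (curu H)) X e) (law (St H)),
      bev (env_law (lmax (curu H)) X e) (translate (St H) (t_pre X))
    & post_ok (lmax (curu H)) X e].
Proof.
move=> okK; have Eb := env_lawE e X _ okK; rewrite andbA.
have -> : bev e (law (product (St H) X)) = bev e (bcirc (St H) (vminus X)
      (BAnd (law (St H)) (translate (St H) (t_pre X)))) &&
   bev e (foldr BAnd BTop [seq biff (BVar (q, false)) (bcirc (St H) (vminus X) (post X q)) | q <- vminus X]).
  by [].
rewrite Eb; congr (_ && _); rewrite /post_ok -/(vminus X).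
have -> : Wof X = vminus X by [].
suff G s : bev e (foldr BAnd BTop [seq biff (BVar (q, false)) (bcirc (St H) (vminus X) (post X q)) | q <- s])
   = all (fun a => ((a, false) \in e) == bev (env_law (lmax (curu H)) X e) (postb X a)) s by apply: G.
elim: s => // q s IH.
rewrite /= -IH -postbE -Eb /bev /=; congr (_ && _).
by case: (_ \in e); case: (beval _ _).
Qed.

Lemma obs_product K H e X i : okH K H ->
  bev e (obs (product (St H) X) i) =
  bev (env_obs2 (lmax (curu H)) X e) (obs (St H) i) && bev e (nth BBot (t_obs X) i).
Proof. by move=> okK; rewrite -(env_obsE e X _ okK). Qed.

Lemma ltn_rank c a b x y : a < b -> x < c + y -> c * a + x < c * b + y.
Proof.
move=> ab xy; have le : c * a.+1 <= c * b by rewrite leq_mul2l ab orbT.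
by rewrite mulnS in le; lia.
Qed.

Lemma iffN (r : bool) P : (r <-> P) -> (~~ r <-> ~ P).
Proof. by move=> [a b]; split=> [/negP n /b|n]; [apply: n|apply/negP => /a]. Qed.
Lemma iffA (r1 r2 : bool) P Q : (r1 <-> P) -> (r2 <-> Q) -> (r1 && r2 <-> P /\ Q).
Proof. by move=> [a b] [c d]; split=> [/andP[/a ? /c ?]|[/b ? /d ?]] //; apply/andP. Qed.
Lemma iffI (r1 r2 : bool) P Q : (r1 <-> P) -> (r2 <-> Q) -> (r1 ==> r2 <-> (P -> Q)).
Proof. by move=> [a b] [c d]; split=> [/implyP n /b/n/c|n] //; apply/implyP => /a/n/d. Qed.
Lemma iff_impl (a b : bool) : ~~ (a && ~~ b) <-> (a -> b).
Proof. by case: a b => [] []; split=> //; apply. Qed.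

Lemma spec0_not b H e g : spec0 b H e (Not g) <-> ~ spec0 b H e g.
Proof.
rewrite /spec0; case: b; first exact: sat_not.
by rewrite translate_not /bev /=; apply: iffN.
Qed.

Lemma spec0_and b H e g h : spec0 b H e (And g h) <-> spec0 b H e g /\ spec0 b H e h.
Proof.
rewrite /spec0; case: b; first exact: sat_and.
by rewrite translate_and /bev /=; apply: iffA.
Qed.

Lemma spec0_announce b H e g h vc :
  spec0 b H e (Announce g h) <-> (spec0 b H e g -> spec0 b ((Announce g h, vc) :: H) e h).
Proof.
rewrite /spec0; case: b; first exact: sat_announce.
by rewrite translate_announce /bev /bimp /=; apply: iff_impl.
Qed.

Lemma spec0_event K (b : bool) H (e : seq var) X x h vc : okH K H -> (b -> all (fun w => ~~ w.2) e) ->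
  spec0 b H e (Event X x h) <-> (spec0 b H e (ffix x (t_plus X) (t_pre X)) ->
     spec0 b ((Event X x h, vc) :: H) (env_ev b (lmax (curu H)) X x e) h).
Proof.
move=> okK; rewrite /spec0; case: b => ue.
  by rewrite (env_ev_true _ _ okK) ?ue //; apply: sat_event.
rewrite -(env_ev_false _ _ _ _ okK) translate_event /bimp; exact: iff_impl.
Qed.

Lemma rank_gt0 K q : 0 < rank K q.
Proof.
rewrite /rank; case: ifP => _; first by rewrite muln_gt0 addn_gt0 orbT /= addn_gt0 muln_gt0 flen_gt0 orbT.
by do 3?[case: ifP => _]; lia.
Qed.

(** Each mode makes calls of smaller rank, so fuel that starts at the rank or above never runs out
    before a base case. *)
Theorem qrecP K m q : okq K q -> rank K q <= m -> qrec m (u, q) <-> spec q.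
Proof.
elim: m q => [|m IH] q; first by rewrite leqNgt rank_gt0.
case: q => md [b [H [e [f [i [vs t]]]]]] [/= okK le5 size_f ue sub] rk.
have sub0 (b' : bool) H' (e' : seq var) g : okH K H' -> size (curu H') + flen g <= K ->
    (b' -> all (fun w => ~~ w.2) e') ->
    (K + 5) * (mu H' + 2 * flen g) <= m -> qrec m (u, mkq 0 b' H' e' g 0 [::] [::]) <-> spec0 b' H' e' g.
  by move=> h1 h2 h3 h4; apply: (IH (mkq 0 b' H' e' g 0 [::] [::])) => //; split=> //= *; apply: h3.
have lawP H' e' : okH K H' -> (K + 5) * mu H' + 1 <= m ->
    qrec m (u, mkq 4 false H' e' Top 0 [::] [::]) <-> bev e' (law (St H')).
  by move=> h1 h2; apply: (IH (mkq 4 false H' e' Top 0 [::] [::])).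
have obsP H' e' j : okH K H' -> (K + 5) * mu H' + 1 <= m ->
    qrec m (u, mkq 5 false H' e' Top j [::] [::]) <-> bev e' (obs (St H') j).
  by move=> h1 h2; apply: (IH (mkq 5 false H' e' Top j [::] [::])).
have unpN t' : b -> all (fun w => ~~ w.2) (env_new b (curu H) t' e).
  by rewrite /env_new => ->; apply: unp_unp.
case: md le5 size_f ue sub rk => [|[|[|[|[|[|md]]]]]] // _ size_f ue sub rk.
- have {}size_f := size_f isT; have {}ue := fun x => ue x isT.
  have lt a : a < mu H + 2 * flen f -> (K + 5) * a <= m.
    by move=> l; rewrite -ltnS; apply: leq_trans rk; rewrite /rank /= ltn_pmul2l //; lia.
  rewrite /spec /=; case: f size_f lt rk => [||a|g|g h|j g|g h|X x h] size_f lt rk; rewrite /qbase /=.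
  + by rewrite /qg /= /spec0; case: (b).
  + by rewrite /qg /= /spec0; case: (b).
  + by rewrite /qg /= /spec0; case: (b) => //; rewrite /sat /= mem_fs.
  + rewrite spec0_not; apply: iffN; apply: sub0 => //; first by move: size_f => /=; lia.
    by apply: lt => /=; lia.
  + rewrite spec0_and; apply: iffA; (apply: sub0 => //; first by move: size_f => /=; lia);
    by apply: lt => /=; lia.
  + rewrite (spec_know _ _ okK) //.
    have R : qrec m (u, mkq 1 b H e g j (curu H) [::]) <-> spec (mkq 1 b H e g j (curu H) [::]).
      apply: IH; last first.
        rewrite /rank /= -ltnS; apply: leq_trans rk; rewrite /rank /= -[X in _ < X]addn0 -addnA.
        by apply: ltn_rank => /=; move: size_f => /=; lia.
      by split=> //= *; [move: size_f => /=; lia | apply: ue | rewrite cats0].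
    rewrite /qh /qa /= R /spec /=; split=> S t' s; first by apply: S => //; rewrite cats0.
    by rewrite cats0 => s'; apply: S.
  + rewrite (spec0_announce _ _ _ _ _ (curu H)); apply: iffI; apply: sub0 => //=;
      by [move: size_f => /=; lia | apply: lt => /=; rewrite /mu /=; lia].
  + rewrite (spec0_event _ _ _ (newv (curu H) (Event X x h)) okK) //.
    have tp := tlen_pre X; have ts : size (t_plus X) + size (t_minus X) <= tlen X.
      by case: (X) => /= *; lia.
    apply: iffI; apply: sub0 => //=.
    * by rewrite ffix_len; move: size_f => /=; lia.
    * by apply: lt; rewrite ffix_len /=; lia.
    * by rewrite !size_cat !size_map; move: size_f => /=; lia.
    * by move=> bT; rewrite bT; apply: all_env_ev; apply: ue.
    * by apply: lt; rewrite /mu /=; lia.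
- have {}size_f := size_f isT; have {}ue := fun x => ue x isT; have {}sub := sub isT.
  rewrite /qbase /=; case: vs sub rk => [|a vs] sub rk; rewrite /qh /qa /qbb /=.
    have R : qrec m (u, mkq 2 b H e f i [::] t) <-> spec (mkq 2 b H e f i [::] t).
      apply: IH; last by move: rk; rewrite /rank /=; lia.
      by split=> //= *; apply: ue.
    (* With no atom left to decide, the only admissible set is [t], up to the way it is listed. *)
    rewrite andbb R /spec /=; split=> [S t' s1 s2|]; last by apply.
    have tE : t =i t' by move=> x; apply/idP/idP => [/s1|/s2].
    by have [G _] := specK_ext b e f i tE sub; apply: G.
  have R t' : {subset vs ++ t' <= curu H} ->
      qrec m (u, mkq 1 b H e f i vs t') <-> spec (mkq 1 b H e f i vs t').
    move=> s; apply: IH; last by move: rk; rewrite /rank /=; lia.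
    by split=> //= *; apply: ue.
  have s1 : {subset vs ++ t <= curu H}.
    by move=> x xs; apply: sub; rewrite inE xs orbT.
  have s2 : {subset vs ++ a :: t <= curu H}.
    by move=> x xs; apply: sub; move: xs; rewrite !(inE, mem_cat) orbCA.
  have /= R1 := R _ s1; have /= R2 := R _ s2.
  (* The sets that remain possible are split according to whether they contain [a]. *)
  have -> : spec (mkq 1 b H e f i (a :: vs) t) <->
     spec (mkq 1 b H e f i vs t) /\ spec (mkq 1 b H e f i vs (a :: t)); last exact: iffA.
  rewrite /spec /=; split=> [S|[S1 S2] t' st ts].
    split=> t' st ts; apply: S => //.
    + by move=> x /ts xs; rewrite inE xs orbT.
    + by move=> x xt; apply: st; rewrite inE xt orbT.
    + by move=> x /ts; rewrite !(inE, mem_cat) orbCA.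
  case at': (a \in t').
    apply: S2 => x; first by rewrite inE => /orP[/eqP->|/st].
    by move/ts; rewrite !(inE, mem_cat) orbCA.
  apply: S1 => // x xt; have := ts x xt; rewrite inE => /orP[/eqP ea|//].
  by rewrite -ea xt in at'.
- have {}size_f := size_f isT; have {}ue := fun x => ue x isT; have {}sub := sub isT.
  rewrite /qbase /qh /qa /qbb /= /spec /= /specK; apply: iffI.
    by apply: lawP => //; move: rk; rewrite /rank /= mulnDr; lia.
  apply: (IH (mkq 3 b H e f i [::] t)); last by move: rk; rewrite /rank /=; lia.
  by split=> //=; [move=> ? _; apply: ue | move=> _ x xt; apply: sub; rewrite mem_cat xt orbT].
- have {}size_f := size_f isT.
  rewrite /qbase /qh /qa /qbb /= /spec /= ; apply: iffI.
    by apply: obsP => //; move: rk; rewrite /rank /= mulnDr; lia.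
  by apply: sub0 => //; [exact: unpN | move: rk; rewrite /rank /=; lia].
- case: H okK rk {sub size_f ue unpN} => [|[w vc] H] okK rk; rewrite /qbase /=.
    by rewrite /qg /= /spec /= -bddevE.
  case: okK => uw -> sw okK.
  have lt : (K + 5) * (mu1 w + mu H) <= m by move: rk; rewrite /rank /= /mu /=; lia.
  have le : (K + 5) * mu H + 1 <= m.
    apply: leq_trans lt; rewrite mulnDr addnC leq_add2r muln_gt0 addn_gt0 orbT.
    by case: (w) uw => //= *; lia.
  rewrite /spec /= /qh /qa /qbb /qtl /qhd /=; case: w uw sw lt {rk} => //= [g h _ sw lt|X x h _ sw lt].
    rewrite [bev e _]/(bev e (law (St H)) && bev e (translate (St H) g)).
    apply: (iff_trans (iffA (lawP H e okK le) (sub0 false H e g okK _ _ _))) => //.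
    + by lia.
    + by apply: leq_trans lt; rewrite leq_mul2l; apply/orP; right; lia.
    + by split=> [|/andP[]] // [-> ->].
  rewrite (law_product _ _ okK).
  have P1 := lawP H (env_law (lmax (curu H)) X e) okK le.
  have P2 : qrec m (u, mkq 0 false H (env_law (lmax (curu H)) X e) (t_pre X) 0 [::] [::]) <->
     bev (env_law (lmax (curu H)) X e) (translate (St H) (t_pre X)).
    apply: (sub0 false) => //; first by have := tlen_pre X; lia.
    apply: leq_trans lt; rewrite leq_mul2l; apply/orP; right.
    by have := tlen_pre X; lia.
  by apply: iff_trans (iffA P1 (iffA P2 (iff_refl (post_ok _ _ _)))) _; split=> [[-> [-> ->]]|/and3P[-> -> ->]].
case: H okK rk {sub size_f ue unpN} => [|[w vc] H] okK rk; rewrite /qbase /=.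
  rewrite /qg /= /spec /= -bddevE; case: (ltnP i (size u.2.2.1)) => li.
    by rewrite (nth_map (Bdd [::] (inl false))).
  by rewrite !nth_default ?size_map.
case: okK => uw -> sw okK.
have le : (K + 5) * mu H + 1 <= m.
  have lt : (K + 5) * (mu1 w + mu H) <= m by move: rk; rewrite /rank /= /mu /=; lia.
  apply: leq_trans lt; rewrite mulnDr addnC leq_add2r muln_gt0 addn_gt0 orbT.
  by case: (w) uw => //= *; lia.
rewrite /spec /= /qh /qa /qbb /qtl /qhd /=; case: w uw sw {rk} => //= [g h _ sw|X x h _ sw].
  exact: obsP.
rewrite (obs_product _ _ _ okK).
by apply: iff_trans (iffA (obsP H _ i okK le) (iff_refl _)) _; split=> [[-> ->]|/andP[-> ->]].
Qed.

End Correct.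

(** * Complexity of the evaluation *)

Ltac cpt_user ::= first [ cpt_form | cpt_fun ].

Lemma cpt_bref_val X {eX : enc X} (vs : X -> seq bool) (r : X -> bref) :
  cpt false vs -> cpt false r -> cpt false (fun x => bref_val (vs x) (r x)).
Proof.
move=> *; apply: (@cpt_comp false _ _ _ _ _ _ (fun x => (vs x, r x)) (fun y => bref_val y.1 y.2)); last by cpt.
by rewrite /bref_val; apply: (@cpt_scase false (seq bool * bref)%type _ bool nat bool _ _ _ snd (fun _ b => b) (fun y j => nth false y.1 j)); cpt.
Qed.

Lemma cpt_bddev X {eX : enc X} (e : X -> seq var) (B : X -> bdd) :
  cpt false e -> cpt false B -> cpt false (fun x => bddev (e x) (B x)).
Proof.
move=> Ce CB; rewrite /bddev; apply: cpt_bref_val; last by cpt.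
have [q szq] := cpt_size (cpt_bdd_nodes CB).
apply: (cpt_foldl (op := fun x (vs : seq bool) (u : var * (bref * bref)) =>
  vs ++ [:: if u.1 \in e x then bref_val vs u.2.2 else bref_val vs u.2.1])
  (p := fun n => 10 * pb q n + 10)).
- by cpt.
- by cpt.
- apply: cpt_cat; first by cpt.
  apply: cpt_cons; last by cpt.
  have Ce' : cpt false (fun u : X * seq bool * (var * (bref * bref)) => e u.1.1).
    by apply: (@cpt_comp false _ _ _ _ _ _ (fun u : X * seq bool * (var * (bref * bref)) => u.1.1) e) => //; cpt.
  apply: cpt_if; first by cpt.
    by apply: cpt_bref_val; cpt.
  by apply: cpt_bref_val; cpt.
- by polyn.
move=> x i; set s := take i _.
have le : size s <= pb q (sz x).
  apply: leq_trans (szq x); know (size_sz (bdd_nodes (B x))).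
  by rewrite /s size_take_min; lia.
set w := foldl _ _ _; have sw : size w = size s.
  rewrite /w; elim/last_ind: (s) => // t y IH.
  by rewrite foldl_rcons size_cat IH size_rcons addn1.
have : all (fun b : bool => sz b <= 9) w by apply/allP => b _; know (sz_bool b); lia.
by move/sz_all; rewrite sw; lia.
Qed.

Lemma cpt_msub X {eX : enc X} (W new : X -> seq atom) (b : X -> bool) (e : X -> seq var) :
  cpt false W -> cpt false b -> cpt false new -> cpt false e ->
  cpt false (fun x => msub (W x) (b x) (new x) (e x)).
Proof.
move=> CW Cb Cn Ce; rewrite /msub; apply: cpt_cat.
  apply: (cpt_filter (F := fun x (v : var) => ~~ ((v.2 == b x) && (v.1 \in W x)))) => //.
  have C1 : cpt false (fun u : X * var => b u.1) by apply: (cpt_comp Cb); cpt.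
  have C2 : cpt false (fun u : X * var => W u.1) by apply: (cpt_comp CW); cpt.
  by cpt.
apply: (cpt_map (F := fun x (a : atom) => (a, b x))) => //.
have C1 : cpt false (fun u : X * atom => b u.1) by apply: (cpt_comp Cb); cpt.
by cpt.
Qed.

Lemma cpt_unp X {eX : enc X} (s : X -> seq atom) : cpt false s -> cpt false (fun x => unp (s x)).
Proof. by move=> *; rewrite /unp; cpt. Qed.
Lemma cpt_prm X {eX : enc X} (s : X -> seq atom) : cpt false s -> cpt false (fun x => prm (s x)).
Proof. by move=> *; rewrite /prm; cpt. Qed.

Lemma lmax_sz (s : seq atom) : foldl maxn 0 [seq a.2 | a <- s] <= sz s.
Proof.
have G : forall k, foldl maxn k [seq a.2 | a <- s] <= maxn k (sz s); last by have := G 0; rewrite max0n.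
elim: s => [|[a b] s IH] k /=; first exact: leq_maxl.
apply: leq_trans (IH _) _; rewrite sz_cons sz_pair !sz_nat.
by move: (sz s) => n; lia.
Qed.

Lemma cpt_lmax X {eX : enc X} (s : X -> seq atom) : cpt false s -> cpt false (fun x => lmax (s x)).
Proof.
move=> Cs; rewrite /lmax; apply: cpt_S; have [q szq] := cpt_size Cs.
apply: (cpt_foldl (op := fun _ : X => maxn) (p := fun n => 2 * pb q n + 1)).
- by cpt.
- by cpt.
- by rewrite /maxn; cpt.
- by polyn.
move=> x i; rewrite sz_nat -map_take.
rewrite -mul2n addn1 ltnS leq_pmul2l //.
exact: leq_trans (lmax_sz _) (leq_trans (sz_take _ _) (szq x)).
Qed.

Lemma cpt_circl X {eX : enc X} (l : X -> nat) (a : X -> atom) :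
  cpt false l -> cpt false a -> cpt false (fun x => circl (l x) (a x)).
Proof. by move=> *; rewrite /circl; cpt. Qed.

Lemma cpt_Wof X {eX : enc X} (T : X -> transformer) : cpt false T -> cpt false (fun x => Wof (T x)).
Proof. by move=> *; rewrite /Wof; cpt. Qed.

Lemma cpt_postb X {eX : enc X} (T : X -> transformer) (a : X -> atom) :
  cpt false T -> cpt false a -> cpt false (fun x => postb (T x) (a x)).
Proof.
move=> CT Ca; rewrite /postb; apply: cpt_lcase; [|by cpt|by cpt].
apply: (cpt_filter (F := fun x (qb : atom * bform) => qb.1 == a x)); first by cpt.
have C1 : cpt false (fun u : X * (atom * bform) => a u.1) by apply: (cpt_comp Ca); cpt.
by cpt.
Qed.

Ltac cpt_ev := lazymatch goal with
  | |- cpt _ (fun x => bddev (@?f x) (@?g x)) => apply: cpt_bddev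
  | |- cpt _ (fun x => msub (@?f x) (@?g x) (@?h x) (@?k x)) => apply: cpt_msub
  | |- cpt _ (fun x => unp (@?f x)) => apply: cpt_unp
  | |- cpt _ (fun x => prm (@?f x)) => apply: cpt_prm
  | |- cpt _ (fun x => lmax (@?f x)) => apply: cpt_lmax
  | |- cpt _ (fun x => circl (@?f x) (@?g x)) => apply: cpt_circl
  | |- cpt _ (fun x => Wof (@?f x)) => apply: cpt_Wof
  | |- cpt _ (fun x => postb (@?f x) (@?g x)) => apply: cpt_postb
  end.
Ltac cpt_user ::= first [ cpt_form | cpt_fun | cpt_ev ].

Notation lXe := (nat * (transformer * (seq atom * seq var)))%type.

Lemma cpt_env_ev2' : cpt false (fun y : lXe => env_ev2 y.1 y.2.1 y.2.2.1 y.2.2.2).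
Proof. by rewrite /env_ev2; cpt. Qed.
Lemma cpt_env_ev2 X {eX : enc X} (l : X -> nat) (T : X -> transformer) (x : X -> seq atom) (e : X -> seq var) :
  cpt false l -> cpt false T -> cpt false x -> cpt false e ->
  cpt false (fun z => env_ev2 (l z) (T z) (x z) (e z)).
Proof.
move=> *; apply: (@cpt_comp false _ _ _ _ _ _ (fun z => (l z, (T z, (x z, e z)))) _ cpt_env_ev2').
by cpt.
Qed.

Lemma cpt_env_law' : cpt false (fun y : lXe => env_law y.1 y.2.1 y.2.2.2).
Proof. by rewrite /env_law; cpt. Qed.
Lemma cpt_env_law X {eX : enc X} (l : X -> nat) (T : X -> transformer) (e : X -> seq var) :
  cpt false l -> cpt false T -> cpt false e ->
  cpt false (fun z => env_law (l z) (T z) (e z)).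
Proof.
move=> *; apply: (@cpt_comp false _ _ _ _ _ _ (fun z => (l z, (T z, ([::], e z)))) _ cpt_env_law').
by cpt.
Qed.

Ltac cpt_ev2 := lazymatch goal with
  | |- cpt _ (fun x => env_ev2 (@?f x) (@?g x) (@?h x) (@?k x)) => apply: cpt_env_ev2
  | |- cpt _ (fun x => env_law (@?f x) (@?g x) (@?h x)) => apply: cpt_env_law
  end.
Ltac cpt_user ::= first [ cpt_form | cpt_fun | cpt_ev | cpt_ev2 ].

Lemma cpt_env_ev' : cpt false (fun y : bool * lXe => env_ev y.1 y.2.1 y.2.2.1 y.2.2.2.1 y.2.2.2.2).
Proof. by rewrite /env_ev; cpt. Qed.
Lemma cpt_env_ev X {eX : enc X} (b : X -> bool) (l : X -> nat) (T : X -> transformer) (x : X -> seq atom) (e : X -> seq var) :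
  cpt false b -> cpt false l -> cpt false T -> cpt false x -> cpt false e ->
  cpt false (fun z => env_ev (b z) (l z) (T z) (x z) (e z)).
Proof.
move=> *; apply: (@cpt_comp false _ _ _ _ _ _ (fun z => (b z, (l z, (T z, (x z, e z))))) _ cpt_env_ev').
by cpt.
Qed.

Lemma cpt_env_obs2' : cpt false (fun y : lXe => env_obs2 y.1 y.2.1 y.2.2.2).
Proof. by rewrite /env_obs2; cpt. Qed.
Lemma cpt_env_obs2 X {eX : enc X} (l : X -> nat) (T : X -> transformer) (e : X -> seq var) :
  cpt false l -> cpt false T -> cpt false e ->
  cpt false (fun z => env_obs2 (l z) (T z) (e z)).
Proof.
move=> *; apply: (@cpt_comp false _ _ _ _ _ _ (fun z => (l z, (T z, ([::], e z)))) _ cpt_env_obs2').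
by cpt.
Qed.

Lemma cpt_post_ok' : cpt false (fun y : lXe => post_ok y.1 y.2.1 y.2.2.2).
Proof. by rewrite /post_ok; cpt. Qed.
Lemma cpt_post_ok X {eX : enc X} (l : X -> nat) (T : X -> transformer) (e : X -> seq var) :
  cpt false l -> cpt false T -> cpt false e ->
  cpt false (fun z => post_ok (l z) (T z) (e z)).
Proof.
move=> *; apply: (@cpt_comp false _ _ _ _ _ _ (fun z => (l z, (T z, ([::], e z)))) _ cpt_post_ok').
by cpt.
Qed.

Lemma cpt_env_obs X {eX : enc X} (b : X -> bool) (vc t : X -> seq atom) (e : X -> seq var) :
  cpt false b -> cpt false vc -> cpt false t -> cpt false e ->
  cpt false (fun z => env_obs (b z) (vc z) (t z) (e z)).
Proof. by move=> *; rewrite /env_obs; cpt. Qed.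
Lemma cpt_env_new X {eX : enc X} (b : X -> bool) (vc t : X -> seq atom) (e : X -> seq var) :
  cpt false b -> cpt false vc -> cpt false t -> cpt false e ->
  cpt false (fun z => env_new (b z) (vc z) (t z) (e z)).
Proof. by move=> *; rewrite /env_new; cpt. Qed.

Lemma cpt_curv X {eX : enc X} (V : X -> seq atom) (H : X -> hist) :
  cpt false V -> cpt false H -> cpt false (fun z => curv (V z) (H z)).
Proof. by move=> *; rewrite /curv; cpt. Qed.

Lemma cpt_newv' : cpt false (fun y : seq atom * form => newv y.1 y.2).
Proof. by rewrite /newv; cpt. Qed.
Lemma cpt_newv X {eX : enc X} (V : X -> seq atom) (f : X -> form) :
  cpt false V -> cpt false f -> cpt false (fun z => newv (V z) (f z)).
Proof.
by move=> *; apply: (@cpt_comp false _ _ _ _ _ _ (fun z => (V z, f z)) _ cpt_newv'); cpt.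
Qed.
Lemma cpt_behead X A {eX : enc X} {eA : enc A} (s : X -> seq A) :
  cpt false s -> cpt false (fun z => behead (s z)).
Proof. by move=> *; rewrite /behead; cpt. Qed.
Lemma cpt_fl' X {eX : enc X} (f : X -> form) : cpt false f -> cpt false (fun z => fl (f z)).
Proof. by move=> C; apply: (cpt_comp cpt_fl C). Qed.
Lemma cpt_fleaf' X {eX : enc X} (f : X -> form) : cpt false f -> cpt false (fun z => fleaf (f z)).
Proof. by move=> C; apply: (cpt_comp cpt_fleaf C). Qed.

Ltac cpt_ev3 := lazymatch goal with
  | |- cpt _ (fun x => env_ev (@?b x) (@?f x) (@?g x) (@?h x) (@?k x)) => apply: cpt_env_ev
  | |- cpt _ (fun x => env_obs2 (@?f x) (@?g x) (@?h x)) => apply: cpt_env_obs2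
  | |- cpt _ (fun x => post_ok (@?f x) (@?g x) (@?h x)) => apply: cpt_post_ok
  | |- cpt _ (fun x => env_obs (@?f x) (@?g x) (@?h x) (@?k x)) => apply: cpt_env_obs
  | |- cpt _ (fun x => env_new (@?f x) (@?g x) (@?h x) (@?k x)) => apply: cpt_env_new
  | |- cpt _ (fun x => curv (@?f x) (@?g x)) => apply: cpt_curv
  | |- cpt _ (fun x => newv (@?f x) (@?g x)) => apply: cpt_newv
  | |- cpt _ (fun x => behead (@?f x)) => apply: cpt_behead
  | |- cpt _ (fun x => fl (@?f x)) => apply: cpt_fl'
  | |- cpt _ (fun x => fleaf (@?f x)) => apply: cpt_fleaf'
  end.
Ltac cpt_user ::= first [ cpt_form | cpt_fun | cpt_ev | cpt_ev2 | cpt_ev3 ].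

Lemma cpt_qbase : cpt false qbase.
Proof. by rewrite /qbase; cpt. Qed.
Lemma cpt_qg : cpt false qg.
Proof. by rewrite /qg; cpt. Qed.
Lemma cpt_qhd : cpt false qhd.
Proof. by rewrite /qhd; cpt. Qed.
Lemma cpt_qhd' X {eX : enc X} (f : X -> vq) : cpt false f -> cpt false (fun z => qhd (f z)).
Proof. by move=> C; apply: (cpt_comp cpt_qhd C). Qed.
Ltac cpt_ev4 := lazymatch goal with
  | |- cpt _ (fun x => qhd (@?f x)) => apply: cpt_qhd'
  end.
Ltac cpt_user ::= first [ cpt_form | cpt_fun | cpt_ev | cpt_ev2 | cpt_ev3 | cpt_ev4 ].
Lemma cpt_qa : cpt false qa.
Proof. by rewrite /qa /qtl /mkq; cpt. Qed.
Lemma cpt_qa' X {eX : enc X} (f : X -> vq) : cpt false f -> cpt false (fun z => qa (f z)).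
Proof. by move=> C; apply: (cpt_comp cpt_qa C). Qed.
Ltac cpt_ev5 := lazymatch goal with
  | |- cpt _ (fun x => qa (@?f x)) => apply: cpt_qa'
  end.
Ltac cpt_user ::= first [ cpt_form | cpt_fun | cpt_ev | cpt_ev2 | cpt_ev3 | cpt_ev4 | cpt_ev5 ].
Lemma cpt_qbb : cpt false (fun u : vq * bool => qbb u.1 u.2).
Proof. by rewrite /qbb /qpush /qtl /mkq; cpt. Qed.
Lemma cpt_qh : cpt false (fun u : vq * bool * bool => qh u.1.1 u.1.2 u.2).
Proof. by rewrite /qh /qtl; cpt. Qed.

(** * Deciding the validity of an instance *)

Definition uniqb (s : seq (var * (bref * bref))) : bool :=
  all (fun i => ~~ (nth (((0, 0), false), (inl false, inl false)) s i \in drop i.+1 s)) (iota 0 (size s)).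

Lemma uniqbE s : uniqb s = uniq s.
Proof.
rewrite /uniqb; elim: s => //= x s IH; rewrite drop0 -IH; congr (_ && _).
by rewrite -[1]/(1 + 0) iotaDl all_map; apply: eq_all.
Qed.

Definition inV (p : bool) (V : seq atom) (v : var) : bool := (p || ~~ v.2) && (v.1 \in V).
Definition child_ok (B : bdd) (i : nat) (r : bref) : bool :=
  match r with inr j => (j < i) && var_lt (bdd_node B i).1 (bdd_node B j).1 | inl _ => true end.
Definition node_ok (p : bool) (V : seq atom) (B : bdd) (i : nat) : bool :=
  [&& inV p V (bdd_node B i).1, (bdd_node B i).2.1 != (bdd_node B i).2.2,
      child_ok B i (bdd_node B i).2.1, child_ok B i (bdd_node B i).2.2
    & (bdd_root B == inr i) || has (fun u => (u.2.1 == inr i) || (u.2.2 == inr i)) (bdd_nodes B)].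
Definition robddb (p : bool) (V : seq atom) (B : bdd) : bool :=
  [&& uniqb (bdd_nodes B), (match bdd_root B with inr j => j < size (bdd_nodes B) | inl _ => true end)
    & all (node_ok p V B) (iota 0 (size (bdd_nodes B)))].

Lemma robddbE p V B :
  robddb p V B = robdd (if p then over_primed V else over_atoms V) B.
Proof.
rewrite /robddb /robdd uniqbE; congr [&& _, _ & _].
apply: eq_all => i; rewrite /node_ok; case: (bdd_node B i) => v [lo hi] /=.
have E r : child_ok B i r = bdd_child_ok B i r by case: r.
by rewrite !E; congr [&& _, _, _, _ & _]; rewrite /inV; case: p.
Qed.

Definition bsz (B : bdd) : nat := size (bdd_nodes B) + (if bdd_nodes B is _ :: _ then 2 else 1).
Definition isz (u : inst) : nat :=
  size u.1 + bsz u.2.1 + sumn [seq bsz B | B <- u.2.2.1] + flen u.2.2.2.2.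

Lemma iszE u : isz u = input_size (inst_of u).
Proof.
have E B : bsz B = bdd_size B by rewrite /bsz /bdd_size; case: (bdd_nodes B).
by rewrite /isz /input_size E; congr (_ + _ + sumn _ + _); apply: eq_map.
Qed.

Definition validb (L : logic) (u : inst) : bool :=
  [&& all (fun a => a.2 == 0) u.1, sorted atom_lt u.1, robddb false u.1 u.2.1,
      all (robddb true u.1) u.2.2.1, sorted atom_lt u.2.2.2.1,
      all (fun a => a \in u.1) u.2.2.2.1 && bddev (unp u.2.2.2.1) u.2.1,
      all (fun a => a.1 < isz u) u.1
    & check L ((size u.2.2.1, isz u), (u.1, [::])) u.2.2.2.2].

Lemma fs_unp s : fs (unp s) = [fset a | a in s].
Proof.
by apply/fsetP => a; rewrite mem_fs mem_unp; apply/idP/imfsetP => [/= ?|[b /= bs ->]//]; exists a.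
Qed.

Lemma validbE L u : validb L u = valid L (inst_of u).
Proof.
rewrite /validb /valid /= !robddbE /compact all_cat /check -iszE /=.
rewrite (eq_all (robddbE true u.1)).
have -> : all (fun a => a \in u.1) u.2.2.2.1 && bddev (unp u.2.2.2.1) u.2.1 =
   is_state (inst_struct (inst_of u)) (inst_state (inst_of u)).
  rewrite /is_state -bddevE; congr (_ && _).
    apply/allP/fsubsetP => [S a /imfsetP[b /= bs ->]|S a au].
      by apply/imfsetP; exists b => //=; apply: S.
    have /imfsetP[b /= bV ->] // : a \in [fset a | a in u.1].
    by apply: S; apply/imfsetP; exists a.
  by rewrite /inst_state -fs_unp /bev; apply: beval_ext => v; rewrite val1_fs // unp_unp.
congr [&& _, _, _, _, _, _ & _].
by rewrite andbCA; congr (_ && _); rewrite andbCA.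
Qed.

Lemma cpt_uniqb X {eX : enc X} (s : X -> seq (var * (bref * bref))) :
  cpt false s -> cpt false (fun z => uniqb (s z)).
Proof.
move=> C; apply: (@cpt_comp false _ _ _ _ _ _ s uniqb) => //; rewrite /uniqb; cpt.
by apply: (@cpt_size_seq false _ _ _ _ (fun z => z)); exact: cpt_id.
Qed.
Lemma cpt_bdd_node X {eX : enc X} (B : X -> bdd) (i : X -> nat) :
  cpt false B -> cpt false i -> cpt false (fun z => bdd_node (B z) (i z)).
Proof. by move=> *; rewrite /bdd_node; cpt. Qed.
Ltac cpt_ev6 := lazymatch goal with
  | |- cpt _ (fun x => uniqb (@?f x)) => apply: cpt_uniqb
  | |- cpt _ (fun x => bdd_node (@?f x) (@?g x)) => apply: cpt_bdd_node
  end.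
Ltac cpt_user ::= first [ cpt_form | cpt_fun | cpt_ev | cpt_ev2 | cpt_ev3 | cpt_ev4 | cpt_ev5 | cpt_ev6 ].

Lemma cpt_child_ok' : cpt false (fun y : bdd * (nat * bref) => child_ok y.1 y.2.1 y.2.2).
Proof. by rewrite /child_ok /var_lt /atom_lt; cpt. Qed.
Lemma cpt_child_ok X {eX : enc X} (B : X -> bdd) (i : X -> nat) (r : X -> bref) :
  cpt false B -> cpt false i -> cpt false r -> cpt false (fun z => child_ok (B z) (i z) (r z)).
Proof.
by move=> *; apply: (@cpt_comp false _ _ _ _ _ _ (fun z => (B z, (i z, r z))) _ cpt_child_ok'); cpt.
Qed.
Ltac cpt_ev7 := lazymatch goal with
  | |- cpt _ (fun x => child_ok (@?f x) (@?g x) (@?h x)) => apply: cpt_child_ok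
  end.
Ltac cpt_user ::= first [ cpt_form | cpt_fun | cpt_ev | cpt_ev2 | cpt_ev3 | cpt_ev4 | cpt_ev5 | cpt_ev6 | cpt_ev7 ].
Lemma cpt_robddb' : cpt false (fun y : bool * (seq atom * bdd) => robddb y.1 y.2.1 y.2.2).
Proof. by rewrite /robddb /node_ok /inV; cpt. Qed.
Lemma cpt_robddb X {eX : enc X} (p : X -> bool) (V : X -> seq atom) (B : X -> bdd) :
  cpt false p -> cpt false V -> cpt false B -> cpt false (fun z => robddb (p z) (V z) (B z)).
Proof.
by move=> *; apply: (@cpt_comp false _ _ _ _ _ _ (fun z => (p z, (V z, B z))) _ cpt_robddb'); cpt.
Qed.
Lemma cpt_isz : cpt false isz.
Proof. by rewrite /isz /bsz; cpt. Qed.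
Lemma cpt_isz' X {eX : enc X} (f : X -> inst) : cpt false f -> cpt false (fun z => isz (f z)).
Proof. by move=> C; apply: (cpt_comp cpt_isz C). Qed.
Ltac cpt_ev8 := lazymatch goal with
  | |- cpt _ (fun x => robddb (@?f x) (@?g x) (@?h x)) => apply: cpt_robddb
  | |- cpt _ (fun x => isz (@?h x)) => apply: cpt_isz'
  | |- cpt _ (fun x => check _ (@?g x) (@?h x)) => apply: cpt_check
  end.
Ltac cpt_user ::= first [ cpt_form | cpt_fun | cpt_ev | cpt_ev2 | cpt_ev3 | cpt_ev4 | cpt_ev5 | cpt_ev6 | cpt_ev7 | cpt_ev8 ].
Lemma cpt_validb L : cpt false (validb L).
Proof.
rewrite /validb; cpt.
exact: cpt_isz.
Qed.

(** * Size of the queries *)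

(** What is retained of [wf] along the recursion. Unlike [wf] it refers to no vocabulary, and fixing
    atoms by constants preserves it. *)
Fixpoint wb (f : form) : bool :=
  match f with
  | Top | Bot | Atom _ => true
  | Not g | Know _ g => wb g
  | And g h | Announce g h => wb g && wb h
  | Event (Transformer Vp g pm om) x h => [&& all base Vp, all base [seq qb.1 | qb <- pm], wb g & wb h]
  end.

Lemma wb_event X x h :
  wb (Event X x h) = [&& all base (t_plus X), all base (Wof X), wb (t_pre X) & wb h].
Proof. by case: X. Qed.

Lemma wb_fl f : wb f -> wb (fl f).
Proof. by case: f => //= [g h /andP[]|g h /andP[]|[Vp g pm om] x h /and4P[]]. Qed.

Lemma wb_ffix x W f : wb (ffix x W f) = wb f.
Proof.
move: f; fix IH 1; case=> [||a|g|g h|i g|g h|[Vp g pm om] y h]; rewrite ffixE.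
- by [].
- by [].
- by clear; case: ifP => // _; case: ifP.
- exact: IH g.
- by rewrite /wb -/wb (IH g) (IH h).
- exact: IH g.
- by rewrite /wb -/wb (IH g) (IH h).
rewrite !wb_event; cbn [t_plus t_pre]; rewrite (IH g) (IH h) /Wof; clear.
by cbn [t_minus]; rewrite -map_comp.
Qed.

Lemma wf_wb n f : forall V P, wf n V P f -> all base V -> wb f.
Proof.
move: f; fix IH 1; case=> [||a|g|g h|i g|g h|[Vp g pm om] y h] V P.
- by [].
- by [].
- by [].
- exact: IH g V P.
- by move=> /= /andP[/IH wg /IH wh] bV; rewrite wg // wh.
- by move=> /= /andP[_ /IH wg] bV; apply: wg.
- by move=> /= /andP[/IH wg /IH wh] bV; rewrite wg // wh.
move=> /and4P[/and5P[base_Vp _ _ wf_g /and5P[_ sub_V _ _ _]] _ _ wf_h] bV.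
rewrite wb_event; cbn [t_plus t_pre]; rewrite base_Vp (IH g _ _ wf_g bV).
rewrite (IH h _ _ wf_h); last by rewrite all_cat bV base_Vp.
clear IH; rewrite !andbT; apply/allP => a aW; apply: (allP bV); exact: (allP sub_V).
Qed.

Lemma sz_atom (a : atom) : sz a = 2 * (a.1 + a.2) + 3.
Proof. by case: a => p k; rewrite sz_pair !sz_nat /=; lia. Qed.

Section Sizes.

Variable N : nat.

Definition aok (j : nat) (a : atom) : bool := (a.1 <= N) && (a.2 <= j).
(** [N] stands for the size of the instance. [maxm] bounds the recursion depth and thereby the
    number of updates, [maxv] the vocabulary after them, each adding at most [2 * N] atoms, [maxc]
    the growth of the valuation in one step, [maxe] its total size, and [lay] the layers. In [maxc],
    [2 * maxv] comes from the two reassignments of a knowledge operator and [3 * N] from those of an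
    event. *)
Definition maxm := (2 * N + 5) * (2 * N).
Definition maxv := N * (2 * maxm + 1).
Definition maxc := 2 * maxv + 3 * N.
Definition maxe := N + maxm * maxc.
Definition lay := N + maxm + 1.
Definition eok (e : seq var) : bool := all (fun v => aok lay v.1) e.

Fixpoint hok (H : hist) : bool :=
  if H is (w, vc) :: H' then
    [&& sz w <= N, wb w, size vc <= N * (2 * size H + 1), all (aok (size H)) vc & hok H']
  else true.

Lemma aok_le j j' a : j <= j' -> aok j a -> aok j' a.
Proof. by rewrite /aok => le /andP[-> h]; apply: leq_trans h le. Qed.

Lemma all_aok_le j j' s : j <= j' -> all (aok j) s -> all (aok j') s.
Proof. by move=> le; apply: sub_all => a; apply: aok_le. Qed.

Lemma aok_sz (s : seq atom) : sz s <= N -> all (aok N) s.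
Proof.
move=> le; apply/allP => a as_; have := leq_trans (sz_mem as_) le; rewrite sz_atom /aok; lia.
Qed.

Lemma aok_fst (s : seq (atom * bform)) : sz s <= N -> all (aok N) [seq qb.1 | qb <- s].
Proof.
elim: s => //= -[a b] s IH; rewrite sz_cons sz_pair sz_atom => le; rewrite IH; last by lia.
by rewrite /aok /=; lia.
Qed.

Lemma all_filter_sub (T : Type) (p q : pred T) s : all p s -> all p (filter q s).
Proof. by elim: s => //= x s IH /andP[px /IH]; case: (q x) => //= ->; rewrite px. Qed.

Lemma eok_msub W b new e : eok e -> all (aok lay) new ->
  eok (msub W b new e) /\ size (msub W b new e) <= size e + size new.
Proof.
move=> ee en; split; first by rewrite /eok /msub all_cat all_filter_sub //= all_map.
by rewrite /msub size_cat size_map leq_add2r size_filter count_size.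
Qed.

Lemma eok_unp b s : all (aok lay) s -> eok [seq (a, b) | a <- s].
Proof. by rewrite /eok all_map. Qed.

Lemma cur_ok V H : size V <= N -> all (aok 0) V -> hok H ->
  size (curv V H) <= N * (2 * size H + 1) /\ all (aok (size H)) (curv V H).
Proof.
case: H => [|[w vc] H] sV aV; first by rewrite /= muln0 add0n muln1.
by case/and5P.
Qed.

Lemma event_ok X x h : sz (Event X x h) <= N -> wb (Event X x h) ->
  [/\ all (aok 0) (t_plus X), all (aok 0) (Wof X),
      [/\ size (t_plus X) + size (Wof X) <= N, size (Wof X) <= N & size x <= N], all (aok N) x
    & [/\ sz (t_pre X) <= N, wb (t_pre X), sz h <= N & wb h]].
Proof.
case: X => Vp g pm om; rewrite sz_Event sz_Transformer /= => le /and4P[bV bW wg wh].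
have szW : all (aok N) [seq qb.1 | qb <- pm] && (size pm < sz pm).
  by know (size_sz pm) => ->; rewrite andbT; apply: aok_fst; lia.
know (size_sz Vp) => s1; know (size_sz x) => s2.
have b0 s : all base s -> all (aok N) s -> all (aok 0) s.
  by move=> /allP h1 /allP h2; apply/allP => a as_; have := h1 a as_; have := h2 a as_; rewrite /base /aok; lia.
case/andP: szW => aW sW; split; rewrite /Wof ?size_map /=.
- by apply: b0 => //; apply: aok_sz; lia.
- exact: b0.
- by split; lia.
- by apply: aok_sz; lia.
- by split=> //; lia.
Qed.

Lemma lmax_ok j vc : all (aok j) vc -> lmax vc <= j.+1.
Proof.
rewrite /lmax ltnS => h; elim/last_ind: vc h => //= s a IH.
rewrite all_rcons map_rcons foldl_rcons => /andP[/andP[_ aj] /IH h].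
by rewrite geq_max h aj.
Qed.

Lemma circ_ok l W s : all (aok 0) W -> {subset s <= W} -> all (aok l) [seq circl l a | a <- s].
Proof.
move=> /allP h sub; apply/allP => a /mapP[b /sub/h]; rewrite /aok /circl => /andP[h1 h2] -> /=; lia.
Qed.

(** Since replaced atoms lie in layer 0, all their copies land in the single layer [lmax vc], one
    above those present at most. Copying atoms of high layers could double the number of layers at
    every update. *)
Lemma newv_ok vc k f : sz f <= N -> wb f -> size vc <= N * (2 * k + 1) -> all (aok k) vc ->
  size (newv vc f) <= N * (2 * k.+1 + 1) /\ all (aok k.+1) (newv vc f).
Proof.
have m : N * (2 * k + 1) + N <= N * (2 * k.+1 + 1) by nia.
move=> le wf sv av; have av' : all (aok k.+1) vc by apply: all_aok_le av.
case: f le wf => [||a|g|g h|i g|g h|X x h] /= le wf; try (by split=> //; apply: leq_trans sv _; lia).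
have [aV aW [s1 _ _] _ _] := event_ok le wf; split.
  by rewrite !size_cat size_map; lia.
rewrite !all_cat av' (all_aok_le (leq0n _) aV) /=.
have := @circ_ok (lmax vc) (Wof X) (Wof X) aW (fun _ h => h).
by apply: all_aok_le; apply: lmax_ok.
Qed.

Lemma env_new_ok b vc t e : eok e -> all (aok lay) t -> size t <= maxv ->
  eok (env_new b vc t e) /\ size (env_new b vc t e) <= size e + maxc.
Proof.
move=> ee et st; rewrite /env_new; case: b.
  by split; [apply: eok_unp | rewrite size_map /maxc; lia].
have [e1 s1] := eok_msub vc true ee et; have [e2 s2] := eok_msub vc false e1 et.
by split=> //; rewrite /maxc; lia.
Qed.

Lemma env_obs_ok b vc t e : eok e -> all (aok lay) t -> size t <= maxv ->
  eok (env_obs b vc t e) /\ size (env_obs b vc t e) <= size e + maxc.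
Proof.
move=> ee et st; rewrite /env_obs; case: b.
  split; last by rewrite size_cat size_map /maxc; lia.
  by rewrite /eok all_cat -/(eok e) ee; apply: eok_unp.
have [e1 s1] := eok_msub vc true ee et.
by split=> //; rewrite /maxc; lia.
Qed.

Lemma sub_filter (T : eqType) (p : pred T) s : {subset filter p s <= s}.
Proof. by move=> x; rewrite mem_filter => /andP[]. Qed.

Lemma size_filter_le (T : Type) (p : pred T) s : size (filter p s) <= size s.
Proof. by rewrite size_filter count_size. Qed.

Lemma env_ev_ok b l X x h e : sz (Event X x h) <= N -> wb (Event X x h) -> eok e -> l <= lay ->
  eok (env_ev b l X x e) /\ size (env_ev b l X x e) <= size e + maxc.
Proof.
move=> le wf ee ll; have [aV aW [_ s2 s3] ax _] := event_ok le wf.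
have aW' : all (aok lay) (Wof X) by apply: all_aok_le aW.
have ax' : all (aok lay) x by apply: all_aok_le ax; rewrite /lay; lia.
have ac (p : pred atom) : all (aok lay) [seq circl l a | a <- Wof X & p a].
  by apply: all_aok_le ll _; apply: circ_ok aW _; apply: sub_filter.
have sf (p : pred atom) : size [seq a <- Wof X | p a] <= N by apply: leq_trans (size_filter_le _ _) s2.
rewrite /env_ev; case: b.
  split.
    rewrite /eok !all_cat all_filter_sub // -!/(eok _) !eok_unp //.
    exact: all_filter_sub.
  rewrite !size_cat !size_map.
  apply: leq_trans (leq_add (size_filter_le _ _) (leq_add (sf _) (leq_add s3 (sf _)))) _.
  by rewrite /maxc; lia.
have [e1 s1] := eok_msub [seq circl l a | a <- Wof X] false ee (ac (fun a => (a, false) \in e)).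
have [e2 s4] := eok_msub (t_plus X) false e1 (all_filter_sub (mem (t_plus X)) ax').
have [e3 s5] := eok_msub (Wof X) false e2 (all_filter_sub (fun a => bev (env_ev2 l X x e) (postb X a)) aW').
split=> //; apply: leq_trans s5 _.
have t1 : size [seq circl l a | a <- Wof X & (a, false) \in e] <= N by rewrite size_map; apply: sf.
have t2 : size [seq a <- x | a \in t_plus X] <= N by apply: leq_trans (size_filter_le _ _) s3.
apply: leq_trans (leq_add (leq_trans s4 (leq_add (leq_trans s1 (leq_add (leqnn _) t1)) t2)) (sf _)) _.
by rewrite /maxc; lia.
Qed.

Lemma env_law_ok l X x h e : sz (Event X x h) <= N -> wb (Event X x h) -> eok e ->
  eok (env_law l X e) /\ size (env_law l X e) <= size e + N.
Proof.
move=> le wf ee; have [aV aW [_ s2 s3] ax _] := event_ok le wf.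
have aW' : all (aok lay) (Wof X) by apply: all_aok_le aW.
have [e1 s1] := eok_msub (Wof X) false ee (all_filter_sub (fun a => (circl l a, false) \in e) aW').
split=> //; apply: leq_trans s1 _; rewrite leq_add2l.
by apply: leq_trans (size_filter_le _ _) s2.
Qed.

Lemma env_obs2_ok l X x h e : sz (Event X x h) <= N -> wb (Event X x h) -> eok e ->
  eok (env_obs2 l X e) /\ size (env_obs2 l X e) <= size e + maxc.
Proof.
move=> le wf ee; have [aV aW [_ s2 s3] ax _] := event_ok le wf.
have aW' : all (aok lay) (Wof X) by apply: all_aok_le aW.
have [e1 s1] := env_law_ok l le wf ee.
have [e2 s4] := eok_msub (Wof X) true e1 (all_filter_sub (fun a => (circl l a, true) \in e) aW').
split=> //; apply: leq_trans s4 _.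
by apply: leq_trans (leq_add s1 (leq_trans (size_filter_le _ _) s2)) _; rewrite /maxc; lia.
Qed.

(** The remaining depth [m] is a budget: each step spends one unit, which pays for one more update
    in the history and for [maxc] more entries in the valuation. *)
Definition Invq (V : seq atom) (m : nat) (v : vq) : Prop :=
  [/\ [/\ qm v <= 5, qi v <= N, sz (qf v) <= N & wb (qf v)],
      hok (qH v) && (size (qH v) + m <= maxm),
      eok (qe v) && (size (qe v) + m * maxc <= maxe),
      [/\ size (qvs v) + size (qt v) <= maxv, all (aok lay) (qvs v) & all (aok lay) (qt v)]
    & v.1.1 = V].

Lemma Invq_step V m v r : size V <= N -> all (aok 0) V -> 3 <= N ->
  Invq V m.+1 v -> ~~ qbase v -> Invq V m (qa v) /\ Invq V m (qbb v r).
Proof.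
case: v => u [md [b [H [e [f [i [vs t]]]]]]] sV aV N3 [/= [le5 iN sf wf] /andP[hH sH] /andP[ee se] [svt avs at_] uV] nb.
(* What all successor queries have in common: at most one more update, and at most [maxc] more
   entries in the valuation. *)
have J md' b' H' e' f' i' vs' t' : md' <= 5 -> hok H' /\ size H' <= (size H).+1 ->
    eok e' /\ size e' <= size e + maxc -> sz f' <= N /\ wb f' -> i' <= N ->
    [/\ size vs' + size t' <= maxv, all (aok lay) vs' & all (aok lay) t'] ->
    Invq V m (u, mkq md' b' H' e' f' i' vs' t').
  move=> h1 [h2 h3] [h4 h5] [h6 h7] h8 h9; split=> //=.
  - by rewrite h2; lia.
  - by rewrite h4 /=; move: se; rewrite mulSn; lia.
have [cs ca] := cur_ok sV aV hH; rewrite -uV in cs ca.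
have sH' : size H < maxm by lia.
have cs' : size (curv u.1 H) <= maxv by apply: leq_trans cs _; rewrite /maxv leq_mul2l; apply/orP; right; lia.
have ca' : all (aok lay) (curv u.1 H) by apply: all_aok_le ca; rewrite /lay; lia.
have hH' : hok H /\ size H <= (size H).+1 by [].
have eE : eok e /\ size e <= size e + maxc by split=> //; lia.
have fT : sz Top <= N /\ wb Top by rewrite sz_Top.
have n0 : [/\ size ([::] : seq atom) + size ([::] : seq atom) <= maxv, all (aok lay) [::] & all (aok lay) [::]].
  by split.
have tl : hok (behead H) /\ size (behead H) <= (size H).+1.
  by case: (H) hH => [|[w vc] H'] //= /and5P[_ _ _ _ h]; split=> //; rewrite leqW.
have Nc : N <= maxc by rewrite /maxc; clear; lia.
have tm : size t <= maxv by move: svt; clear; lia.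
have hd : sz (qhd (u, (md, (b, (H, (e, (f, (i, (vs, t)))))))) ) <= N /\
          wb (qhd (u, (md, (b, (H, (e, (f, (i, (vs, t)))))))) ).
  by rewrite /qhd /=; case: (H) hH => [|[w vc] H'] //= /and5P[].
have flok g : sz g <= N /\ wb g -> sz (fl g) <= N /\ wb (fl g).
  case=> h1 h2; split; last exact: wb_fl.
  case lg: (fleaf g); last by have [h _] := sz_fl (negbT lg); apply: leq_trans (ltnW h) h1.
  by case: (g) lg => //=; rewrite sz_Top.
have pushok : wb f -> hok ((f, newv (curv u.1 H) f) :: H) /\ size ((f, newv (curv u.1 H) f) :: H) <= (size H).+1.
  move=> _; have [n1 n2] := newv_ok sf wf cs ca; split=> //=.
  by apply/and5P; split.
have A : Invq V m (qa (u, (md, (b, (H, (e, (f, (i, (vs, t))))))))).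
  rewrite /qa /=; case: ifP => [/eqP e0|n0'].
    rewrite e0 /qbase /= in nb.
    case: f sf wf nb flok {pushok hd} => [||a|g|g h|j g|g h|X x h] sf wf nb flok //; try (by apply: J => //; apply: (flok _ (conj sf wf))).
      move: sf; rewrite sz_Know sz_nat => sf.
      have [s1 s2] : sz g <= N /\ j <= N by move: sf; clear; lia.
      by apply: J => //; split; rewrite ?addn0.
    have [_ _ _ _ [h1 h2 h3 h4]] := event_ok sf wf.
    by apply: J => //; split; [apply: leq_trans (sz_ffix _ _ _) h1 | rewrite wb_ffix].
  case: ifP => [/eqP e1|n1].
    case: vs svt avs {hd nb} => [|a vs] svt avs; apply: J => //.
    by move: svt avs; rewrite /= addSn => /ltnW svt /andP[_ ?]; split.
  case: ifP => [/eqP e2|n2]; first by apply: J => //; apply: env_new_ok.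
  case: ifP => [/eqP e3|n3]; first by apply: J => //; apply: env_obs_ok.
  case: ifP => [/eqP e4|n4]; rewrite /qtl /=; apply: J => //.
    case: (qhd _) hd => // X x h [h1 h2]; have [h3 h4] := env_law_ok (lmax (curv u.1 (behead H))) h1 h2 ee.
    by split=> //; apply: leq_trans h4 _; rewrite leq_add2l.
  by case: (qhd _) hd => // X x h [h1 h2]; apply: (env_obs2_ok _ h1 h2 ee).
split=> //; rewrite /qbb /=; case: ifP => [/eqP e0|n0'].
  rewrite e0 /qbase /= in nb.
  case: f sf wf nb A flok pushok {hd} => [||a|g|g h|j g|g h|X x h] sf wf nb A flok pushok //.
  - move: sf wf; rewrite sz_And /= => sf /andP[_ wh]; have s1 : sz h <= N by move: sf; clear; lia.
    by apply: J.
  - by rewrite /qpush /=; move: (sf) (wf); rewrite sz_Announce /= => sf' /andP[_ wh]; have s1 : sz h <= N by [move: sf'; clear; lia]; apply: J => //; apply: pushok.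
  have [_ _ _ _ [h1 h2 h3 h4]] := event_ok sf wf.
  rewrite /qpush /=; apply: J => //; first exact: pushok.
  apply: (env_ev_ok _ sf wf ee); apply: leq_trans (lmax_ok ca) _.
  by rewrite /lay addn1 ltnS (leq_trans (ltnW sH')) // leq_addl.
case: ifP => [/eqP e1|n1].
  case: vs svt avs A {hd nb} => [|a vs] svt avs A //; apply: J => //.
  by move: svt avs => /= svt /andP[aa ?]; split=> //=; [rewrite addnS -addSn | rewrite aa].
case: ifP => [/eqP e2|n2]; first by apply: J.
case: ifP => [/eqP e3|n3]; first by apply: J => //; apply: env_new_ok.
case: ifP => [/eqP e4|n4] //; rewrite /qtl /=; apply: J => //; last exact: flok.
case: (qhd _) hd => // X x h [h1 h2]; have [h3 h4] := env_law_ok (lmax (curv u.1 (behead H))) h1 h2 ee.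
by split=> //; apply: leq_trans h4 _; rewrite leq_add2l.
Qed.

(** An atom of the recursion has size at most [2 * (N + lay) + 3]; the rest of the 10 is room for
    the prime flag and for list cells. *)
Definition sza := 2 * (N + lay) + 10.
Definition bound := maxm + N + (N + (maxv * sza + 10)) * (maxm + 10) + maxe * sza
   + 2 * (maxv * sza) + 10 * N + 100.

Lemma sz_aok j s : j <= lay -> all (aok j) s -> sz s <= size s * (sza - 5) + 1.
Proof.
move=> le h; have : all (fun a : atom => sz a <= sza - 6) s.
  by apply: sub_all h => a; rewrite /aok sz_atom /sza; lia.
by move/sz_all; rewrite /sza; lia.
Qed.

Lemma Invq_sz V m v : Invq V m v -> sz v.1 <= N -> sz v <= bound /\ m <= bound.
Proof.
case: v => u [md [b [H [e [f [i [vs t]]]]]]] [/= [le5 iN sf wf] /andP[hH sH] /andP[ee se] [svt avs at_] uV] su.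
rewrite !sz_pair !sz_nat.
have l0 := leqnn lay; have s1 := sz_aok l0 avs; have s2 := sz_aok l0 at_.
have sb := sz_bool b.
have s3 : sz e <= maxe * sza + 1.
  have : all (fun v : var => sz v <= sza - 1) e.
    apply: sub_all ee => -[a c]; rewrite sz_pair /aok sz_atom /sza /=.
    by have := sz_bool c; lia.
  move/sz_all => /leq_trans-> //; rewrite leq_add2r; apply: leq_mul; first by lia.
  by rewrite /sza; lia.
have s4 : sz H <= maxm * (N + (maxv * sza + 10)) + 1.
  have : all (fun h : form * seq atom => sz h <= N + (maxv * sza + 9)) H.
    elim: H hH sH {se} => //= -[w vc] H IH /and5P[h1 h2 h3 h4 h5] sH.
    rewrite IH //; last by lia.
    rewrite andbT sz_pair; have lj : (size H).+1 <= lay by rewrite /lay; lia.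
    have := sz_aok lj h4.
    have : size vc * (sza - 5) <= maxv * sza.
      apply: leq_mul; last by rewrite /sza; lia.
      by apply: leq_trans h3 _; rewrite /maxv leq_mul2l; apply/orP; right; lia.
    lia.
  move/sz_all => /leq_trans-> //; rewrite leq_add2r; apply: leq_mul; first by lia.
  by rewrite !ltn_add2l.
have s5 : size vs * (sza - 5) + size t * (sza - 5) <= maxv * sza.
  by rewrite -mulnDl; apply: leq_mul => //; rewrite /sza; lia.
have s6 : (N + (maxv * sza + 10)) * (maxm + 10) = maxm * (N + (maxv * sza + 10)) + (N + (maxv * sza + 10)) * 10.
  by rewrite mulnDr mulnC.
rewrite /bound s6; split; lia.
Qed.

End Sizes.

(** * The decision procedure *)

Definition fuel (u : inst) : nat := (size u.1 + flen u.2.2.2.2 + 5) * (2 * flen u.2.2.2.2).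
Definition query0 (u : inst) : vq := (u, mkq 0 true [::] (unp u.2.2.2.1) u.2.2.2.2 0 [::] [::]).

Lemma poly_bound_sz : poly bound.
Proof. by rewrite /bound /sza /lay /maxe /maxc /maxv /maxm; polyn. Qed.

Definition Inv (u : inst) (m : nat) (v : vq) : Prop := v.1 = u /\ Invq (sz u) u.1 m v.

Lemma inst_sizes (u : inst) :
  [/\ sz u.1 <= sz u, sz u.2.2.2.1 <= sz u, sz u.2.2.2.2 <= sz u & 3 <= sz u].
Proof.
case: u => V [l [o [s f]]]; rewrite !sz_pair /=; know (sz_gt0 V); know (sz_gt0 l); know (sz_gt0 o).
by know (sz_gt0 s); know (sz_gt0 f); clear; move=> *; split; lia.
Qed.

Lemma validb_wb L u : validb L u -> [/\ all base u.1, wb u.2.2.2.2 & size u.1 <= sz u /\ all (aok (sz u) 0) u.1].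
Proof.
rewrite validbE => /and5P[bV _ _ _ /and5P[_ _ wff _ _]].
have [s1 _ _ _] := inst_sizes u; split=> //; first exact: wf_wb wff bV.
split; first by apply: leq_trans s1; know (size_sz u.1) => /ltnW.
apply/allP => a aV; have := allP bV a aV; have := allP (aok_sz s1) a aV.
by rewrite /aok /base => /andP[-> _] /= /eqP->.
Qed.

Lemma fuel_le u : fuel u <= maxm (sz u).
Proof.
have [s1 _ s3 _] := inst_sizes u; rewrite /fuel /maxm.
have s4 := leq_trans (sz_flen u.2.2.2.2) s3.
have s5 : size u.1 <= sz u by apply: leq_trans s1; know (size_sz u.1) => /ltnW.
by apply: leq_mul; move: s4 s5; clear; lia.
Qed.

Lemma Inv_query0 L u : validb L u -> Inv u (fuel u) (query0 u).
Proof.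
move=> /validb_wb[bV wbf [sV aV]]; have [s1 s2 s3 s4] := inst_sizes u.
split=> //; split=> //=; first exact: fuel_le.
  have ss : size u.2.2.2.1 <= sz u by apply: leq_trans s2; know (size_sz u.2.2.2.1) => /ltnW.
apply/andP; split; last by rewrite /maxe size_map; apply: leq_add => //; apply: leq_mul => //; apply: fuel_le.
apply: eok_unp; apply: all_aok_le (aok_sz s2).
by rewrite /lay; clear; lia.
Qed.

Lemma cpt_fuel : cpt false fuel.
Proof. by rewrite /fuel; cpt. Qed.
Lemma cpt_query0 : cpt false query0.
Proof. by rewrite /query0 /mkq; cpt. Qed.

Lemma cpt_qrec L : cpt false (fun u => if validb L u then qrec (fuel u) (query0 u) else false).
Proof.
apply: (@cpt_rec2 _ _ _ _ qbase qg qa qbb qh _ _ (validb L) (fun _ => false) fuel query0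
  (fun n => bound n + 3) Inv).
- exact: cpt_qbase.
- exact: cpt_qg.
- exact: cpt_qa.
- exact: cpt_qbb.
- exact: cpt_qh.
- exact: cpt_validb.
- by cpt.
- exact: cpt_fuel.
- exact: cpt_query0.
- by apply: poly_add; [exact: poly_bound_sz | exact: poly_const].
- exact: Inv_query0.
- move=> u m v /validb_wb[_ _ [sV aV]] [vu iv] nb; have [_ _ _ s4] := inst_sizes u.
  have [i1 i2] := Invq_step (rec2 qbase qg qa qbb qh m (qa v)) sV aV s4 iv nb.
  by split; split.
move=> u m v _ [vu iv]; have [b1 b2] : sz v <= bound (sz u) /\ m <= bound (sz u).
  by apply: (Invq_sz iv); rewrite vu.
split.
- by apply: leq_trans b2 _; rewrite leq_addr.
- by apply: leq_trans b1 _; rewrite leq_addr.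
by apply: leq_trans (sz_bool _) _; rewrite leq_addl.
Qed.

Definition decide (L : logic) (w : seq bool) : bool :=
  if parse w is Some u then (if validb L u then qrec (fuel u) (query0 u) else false) else false.

Lemma cpt_decide L : cpt false (decide L).
Proof.
rewrite /decide; apply: (@cpt_ocase false _ _ inst bool _ _ parse (fun _ => false)
  (fun _ u => if validb L u then qrec (fuel u) (query0 u) else false)).
- by apply: (@cpt_parse_inst _ _ (fun w => w)); exact: cpt_id.
- exact: cpt_const.
apply: (@cpt_comp false _ _ _ _ _ _ snd
   (fun u => if validb L u then qrec (fuel u) (query0 u) else false)); first exact: cpt_qrec.
exact: cpt_snd0.
Qed.

Lemma qrec_sat u :
  qrec (fuel u) (query0 u) <-> sat (inst_struct (inst_of u)) (inst_state (inst_of u)) u.2.2.2.2.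
Proof.
(* For this [K] the rank of the initial query is exactly [fuel u]. *)
pose K := size u.1 + flen u.2.2.2.2.
have ok0 : okq u K (query0 u).2 by split=> //= _ _; apply: unp_unp.
have := qrecP ok0; rewrite /rank /spec /= => /(_ (fuel u)).
rewrite /mu /= add0n /spec0 /= fs_unp; apply.
by rewrite /fuel /K.
Qed.

Theorem model_checking_PSPACE L : PSPACE (model_checking L).
Proof.
apply: (cpt_PSPACE (cpt_decide L)) => w; rewrite /decide; case e: (parse w) => [u|].
  move/parseP: e => e; rewrite validbE; split.
    case v: (valid L _) => // /qrec_sat s; exists (inst_of u); split=> //.
  case=> I [eI vI sI].
  have : parse w = Some (i_voc I, (i_law I, (i_obs I, (i_state I, i_form I)))).
    by apply/parseP; rewrite -eI; case: (I).
  move/parseP: e => -> [eu]; have uI : inst_of u = I by rewrite eu; case: (I).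
  by rewrite uI vI; apply/qrec_sat; rewrite uI; rewrite -uI in sI *.
split=> // -[I [eI vI sI]].
have : parse w = Some (i_voc I, (i_law I, (i_obs I, (i_state I, i_form I)))).
  by apply/parseP; rewrite -eI; case: (I).
by rewrite e.
Qed.

(** * Configurations as assignments *)

Section Bits.

Variable M : tm.

Definition ct : finType := option (bool + tm_symb M).
Definition tape_ix : finType := 'I_(tm_k M).+1.
(** The kinds of bits at one position of a configuration: one for each state, and one for each tape,
    side of the head and possible content of a cell. Cells are addressed by their distance from the
    head. The state is repeated at every position, so that all positions carry the same bits; [view]
    reads it at position 0. *)
Definition zt : finType := (tm_state M + tape_ix * bool * ct)%type.
Definition views : finType := (tm_state M * {ffun tape_ix -> ct})%type.

Definition side (b : bool) (t : tape (tm_symb M)) : seq ct := if b then tright t else tleft t.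

Definition asg := nat -> zt -> bool.

Definition config_bits (c : config M) : asg := fun j z =>
  match z with
  | inl q => c_state c == q
  | inr y => nth None (side y.1.2 (c_tapes c y.1.1)) j == y.2
  end.

Definition trans (v : views) : option (tm_state M * {ffun tape_ix -> ct * move}) := tm_delta v.1 v.2.

Definition view (X : asg) (v : views) : bool :=
  X 0 (inl v.1) && all (fun i => X 0 (inr (i, true, v.2 i))) (enum tape_ix).

(* The content of a cell after a step: either the symbol just written, or the
   content of another cell before it. *)
Definition source (a : ct * move) (b : bool) (j : nat) : ct + bool * nat :=
  match a.2 with
  | Stay => if b && (j == 0) then inl a.1 else inr (b, j)
  | MoveR => if b then inr (true, j.+1) else if j == 0 then inl a.1 else inr (false, j.-1)
  | MoveL => if b then (if j == 0 then inr (false, 0) else if j == 1 then inl a.1 else inr (true, j.-1))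
             else inr (false, j.+1)
  end.

Lemma sourceP (a : ct * move) b (t : tape (tm_symb M)) j :
  nth None (side b (tmove a.2 (twrite a.1 t))) j =
  match source a b j with inl c => c | inr y => nth None (side y.1 t) y.2 end.
Proof.
case: a => c []; rewrite /source /side /=; case: b => /=.
- case: j => [|[|j]] //=.
  by case: (tright t) => //=; rewrite nth_nil.
- by case: (tleft t) => //=; rewrite nth_nil.
- by case: j => //= j; case: (tright t) => //=; rewrite nth_nil.
- by [].
- by case: (tright t) => //=; rewrite nth_nil.
- by case: j.
Qed.

Variable S : nat.

(** A cell outside the window of [S] positions counts as blank, which is correct for configurations
    within the space bound. *)
Definition value (X : asg) (i : tape_ix) (d : ct) (r : ct + bool * nat) : bool :=
  match r with
  | inl c => c == d
  | inr y => if y.2 < S then X y.2 (inr (i, y.1, d)) else d == None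
  end.

Definition after_step (X : asg) (j : nat) (z : zt) (v : views) : bool :=
  match trans v with
  | None => X j z
  | Some qa =>
      match z with
      | inl q => qa.1 == q
      | inr y => value X y.1.1 y.2 (source (qa.2 y.1.1) y.1.2 j)
      end
  end.

Definition next_bit (X : asg) (j : nat) (z : zt) : bool :=
  has (fun v => view X v && after_step X j z v) (enum views).

Definition stopped (P : pred (tm_state M)) (X : asg) : bool :=
  has (fun v => view X v && (~~ isSome (trans v) && P v.1)) (enum views).

Definition cview (c : config M) : views := (c_state c, [ffun i => tread (c_tapes c i)]).

Lemma view_bits c v : view (config_bits c) v = (v == cview c).
Proof.
case: v => q s; rewrite /view /=; apply/andP/eqP => [[/eqP <- /allP h]|[-> ->]].
  congr (_, _); apply/ffunP => i; have := h i (mem_enum _ i); rewrite /= => /eqP <-.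
  by rewrite ffunE /tread nth0.
by split=> //; apply/allP => i _ /=; rewrite ffunE /tread nth0.
Qed.

Lemma has_view c (F : pred views) :
  has (fun v => view (config_bits c) v && F v) (enum views) = F (cview c).
Proof.
apply/hasP/idP => [[v _]|h]; first by rewrite view_bits => /andP[/eqP ->].
by exists (cview c); rewrite ?mem_enum // view_bits eqxx.
Qed.

Lemma trans_cview c : trans (cview c) = action c.
Proof. by []. Qed.

Lemma stopped_bits P c : stopped P (config_bits c) = halted c && P (c_state c).
Proof. by rewrite /stopped has_view trans_cview. Qed.

Definition small_config (c : config M) : Prop := forall i b, size (side b (c_tapes c i)) <= S.

Lemma nxt_bits c j z : small_config c -> next_bit (config_bits c) j z = config_bits (step c) j z.
Proof.
move=> sm; rewrite /next_bit has_view /after_step trans_cview /step.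
case: (action c) => [[q act]|] //; case: z => [q'|[[i b] d]] //=.
rewrite ffunE sourceP /value; case: (source _ b j) => [c'|[b' j']] //=.
by case: ltnP => // le; rewrite nth_default ?(leq_trans (sm i b')) // eq_sym.
Qed.

Definition eqS (X Y : asg) : Prop := forall j z, j < S -> X j z = Y j z.
Definition stp (X Y : asg) : Prop := forall j z, j < S -> Y j z = next_bit X j z.

(** Admitting equality at level 0 makes [2 ^ t] an upper bound on the number of steps. The midpoint
    [Z] is an arbitrary table of bits, just as a world may hold arbitrary tables; by [reach_run],
    from a configuration of the run only configurations of the run are reached, up to the window. *)
Fixpoint reach (t : nat) (X Y : asg) : Prop :=
  if t is t'.+1 then exists Z, reach t' X Z /\ reach t' Z Y else eqS X Y \/ stp X Y.

Lemma eqS_sym X Y : eqS X Y -> eqS Y X.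
Proof. by move=> e j z lt; rewrite e. Qed.

Lemma eqS_trans X Y Z : eqS X Y -> eqS Y Z -> eqS X Z.
Proof. by move=> e f j z lt; rewrite e // f. Qed.

Hypothesis S_gt0 : 0 < S.

Lemma view_ext X X' v : eqS X X' -> view X v = view X' v.
Proof. by move=> e; rewrite /view e //; congr (_ && _); apply: eq_all => i; rewrite e. Qed.

Lemma nxt_ext X X' j z : eqS X X' -> j < S -> next_bit X j z = next_bit X' j z.
Proof.
move=> e lt; apply: eq_has => v; rewrite (view_ext _ e); congr (_ && _).
rewrite /after_step; case: (trans v) => [[q a]|]; last exact: e.
case: z => [q'|[[i b] d]] //=; rewrite /value; case: (source _ _ _) => [c|[b' j']] //=.
by case: ifP => // h; apply: e.
Qed.

Lemma stopped_ext P X X' : eqS X X' -> stopped P X = stopped P X'.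
Proof. by move=> e; apply: eq_has => v; rewrite (view_ext _ e). Qed.

Lemma reach_ext t X X' Y Y' : eqS X X' -> eqS Y Y' -> reach t X Y -> reach t X' Y'.
Proof.
elim: t X X' Y Y' => [|t IH] X X' Y Y' eX eY /=.
  case=> [e|e]; [left | right].
    by apply: eqS_trans (eqS_sym eX) (eqS_trans e eY).
  by move=> j z lt; rewrite -eY // e // (nxt_ext _ eX).
case=> Z [h1 h2]; exists Z; split; first by apply: IH h1.
by apply: IH h2.
Qed.

Variable w : seq bool.
Hypothesis small_run : forall n, small_config (run M w n).

Lemma stp_bits n Y : stp (config_bits (run M w n)) Y <-> eqS (config_bits (run M w n.+1)) Y.
Proof. by split=> h j z lt; have := h j z lt; rewrite nxt_bits. Qed.

Lemma reach_run t n Y : reach t (config_bits (run M w n)) Y <->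
  exists m, m <= 2 ^ t /\ eqS (config_bits (run M w (n + m))) Y.
Proof.
elim: t n Y => [|t IH] n Y /=.
  rewrite stp_bits; split=> [[h|h]|[[|[|m]] [//]]].
  - by exists 0; rewrite addn0.
  - by exists 1; rewrite addn1.
  - by rewrite addn0; left.
  - by rewrite addn1; right.
split=> [[Z [/IH[m1 [le1 e1]] h]]|[m [le e]]].
  have /IH[m2 [le2 e2]] := reach_ext (eqS_sym e1) (fun j z _ => erefl (Y j z)) h.
  exists (m1 + m2); rewrite addnA; split=> //.
  by rewrite expnS mul2n -addnn leq_add.
have [m1 [m2 [em le1 le2]]] : exists m1 m2, [/\ m = m1 + m2, m1 <= 2 ^ t & m2 <= 2 ^ t].
  exists (minn m (2 ^ t)), (m - 2 ^ t); rewrite expnS mul2n -addnn in le.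
  by split; lia.
exists (config_bits (run M w (n + m1))); split; apply/IH; first by exists m1.
by exists m2; rewrite -addnA -em.
Qed.

Lemma run_halted m n : halted (run M w m) -> m <= n -> run M w n = run M w m.
Proof.
move=> hm /subnK<-; elim: (n - m) => // k IH.
rewrite addSn [LHS]/= -/(run M w (k + m)) IH /step.
by move: hm; rewrite /halted; case: (action _).
Qed.

(** Within the space bound the bits in the window determine those after the next step. Two
    configurations with equal bits may differ as records, by trailing blanks, but this never shows
    later. *)
Lemma eq_bits_run i j k : eqS (config_bits (run M w i)) (config_bits (run M w j)) ->
  eqS (config_bits (run M w (i + k))) (config_bits (run M w (j + k))).
Proof.
move=> e; elim: k => [|k IH]; first by rewrite !addn0.
rewrite !addnS; apply/stp_bits => l z lt.
have := (stp_bits (i + k) (config_bits (run M w (i + k).+1))).2 (fun _ _ _ => erefl) l z lt.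
rewrite (nxt_ext _ IH) // => <-.
have h := (stp_bits (j + k) (config_bits (run M w (j + k).+1))).2 (fun _ _ _ => erefl) l z lt.
have h' := (stp_bits (i + k) (config_bits (run M w (i + k).+1))).2 (fun _ _ _ => erefl) l z lt.
by rewrite h h' (nxt_ext _ IH).
Qed.

(** Pigeonhole: let m be the first halting time. If the bits at times i < j up to m agreed, the
    machine would already have halted at time i + (m - j). So these tables of bits are pairwise
    distinct, and there are only [2 ^ (S * #|zt|)] of them. *)
Lemma halt_early n : halted (run M w n) ->
  exists2 m, m <= 2 ^ (S * #|zt|) & halted (run M w m).
Proof.
move=> hn; have ex : exists n, halted (run M w n) by exists n.
case: (ex_minnP ex) => m hm minm; exists m => //.
pose f (i : 'I_m.+1) : {ffun 'I_S * zt -> bool} := [ffun y : 'I_S * zt => config_bits (run M w i) y.1 y.2].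
have lt_inj (i j : 'I_m.+1) : i < j -> f i = f j -> False.
  move=> lt /ffunP e.
  have eb : eqS (config_bits (run M w i)) (config_bits (run M w j)).
    by move=> l z ltl; have := e (Ordinal ltl, z); rewrite !ffunE.
  have {}eb := eq_bits_run (m - j) eb; rewrite subnKC in eb; last by rewrite -ltnS.
  have := stopped_ext xpredT eb; rewrite !stopped_bits hm andbT => hi.
  have := minm _ hi; have := ltn_ord j; lia.
have inj : injective f.
  move=> i j e; apply: val_inj; case: (ltngtP i j) => // lt; first by case: (lt_inj _ _ lt e).
  by case: (lt_inj _ _ lt (esym e)).
have := leq_card f inj; rewrite card_ord card_ffun card_bool card_prod card_ord.
exact: leq_trans.
Qed.

Lemma accept_reach t (A : Prop) : S * #|zt| <= t ->
  (exists n, halted (run M w n) /\ (tm_accept (c_state (run M w n)) <-> A)) ->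
  A <-> exists Y, reach t (config_bits (init M w)) Y /\ stopped (@tm_accept M) Y.
Proof.
move=> le [n [hn acc]]; have [m lem hm] := halt_early hn.
have en k : halted (run M w k) -> run M w k = run M w n.
  by move=> hk; case: (leqP k n) => [l|/ltnW l]; [rewrite -(run_halted hk l) | rewrite (run_halted hn l)].
split=> [/acc a|[Y [/(reach_run t 0)[k [_ e]]]]].
  exists (config_bits (run M w m)); rewrite stopped_bits hm (en m hm) a; split=> //.
  apply/(reach_run t 0); exists m; split; last by rewrite add0n (en m hm).
  by apply: leq_trans lem _; rewrite leq_exp2l.
by rewrite -(stopped_ext _ e) stopped_bits add0n => /andP[/en-> /acc].
Qed.

End Bits.

(** * Connectives, and a syntactic class inside all three languages *)

Definition ands (l : seq form) : form := foldr And Top l.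
Definition for_ (f g : form) : form := Not (And (Not f) (Not g)).
Definition fimp (f g : form) : form := Not (And f (Not g)).
Definition fiff (f g : form) : form := And (fimp f g) (fimp g f).
Definition fconst (b : bool) : form := if b then Top else Bot.
Definition ors (l : seq form) : form := Not (ands [seq Not f | f <- l]).

Section SatBool.

Variables (F : bstruct) (s : {fset atom}).
Notation ev f b := (sat F s f <-> (b : bool)).

Lemma ev_atom a : ev (Atom a) (a \in s).
Proof. by []. Qed.
Lemma ev_const b : ev (fconst b) b.
Proof. by case: b. Qed.
Lemma ev_not f b : ev f b -> ev (Not f) (~~ b).
Proof. by move=> [h1 h2]; rewrite sat_not; split=> [n|/negP n]; [apply/negP => /h2 | move/h1]. Qed.
Lemma ev_and f g b c : ev f b -> ev g c -> ev (And f g) (b && c).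
Proof. by move=> [h1 h2] [k1 k2]; rewrite sat_and; split=> [[/h1-> /k1->]|/andP[/h2 ? /k2 ?]]. Qed.
Lemma ev_eq f b c : ev f b -> b = c -> ev f c.
Proof. by move=> h <-. Qed.
Lemma ev_imp f g b c : ev f b -> ev g c -> ev (fimp f g) (b ==> c).
Proof. by move=> hf hg; apply: ev_eq (ev_not (ev_and hf (ev_not hg))) _; case: b c {hf hg} => [] []. Qed.

Lemma ev_iff f g b c : ev f b -> ev g c -> ev (fiff f g) (b == c).
Proof. by move=> hf hg; apply: ev_eq (ev_and (ev_imp hf hg) (ev_imp hg hf)) _; case: b c {hf hg} => [] []. Qed.
Lemma ev_ands (T : eqType) (l : seq T) (G : T -> form) (b : T -> bool) :
  (forall y, y \in l -> ev (G y) (b y)) -> ev (ands [seq G y | y <- l]) (all b l).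
Proof.
elim: l => [|y l IH] h /=; first by [].
apply: ev_and; first by apply: h; rewrite mem_head.
by apply: IH => z zl; apply: h; rewrite inE zl orbT.
Qed.
Lemma ev_ors (T : eqType) (l : seq T) (G : T -> form) (b : T -> bool) :
  (forall y, y \in l -> ev (G y) (b y)) -> ev (ors [seq G y | y <- l]) (has b l).
Proof.
move=> h; rewrite /ors -map_comp -[has b l]negbK -all_predC; apply: ev_not.
by apply: ev_ands => y yl; apply: ev_not; apply: h.
Qed.

End SatBool.

(** One check that, by [elf_ok], yields well-formedness and membership in each of the three
    languages at once. *)
Fixpoint elf (n N : nat) (f : form) : bool :=
  match f with
  | Top | Bot => true
  | Atom a => (a.1 < N) && (a.2 == 0)
  | Not g => elf n N g
  | And g h => elf n N g && elf n N h
  | Know i g => (i < n) && elf n N g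
  | _ => false
  end.

Lemma elf_ands n N (T : eqType) (l : seq T) (G : T -> form) :
  (forall y, y \in l -> elf n N (G y)) -> elf n N (ands [seq G y | y <- l]).
Proof.
elim: l => //= y l IH h; rewrite h ?mem_head ?IH // => z zl.
by apply: h; rewrite inE zl orbT.
Qed.

Lemma elf_ors n N (T : eqType) (l : seq T) (G : T -> form) :
  (forall y, y \in l -> elf n N (G y)) -> elf n N (ors [seq G y | y <- l]).
Proof. by move=> h; rewrite /ors -map_comp /=; apply: elf_ands. Qed.

Definition voc_upto (N : nat) : seq atom := [seq (p, 0) | p <- iota 0 N].

Lemma mem_voc_upto N a : (a \in voc_upto N) = (a.1 < N) && (a.2 == 0).
Proof.
apply/mapP/andP => [[p]|[lt /eqP e]]; first by rewrite mem_iota add0n => /andP[_ ?] ->.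
by exists a.1; [rewrite mem_iota | case: a e {lt} => p k /= ->].
Qed.

Lemma elf_ok n N L f : elf n N f ->
  [/\ wf n (voc_upto N) [::] f, in_logic L f & new_atoms f = [::]].
Proof.
elim: f => //= [a|g IHg h IHh|i g IH].
- by move=> h; rewrite cats0 mem_voc_upto h.
- by case/andP => /IHg[-> -> ->] /IHh[-> -> ->].
- by case/andP => -> /IH[].
Qed.

(** * Diagrams expressing that an interval of atoms keeps its values *)

(** Three nodes per atom p: one tests p, and according to the outcome one of two nodes tests p' and
    either fails or goes on to the next larger atom. The interleaved variable order makes this
    linear. Children have to precede parents, so the list begins with the largest atom [top - 1];
    [keep_next m] enters the part for the [m] largest atoms. *)
Definition keep_next (m : nat) : bref := if m == 0 then inl true else inr (3 * m).-1.
Definition keep_nodes (top m : nat) : seq (var * (bref * bref)) :=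
  let p := top - m.+1 in
  [:: (((p, 0), true), (keep_next m, inl false)); (((p, 0), true), (inl false, keep_next m));
      (((p, 0), false), (inr (3 * m), inr (3 * m).+1))].
Definition keep (top n : nat) : bdd :=
  Bdd (flatten [seq keep_nodes top m | m <- iota 0 n]) (keep_next n).

Lemma keep_cat top n : bdd_nodes (keep top n.+1) = bdd_nodes (keep top n) ++ keep_nodes top n.
Proof. by rewrite /keep -addn1 iotaD map_cat flatten_cat add0n. Qed.

Lemma size_keep top n : size (bdd_nodes (keep top n)) = 3 * n.
Proof. by elim: n => // n IH; rewrite keep_cat size_cat IH /=; lia. Qed.

Definition keep_node (top i : nat) := nth (((0, 0), false), (inl false, inl false)) (keep_nodes top (i %/ 3)) (i %% 3).

Lemma nth_keep top n i : i < 3 * n -> bdd_node (keep top n) i = keep_node top i.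
Proof.
rewrite /bdd_node; elim: n => // n IH lt; rewrite keep_cat nth_cat size_keep.
case: ltnP => [/IH //|le].
have [r [lr ->]] : exists r, r < 3 /\ i = 3 * n + r by exists (i - 3 * n); lia.
by rewrite /keep_node addKn mulnC divnMDl // divn_small // modnMDl modn_small // addn0.
Qed.

Lemma keep_split i : exists m r, r < 3 /\ i = 3 * m + r.
Proof. by exists (i %/ 3), (i %% 3); rewrite ltn_mod mulnC -divn_eq. Qed.

Lemma keep_nodeE top m r : r < 3 -> keep_node top (3 * m + r) =
  nth (((0, 0), false), (inl false, inl false)) (keep_nodes top m) r.
Proof. by move=> lr; rewrite /keep_node mulnC divnMDl // divn_small // modnMDl modn_small // addn0. Qed.

Lemma robdd_keep (V : seq atom) top n : n <= top -> (forall p, p < top -> (p, 0) \in V) ->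
  robdd (over_primed V) (keep top n).
Proof.
move=> le inV; apply/and3P; split.
- apply/(uniqP (((0, 0), false), (inl false, inl false))) => i j; rewrite !inE size_keep => li lj.
  have := nth_keep top li; have := nth_keep top lj; rewrite /bdd_node => -> ->.
  have [m [r [lr ei]]] := keep_split i; have [m' [r' [lr' ej]]] := keep_split j.
  rewrite ei ej !keep_nodeE // => e.
  have em : m = m'.
    have : (nth (((0, 0), false), (inl false, inl false)) (keep_nodes top m) r).1.1.1 =
           (nth (((0, 0), false), (inl false, inl false)) (keep_nodes top m') r').1.1.1 by rewrite e.
    have E k q : q < 3 -> (nth (((0, 0), false), (inl false, inl false)) (keep_nodes top k) q).1.1.1 = top - k.+1.
      by case: q => [|[|[|q]]].
    by rewrite !E //; lia.
  rewrite -em in e *; congr (_ + _); move: e.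
  have nF : keep_next m <> inl false by rewrite /keep_next; case: ifP.
  by case: r r' lr lr' {ei ej} => [|[|[|r]]] [|[|[|r']]] //= _ _ [] // e1 e2; case: nF.
- rewrite /= /keep_next; case: eqP => // /eqP n0; rewrite -/(bdd_nodes (keep top n)) size_keep.
  by rewrite -lt0n in n0; lia.
apply/allP => i; rewrite mem_iota add0n => /andP[_]; rewrite size_keep => li.
rewrite nth_keep //.
have [m [r [lr ei]]] := keep_split i; rewrite ei keep_nodeE //.
have lm : m < n by lia.
have pV : (top - m.+1, 0) \in V by apply: inV; lia.
have nF : keep_next m <> inl false by rewrite /keep_next; case: ifP.
have cn q : q < 2 -> bdd_child_ok (keep top n) (3 * m + q) (keep_next m).
  move=> lq; rewrite /keep_next; case: eqP => // /eqP m0; rewrite -lt0n in m0.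
  rewrite /bdd_child_ok; apply/andP; split; first by lia.
  rewrite !nth_keep; try lia.
  have -> : (3 * m).-1 = 3 * m.-1 + 2 by lia.
  rewrite !keep_nodeE //; last by lia.
  case: q lq => [|[|q]] // _; rewrite /var_lt /atom_lt /=; apply/orP; left; lia.
have used q : q < 2 -> has (fun u => (u.2.1 == inr (3 * m + q)) || (u.2.2 == inr (3 * m + q))) (bdd_nodes (keep top n)).
  move=> lq; apply/hasP; exists (keep_node top (3 * m + 2)).
    have l2 : 3 * m + 2 < 3 * n by lia.
    by rewrite -(nth_keep top l2) /bdd_node mem_nth // size_keep.
  by rewrite keep_nodeE //=; case: q lq => [|[|q]] // _; rewrite ?addn0 ?addn1 eqxx ?orbT.
case: r lr ei => [|[|[|r]]] // _ ei; rewrite [nth _ _ _]/=.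
- rewrite /over_primed pV (cn 0) // used // orbT !andbT /=; apply/eqP; exact: nF.
- rewrite /over_primed pV (cn 1) // used // orbT !andbT /= eq_sym; apply/eqP; exact: nF.
have cc q : q < 2 -> bdd_child_ok (keep top n) (3 * m + 2) (inr (3 * m + q)).
  move=> lq; apply/andP; split; first by lia.
  rewrite !nth_keep; try lia.
  rewrite !keep_nodeE //; last by lia.
  by case: q lq => [|[|q]] // _; rewrite /var_lt /= eqxx orbT.
have := cc 0 isT; have := cc 1 isT; rewrite addn0 addn1 => -> ->.
rewrite /over_primed pV /=; apply/andP; split; first by apply/eqP => -[]; lia.
(* The node that tests p is the root for the smallest atom, and otherwise a child of nodes of the
   next smaller atom. *)
case: (ltnP m.+1 n) => ln; last first.
  apply/orP; left; apply/eqP; rewrite /keep_next ifF; last by apply/eqP; lia.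
  by congr inr; lia.
apply/orP; right; apply/hasP; exists (keep_node top (3 * m.+1 + 0)).
  have l2 : 3 * m.+1 + 0 < 3 * n by lia.
  by rewrite -(nth_keep top l2) /bdd_node mem_nth // size_keep.
rewrite keep_nodeE //=; apply/orP; left; apply/eqP; rewrite /keep_next /=.
by congr inr; lia.
Qed.

Lemma keepE e top n : n <= top ->
  bddev e (keep top n) = all (fun p => (((p, 0), false) \in e) == (((p, 0), true) \in e)) (iota (top - n) n).
Proof.
move=> le; pose op (vs : seq bool) (u : var * (bref * bref)) :=
  vs ++ [:: if u.1 \in e then bref_val vs u.2.2 else bref_val vs u.2.1].
have sz_op l : size (foldl op [::] l) = size l.
  by elim/last_ind: l => // l u IH; rewrite foldl_rcons /op size_cat IH size_rcons addn1.
rewrite /bddev -/op; elim: n le => // n IH le.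
rewrite keep_cat foldl_cat; have sv := sz_op (bdd_nodes (keep top n)).
move/(_ (ltnW le)): IH; rewrite size_keep in sv.
move: (foldl op [::] _) sv => vs sv IH.
have -> : iota (top - n.+1) n.+1 = (top - n.+1) :: iota (top - n) n by rewrite /= -subSn // subSS.
rewrite [all _ (_ :: _)]/= -IH; set p := top - n.+1.
have nx l : bref_val (vs ++ l) (keep_next n) = bref_val vs (keep_next n).
  rewrite /keep_next; case: eqP => //= n0; rewrite nth_cat sv ifT //; lia.
have -> : bref_val (foldl op vs (keep_nodes top n)) (bdd_root (keep top n.+1)) =
    if ((p, 0), false) \in e then (if ((p, 0), true) \in e then bref_val vs (keep_next n) else false)
    else (if ((p, 0), true) \in e then false else bref_val vs (keep_next n)).
  pose v0 := if ((p, 0), true) \in e then false else bref_val vs (keep_next n).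
  pose v1 := if ((p, 0), true) \in e then bref_val vs (keep_next n) else false.
  have E : foldl op vs (keep_nodes top n) = ((vs ++ [:: v0]) ++ [:: v1]) ++
      [:: if ((p, 0), false) \in e then nth false ((vs ++ [:: v0]) ++ [:: v1]) (3 * n).+1
          else nth false ((vs ++ [:: v0]) ++ [:: v1]) (3 * n)].
    by rewrite /v1 -(nx [:: v0]).
  have -> : bdd_root (keep top n.+1) = inr (size ((vs ++ [:: v0]) ++ [:: v1])).
    by rewrite !size_cat sv /= /keep_next /=; congr inr; lia.
  have N1 : nth false ((vs ++ [:: v0]) ++ [:: v1]) (3 * n).+1 = v1.
    by rewrite nth_cat size_cat sv /= addn1 ltnn subnn.
  have N0 : nth false ((vs ++ [:: v0]) ++ [:: v1]) (3 * n) = v0.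
    by rewrite nth_cat size_cat sv /= addn1 ltnSn nth_cat sv ltnn subnn.
  by rewrite E N1 N0 /= nth_cat ltnn subnn.
by rewrite /bdd_root /keep; case: (_ \in e); case: (_ \in e).
Qed.

(** * The formula of a computation *)

Section Formulas.

Variables (M : tm) (S : nat).
Hypothesis S_gt0 : 0 < S.

Notation zt := (zt M).
Notation views := (views M).
Notation tape_ix := (tape_ix M).

Definition zn : nat := size (enum zt).
Definition zrank (z : zt) : nat := index z (enum zt).
(** Mixed-radix numbering: block [X] is the interval from [X * blk] to [X.+1 * blk]. What an agent
    keeps is then a run of consecutive atoms, as [keep] requires. *)
Definition at_ (X j : nat) (z : zt) : atom := ((X * S + j) * zn + zrank z, 0).
Definition blk : nat := S * zn.

Lemma zrank_lt z : zrank z < zn.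
Proof. by rewrite index_mem mem_enum. Qed.

Lemma zn_gt0 : 0 < zn.
Proof. by apply: leq_ltn_trans (zrank_lt (inl (tm_start M))). Qed.

Lemma at_range X j z : j < S -> X * blk <= (at_ X j z).1 < X.+1 * blk.
Proof.
move=> lj; have lz := zrank_lt z; rewrite /at_ /blk /=; apply/andP; split.
  by rewrite mulnA mulnDl -addnA leq_addr.
have : (X * S + j).+1 * zn <= X.+1 * (S * zn).
  by rewrite mulnA leq_mul2r mulSn; apply/orP; right; lia.
rewrite mulSn; lia.
Qed.

Lemma at_decode p : exists X j z, j < S /\ at_ X j z = (p, 0).
Proof.
exists (p %/ zn %/ S), (p %/ zn %% S), (nth (inl (tm_start M)) (enum zt) (p %% zn)).
rewrite ltn_mod S_gt0; split=> //; rewrite /at_ -divn_eq /zrank index_uniq ?enum_uniq -?divn_eq //.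
by rewrite ltn_mod zn_gt0.
Qed.

Lemma at_inj X j z X' j' z' : j < S -> j' < S -> at_ X j z = at_ X' j' z' ->
  [/\ X = X', j = j' & z = z'].
Proof.
move=> lj lj' [e]; have lz := zrank_lt z; have lz' := zrank_lt z'.
have e1 : X * S + j = X' * S + j'.
  by have := congr1 (fun p => p %/ zn) e; rewrite !divnMDl ?zn_gt0 // !divn_small // !addn0.
have e2 : zrank z = zrank z'.
  by have := congr1 (fun p => p %% zn) e; rewrite !modnMDl !modn_small.
split.
- by have := congr1 (fun p => p %/ S) e1; rewrite !divnMDl // !divn_small // !addn0.
- by have := congr1 (fun p => p %% S) e1; rewrite !modnMDl !modn_small.
- by have := congr1 (nth z (enum zt)) e2; rewrite !nth_index ?mem_enum.
Qed.

(** The three agents keep the blocks 0 and 1, the blocks 0 to 2, and the blocks 3 and 4. As the law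
    is true, every set of atoms is a state; the given one is empty. *)
Definition hinst (f : form) : inst :=
  (voc_upto (5 * blk), (Bdd [::] (inl true),
   ([:: keep (2 * blk) (2 * blk); keep (3 * blk) (3 * blk); keep (5 * blk) (2 * blk)], ([::], f)))).

Definition hs : bstruct := inst_struct (inst_of (hinst Top)).

Definition asgn (s : {fset atom}) (X : nat) : asg M := fun j z => at_ X j z \in s.
Definition agree (lo hi : nat) (s t : {fset atom}) : Prop :=
  forall X, lo <= X < hi -> eqS S (asgn t X) (asgn s X).

Lemma sat_agent i lo n s f : n <= lo + n -> obs hs i = bdd_form (keep ((lo + n) * blk) (n * blk)) ->
  sat hs s (Know i f) <-> forall t, t `<=` voc hs -> agree lo (lo + n) s t -> sat hs t f.
Proof.
move=> _ oi.
have oE t : beval (val2 s t) (obs hs i) <-> agree lo (lo + n) s t.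
  pose e := unp (enum_fset s) ++ prm (enum_fset t).
  have -> : beval (val2 s t) (obs hs i) = bev e (obs hs i).
    apply: beval_ext => -[a []]; rewrite /val2 mem_cat mem_unp mem_prm //=.
    by rewrite orbF.
  have in0 p : (((p, 0), false) \in e) = ((p, 0) \in s) by rewrite mem_cat mem_unp mem_prm /= orbF.
  have in1 p : (((p, 0), true) \in e) = ((p, 0) \in t) by rewrite mem_cat mem_unp mem_prm.
  rewrite oi bddevE keepE; last by rewrite leq_mul2r leq_addl orbT.
  have -> : (lo + n) * blk - n * blk = lo * blk by rewrite mulnDl addnK.
  split=> [/allP h X /andP[l1 l2] j z lj|h].
    have /andP[r1 r2] := at_range X z lj.
    have mi : (at_ X j z).1 \in iota (lo * blk) (n * blk).
      rewrite mem_iota -mulnDl; apply/andP; split; first by apply: leq_trans r1; rewrite leq_mul2r l1 orbT.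
      by apply: leq_trans r2 _; rewrite leq_mul2r l2 orbT.
    by have := h _ mi; rewrite in0 in1 => /eqP e'; apply: esym e'.
  apply/allP => p; rewrite mem_iota -mulnDl in0 in1 => /andP[l1 l2].
  have [X [j [z [lj ep]]]] := at_decode p; rewrite -ep eq_sym; apply/eqP.
  apply: h => //; have /andP[] := at_range X z lj; rewrite ep /= => r1 r2.
  apply/andP; split.
    by have := leq_ltn_trans l1 r2; rewrite ltn_mul2r ltnS => /andP[].
  by have := leq_ltn_trans r1 l2; rewrite ltn_mul2r => /andP[].
rewrite sat_know; split=> h t.
  by move=> sub ag; apply: h; [rewrite /is_state sub | apply/oE].
by move=> /andP[sub _] /oE; apply: h.
Qed.

Lemma sat_agent0 s f : sat hs s (Know 0 f) <-> forall t, t `<=` voc hs -> agree 0 2 s t -> sat hs t f.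
Proof. exact: (@sat_agent 0 0 2). Qed.
Lemma sat_agent1 s f : sat hs s (Know 1 f) <-> forall t, t `<=` voc hs -> agree 0 3 s t -> sat hs t f.
Proof. exact: (@sat_agent 1 0 3). Qed.
Lemma sat_agent2 s f : sat hs s (Know 2 f) <-> forall t, t `<=` voc hs -> agree 3 5 s t -> sat hs t f.
Proof. exact: (@sat_agent 2 3 2). Qed.

(** Distinct bits have distinct atoms by [at_inj], so the five blocks can be prescribed
    independently of each other. *)
Lemma realize (g : nat -> asg M) : exists2 t, t `<=` voc hs &
  forall X j z, X < 5 -> j < S -> asgn t X j z = g X j z.
Proof.
pose ok (a : atom) := has (fun X => has (fun j => has (fun z => (at_ X j z == a) && g X j z) (enum zt)) (iota 0 S)) (iota 0 5).
exists [fset a in voc hs | ok a]; first exact: fset_sub.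
move=> X j z lX lj; rewrite /asgn !inE /=.
have /andP[_ r2] := at_range X z lj.
rewrite mem_voc_upto (leq_trans r2) ?leq_mul2r ?lX ?orbT //=.
apply/hasP/idP => [[X' _ /hasP[j' lj' /hasP[z' _ /andP[/eqP e h]]]]|h].
  by move: lj'; rewrite mem_iota add0n => /andP[_ lj']; have [<- <- <-] := at_inj lj' lj e.
exists X; first by rewrite mem_iota.
apply/hasP; exists j; first by rewrite mem_iota.
by apply/hasP; exists z; rewrite ?mem_enum // eqxx.
Qed.

Definition viewf (X : nat) (v : views) : form :=
  And (Atom (at_ X 0 (inl v.1))) (ands [seq Atom (at_ X 0 (inr (i, true, v.2 i))) | i <- enum tape_ix]).
Definition valuef (i : tape_ix) (d : ct M) (r : ct M + bool * nat) : form :=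
  match r with
  | inl c => fconst (c == d)
  | inr y => if y.2 < S then Atom (at_ 0 y.2 (inr (i, y.1, d))) else fconst (d == None)
  end.
Definition afterf (j : nat) (z : zt) (v : views) : form :=
  match trans v with
  | None => Atom (at_ 0 j z)
  | Some qa =>
      match z with
      | inl q => fconst (qa.1 == q)
      | inr y => valuef y.1.1 y.2 (source (qa.2 y.1.1) y.1.2 j)
      end
  end.
Definition nxtf (j : nat) (z : zt) : form :=
  ors [seq And (viewf 0 v) (afterf j z v) | v <- enum views].
Definition stopf (X : nat) : form :=
  ors [seq And (viewf X v) (fconst (~~ isSome (trans v) && tm_accept v.1)) | v <- enum views].
Definition allj (G : nat -> zt -> form) : form :=
  ands [seq ands [seq G j z | z <- enum zt] | j <- iota 0 S].
Definition eqf (X Y : nat) : form := allj (fun j z => fiff (Atom (at_ X j z)) (Atom (at_ Y j z))).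
Definition stepf : form := allj (fun j z => fiff (Atom (at_ 1 j z)) (nxtf j z)).
Definition initf (w : seq bool) : form :=
  allj (fun j z => fiff (Atom (at_ 0 j z)) (fconst (config_bits (init M w) j z))).
(* The blocks 0, ..., 4 are A, B, M, C, D: [condf] says that (C, D) is (A, M) or
   (M, B). *)
Definition condf : form := for_ (And (eqf 3 0) (eqf 4 2)) (And (eqf 3 2) (eqf 4 1)).
Definition pairf : form := And (eqf 0 3) (eqf 1 4).
Fixpoint phi (t : nat) : form :=
  if t is t'.+1 then
    Not (Know 0 (Not (Know 1 (fimp condf (Know 2 (fimp pairf (phi t')))))))
  else for_ (eqf 0 1) stepf.
(** The outer agent 2 forgets A and B, so its dual chooses both, whatever the initial state is. *)
Definition topf (w : seq bool) (t : nat) : form :=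
  Not (Know 2 (Not (And (And (initf w) (stopf 1)) (phi t)))).

Section Sat.

Variable s : {fset atom}.
Notation ev f b := (sat hs s f <-> (b : bool)).

Lemma sat_allj G (b : nat -> zt -> bool) :
  (forall j z, j < S -> ev (G j z) (b j z)) ->
  sat hs s (allj G) <-> forall j z, j < S -> b j z.
Proof.
move=> h; have E : ev (allj G) (all (fun j => all (b j) (enum zt)) (iota 0 S)).
  apply: ev_ands => j; rewrite mem_iota add0n => /andP[_ lj].
  by apply: ev_ands => z _; apply: h.
rewrite E; split=> [/allP k j z lj|k].
  have ji : j \in iota 0 S by rewrite mem_iota.
  by apply: (allP (k j ji)); rewrite mem_enum.
apply/allP => j; rewrite mem_iota add0n => /andP[_ lj]; apply/allP => z _; exact: k.
Qed.

Lemma sat_eqf X Y : sat hs s (eqf X Y) <-> eqS S (asgn s X) (asgn s Y).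
Proof.
rewrite (sat_allj (b := fun j z => asgn s X j z == asgn s Y j z)); last first.
  by move=> j z _; apply: ev_iff; apply: ev_atom.
by split=> h j z lj; apply/eqP; apply: h.
Qed.

Lemma ev_view X v : ev (viewf X v) (view (asgn s X) v).
Proof. by apply: ev_and; [apply: ev_atom | apply: ev_ands => i _; apply: ev_atom]. Qed.

Lemma ev_nxt j z : ev (nxtf j z) (next_bit S (asgn s 0) j z).
Proof.
apply: ev_ors => v _; apply: ev_and; first exact: ev_view.
rewrite /afterf /after_step; case: (trans v) => [[q a]|]; last exact: ev_atom.
case: z => [q'|[[i b] d]]; first exact: ev_const.
rewrite /= /valuef /value; case: (source _ _ _) => [c|[b' j']] /=; first exact: ev_const.
by case: ifP => _; [apply: ev_atom | apply: ev_const].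
Qed.

Lemma ev_stop X : ev (stopf X) (stopped (@tm_accept M) (asgn s X)).
Proof. by apply: ev_ors => v _; apply: ev_and; [apply: ev_view | apply: ev_const]. Qed.

Lemma sat_stepf : sat hs s stepf <-> stp S (asgn s 0) (asgn s 1).
Proof.
rewrite (sat_allj (b := fun j z => asgn s 1 j z == next_bit S (asgn s 0) j z)); last first.
  by move=> j z _; apply: ev_iff; [apply: ev_atom | apply: ev_nxt].
by split=> h j z lj; apply/eqP; apply: h.
Qed.

Lemma sat_initf w : sat hs s (initf w) <-> eqS S (asgn s 0) (config_bits (init M w)).
Proof.
rewrite (sat_allj (b := fun j z => asgn s 0 j z == config_bits (init M w) j z)); last first.
  by move=> j z _; apply: ev_iff; [apply: ev_atom | apply: ev_const].
by split=> h j z lj; apply/eqP; apply: h.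
Qed.

(** Satisfaction is a proposition, so recovering a disjunction from its coding by negation and
    conjunction takes classical logic; the same holds for the duals of knowledge operators below. *)
Lemma sat_or f g : sat hs s (for_ f g) <-> sat hs s f \/ sat hs s g.
Proof.
rewrite /for_ sat_not sat_and !sat_not; split; last by tauto.
by move=> n; apply: NNPP; tauto.
Qed.

Lemma sat_imp f g : sat hs s (fimp f g) <-> (sat hs s f -> sat hs s g).
Proof.
rewrite /fimp sat_not sat_and sat_not; split; last by tauto.
by move=> n a; apply: NNPP; tauto.
Qed.

Lemma sat_condf : sat hs s condf <->
  (eqS S (asgn s 3) (asgn s 0) /\ eqS S (asgn s 4) (asgn s 2)) \/
  (eqS S (asgn s 3) (asgn s 2) /\ eqS S (asgn s 4) (asgn s 1)).
Proof. by rewrite sat_or !sat_and !sat_eqf. Qed.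

Lemma sat_pairf : sat hs s pairf <->
  eqS S (asgn s 0) (asgn s 3) /\ eqS S (asgn s 1) (asgn s 4).
Proof. by rewrite sat_and !sat_eqf. Qed.

End Sat.

Lemma sat_phi t s : sat hs s (phi t) <-> reach S t (asgn s 0) (asgn s 1).
Proof.
elim: t s => [|t IH] s; first by rewrite sat_or sat_eqf sat_stepf.
rewrite [phi _]/= sat_not sat_agent0 [reach _ _ _ _]/=; split=> [n|[Z [h1 h2]] n].
  have [s1 [sub1 [ag1 k1]]] : exists s1, s1 `<=` voc hs /\ (agree 0 2 s s1 /\
      sat hs s1 (Know 1 (fimp condf (Know 2 (fimp pairf (phi t)))))).
    apply: NNPP => ne; apply: n => s1 sub1 ag1; rewrite sat_not => k1.
    by apply: ne; exists s1.
  have key (C D : asg M) : (eqS S C (asgn s1 0) /\ eqS S D (asgn s1 2)) \/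
      (eqS S C (asgn s1 2) /\ eqS S D (asgn s1 1)) -> reach S t C D.
    (* [s2] places C and D beside the given A, B and M, and [s3] has them in the blocks A and B as
       well. The M of [s3] is arbitrary; C fills it. *)
    move=> CD; have [s2 sub2 e2] := realize (fun X => nth C [:: asgn s1 0; asgn s1 1; asgn s1 2; C; D] X).
    have [s3 sub3 e3] := realize (fun X => nth C [:: C; D; C; C; D] X).
    have e X : X < 5 -> eqS S (asgn s2 X) (nth C [:: asgn s1 0; asgn s1 1; asgn s1 2; C; D] X).
      by move=> lX j z lj; apply: e2.
    have f X : X < 5 -> eqS S (asgn s3 X) (nth C [:: C; D; C; C; D] X).
      by move=> lX j z lj; apply: e3.
    have c2 : sat hs s2 condf.
      apply/sat_condf; case: CD => -[c d]; [left|right]; split.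
      - exact: eqS_trans (e 3 isT) (eqS_trans c (eqS_sym (e 0 isT))).
      - exact: eqS_trans (e 4 isT) (eqS_trans d (eqS_sym (e 2 isT))).
      - exact: eqS_trans (e 3 isT) (eqS_trans c (eqS_sym (e 2 isT))).
      - exact: eqS_trans (e 4 isT) (eqS_trans d (eqS_sym (e 1 isT))).
    have p3 : sat hs s3 pairf.
      by apply/sat_pairf; split; [apply: eqS_trans (f 0 isT) (eqS_sym (f 3 isT))
        | apply: eqS_trans (f 1 isT) (eqS_sym (f 4 isT))].
    move/sat_agent1: k1 => /(_ s2 sub2) k1.
    have {}k1 : sat hs s2 (fimp condf (Know 2 (fimp pairf (phi t)))).
      by apply: k1 => -[|[|[|X]]] // _; [apply: (e 0) | apply: (e 1) | apply: (e 2)].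
    move/sat_imp: k1 => /(_ c2)/sat_agent2/(_ s3 sub3) k2.
    have {}k2 : sat hs s3 (fimp pairf (phi t)).
      apply: k2 => -[|[|[|[|[|X]]]]] // _.
      - exact: eqS_trans (f 3 isT) (eqS_sym (e 3 isT)).
      - exact: eqS_trans (f 4 isT) (eqS_sym (e 4 isT)).
    move/sat_imp: k2 => /(_ p3)/IH; apply: reach_ext => //; [exact: (f 0) | exact: (f 1)].
  exists (asgn s1 2); split.
    by apply: key; left; split=> //; apply: eqS_sym; apply: ag1.
  by apply: key; right; split=> //; apply: eqS_sym; apply: ag1.
(* The midpoint goes into the block M. The blocks C and D are forgotten by agent 1 right away, so
   their contents are arbitrary. *)
have [s1 sub1 e1] := realize (fun X => nth Z [:: asgn s 0; asgn s 1; Z; Z; Z] X).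
have e X : X < 5 -> eqS S (asgn s1 X) (nth Z [:: asgn s 0; asgn s 1; Z; Z; Z] X).
  by move=> lX j z lj; apply: e1.
have := n s1 sub1; rewrite sat_not sat_agent1; apply.
  by case=> [|[|X]] // _; [apply: (e 0) | apply: (e 1)].
move=> s2 sub2 ag2; rewrite sat_imp => /sat_condf c; rewrite sat_agent2 => s3 sub3 ag3.
rewrite sat_imp => /sat_pairf[p1 p2]; apply/IH.
have g0 := eqS_trans (ag2 0 isT) (e 0 isT); have g1 := eqS_trans (ag2 1 isT) (e 1 isT).
have g2 := eqS_trans (ag2 2 isT) (e 2 isT).
have q0 := eqS_trans p1 (ag3 3 isT); have q1 := eqS_trans p2 (ag3 4 isT).
case: c => -[c1 c2].
  by apply: reach_ext h1 => //; apply: eqS_sym; [apply: eqS_trans q0 (eqS_trans c1 g0) | apply: eqS_trans q1 (eqS_trans c2 g2)].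
by apply: reach_ext h2 => //; apply: eqS_sym; [apply: eqS_trans q0 (eqS_trans c1 g2) | apply: eqS_trans q1 (eqS_trans c2 g1)].
Qed.

Lemma sat_topf w t s : sat hs s (topf w t) <->
  exists Y, reach S t (config_bits (init M w)) Y /\ stopped (@tm_accept M) Y.
Proof.
rewrite /topf sat_not sat_agent2; split=> [n|[Y [r st]] n].
  have [s1 k1] : exists s1, sat hs s1 (And (And (initf w) (stopf 1)) (phi t)).
    apply: NNPP => ne; apply: n => s1 sub1 ag1; rewrite sat_not => k1.
    by apply: ne; exists s1.
  move: k1; rewrite !sat_and ev_stop sat_initf sat_phi => -[[i st] r].
  by exists (asgn s1 1); split=> //; apply: reach_ext r.
have [s1 sub1 e1] := realize (fun X => nth Y [:: config_bits (init M w); Y; Y; asgn s 3; asgn s 4] X).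
have e X : X < 5 -> eqS S (asgn s1 X) (nth Y [:: config_bits (init M w); Y; Y; asgn s 3; asgn s 4] X).
  by move=> lX j z lj; apply: e1.
have := n s1 sub1; rewrite sat_not; apply.
  by case=> [|[|[|[|[|X]]]]] // _; [apply: (e 3) | apply: (e 4)].
rewrite !sat_and ev_stop sat_initf sat_phi; split.
  by split; [apply: (e 0) | rewrite (stopped_ext _ _ (e 1 isT))].
by apply: reach_ext r => //; apply: eqS_sym; [apply: (e 0) | apply: (e 1)].
Qed.

Lemma elf_at X j z : X < 5 -> j < S -> elf 3 (5 * blk) (Atom (at_ X j z)).
Proof.
move=> lX lj; have /andP[_ r] := at_range X z lj; rewrite /elf andbT.
by apply: leq_trans r _; rewrite leq_mul2r lX orbT.
Qed.

Lemma elf_const n N b : elf n N (fconst b). Proof. by case: b. Qed.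

Lemma elf_allj G : (forall j z, j < S -> elf 3 (5 * blk) (G j z)) -> elf 3 (5 * blk) (allj G).
Proof.
move=> h; apply: elf_ands => j; rewrite mem_iota add0n => /andP[_ lj].
by apply: elf_ands => z _; apply: h.
Qed.

Lemma elf_iff n N f g : elf n N f -> elf n N g -> elf n N (fiff f g).
Proof. by move=> /= -> ->. Qed.

Lemma elf_eqf X Y : X < 5 -> Y < 5 -> elf 3 (5 * blk) (eqf X Y).
Proof. by move=> lX lY; apply: elf_allj => j z lj; apply: elf_iff; apply: elf_at. Qed.

Lemma elf_view X v : X < 5 -> elf 3 (5 * blk) (viewf X v).
Proof.
by move=> lX; apply/andP; split; [apply: elf_at | apply: elf_ands => i _; apply: elf_at].
Qed.

Lemma elf_topf w t : elf 3 (5 * blk) (topf w t).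
Proof.
have ei : elf 3 (5 * blk) (initf w).
  by apply: elf_allj => j z lj; apply: elf_iff; [apply: elf_at | apply: elf_const].
have es : elf 3 (5 * blk) (stopf 1).
  by apply: elf_ors => v _; apply/andP; split; [apply: elf_view | apply: elf_const].
have et : elf 3 (5 * blk) stepf.
  apply: elf_allj => j z lj; apply: elf_iff; first exact: elf_at.
  apply: elf_ors => v _; apply/andP; split; first exact: elf_view.
  rewrite /afterf; case: (trans v) => [[q a]|]; last exact: elf_at.
  case: z => [q'|[[i b] d]]; first exact: elf_const.
  rewrite /= /valuef; case: (source _ _ _) => [c|[b' j']] /=; first exact: elf_const.
  by case: ifP => lj'; [apply: elf_at | apply: elf_const].
have ep : elf 3 (5 * blk) (phi t).
  elim: t => [|t IH]; first by rewrite /= elf_eqf.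
  by rewrite /= !elf_eqf.
change ((2 < 3) && ((elf 3 (5 * blk) (initf w) && elf 3 (5 * blk) (stopf 1)) && elf 3 (5 * blk) (phi t))).
by rewrite ei es ep.
Qed.

Lemma valid_hinst L w t : valid L (inst_of (hinst (topf w t))).
Proof.
have [wff inl_ new] := elf_ok L (elf_topf w t).
have inV p : p < 5 * blk -> (p, 0) \in voc_upto (5 * blk) by move=> lt; rewrite mem_voc_upto lt.
rewrite /valid; cbn [inst_of hinst fst snd i_voc i_law i_obs i_state i_form].
apply/and5P; split.
- by apply/allP => a; rewrite mem_voc_upto => /andP[].
- rewrite /voc_upto sorted_map; apply: sub_sorted (iota_ltn_sorted 0 (5 * blk)).
  by [].
- by [].
- rewrite /= !robdd_keep //; try (by move=> p lt; apply: inV; apply: leq_trans lt _; rewrite leq_mul2r orbT).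
  by rewrite leq_mul2r orbT.
apply/and5P; split=> //.
- by rewrite /is_state; apply/andP; split=> //; apply/fsubsetP => a /imfsetP[].
- rewrite /compact; cbn [i_voc i_form]; rewrite new cats0; apply/allP => a.
  rewrite mem_voc_upto => /andP[lt _]; apply: leq_trans lt _.
  have sv : size (voc_upto (5 * blk)) = 5 * blk by rewrite size_map size_iota.
  apply: (@leq_trans (size (voc_upto (5 * blk)))); first by rewrite sv.
  exact: leq_trans (leq_addr _ _) (leq_trans (leq_addr _ _) (leq_addr _ _)).
Qed.

End Formulas.

(** * The reduction *)

Ltac cpt_user ::= fail.

(** The reduction writes formulas directly as serialized lists. Serializing a formula given as a
    tree would call for the recursion [cpt_frec], which bounds only the space. *)
Definition cf X {eX : enc X} (F : X -> form) : Prop := cpt true (fun x => ser_form (F x)).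

Section Serialization.

Context (X : Type) {eX : enc X}.

Lemma cf_const f : cf (fun _ : X => f).
Proof. exact: cpt_const. Qed.

Lemma cf_atom (p : X -> nat) : cpt true p -> cf (fun x => Atom (p x, 0)).
Proof. by move=> C; rewrite /cf /= /ser_atom /=; cpt. Qed.

Lemma cf_not (F : X -> form) : cf F -> cf (fun x => Not (F x)).
Proof. by move=> C; rewrite /cf /=; cpt. Qed.

Lemma cf_and (F G : X -> form) : cf F -> cf G -> cf (fun x => And (F x) (G x)).
Proof. by move=> C D; rewrite /cf /=; cpt. Qed.

Lemma cf_know i (F : X -> form) : cf F -> cf (fun x => Know i (F x)).
Proof. by move=> C; rewrite /cf /=; cpt. Qed.

Lemma cf_if (b : X -> bool) (F G : X -> form) : cpt true b -> cf F -> cf G ->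
  cf (fun x => if b x then F x else G x).
Proof.
move=> B C D; apply: (@cpt_ext true _ _ _ _ _ (fun x => if b x then ser_form (F x) else ser_form (G x))).
  by move=> x; case: (b x).
by cpt.
Qed.

Lemma cf_ext (F G : X -> form) : F =1 G -> cf F -> cf G.
Proof. by move=> e; apply: cpt_ext => x; rewrite e. Qed.

Lemma cf_iff (F G : X -> form) : cf F -> cf G -> cf (fun x => fiff (F x) (G x)).
Proof. by move=> C D; apply: cf_and; apply: cf_not; apply: cf_and => //; apply: cf_not. Qed.

Lemma cf_or (F G : X -> form) : cf F -> cf G -> cf (fun x => for_ (F x) (G x)).
Proof. by move=> C D; apply: cf_not; apply: cf_and; apply: cf_not. Qed.

Lemma cf_fconst (b : X -> bool) : cpt true b -> cf (fun x => fconst (b x)).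
Proof. by move=> B; apply: cf_if => //; apply: cf_const. Qed.

Lemma cf_ands (T : Type) (l : seq T) (G : X -> T -> form) :
  (forall y, cf (fun x => G x y)) -> cf (fun x => ands [seq G x y | y <- l]).
Proof.
move=> h; elim: l => [|y l IH] /=; first exact: cf_const.
exact: cf_and.
Qed.

Lemma cf_ors (T : Type) (l : seq T) (G : X -> T -> form) :
  (forall y, cf (fun x => G x y)) -> cf (fun x => ors [seq G x y | y <- l]).
Proof.
move=> h; apply: cf_not.
apply: (@cf_ext (fun x => ands [seq Not (G x y) | y <- l])) => [x|]; first by rewrite -map_comp.
by apply: cf_ands => y; apply: cf_not.
Qed.

(** Prefix notation turns an iterated conjunction into a plain concatenation, which the operations
    on lists can compute. *)
Lemma ser_ands (T : Type) (l : seq T) (G : T -> form) :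
  ser_form (ands [seq G y | y <- l]) = flatten [seq 4 :: ser_form (G y) | y <- l] ++ [:: 0].
Proof. by elim: l => //= y l ->; rewrite -catA. Qed.

Lemma cf_ands_iota (n : X -> nat) (G : X -> nat -> form) : cpt true n ->
  cf (fun u : X * nat => G u.1 u.2) -> cf (fun x => ands [seq G x j | j <- iota 0 (n x)]).
Proof.
move=> N C; apply: (@cpt_ext true _ _ _ _ _
  (fun x => flatten [seq 4 :: ser_form (G x j) | j <- iota 0 (n x)] ++ [:: 0])).
  by move=> x; rewrite ser_ands.
apply: cpt_cat; last by cpt.
apply: cpt_flatten; apply: (cpt_map (F := fun x j => 4 :: ser_form (G x j))); first by cpt.
by apply: cpt_cons; [cpt | exact: C].
Qed.

Lemma cpt_pred (n : X -> nat) : cpt true n -> cpt true (fun x => (n x).-1).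
Proof.
move=> C; apply: (@cpt_ext true _ _ _ _ _ (fun x => n x - 1)); last by cpt.
by move=> x; rewrite subn1.
Qed.

Variables (M : tm) (S J : X -> nat).
Hypotheses (CS : cpt true S) (CJ : cpt true J).

Lemma cf_at B (J' : X -> nat) (z : zt M) : cpt true J' -> cf (fun x => Atom (at_ (S x) B (J' x) z)).
Proof. by move=> C; apply: cf_atom; cpt. Qed.

Lemma cf_view B (v : views M) : cf (fun x => viewf (S x) B v).
Proof.
have C0 : cpt true (fun _ : X => 0) by cpt.
by apply: cf_and; [apply: cf_at | apply: cf_ands => i; apply: cf_at].
Qed.

Lemma cf_value i d (a : ct M * move) b : cf (fun x => valuef (S x) i d (source a b (J x))).
Proof.
have vl (c : ct M) : cf (fun x => valuef (S x) i d (inl c)) by apply: cf_const.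
have vr b' (J' : X -> nat) : cpt true J' -> cf (fun x => valuef (S x) i d (inr (b', J' x))).
  move=> C; apply: (@cf_ext (fun x => if J' x < S x then Atom (at_ (S x) 0 (J' x) (inr (i, b', d)))
    else fconst (d == None))) => //.
  by apply: cf_if; [cpt | apply: cf_at | apply: cf_const].
have vif (t : X -> bool) (r r' : X -> ct M + bool * nat) : cpt true t ->
    cf (fun x => valuef (S x) i d (r x)) -> cf (fun x => valuef (S x) i d (r' x)) ->
    cf (fun x => valuef (S x) i d (if t x then r x else r' x)).
  move=> T C D; apply: (@cf_ext (fun x => if t x then valuef (S x) i d (r x) else valuef (S x) i d (r' x))).
    by move=> x; case: (t x).
  exact: cf_if.
have J0 : cpt true (fun x => J x == 0) by cpt.
have J1 : cpt true (fun x => J x == 1) by cpt.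
have JS : cpt true (fun x => (J x).+1) by cpt.
have JP := cpt_pred CJ; have C0 : cpt true (fun _ : X => 0) by cpt.
case: a => c []; rewrite /source; case: b => /=.
- by apply: (vif _ (fun _ => inr (false, 0))) => //; [apply: (vr false (fun _ => 0)) | apply: vif => //; apply: vr].
- exact: vr.
- by apply: vif => //; apply: vr.
- exact: vr.
- exact: vr.
- by apply: vif => //; apply: vr.
Qed.

Lemma cf_nxt (z : zt M) : cf (fun x => nxtf (S x) (J x) z).
Proof.
apply: cf_ors => v; apply: cf_and; first exact: cf_view.
rewrite /afterf; case: (trans v) => [[q a]|]; last exact: cf_at.
by case: z => [q'|[[i b] d]]; [apply: cf_const | apply: cf_value].
Qed.

Lemma cf_stop B : cf (fun x => stopf M (S x) B).
Proof. by apply: cf_ors => v; apply: cf_and; [apply: cf_view | apply: cf_const]. Qed.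

(** Only the right side of the first tape depends on the input; the state is fixed and all other
    cells are blank. *)
Lemma cpt_bits_init (W : X -> seq bool) (z : zt M) :
  cpt true W -> cpt true (fun x => config_bits (init M (W x)) (J x) z).
Proof.
move=> CW; case: z => [q|[[i b] d]].
  by apply: (@cpt_ext true _ _ _ _ _ (fun _ => tm_start M == q)) => //; exact: cpt_const.
case: (boolP ((i == ord0) && b)) => [/andP[i0 bT]|ni].
  apply: (@cpt_ext true _ _ _ _ _ (fun x =>
    match d with
    | None => size (W x) <= J x
    | Some (inl e) => (J x < size (W x)) && (nth false (W x) (J x) == e)
    | Some (inr _) => false
    end)).
    move=> x; rewrite /config_bits /= ffunE i0 /side bT /=.
    case: (ltnP (J x) (size (W x))) => h; first by rewrite (nth_map false) //; case: (d) => [[e|g]|].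
    by rewrite nth_default ?size_map //; case: (d) => [[e|g]|].
  by case: (d) => [[e|g]|]; cpt.
apply: (@cpt_ext true _ _ _ _ _ (fun x => None == d)); last exact: cpt_const.
move=> x; rewrite /config_bits /= ffunE; case: (i == ord0) ni => /=; last by rewrite /side; case: b => _; rewrite nth_nil.
by move/negbTE->; rewrite /side nth_nil.
Qed.

End Serialization.

Section Reduction.

Variables (M : tm) (S : seq bool -> nat).
Hypothesis CS : cpt true S.

Lemma CS1 : cpt true (fun u : seq bool * nat => S u.1).
Proof. by apply: (cpt_comp CS); cpt. Qed.

Lemma cf_allj (G : seq bool -> nat -> zt M -> form) :
  (forall z, cf (fun u : seq bool * nat => G u.1 u.2 z)) -> cf (fun w => allj (S w) (G w)).
Proof.
move=> h; apply: (cf_ands_iota (G := fun w j => ands [seq G w j z | z <- enum (zt M)])) => //.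
by apply: cf_ands.
Qed.

Lemma cf_eqf B B' : cf (fun w => eqf M (S w) B B').
Proof.
apply: (cf_allj (G := fun w j z => fiff (Atom (at_ (S w) B j z)) (Atom (at_ (S w) B' j z)))) => z.
have C2 : cpt true (fun u : seq bool * nat => u.2) by cpt.
by apply: cf_iff; apply: (cf_at CS1).
Qed.

Lemma cf_stepf : cf (fun w => stepf M (S w)).
Proof.
apply: (cf_allj (G := fun w j z => fiff (Atom (at_ (S w) 1 j z)) (nxtf (S w) j z))) => z.
have C2 : cpt true (fun u : seq bool * nat => u.2) by cpt.
by apply: cf_iff; [apply: (cf_at CS1) | apply: (cf_nxt CS1 C2)].
Qed.

Lemma cf_initf : cf (fun w => initf M (S w) w).
Proof.
apply: (cf_allj (G := fun w j z => fiff (Atom (at_ (S w) 0 j z)) (fconst (config_bits (init M w) j z)))) => z.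
have C2 : cpt true (fun u : seq bool * nat => u.2) by cpt.
apply: cf_iff; first exact: (cf_at CS1).
by apply: cf_fconst; apply: cpt_bits_init => //; cpt.
Qed.

Definition phi_prefix (w : seq bool) : seq nat :=
  [:: 3; 5; 0; 3; 5; 1; 3; 4] ++ ser_form (condf M (S w)) ++ [:: 3; 5; 2; 3; 4]
  ++ ser_form (pairf M (S w)) ++ [:: 3].

(** The formula of the previous level occurs once in [phi] and in last position, so in prefix
    notation a level merely prepends one fixed block. This replaces a recursion by a repetition and
    keeps the length linear in [t]. *)
Lemma ser_phi w t : ser_form (phi M (S w) t) =
  flatten (nseq t (phi_prefix w)) ++ ser_form (phi M (S w) 0).
Proof.
elim: t => // t IH.
have -> : ser_form (phi M (S w) t.+1) = phi_prefix w ++ ser_form (phi M (S w) t).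
  by rewrite /phi_prefix -!catA.
by rewrite IH catA.
Qed.

Lemma cf_phi (t : seq bool -> nat) : cpt true t -> cf (fun w => phi M (S w) (t w)).
Proof.
move=> T; apply: (@cpt_ext true _ _ _ _ _
  (fun w => flatten (nseq (t w) (phi_prefix w)) ++ ser_form (phi M (S w) 0))).
  by move=> w; rewrite ser_phi.
have C1 : cf (fun w => condf M (S w)).
  by apply: cf_or; apply: cf_and; apply: cf_eqf.
have C2 : cf (fun w => pairf M (S w)) by apply: cf_and; apply: cf_eqf.
have C3 : cf (fun w => phi M (S w) 0) by apply: cf_or; [apply: cf_eqf | apply: cf_stepf].
apply: cpt_cat; last exact: C3.
apply: cpt_flatten; apply: cpt_nseq => //; rewrite /phi_prefix.
apply: cpt_cat; first by cpt.
apply: cpt_cat; first exact: C1.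
apply: cpt_cat; first by cpt.
by apply: cpt_cat; [exact: C2 | cpt].
Qed.

Lemma cf_topf (t : seq bool -> nat) : cpt true t -> cf (fun w => topf M (S w) w (t w)).
Proof.
move=> T; apply: cf_not; apply: cf_know; apply: cf_not; apply: cf_and; last exact: cf_phi.
by apply: cf_and; [apply: cf_initf | apply: cf_stop].
Qed.

Definition ser_next (m : nat) : seq nat := if m == 0 then [:: 0; 1] else [:: 1; 3 * m - 1].
Definition ser_keep (top m : nat) : seq nat :=
  [:: top - m.+1; 0; 1] ++ ser_next m ++ [:: 0; 0; top - m.+1; 0; 1; 0; 0] ++ ser_next m
  ++ [:: top - m.+1; 0; 0; 1; 3 * m; 1; (3 * m).+1].

Lemma ser_nextE m : ser_bref (keep_next m) = ser_next m.
Proof. by rewrite /keep_next /ser_next; case: eqP => //= _; rewrite subn1. Qed.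

Lemma ser_keepE top n : ser_bdd (keep top n) =
  3 * n :: flatten [seq ser_keep top m | m <- iota 0 n] ++ ser_next n.
Proof.
rewrite /ser_bdd /ser_seq size_keep cat_cons; congr (_ :: _ ++ _); last exact: ser_nextE.
rewrite /keep [bdd_nodes _]/=; elim: (iota 0 n) => //= m l IH.
by rewrite -IH !ser_nextE -!catA /= -!catA.
Qed.

Lemma cpt_keep (a b : seq bool -> nat) : cpt true a -> cpt true b ->
  cpt true (fun w => ser_bdd (keep (a w) (b w))).
Proof.
move=> Ca Cb; apply: (@cpt_ext true _ _ _ _ _ (fun w => 3 * b w ::
  flatten [seq ser_keep (a w) m | m <- iota 0 (b w)] ++ ser_next (b w))).
  by move=> w; rewrite ser_keepE.
apply: cpt_cons; first by cpt.
apply: cpt_cat; last by rewrite /ser_next; cpt.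
apply: cpt_flatten; apply: (cpt_map (F := fun w m => ser_keep (a w) m)); first by cpt.
have C1 : cpt true (fun u : seq bool * nat => a u.1) by apply: (cpt_comp Ca); cpt.
by rewrite /ser_keep /ser_next; cpt.
Qed.

(** [S w * zn M] levels suffice, because by [halt_early] a halting run within the space bound halts
    after at most 2 to this power steps. *)
Definition reduction (w : seq bool) : seq bool :=
  encode (inst_of (hinst M (S w) (topf M (S w) w (S w * zn M)))).

Lemma cpt_reduction : cpt true reduction.
Proof.
have CD : cpt true (fun w => blk M (S w)) by rewrite /blk; cpt.
have Ck k n : cpt true (fun w => ser_bdd (keep (k * blk M (S w)) (n * blk M (S w)))) by apply: cpt_keep; cpt.
have CT : cf (fun w => topf M (S w) w (S w * zn M)) by apply: cf_topf; cpt.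
rewrite /reduction /encode; apply: cpt_flatten.
apply: (@cpt_ext true _ _ _ _ _ (fun w => [seq nseq m true ++ [:: false] | m <-
  (5 * blk M (S w) :: flatten [seq [:: p; 0] | p <- iota 0 (5 * blk M (S w))])
  ++ [:: 0; 0; 1] ++ (3 :: ser_bdd (keep (2 * blk M (S w)) (2 * blk M (S w)))
    ++ ser_bdd (keep (3 * blk M (S w)) (3 * blk M (S w)))
    ++ ser_bdd (keep (5 * blk M (S w)) (2 * blk M (S w)))) ++ [:: 0]
  ++ ser_form (topf M (S w) w (S w * zn M))])).
  move=> w.
  have -> : ser_instance (inst_of (hinst M (S w) (topf M (S w) w (S w * zn M)))) =
    ser_seq ser_atom (voc_upto (5 * blk M (S w))) ++ [:: 0; 0; 1]
    ++ ser_seq ser_bdd [:: keep (2 * blk M (S w)) (2 * blk M (S w));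
       keep (3 * blk M (S w)) (3 * blk M (S w)); keep (5 * blk M (S w)) (2 * blk M (S w))]
    ++ [:: 0] ++ ser_form (topf M (S w) w (S w * zn M)) by [].
  rewrite /ser_seq size_map size_iota -map_comp [flatten [seq ser_bdd _ | _ <- _]]/= cats0.
  by apply: eq_map => m; rewrite /ser_nat cats1.
apply: cpt_map; last by cpt.
apply: cpt_cat; first by cpt.
apply: cpt_cat; first by cpt.
apply: cpt_cat; last by apply: cpt_cat; [cpt | exact: CT].
apply: cpt_cons; first by cpt.
by apply: cpt_cat; [exact: Ck | apply: cpt_cat; exact: Ck].
Qed.

End Reduction.

(** * Hardness and completeness *)

Lemma encode_inst_inj I J : encode I = encode J -> I = J.
Proof.
pose tup I := (i_voc I, (i_law I, (i_obs I, (i_state I, i_form I)))).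
have E K : inst_of (tup K) = K by case: K.
move=> e; have h1 : parse (encode I) = Some (tup I) by apply/parseP; rewrite E.
have h2 : parse (encode I) = Some (tup J) by rewrite e; apply/parseP; rewrite E.
have e' : tup J = tup I by apply: Some_inj; rewrite -h1 -h2.
by rewrite -(E I) -(E J) e'.
Qed.

Lemma size_side_space (M : tm) (c : config M) i b : size (side b (c_tapes c i)) <= space c.
Proof.
rewrite /space (bigD1 i) //=; apply: leq_trans (leq_addr _ _).
by rewrite /side; case: b; rewrite ?leq_addl ?leq_addr.
Qed.

Theorem model_checking_hard L : PSPACE_hard (model_checking L).
Proof.
(* The successor makes the window nonempty, as position 0 must lie in it for the state and the
   scanned cells to be read. *)
move=> A [M [c [k H]]]; pose S (w : seq bool) := (poly_bound c k (size w)).+1.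
have Cz : cpt true (fun w : seq bool => size w).
  by apply: (@cpt_size_seq true _ _ _ _ (fun w => w)); exact: cpt_id.
have CS : cpt true S by rewrite /S /poly_bound; cpt.
exists (reduction M S); split; first exact: cpt_polytime (cpt_reduction M CS).
move=> w; have [sp ex] := H w.
have S0 : 0 < S w by [].
have small n : small_config (S w) (run M w n).
  by move=> i b; apply: leq_trans (size_side_space _ _ _) _; apply: leqW; apply: sp.
have lt : S w * #|zt M| <= S w * zn M by rewrite /zn -cardE.
rewrite (accept_reach S0 small lt ex) -(@sat_topf M (S w) S0 w (S w * zn M)
  (inst_state (inst_of (hinst M (S w) (topf M (S w) w (S w * zn M)))))).
split=> [h|[I [eI vI]]].
  by exists (inst_of (hinst M (S w) (topf M (S w) w (S w * zn M)))); split=> //; apply: valid_hinst.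
by rewrite (encode_inst_inj eI).
Qed.

Theorem theorem9 (L : logic) : PSPACE_complete (model_checking L).
Proof. by split; [apply: model_checking_PSPACE | apply: model_checking_hard]. Qed.
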